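(* Let $d\ge 2$ be an integer, $\nu=\frac{d-2}{2}$, $r>0$, let $x\in\mathbf{R}^d$ with $x\neq 0$ and $|x|\ne r$, and let $v\in\mathbf{R}^d$ with $v\ne 0$. Let $\sigma^{(v)}$ be the first hitting time of the sphere $S^{d-1}_r=\{y\in\mathbf{R}^d:|y|=r\}$ by the Brownian motion with drift $B^{(v)}_t=B_t+vt$, where $B$ is a standard $d$-dimensional Brownian motion with $B_0=x$. Then the (possibly defective) density $p^{(v)}_\nu(t;x)$, $t>0$, of $\sigma^{(v)}$ is given as follows. When $d=2$ (so $\nu=0$), $$p_0^{(v)}(t;x) = e^{-\langle v,x\rangle-\frac12|v|^2t}\Bigl\{ I_0(|v|r)\,p_0(t;x)+\sum_{n=1}^\infty n\,C_n^0\Bigl(\frac{\langle v,x\rangle}{|v|\,|x|}\Bigr) I_n(|v|r)\,\frac{|x|^n}{r^n}\,p_n(t;x)\Bigr\}.$$ When $d\ge 3$, $$p^{(v)}_\nu(t;x)=2^\nu\,\Gamma(\nu)\,e^{-\langle v,x\rangle-\frac12|v|^2t}\sum_{n=0}^\infty(\nu+n)\,C_n^\nu\Bigl(\frac{\langle v,x\rangle}{|v|\,|x|}\Bigr)I_{\nu+n}(|v|r)\,\frac{|x|^n}{|v|^\nu r^{\nu+n}}\,p_{\nu+n}(t;x).$$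
   Context: $\langle\cdot,\cdot\rangle$ and $|\cdot|$ are the Euclidean inner product and norm on $\mathbf{R}^d$. ''Density of $\sigma^{(v)}$'' means the density of the law of $\sigma^{(v)}$ restricted to $(0,\infty)$ (possibly $P(\sigma^{(v)}=\infty)>0$), so that $P(\sigma^{(v)}\le t)=\int_0^t p^{(v)}_\nu(s;x)\,ds$. For $\mu\ge0$, $p_\mu(t;x)$ denotes the (possibly defective) density on $(0,\infty)$ of the first hitting time to $r$ of a Bessel process with index $\mu$ (generator $\frac12\frac{d^2}{d\rho^2}+\frac{2\mu+1}{2\rho}\frac{d}{d\rho}$) starting from $|x|$. For every $\lambda>0$ it satisfies $$\int_0^\infty e^{-\lambda s}p_\mu(s;x)\,ds=\frac{r^\mu K_\mu(|x|\sqrt{2\lambda})}{|x|^\mu K_\mu(r\sqrt{2\lambda})}\ \text{ if } |x|>r,\qquad \int_0^\infty e^{-\lambda s}p_\mu(s;x)\,ds=\frac{r^\mu I_\mu(|x|\sqrt{2\lambda})}{|x|^\mu I_\mu(r\sqrt{2\lambda})}\ \text{ if } |x|<r.$$ For $\mu=\nu=\frac{d-2}{2}$, $p_\nu(t;x)$ is the density of the first hitting time of $S^{d-1}_r$ by $B$. $I_\mu$ and $K_\mu$ are the modified Bessel functions of the first and second kind. $C_n^\nu$ is the Gegenbauer polynomial. For $\nu>0$ it is characterized by $(1-2t\xi+t^2)^{-\nu}=\sum_{n=0}^\infty C_n^\nu(\xi)t^n$. For $\nu=0$, $C_0^0(\xi)=1$ and, for $n\ge1$, $C_n^0(\xi)=\sum_{m=0}^{[n/2]}(-1)^m\frac{\Gamma(n-m)}{\Gamma(m+1)\Gamma(n-2m+1)}(2\xi)^{n-2m}$,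 equivalently $C_n^0(\cos\theta)=\frac2n\cos(n\theta)$. *)

(* Defs.v *)
From HB Require Import structures.
From mathcomp Require Import all_boot all_order all_algebra.
From mathcomp Require Import all_classical all_reals all_analysis.

Set Implicit Arguments.
Unset Strict Implicit.
Unset Printing Implicit Defensive.

Import Order.TTheory GRing.Theory Num.Theory.
Import numFieldTopology.Exports numFieldNormedType.Exports.

Local Open Scope classical_set_scope.
Local Open Scope ring_scope.

(* The norm `|x| of MathComp-Analysis on row vectors is the sup norm, hence the
   separate Euclidean norm. *)
Definition dotv (R : realType) (d : nat) (u w : 'rV[R]_d) : R :=
  \sum_(i < d) u ord0 i * w ord0 i.

Definition enorm (R : realType) (d : nat) (u : 'rV[R]_d) : R :=
  Num.sqrt (dotv u u).

(* Euler's integral; only meaningful for a > 0. *)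
Definition Gamma (R : realType) (a : R) : R :=
  \int[@lebesgue_measure R]_(t in `]0, +oo[) (t `^ (a - 1) * expR (- t)).

(* Modified Bessel function of the first kind, for mu >= 0 and z > 0. *)
Definition besselI (R : realType) (mu z : R) : R :=
  limn (series (fun k =>
    (z / 2) `^ (2 * k%:R + mu) / ((k`!)%:R * Gamma (k%:R + mu + 1)))).

Definition cosh (R : realType) (t : R) : R := (expR t + expR (- t)) / 2.

(* Modified Bessel function of the second kind (Macdonald function), for z > 0:
   K_mu(z) = int_0^oo exp(-z cosh t) cosh(mu t) dt. *)
Definition besselK (R : realType) (mu z : R) : R :=
  \int[@lebesgue_measure R]_(t in `[0, +oo[)
    (expR (- z * cosh t) * cosh (mu * t)).

(* C nu n is the Gegenbauer polynomial C_n^nu.  The two conditions determine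
   C nu for nu > 0 and nu = 0 respectively. *)
Record gegenbauer (R : realType) (C : R -> nat -> {poly R}) : Prop := {
  gegenbauer_gen : forall nu xi t : R,
    0 < nu -> `|xi| <= 1 -> `|t| < 1 ->
    series (fun n => (C nu n).[xi] * t ^+ n) @ \oo
      --> (1 - 2 * t * xi + t ^+ 2) `^ (- nu);
  gegenbauer_00 : forall xi : R, (C 0 0%N).[xi] = 1;
  gegenbauer_0n : forall (n : nat) (xi : R), (0 < n)%N ->
    (C 0 n).[xi] =
      \sum_(0 <= m < n./2.+1)
        (-1) ^+ m * (Gamma (n - m)%:R
                     / (Gamma m.+1%:R * Gamma (n - m.*2).+1%:R))
        * (2 * xi) ^+ (n - m.*2)
}.

(* Taking some of the A i to be setT yields the product rule for subfamilies. *)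
Definition independent_family (R : realType) (disp : measure_display)
    (T : measurableType disp) (P : probability T R)
    (I : finType) (X : I -> T -> R) : Prop :=
  forall A : I -> set R, (forall i, measurable (A i)) ->
    P (\bigcap_(i in [set: I]) (X i @^-1` A i))
      = (\prod_(i : I) P (X i @^-1` A i))%E.

(* Processes are indexed by R but constrained only at times t >= 0. *)
Record brownian (R : realType) (disp : measure_display)
    (T : measurableType disp) (P : probability T R) (d : nat)
    (x : 'rV[R]_d) (B : R -> T -> 'rV[R]_d) : Prop := {
  brownian_measurable : forall (t : R) (i : 'I_d), 0 <= t ->
    measurable_fun [set: T] (fun w => B t w ord0 i);
  brownian_start : forall w : T, B 0 w = x;
  brownian_continuous : forall w : T,
    {within `[0, +oo[, continuous (fun t => B t w)};
  brownian_gaussian : forall (s t : R) (i : 'I_d) (A : set R),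
    0 <= s -> s < t -> measurable A ->
    P [set w | A (B t w ord0 i - B s w ord0 i)]
      = normal_prob 0 (Num.sqrt (t - s)) A;
  (* all coordinates of all increments along a subdivision are independent *)
  brownian_independent : forall (k : nat) (t : nat -> R),
    0 <= t 0%N -> (forall j, t j < t j.+1) ->
    independent_family P (fun (ji : 'I_k * 'I_d) (w : T) =>
      B (t ji.1.+1) w ord0 ji.2 - B (t ji.1) w ord0 ji.2)
}.

Definition bessel_generator (R : realType) (mu : R) (f : R -> R) (y : R) : R :=
  derive1n 2 f y / 2 + (2 * mu + 1) / (2 * y) * derive1 f y.

Definition C2c_pos (R : realType) (f : R -> R) : Prop :=
  [/\ forall y, derivable f y 1,
      forall y, derivable (derive1 f) y 1,
      continuous (derive1n 2 f)
    & exists a b : R, 0 < a /\ (forall y, ~ (a <= y <= b) -> f y = 0)].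

Definition natural_filtration (R : realType) (disp : measure_display)
    (T : measurableType disp) (X : R -> T -> R) (s : R) : set (set T) :=
  <<s [set E | exists (u : R) (A : set R),
         [/\ 0 <= u <= s, measurable A & E = X u @^-1` A]] >>.

(* Bessel process with index mu >= 0 started at a > 0, as the solution of the
   martingale problem for its generator: f(X_t) - int_0^t (L f)(X_u) du is a
   martingale for every f in C^2_c((0,oo)).  The origin is not reached when
   mu >= 0, so that the state space is (0,oo). *)
Record bessel_process (R : realType) (disp : measure_display)
    (T : measurableType disp) (P : probability T R)
    (mu a : R) (X : R -> T -> R) : Prop := {
  bessel_measurable : forall t : R, 0 <= t -> measurable_fun [set: T] (X t);
  bessel_start : forall w : T, X 0 w = a;
  bessel_pos : forall (t : R) (w : T), 0 <= t -> 0 < X t w;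
  bessel_continuous : forall w : T,
    {within `[0, +oo[, continuous (fun t => X t w)};
  bessel_martingale : forall (f : R -> R) (s t : R) (A : set T),
    C2c_pos f -> 0 <= s -> s <= t -> natural_filtration X s A ->
    \int[P]_(w in A)
      (f (X t w) - f (X s w)
       - \int[@lebesgue_measure R]_(u in `[s, t])
           bessel_generator mu f (X u w)) = 0
}.

(* First time >= 0 at which the path rho takes the value r; +oo if never. *)
Definition hitting_time (R : realType) (rho : R -> R) (r : R) : \bar R :=
  ereal_inf [set t%:E | t in [set t : R | 0 <= t /\ rho t = r]].

(* q, as a function on (0,oo), is a version of the (possibly defective) density
   of the positive random time sigma. *)
Definition density_of_time (R : realType) (disp : measure_display)
    (T : measurableType disp) (P : probability T R)
    (sigma : T -> \bar R) (q : R -> R) : Prop :=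
  measurable_fun (`]0, +oo[ : set R) q /\
  forall t : R, 0 <= t ->
    P [set w | (sigma w <= t%:E)%E]
      = (\int[@lebesgue_measure R]_(s in `]0%R, t]) (q s)%:E)%E.

(* q is a density of the first hitting time to r of a Bessel process with index
   mu started at a. *)
Definition bessel_hitting_density (R : realType) (mu a r : R) (q : R -> R)
    : Prop :=
  exists (disp : measure_display) (T : measurableType disp)
         (P : probability T R) (X : R -> T -> R),
    bessel_process P mu a X /\
    density_of_time P (fun w => hitting_time (X ^~ w) r) q.

(* Main.v *)
(* Let Z_n be the solid harmonic of degree n with axis v, a multiple of
   |v|^n |y|^n C_n^nu(cos(v, y)).  For real a the function
     |a - t|^(-d/2 - n) exp(|v|^2 t / 2 - <v, y> - |y|^2 / (2 (a - t))) Z_n(y)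
   gives a local martingale along the Brownian motion with drift v.  Stopping it
   at the hitting time tau of the sphere, where |y| = r, and integrating over
   a > 0 (start outside) or inverting a Laplace transform in -a > 0 (start inside)
   turns the Gaussian factors into K_(nu+n) or I_(nu+n), and shows that
     E[exp(|v|^2 tau / 2 - <v, X_tau>) Z_n(X_tau) exp(-u tau)]
   is exp(-<v, x>) Z_n(x) times the Laplace transform of p_(nu+n) at u.  On the
   sphere the plane wave exp(<v, y>) is a sum of multiples of the Z_n(y), whose
   coefficients are proportional to I_(nu+n)(|v| r).  Summing over n gives the
   Laplace transform of tau at the nonnegative integers, and these values
   determine its law. *)
Require Import Defs.
From HB Require Import structures.
From mathcomp Require Import all_boot all_order all_algebra.
From mathcomp Require Import ring lra zify.
From mathcomp Require ssrcomplements mpoly.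

Set Implicit Arguments.
Unset Strict Implicit.
Unset Printing Implicit Defensive.

Import Order.TTheory GRing.Theory Num.Theory.

Local Open Scope ring_scope.

(** * Solid harmonics and Gaussian expectations *)

(** No stochastic calculus is involved: the martingale property is an exact Gaussian integral over
    one increment, in which harmonicity turns the average of Z_n into its value at the mean, and
    stopping is built from finite grids. The obstacle is integrability. For a < 0 the kernel grows
    like exp(|y|^2 / (2 (t - a))), and a stopping time rounded up to a grid lets the path leave the
    ball. This overshoot is controlled by a kernel of degree 0 with pole nearer to 0, which outgrows
    the first kernel and has constant expectation. For a > 0 the kernel is singular at time a but
    tends to 0 there away from the origin, so that paths which have not hit before a drop out. The
    Bessel processes enter through the Laplace transforms of the densities and through the fact that
    each density is almost everywhere nonnegative with mass at most 1. With absolutely summable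
    coefficients this gives convergence of the series for almost every t without any regularity of
    [p]. The transforms are compared at the rates k + |v|^2/2, k a natural number, whose second part
    cancels exp(|v|^2 tau / 2). *)

Fixpoint hermite_moment {R : pzRingType} (m c : R) (k : nat) : R :=
  match k with
  | 0 => 1
  | 1 => m
  | (k'.+1 as k1).+1 => m * hermite_moment m c k1 + c * k1%:R * hermite_moment m c k'
  end.

(** Gaussian integration by parts: [hermite_moment m c k] is the k-th moment of a normal variable of
    mean m and variance c. At k = 0 the predecessor is harmless because its coefficient vanishes. *)
Lemma hermite_momentS {R : pzRingType} (m c : R) k :
  hermite_moment m c k.+1 = m * hermite_moment m c k
    + c * k%:R * hermite_moment m c k.-1.
Proof. by case: k => [|k] //=; rewrite mulr0 mul0r addr0 mulr1. Qed.

(* The recurrence of the Gegenbauer polynomials multiplied by (nu + n); the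
   first coefficient is the value of (n + 2 nu) / (n + nu) at n = 0, which is
   what keeps the case nu = 0 uniform. *)
Definition zonal_coef {R : fieldType} (nu : R) (n : nat) : R :=
  if n is 0 then 2 else (n%:R + 2 * nu) / (n%:R + nu).

(** With L = <v,y> and Q = |v|^2 |y|^2 this is, for nu > 0, (nu + n) / nu times Q^(n/2) C_n^nu(L /
    sqrt Q). The normalization survives at nu = 0, where it gives n Q^(n/2) C_n^0 for n >= 1 and the
    value 1 at n = 0. *)
Fixpoint zonal {R : fieldType} (nu L Q : R) (n : nat) : R :=
  match n with
  | 0 => 1
  | 1 => 2 * (nu + 1) * L
  | (k.+1 as k1).+1 => (nu + k1.+1%:R) / k1.+1%:R *
      (2 * L * zonal nu L Q k1 - zonal_coef nu k * Q * zonal nu L Q k)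
  end.

Module ZonalPolynomial.
Import ssrcomplements mpoly.

Section Zonal.
Context {R : realFieldType} {n : nat}.
Implicit Types (p : {mpoly R[n]}) (a v : 'I_n -> R).

Definition mono a c (m : 'X_{1..n}) : R := \prod_i hermite_moment (a i) c (m i).

(** The expectation of p under independent normal coordinates of means [a i] and common variance c,
    defined through moments so that the calculus stays algebraic. *)
Definition gaussE a c p : R := \sum_(m <- msupp p) p@_m * mono a c m.

Lemma gaussEwE a c p k : (msize p <= k)%N ->
  gaussE a c p = \sum_(m : 'X_{1..n < k}) p@_m * mono a c m.
Proof.
move=> le_pk; pose I : subFinType _ := 'X_{1..n < k}.
rewrite /gaussE (big_mksub I) //=; first last.
- by move=> x /msize_mdeg_lt /leq_trans; apply.
- by rewrite msupp_uniq.
by rewrite big_rmcond //= => i; move/memN_msupp_eq0 ->; rewrite mul0r.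
Qed.

Lemma gaussEP a c s p q : gaussE a c (s *: p + q) = s * gaussE a c p + gaussE a c q.
Proof.
pose k := maxn (msize (s *: p + q)) (maxn (msize p) (msize q)).
rewrite !(@gaussEwE _ _ _ k) ?leq_max ?leqnn ?orbT//.
rewrite mulr_sumr -big_split /=; apply: eq_bigr => m _.
by rewrite mcoeffD mcoeffZ mulrDl mulrA.
Qed.

Lemma gaussE0 a c : gaussE a c 0 = 0.
Proof. by rewrite /gaussE msupp0 big_nil. Qed.

Lemma gaussED a c p q : gaussE a c (p + q) = gaussE a c p + gaussE a c q.
Proof. by rewrite -[in LHS](scale1r p) gaussEP mul1r. Qed.

Lemma gaussEZ a c s p : gaussE a c (s *: p) = s * gaussE a c p.
Proof. by rewrite -[s *: p]addr0 gaussEP gaussE0 addr0. Qed.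

Lemma gaussE_sum a c (I : Type) (r : seq I) (F : I -> {mpoly R[n]}) :
  gaussE a c (\sum_(i <- r) F i) = \sum_(i <- r) gaussE a c (F i).
Proof. by elim/big_ind2: _ => [|x1 y1 x2 y2 <- <-|//]; rewrite ?gaussE0 ?gaussED. Qed.

Lemma gaussEX a c m : gaussE a c 'X_[m] = mono a c m.
Proof. by rewrite /gaussE msuppX big_seq1 mcoeffX eqxx mul1r. Qed.

Lemma gaussE1 a c : gaussE a c 1 = 1.
Proof.
rewrite -mpolyX0 gaussEX /mono big1// => i _.
by rewrite mnm0E.
Qed.

(** Gaussian integration by parts in coordinate i. Both sides are linear in p, and on a monomial the
    identity is the recurrence of [hermite_moment] in that coordinate. *)
Lemma gaussE_stein a c (i : 'I_n) p :
  gaussE a c ('X_i * p) = a i * gaussE a c p + c * gaussE a c (p^`M(i)).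
Proof.
have monoS m : gaussE a c ('X_i * 'X_[m]) =
    a i * gaussE a c 'X_[m] + c * gaussE a c ('X_[m])^`M(i).
  rewrite mderivX gaussEZ -mpolyXD !gaussEX /mono.
  rewrite (bigD1 i)//= [X in _ = _ * X + _](bigD1 i)//=.
  rewrite [X in _ = _ + _ * (_ * X)](bigD1 i)//=.
  rewrite mnmDE mnmBE mnm1E eqxx add1n subn1 hermite_momentS.
  have -> : \prod_(j < n | j != i) hermite_moment (a j) c ((U_(i) + m)%MM j) =
    \prod_(j < n | j != i) hermite_moment (a j) c (m j).
    by apply: eq_bigr => j ji; rewrite mnmDE mnm1E eq_sym (negbTE ji) add0n.
  have -> : \prod_(j < n | j != i) hermite_moment (a j) c ((m - U_(i))%MM j) =
    \prod_(j < n | j != i) hermite_moment (a j) c (m j).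
    by apply: eq_bigr => j ji; rewrite mnmBE mnm1E eq_sym (negbTE ji) subn0.
  by ring.
elim/mpolyind: p => [|s m p _ _ IH]; first by rewrite mulr0 mderiv0 !gaussE0 !mulr0 addr0.
rewrite mulrDr -scalerAr mderivD mderivZ !gaussED !gaussEZ IH monoS.
by ring.
Qed.

Variable v : 'I_n -> R.
Let q := \sum_i v i ^+ 2.
Let L : {mpoly R[n]} := \sum_i v i *: 'X_i.
Let Q : {mpoly R[n]} := \sum_i 'X_i ^+ 2.
(** The recurrence of [zonalP] multiplies by L and Q only. The derivative along v, the Laplacian and
    the Euler operator are closed under commutation with these two multiplications, so everything
    about [zonalP] follows by induction from the rules below. *)
Let dv p := \sum_i v i *: p^`M(i).
Let lap p := \sum_i p^`M(i)^`M(i).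
Let eul p := \sum_i 'X_i * p^`M(i).

Let subU (i : 'I_n) : (U_(i) - U_(i))%MM = 0%MM.
Proof. by apply/mnmP => j; rewrite mnmBE subnn mnm0E. Qed.

Let dL i : L^`M(i) = (v i)%:MP.
Proof.
rewrite /L (big_morph _ (mderivD i) (mderiv0 _ i)) (bigD1 i)//= mderivZ.
rewrite mderivX mnm1E eqxx scale1r subU mpolyX0 big1 ?addr0 ?alg_mpolyC//.
by move=> j ji; rewrite mderivZ mderivX mnm1E (negbTE ji) scale0r scaler0.
Qed.

Let dX i j : ('X_j : {mpoly R[n]})^`M(i) = (j == i)%:R.
Proof.
rewrite mderivX mnm1E; case: eqP => [->|_]; last by rewrite scale0r.
by rewrite scale1r subU mpolyX0.
Qed.

Let dQ i : Q^`M(i) = 'X_i *+ 2.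
Proof.
rewrite /Q (big_morph _ (mderivD i) (mderiv0 _ i)) (bigD1 i)//= expr2 mderivM.
rewrite dX eqxx big1 ?addr0; first by rewrite mul1r mulr1 mulr2n.
by move=> j ji; rewrite expr2 mderivM dX (negbTE ji) mul0r mulr0 addr0.
Qed.

Let dvM p1 p2 : dv (p1 * p2) = dv p1 * p2 + p1 * dv p2.
Proof.
rewrite /dv mulr_suml mulr_sumr -big_split /=; apply: eq_bigr => i _.
by rewrite mderivM scalerDr scalerAl scalerAr.
Qed.

Let eulM p1 p2 : eul (p1 * p2) = eul p1 * p2 + p1 * eul p2.
Proof.
rewrite /eul mulr_suml mulr_sumr -big_split /=; apply: eq_bigr => i _.
by rewrite mderivM; ring.
Qed.

Let dvL : dv L = q%:MP.
Proof.
rewrite /dv /q rmorph_sum /=; apply: eq_bigr => i _.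
by rewrite dL -mul_mpolyC -rmorphM expr2.
Qed.

Let dvQ : dv Q = 2 * L.
Proof.
rewrite /dv /L mulr_sumr; apply: eq_bigr => i _.
by rewrite dQ -scalerAr mulr_natl.
Qed.

Let eulL : eul L = L.
Proof. by apply: eq_bigr => i _; rewrite dL mulrC mul_mpolyC. Qed.

Let eulQ : eul Q = 2 * Q.
Proof. by rewrite /eul /Q mulr_sumr; apply: eq_bigr => i _; rewrite dQ; ring. Qed.

Let lapL p : lap (L * p) = 2 * dv p + L * lap p.
Proof.
rewrite /lap /dv !mulr_sumr -big_split /=; apply: eq_bigr => i _.
rewrite !(mderivM, mderivD) dL mderivC -mul_mpolyC; by ring.
Qed.

Let lapQ p : lap (Q * p) = (2 * n%:R) * p + 4 * eul p + Q * lap p.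
Proof.
have -> : (2 * n%:R) * p = \sum_(i < n) 2 * p.
  by rewrite sumr_const card_ord -[RHS]mulr_natl; ring.
rewrite /lap /eul !mulr_sumr -!big_split /=; apply: eq_bigr => i _.
rewrite !(mderivM, mderivD) !dQ mderivMn dX eqxx /=; by ring.
Qed.

Let gL a c p : gaussE a c (L * p) =
  (\sum_i v i * a i) * gaussE a c p + c * gaussE a c (dv p).
Proof.
rewrite /L /dv !mulr_suml !gaussE_sum mulr_sumr -big_split /=.
apply: eq_bigr => i _; rewrite -scalerAl !gaussEZ gaussE_stein; by ring.
Qed.

Let gE a c p : gaussE a c (eul p) =
  \sum_i a i * gaussE a c p^`M(i) + c * gaussE a c (lap p).
Proof.
rewrite /eul /lap !gaussE_sum mulr_sumr -big_split /=.
by apply: eq_bigr => i _; rewrite gaussE_stein.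
Qed.

(** Two integrations by parts in each coordinate. The first-order sum is eliminated with [gE], which
    leaves only [eul] and [lap], both explicit on homogeneous harmonic polynomials. *)
Let gQ a c p : gaussE a c (Q * p) = (\sum_i a i ^+ 2) * gaussE a c p +
  c * n%:R * gaussE a c p + 2 * c * gaussE a c (eul p) - c ^+ 2 * gaussE a c (lap p).
Proof.
have -> : gaussE a c (Q * p) = (\sum_i a i ^+ 2) * gaussE a c p +
    c * (\sum_i a i * gaussE a c p^`M(i)) + c * n%:R * gaussE a c p
    + c * gaussE a c (eul p).
  set g := gaussE a c p.
  have -> : c * n%:R * g = \sum_(i < n) c * g.
    by rewrite sumr_const card_ord -[RHS]mulr_natl; ring.
  have -> : c * (\sum_i a i * gaussE a c p^`M(i)) =
      \sum_i c * (a i * gaussE a c p^`M(i)) by rewrite mulr_sumr.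
  have -> : c * gaussE a c (eul p) = \sum_i c * gaussE a c ('X_i * p^`M(i)).
    by rewrite /eul gaussE_sum mulr_sumr.
  have -> : (\sum_i a i ^+ 2) * g = \sum_i a i ^+ 2 * g by rewrite mulr_suml.
  rewrite /Q mulr_suml gaussE_sum -!big_split /=.
  apply: eq_bigr => i _; rewrite expr2 -mulrA !gaussE_stein mderivM dX eqxx mul1r.
  by rewrite gaussED gaussE_stein -/g; ring.
by rewrite gE; ring.
Qed.

Variable nu : R.
Hypothesis nu_ge0 : 0 <= nu.
Hypothesis nuE : n%:R = 2 * nu + 2.

Fixpoint zonalP (k : nat) : {mpoly R[n]} :=
  match k with
  | 0 => 1
  | 1 => (2 * (nu + 1)) *: L
  | (k'.+1 as k1).+1 => ((nu + k1.+1%:R) / k1.+1%:R) *: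
      (2 * L * zonalP k1 - (zonal_coef nu k' * q) *: (Q * zonalP k'))
  end.

Let zonalPSS k : zonalP k.+2 = ((nu + k.+2%:R) / k.+2%:R) *:
      (2 * L * zonalP k.+1 - (zonal_coef nu k * q) *: (Q * zonalP k)).
Proof. by []. Qed.

Lemma zonalP_eval (y : 'I_n -> R) k : (zonalP k).@[y] =
  zonal nu (\sum_i v i * y i) (q * \sum_i y i ^+ 2) k.
Proof.
have LE : L.@[y] = \sum_i v i * y i.
  by rewrite /L raddf_sum /=; apply: eq_bigr => i _; rewrite mevalZ mevalXU.
have QE : Q.@[y] = \sum_i y i ^+ 2.
  rewrite /Q raddf_sum /=; apply: eq_bigr => i _.
  by rewrite expr2 mevalM mevalXU.
have [] : (zonalP k).@[y] = zonal nu (\sum_i v i * y i) (q * \sum_i y i ^+ 2) k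
  /\ (zonalP k.+1).@[y] = zonal nu (\sum_i v i * y i) (q * \sum_i y i ^+ 2) k.+1;
  last by [].
elim: k => [|k [IH1 IH2]].
  by split; [rewrite /= meval1|rewrite /= mevalZ LE].
split=> //; rewrite zonalPSS mevalZ mevalB !mevalM mevalZ mevalM IH1 IH2 LE QE.
have -> : (2 : {mpoly R[n]}).@[y] = 2 by rewrite -mpolyC_nat mevalC.
by rewrite /=; ring.
Qed.

Let pos k : nu + k.+1%:R != 0.
Proof. by rewrite gt_eqF// ltr_wpDl// ltr0n. Qed.

Let mpC (r : R) p : r *: p = r%:MP * p. Proof. by rewrite mul_mpolyC. Qed.

Let natC k : (k%:R : {mpoly R[n]}) = (k%:R)%:MP. Proof. by rewrite mpolyC_nat. Qed.

Let dvZ (r : R) p : dv (r *: p) = r *: dv p.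
Proof.
rewrite /dv scaler_sumr; apply: eq_bigr => i _.
by rewrite mderivZ !scalerA mulrC.
Qed.

Let dvB p1 p2 : dv (p1 - p2) = dv p1 - dv p2.
Proof. by rewrite /dv -sumrB; apply: eq_bigr => i _; rewrite mderivB scalerBr. Qed.

Let dvC (r : R) : dv r%:MP = 0.
Proof. by rewrite /dv big1// => i _; rewrite mderivC scaler0. Qed.

Let eulZ (r : R) p : eul (r *: p) = r *: eul p.
Proof. by rewrite /eul scaler_sumr; apply: eq_bigr => i _; rewrite mderivZ scalerAr. Qed.

Let eulB p1 p2 : eul (p1 - p2) = eul p1 - eul p2.
Proof. by rewrite /eul -sumrB; apply: eq_bigr => i _; rewrite mderivB mulrBr. Qed.

Let lapZ (r : R) p : lap (r *: p) = r *: lap p.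
Proof. by rewrite /lap scaler_sumr; apply: eq_bigr => i _; rewrite !mderivZ. Qed.

Let lapB p1 p2 : lap (p1 - p2) = lap p1 - lap p2.
Proof. by rewrite /lap -sumrB; apply: eq_bigr => i _; rewrite !mderivB. Qed.

Let ML2 p : 2 * L * p = 2 *: (L * p).
Proof. by rewrite -mulrA mpC natC. Qed.

(* The Appell property: differentiating along v lowers the degree. *)
Let dv_zonalP k : dv (zonalP k.+1) =
  (q * zonal_coef nu k * (nu + k.+1%:R)) *: zonalP k.
Proof.
suff [] : dv (zonalP k.+1) = (q * zonal_coef nu k * (nu + k.+1%:R)) *: zonalP k
  /\ dv (zonalP k.+2) = (q * zonal_coef nu k.+1 * (nu + k.+2%:R)) *: zonalP k.+1.
  by [].
(* The term with [dv (zonalP j)] is assumed in the form obtained by solving the recurrence for Q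
   times the polynomial of degree j - 1. This form also makes sense at j = 0, where both sides
   vanish. *)
have step j : dv (zonalP j.+1) = (q * zonal_coef nu j * (nu + j.+1%:R)) *: zonalP j ->
    (zonal_coef nu j * q) *: (Q * dv (zonalP j)) =
      (q * (j%:R + 2 * nu)) *:
        (2 *: (L * zonalP j) - (j.+1%:R / (nu + j.+1%:R)) *: zonalP j.+1) ->
    dv (zonalP j.+2) = (q * zonal_coef nu j.+1 * (nu + j.+2%:R)) *: zonalP j.+1.
  move=> H1 H2; rewrite zonalPSS dvZ dvB ML2 !dvZ !dvM dvL dvQ H1.
  rewrite [(zonal_coef nu j * q) *: (_ + _)]scalerDr H2.
  have e1 : zonal_coef nu j * (nu + j.+1%:R) - zonal_coef nu j = j%:R + 2 * nu.
    case: j {H1 H2} => [|j] /=; first by ring.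
    have pj := pos j; rewrite [j.+1%:R + nu]addrC.
    have -> : nu + j.+2%:R = (nu + j.+1%:R) + 1 by rewrite -[j.+2%:R]natr1 addrA.
    move: pj; set s := nu + j.+1%:R => pj.
    by field.
  have p1 := pos j; have p2 := pos j.+1.
  have j2 : j.+2%:R != 0 :> R by rewrite pnatr_eq0.
  have E : (nu + j.+2%:R) / j.+2%:R * (q *
      (2 + (j%:R + 2 * nu) * (j.+1%:R / (nu + j.+1%:R)))) =
      q * zonal_coef nu j.+1 * (nu + j.+2%:R).
    rewrite /= [j.+1%:R + nu]addrC; field.
    have -> : nu + (1 + j%:R) = nu + j.+1%:R by rewrite [1 + _]addrC natr1.
    have -> : 2 + j%:R = j.+2%:R :> R by rewrite -[j.+2]addn2 natrD addrC.
    by rewrite p1 j2.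
  rewrite -E -e1 ML2 !mpC.
  move: (zonalP j) (zonalP j.+1) ((nu + j.+2%:R) / j.+2%:R) => Z Z1 k0.
  move: (j.+1%:R / (nu + j.+1%:R)) (nu + j.+1%:R) (zonal_coef nu j) => k1 k2 k3.
  by ring.
have H2 j : dv (zonalP j.+1) = (q * zonal_coef nu j * (nu + j.+1%:R)) *: zonalP j ->
    (zonal_coef nu j.+1 * q) *: (Q * dv (zonalP j.+1)) =
      (q * (j.+1%:R + 2 * nu)) *: (2 *: (L * zonalP j.+1)
        - (j.+2%:R / (nu + j.+2%:R)) *: zonalP j.+2).
  move=> ->; rewrite zonalPSS ML2 /= [j.+1%:R + nu]addrC.
  have p1 := pos j; have p2 := pos j.+1.
  have j2 : j.+2%:R != 0 :> R by rewrite pnatr_eq0.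
  rewrite [(j.+2%:R / _) *: _]scalerA.
  have -> : j.+2%:R / (nu + j.+2%:R) * ((nu + j.+2%:R) / j.+2%:R) = 1.
    by rewrite mulrA divfK// divff.
  rewrite scale1r subKr -scalerAr !scalerA; congr (_ *: _).
  by move: p1; set s := nu + j.+1%:R => p1; field.
have H0 : dv (zonalP 1) = (q * zonal_coef nu 0 * (nu + 1)) *: zonalP 0.
  by rewrite /= dvZ dvL !mpC mulr1; ring.
elim: k => [|k [IH1 IH2]].
  split => //; apply: step => //.
  have -> : dv (zonalP 0) = 0 by rewrite /= -mpolyC1 dvC.
  rewrite mulr0 scaler0 /= mulr1 scalerA.
  have -> : 1 / (nu + 1) * (2 * (nu + 1)) = 2.
    by field; exact: (pos 0).
  by rewrite subrr scaler0.
by split => //; apply: step => //; exact: H2.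
Qed.

Let eul_zonalP k : eul (zonalP k) = k%:R *: zonalP k.
Proof.
suff [] : eul (zonalP k) = k%:R *: zonalP k /\
  eul (zonalP k.+1) = k.+1%:R *: zonalP k.+1 by [].
elim: k => [|k [IH1 IH2]].
  split; last by rewrite /= eulZ eulL scale1r.
  by rewrite /eul scale0r big1// => i _; rewrite /= -mpolyC1 mderivC mulr0.
split => //; rewrite zonalPSS eulZ eulB ML2 !eulZ !eulM eulL eulQ IH1 IH2.
rewrite !mpC -!natr1; move: (zonalP k) (zonalP k.+1) => Z Z1.
by ring.
Qed.

(** Harmonicity. Here the dimension enters: the contributions of [lapL] and [lapQ] cancel because 4
    (nu + k + 1) = 2 n + 4 k when n = 2 nu + 2. *)
Let lap_zonalP k : lap (zonalP k) = 0.
Proof.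
suff [] : lap (zonalP k) = 0 /\ lap (zonalP k.+1) = 0 by [].
have dp i (r : R) : (r%:MP)^`M(i) = 0 :> {mpoly R[n]} by rewrite mderivC.
elim: k => [|k [IH1 IH2]].
  split; rewrite /lap big1// => i _.
    by rewrite /= -mpolyC1 !dp.
  by rewrite mderivZ dL -mul_mpolyC -mpolyCM !dp.
split => //; rewrite zonalPSS lapZ lapB ML2 !lapZ lapL lapQ IH1 IH2 dv_zonalP.
rewrite eul_zonalP !mpC (natC n) nuE -!natr1; move: (zonalP k) => Z.
by ring.
Qed.

(** The mean value property of harmonic polynomials for Gaussian averages. In the induction the
    terms in c from [gL] and [gQ] cancel for the same reason as in [lap_zonalP]. *)
Lemma gaussE_zonalP a c k : gaussE a c (zonalP k) = (zonalP k).@[a].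
Proof.
suff [] : gaussE a c (zonalP k) = (zonalP k).@[a] /\
  gaussE a c (zonalP k.+1) = (zonalP k.+1).@[a] by [].
have LE : L.@[a] = \sum_i v i * a i.
  by rewrite /L raddf_sum /=; apply: eq_bigr => i _; rewrite mevalZ mevalXU.
have QE : Q.@[a] = \sum_i a i ^+ 2.
  rewrite /Q raddf_sum /=; apply: eq_bigr => i _.
  by rewrite expr2 mevalM mevalXU.
have gB p1 p2 : gaussE a c (p1 - p2) = gaussE a c p1 - gaussE a c p2.
  by rewrite gaussED -scaleN1r gaussEZ mulN1r.
have gL1 : gaussE a c L = L.@[a].
  rewrite -[in LHS](mulr1 L) gL gaussE1 LE -mpolyC1 dvC gaussE0; ring.
elim: k => [|k [IH1 IH2]].
  by rewrite /= gaussE1 meval1 gaussEZ mevalZ gL1.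
split => //; rewrite zonalPSS gaussEZ mevalZ gB mevalB ML2 !gaussEZ !mevalZ.
rewrite gL gQ !mevalM dv_zonalP eul_zonalP lap_zonalP gaussE0 !gaussEZ IH1 IH2.
rewrite LE QE nuE -!natr1; by ring.
Qed.

(** The coordinates of an increment are integrated one at a time, so the mean value property is
    exported as a list of coefficients and exponents, with one-dimensional moments on the averaged
    side. *)
Lemma zonal_decomposition k : exists S : seq (R * ('I_n -> nat)),
  (forall y : 'I_n -> R, zonal nu (\sum_i v i * y i) (q * \sum_i y i ^+ 2) k =
     \sum_(s <- S) s.1 * \prod_i y i ^+ s.2 i) /\
  (forall (a : 'I_n -> R) c,
     \sum_(s <- S) s.1 * \prod_i hermite_moment (a i) c (s.2 i) =
     zonal nu (\sum_i v i * a i) (q * \sum_i a i ^+ 2) k).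
Proof.
exists [seq ((zonalP k)@_m, (fun i => m i)) | m <- msupp (zonalP k)].
split=> [y|a c].
  by rewrite -zonalP_eval mevalE [RHS]big_map.
by rewrite -zonalP_eval -(gaussE_zonalP a c) [LHS]big_map.
Qed.

End Zonal.
End ZonalPolynomial.

From mathcomp Require Import all_classical all_reals all_analysis.
From mathcomp Require Import measurable_realfun.

Import numFieldTopology.Exports numFieldNormedType.Exports.

Local Open Scope classical_set_scope.
Local Open Scope ring_scope.

(** * Independent increments *)

Section Independence.
Context {R : realType} {d : measure_display} {T : measurableType d}
  (P : probability T R) {I : finType} (X : I -> T -> R).
Hypothesis iX : independent_family P X.
Hypothesis mX : forall i, measurable_fun [set: T] (X i).
Variable i0 : I.

Definition other_cylinders : set (set T) :=
  [set E | exists A : I -> set R, [/\ forall i, measurable (A i), A i0 = setT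
     & E = \bigcap_(i in [set: I]) (X i @^-1` A i)]].

(** The sigma-algebra generated by all variables except [X i0], packaged as a type: depending only
    on the other variables becomes plain measurability on this type, and products with the law of
    [X i0] can be formed. *)
Definition others_type : measurableType _ := g_sigma_algebraType other_cylinders.
Local Notation S := others_type.

Let cylinder_measurable (A : I -> set R) : (forall i, measurable (A i)) ->
  measurable (\bigcap_(i in [set: I]) (X i @^-1` A i)).
Proof.
move=> mA; apply: fin_bigcap_measurable; first exact: finite_finset.
by move=> i _; rewrite -[_ @^-1` _]setTI; exact: mX.
Qed.

Lemma other_cylinders_setI : setI_closed other_cylinders.
Proof.
move=> _ _ [A [mA A0 ->]] [B [mB B0 ->]].
exists (fun i => A i `&` B i); split.
- by move=> i; exact: measurableI.
- by rewrite A0 B0 setTI.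
- by rewrite -bigcapI; apply: eq_bigcapr => i _; rewrite preimage_setI.
Qed.

Lemma other_cylinders_setT : other_cylinders setT.
Proof.
exists (fun=> setT); split => //.
by rewrite bigcapT// => i _; rewrite preimage_setT.
Qed.

Lemma others_measurable : <<s other_cylinders >> `<=` @measurable _ T.
Proof.
apply: smallest_sub; first exact: sigma_algebra_measurable.
by move=> _ [A [mA _ ->]]; exact: cylinder_measurable.
Qed.

Lemma measurable_id_others : measurable_fun [set: T] (id : T -> S).
Proof. by move=> _ A mA; rewrite setTI; exact: others_measurable. Qed.

Lemma measurable_fun_others (i : I) : i != i0 ->
  measurable_fun [set: S] (X i : S -> R).
Proof.
move=> ii0 _ B mB; rewrite setTI; apply: sub_sigma_algebra.
exists (fun j => if j == i then B else setT); split.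
- by move=> j; case: ifP.
- by rewrite eq_sym (negbTE ii0).
- apply/seteqP; split => [w XB j _|w /(_ i Logic.I)] /=; last by rewrite eqxx.
  by case: eqP => // ->.
Qed.

(** Both sides are finite measures in B, so they need to be compared only on the cylinders, which
    are stable under intersection. *)
Lemma independent_others (A B : set T) (D : set R) : A = X i0 @^-1` D ->
  measurable D -> <<s other_cylinders >> B -> P (B `&` A) = (P B * P A)%E.
Proof.
move=> -> mD sB; set A' := _ @^-1` _.
have mA' : measurable A' by rewrite -[A']setTI; exact: mX.
have pA0 : 0 <= fine (P A') by rewrite fine_ge0.
rewrite muleC -[P A']fineK; last exact: fin_num_measure.
rewrite -[B `&` A']/(_ `&` _) -/(mrestr P mA' B).
have -> : ((fine (P A'))%:E * P B = mscale (NngNum pA0) P B)%E by [].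
pose Q1 := [the measure _ _ of mrestr P mA'].
pose Q2 := [the measure _ _ of mscale (NngNum pA0) P].
rewrite -[LHS]/(Q1 B) -[RHS]/(Q2 B).
apply: (g_sigma_algebra_measure_unique other_cylinders _ (fun=> setT)) sB => //.
- by move=> E GE; apply: others_measurable; exact: sub_sigma_algebra.
- by move=> _; exact: other_cylinders_setT.
- by rewrite bigcup_const//.
- exact: other_cylinders_setI.
- move=> _ [C [mC C0 ->]]; rewrite /Q1 /Q2 /= /mrestr /mscale /=.
  rewrite fineK; last exact: fin_num_measure.
  (* The cylinder leaves the slot [i0] free; putting D there makes the intersection a full cylinder,
     to which the product rule applies. *)
  pose C' i := if i == i0 then D else C i.
  have mC' i : measurable (C' i) by rewrite /C'; case: ifP.
  have -> : \bigcap_(i in [set: I]) (X i @^-1` C i) `&` A' =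
            \bigcap_(i in [set: I]) (X i @^-1` C' i).
    apply/seteqP; split => [w [hw1 hw2] i _|w hw]; rewrite /C' /=.
      by case: eqP => [->//|_]; exact: hw1.
    split; last by have := hw i0 Logic.I; rewrite /C' /= eqxx.
    move=> i _; have := hw i Logic.I; rewrite /C' /=; case: eqP => [->|//].
    by rewrite C0.
  rewrite (iX mC') (iX mC) (bigD1 i0)//= [in RHS](bigD1 i0)//= C0.
  rewrite preimage_setT probability_setT mul1e /C' eqxx; congr (_ * _)%E.
  by apply: eq_bigr => i /negbTE ->.
- move=> k; rewrite /Q1 /= /mrestr setTI.
  by rewrite ltey_eq fin_num_measure.
Qed.

(** This replaces conditional expectation given the other variables: the joint law of the identity
    into [others_type] and of [X i0] is a product measure, and Tonelli integrates [X i0] with the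
    rest frozen. *)
Lemma integral_freeze (m : probability R R)
    (law : forall A, measurable A -> P (X i0 @^-1` A) = m A)
    (F : S * R -> \bar R) : measurable_fun [set: S * R] F ->
  (forall z, (0 <= F z)%E) ->
  (\int[P]_w F (w, X i0 w) = \int[P]_w \int[m]_u F (w, u))%E.
Proof.
move=> mF F0.
pose phi (w : T) : S * R := (w, X i0 w).
have mphi : measurable_fun [set: T] phi.
  apply/measurable_fun_pairP; split; first exact: measurable_id_others.
  exact: mX.
have mid : measurable_fun [set: T] (id : T -> S) by exact: measurable_id_others.
pose idS : {mfun T >-> S} := HB.pack (id : T -> S) (isMeasurableFun.Build _ _ _ _ _ mid).
pose phiS : {mfun T >-> (S * R)%type} :=
  HB.pack phi (isMeasurableFun.Build _ _ _ _ _ mphi).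
pose PS : probability S R := distribution P idS.
pose PJ : probability (S * R)%type R := distribution P phiS.
have PJE A : measurable A -> (PS \x m)%E A = PJ A.
  apply: product_measure_unique => B D mB mD.
  rewrite /PJ /PS /distribution /pushforward /= -law//.
  by rewrite -(independent_others (A := X i0 @^-1` D) _ mD).
transitivity (\int[PJ]_z F z)%E.
  by rewrite /PJ ge0_integral_distribution.
rewrite (eq_measure_integral (PS \x m)%E); last by move=> A mA _; apply: esym; exact: PJE.
rewrite fubini_tonelli1// /PS ge0_integral_distribution//.
- by apply: measurable_fun_fubini_tonelli_F.
- by move=> y; apply: integral_ge0 => u _; exact: F0.
Qed.

(** The signed version, by positive and negative parts; the nonnegative version applied to the
    absolute value gives the integrability. *)
Lemma integral_freeze_integrable (m : probability R R)
    (law : forall A, measurable A -> P (X i0 @^-1` A) = m A)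
    (F : S * R -> \bar R) : measurable_fun [set: S * R] F ->
  (\int[P]_w \int[m]_u `|F (w, u)| < +oo)%E ->
  P.-integrable [set: T] (fun w => F (w, X i0 w)) /\
  (\int[P]_w F (w, X i0 w) = \int[P]_w \int[m]_u F (w, u))%E.
Proof.
move=> mF Foo.
have mabs : measurable_fun [set: S * R] (fun z => `|F z|)%E.
  exact: measurableT_comp.
have mW : measurable_fun [set: T] (fun w => F (w, X i0 w)).
  apply: (@measurableT_comp _ _ _ _ _ _ F) => //.
  apply/measurable_fun_pairP; split; first exact: measurable_id_others.
  exact: mX.
have intW : P.-integrable [set: T] (fun w => F (w, X i0 w)).
  apply/integrableP; split => //.
  by rewrite (integral_freeze law mabs).
split=> //.
have mp : measurable_fun [set: S * R] F^\+%E by exact: measurable_funepos.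
have mn : measurable_fun [set: S * R] F^\-%E by exact: measurable_funeneg.
have intF (H : S * R -> \bar R) : measurable_fun [set: S * R] H ->
    (forall z, (0 <= H z <= `|F z|)%E) ->
    P.-integrable [set: T] (fun w => \int[m]_u H (w, u))%E.
  move=> mH H0; apply/integrableP; split.
    apply: (@measurableT_comp _ _ _ _ _ _ (fubini_F m H)).
      by apply: measurable_fun_fubini_tonelli_F => // z; case/andP: (H0 z).
    exact: measurable_id_others.
  apply: le_lt_trans Foo; apply: ge0_le_integral => //.
  - apply: measurableT_comp => //.
    apply: (@measurableT_comp _ _ _ _ _ _ (fubini_F m H)).
      by apply: measurable_fun_fubini_tonelli_F => // z; case/andP: (H0 z).
    exact: measurable_id_others.
  - apply: (@measurableT_comp _ _ _ _ _ _ (fubini_F m (fun z => `|F z|)%E)).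
      by apply: measurable_fun_fubini_tonelli_F.
    exact: measurable_id_others.
  - move=> w _; rewrite gee0_abs; last first.
      by apply: integral_ge0 => u _; case/andP: (H0 (w, u)).
    apply: ge0_le_integral => //.
    + by move=> u _; case/andP: (H0 (w, u)).
    + exact: (measurable_fun_pair2 (w : S) mH).
    + exact: (measurable_fun_pair2 (w : S) mabs).
    + by move=> u _; case/andP: (H0 (w, u)).
have Fp z : (0 <= F^\+ z <= `|F z|)%E.
  by have /funeqP/(_ z) /= -> := fune_abse F; rewrite funepos_ge0 leeDl ?funeneg_ge0.
have Fn z : (0 <= F^\- z <= `|F z|)%E.
  by have /funeqP/(_ z) /= -> := fune_abse F; rewrite funeneg_ge0 leeDr ?funepos_ge0.
rewrite integralE.
transitivity (\int[P]_w \int[m]_u (F^\+ (w, u)) -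
              \int[P]_w \int[m]_u (F^\- (w, u)))%E.
  congr (_ - _)%E.
    rewrite -(integral_freeze law mp (funepos_ge0 F)).
    by apply: eq_integral => w _; rewrite funepos.unlock.
  rewrite -(integral_freeze law mn (funeneg_ge0 F)).
  by apply: eq_integral => w _; rewrite funeneg.unlock.
rewrite -integralB//; [|exact: intF..].
apply: eq_integral => w _; rewrite [RHS]integralE.
by congr (_ - _)%E; apply: eq_integral => u _;
  rewrite ?funepos.unlock ?funeneg.unlock.
Qed.

End Independence.

Lemma measurable_bigprod (d : measure_display) (T : measurableType d)
    (R : realType) (I : Type) (r : seq I) (Q : pred I) (h : I -> T -> R) :
  (forall i, Q i -> measurable_fun [set: T] (h i)) ->
  measurable_fun [set: T] (fun x => \prod_(i <- r | Q i) h i x).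
Proof.
move=> mh; elim: r => [|i r IH].
  by under eq_fun do rewrite big_nil; exact: measurable_cst.
under eq_fun do rewrite big_cons.
by case: (boolP (Q i)) => // Qi; apply: measurable_funM => //; exact: mh.
Qed.

Section Chain.
Context {R : realType} {d : measure_display} {T : measurableType d}
  (P : probability T R) {I : finType} (X : I -> T -> R).
Hypothesis iX : independent_family P X.
Hypothesis mX : forall i, measurable_fun [set: T] (X i).
Variables (n : nat) (e : 'I_n -> I).
Hypothesis inj_e : injective e.
Variable m : probability R R.
Hypothesis law : forall i A, measurable A -> P (X (e i) @^-1` A) = m A.
Variables (V : T -> R) (Y : 'I_n -> T -> R).
Hypothesis mV : forall i, measurable_fun [set: others_type X (e i)]
  (V : others_type X (e i) -> R).
Hypothesis mY : forall i j, measurable_fun [set: others_type X (e i)]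
  (Y j : others_type X (e i) -> R).

(** Interpolates between all increments present (k = n) and all increments integrated out (k = 0).
    Passing from k + 1 to k freezes everything except the increment [e k]. *)
Definition chain_term (g Pg : 'I_n -> R -> R) (W : T -> R) k w : R :=
  W w * \prod_(i < n) (if (i < k)%N then g i (Y i w + X (e i) w)
                       else Pg i (Y i w)).

Let freeze_arg (g Pg : 'I_n -> R -> R) (W : T -> R) (k : 'I_n)
    (z : others_type X (e k) * R) : R :=
  W z.1 * (g k (Y k z.1 + z.2) * \prod_(i < n | i != k)
    (if (i < k)%N then g i (Y i z.1 + X (e i) z.1) else Pg i (Y i z.1))).

Let freeze_argE g Pg W (k : 'I_n) w :
  freeze_arg g Pg W (k := k) (w, X (e k) w) = chain_term g Pg W k.+1 w.
Proof.
rewrite /freeze_arg /chain_term [in RHS](bigD1 k)//= ltnSn.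
congr (_ * (_ * _)); apply: eq_bigr => i ik.
rewrite ltnS (leq_eqVlt i k); move: ik; rewrite -val_eqE /= => /negbTE ->.
done.
Qed.

Let measurable_arg (g Pg : 'I_n -> R -> R) (W : T -> R) (k : 'I_n) :
  (forall i, measurable_fun [set: R] (g i)) ->
  (forall i, measurable_fun [set: R] (Pg i)) ->
  measurable_fun [set: others_type X (e k)] (W : others_type X (e k) -> R) ->
  measurable_fun setT (freeze_arg g Pg W (k := k)).
Proof.
move=> mg mPg mW; apply: measurable_funM.
  by apply: (measurableT_comp mW).
apply: measurable_funM.
  apply: (measurableT_comp (mg k)); apply: measurable_funD => //.
  pose Yk : others_type X (e k) -> R := Y k.
  exact: (@measurableT_comp _ _ _ _ _ _ Yk _ fst (@mY k k) measurable_fst).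
apply: measurable_bigprod => i ik.
have mYi : measurable_fun setT
    ((Y i : others_type X (e k) -> R) \o (@fst (others_type X (e k)) R)).
  pose Yi : others_type X (e k) -> R := Y i.
  exact: (@measurableT_comp _ _ _ _ _ _ Yi _ fst (@mY k i) measurable_fst).
have [ltik|_] := boolP (i < k)%N; last exact: (measurableT_comp (mPg i) mYi).
apply: (measurableT_comp (mg i)); apply: measurable_funD => //.
pose Xi : others_type X (e k) -> R := X (e i).
apply: (@measurableT_comp _ _ _ _ _ _ Xi _ fst _ measurable_fst).
apply: measurable_fun_others => //.
by apply: contra ik => /eqP /inj_e ->.
Qed.

Let integral_arg (g Pg : 'I_n -> R -> R) (W : T -> R) (k : 'I_n) w :
  (forall i, measurable_fun [set: R] (g i)) ->
  (forall y, m.-integrable setT (fun u => (g k (y + u))%:E)) ->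
  (forall y, \int[m]_u (g k (y + u))%:E = (Pg k y)%:E)%E ->
  (\int[m]_u (freeze_arg g Pg W (k := k) (w, u))%:E
    = (chain_term g Pg W k w)%:E)%E.
Proof.
move=> mg ig Pgk; rewrite /freeze_arg /=.
pose D := \prod_(i < n | i != k)
  (if (i < k)%N then g i (Y i w + X (e i) w) else Pg i (Y i w)).
rewrite -/D.
transitivity (\int[m]_u ((W w * D)%:E * (g k (Y k w + u))%:E))%E.
  by apply: eq_integral => u _; rewrite -EFinM mulrA mulrAC.
rewrite integralZl//= Pgk -EFinM /chain_term [in RHS](bigD1 k)//= ltnn.
by rewrite -/D mulrAC mulrA.
Qed.

Lemma chain_ge0 (g Pg : 'I_n -> R -> R) (W : T -> R) :
  (forall i, measurable_fun [set: others_type X (e i)]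
     (W : others_type X (e i) -> R)) ->
  (forall i, measurable_fun [set: R] (g i)) ->
  (forall i, measurable_fun [set: R] (Pg i)) ->
  (forall i y, m.-integrable setT (fun u => (g i (y + u))%:E)) ->
  (forall i y, \int[m]_u (g i (y + u))%:E = (Pg i y)%:E)%E ->
  (forall w, 0 <= W w) -> (forall i y, 0 <= g i y) ->
  forall k, (k <= n)%N ->
  (\int[P]_w (chain_term g Pg W k w)%:E = \int[P]_w (chain_term g Pg W 0 w)%:E)%E.
Proof.
move=> mW mg mPg ig Pgi W0 g0.
have Pg0 i y : 0 <= Pg i y.
  by rewrite -lee_fin -Pgi integral_ge0// => u _; rewrite lee_fin.
elim=> [//|k IH] kn; rewrite -(IH (ltnW kn)).
pose k' := Ordinal kn.
transitivity (\int[P]_w (freeze_arg g Pg W (k := k') (w, X (e k') w))%:E)%E.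
  by apply: eq_integral => w _; rewrite freeze_argE.
rewrite (integral_freeze iX mX (law k')
  (F := fun z => (freeze_arg g Pg W (k := k') z)%:E)).
- by apply: eq_integral => w _; rewrite integral_arg.
- by apply/measurable_EFinP; exact: measurable_arg.
- move=> z; rewrite lee_fin mulr_ge0// mulr_ge0//.
  by apply: prodr_ge0 => i _; case: ifP.
Qed.

(** Fubini for the n increments in turn. Each exchange needs absolute integrability of the
    intermediate product, which is derived from the single hypothesis on [aPg]. *)
Lemma chain_integral (n_gt0 : (0 < n)%N) (g Pg aPg : 'I_n -> R -> R) :
  (forall i, measurable_fun [set: R] (g i)) ->
  (forall i, measurable_fun [set: R] (Pg i)) ->
  (forall i, measurable_fun [set: R] (aPg i)) ->
  (forall i y, m.-integrable setT (fun u => (g i (y + u))%:E)) ->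
  (forall i y, \int[m]_u (g i (y + u))%:E = (Pg i y)%:E)%E ->
  (forall i y, \int[m]_u `|g i (y + u)|%:E = (aPg i y)%:E)%E ->
  (\int[P]_w (`|V w| * \prod_(i < n) aPg i (Y i w))%:E < +oo)%E ->
  P.-integrable setT
    (fun w => (V w * \prod_(i < n) g i (Y i w + X (e i) w))%:E) /\
  P.-integrable setT (fun w => (V w * \prod_(i < n) Pg i (Y i w))%:E) /\
  (\int[P]_w (V w * \prod_(i < n) g i (Y i w + X (e i) w))%:E =
   \int[P]_w (V w * \prod_(i < n) Pg i (Y i w))%:E)%E.
Proof.
move=> mg mPg maPg ig Pgi aPgi Voo.
pose ag i y := `|g i y|.
have mag i : measurable_fun [set: R] (ag i) by exact: measurableT_comp.
have iag i y : m.-integrable setT (fun u => (ag i (y + u))%:E).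
  exact: (integrable_abse (ig i y)).
have aPg0 i y : 0 <= aPg i y.
  by rewrite -lee_fin -aPgi integral_ge0// => u _; rewrite lee_fin.
have Pg_le i y : `|Pg i y| <= aPg i y.
  rewrite -lee_fin -abse_EFin -Pgi -aPgi.
  by apply: le_abse_integral => //; case/integrableP: (ig i y).
(* The chain of absolute values has the same integral at every stage, so finiteness at k = 0 carries
   over to all k. *)
have chain_oo k : (k <= n)%N ->
    (\int[P]_w (chain_term ag aPg (fun w => `|V w|) k w)%:E < +oo)%E.
  move=> kn; rewrite chain_ge0//; try exact: Voo.
  all: try by move=> i; apply: measurableT_comp => //; exact: mV.
  by move=> i y; exact: normr_ge0.
have step (k : 'I_n) :
    P.-integrable setT (fun w => (chain_term g Pg V k.+1 w)%:E) /\
    (\int[P]_w (chain_term g Pg V k.+1 w)%:E =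
     \int[P]_w (chain_term g Pg V k w)%:E)%E.
  pose F0 (z : others_type X (e k) * R) := (freeze_arg g Pg V z)%:E.
  have [||I1 I2] := @integral_freeze_integrable _ _ _ _ _ _ iX mX (e k) m
    (@law k) F0.
  - by apply/measurable_EFinP; exact: measurable_arg.
  - apply: le_lt_trans (chain_oo k _); last exact: ltnW.
    have -> : (\int[P]_w (chain_term ag aPg (fun w => `|V w|) k w)%:E =
       \int[P]_w \int[m]_u
         (freeze_arg ag aPg (fun w => `|V w|) (k := k) (w, u))%:E)%E.
      apply: eq_integral => w _; rewrite integral_arg//; exact: aPgi.
    have mA W f f' : (forall i, measurable_fun [set: R] (f i)) ->
       (forall i, measurable_fun [set: R] (f' i)) ->
       measurable_fun [set: others_type X (e k)] (W : others_type X (e k) -> R) ->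
       measurable_fun setT (fun z => (freeze_arg f f' W (k := k) z)%:E).
      by move=> mf mf' mW; apply/measurable_EFinP; exact: measurable_arg.
    have mAV : measurable_fun [set: others_type X (e k)]
        ((fun w => `|V w|) : others_type X (e k) -> R).
      by apply: measurableT_comp => //; exact: mV.
    have pos z : (0 <= (freeze_arg ag aPg (fun w => `|V w|) (k := k) z)%:E)%E.
      rewrite lee_fin /freeze_arg mulr_ge0// mulr_ge0// /ag//.
      by apply: prodr_ge0 => i _; case: ifP.
    apply: (@ge0_le_integral _ _ _ P setT measurableT).
    + by move=> w _; exact: integral_ge0.
    + apply: (@measurableT_comp _ _ _ _ _ _ (fubini_F m
        (fun z => `|F0 z|)%E)).
        apply: measurable_fun_fubini_tonelli_F => //.
        by apply: measurableT_comp => //; exact: mA.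
      exact: measurable_id_others.
    + apply: (@measurableT_comp _ _ _ _ _ _ (fubini_F m
        (fun z => (freeze_arg ag aPg (fun w => `|V w|) (k := k) z)%:E)%E)).
        by apply: measurable_fun_fubini_tonelli_F => //; exact: mA.
      exact: measurable_id_others.
    + move=> w _; apply: (@ge0_le_integral _ _ _ m setT measurableT) => //.
      * apply: measurableT_comp => //.
        exact: (@measurable_fun_pair2 _ _ _ (others_type X (e k)) _ _ F0 w
          (mA V g Pg mg mPg (@mV k))).
      * exact: (@measurable_fun_pair2 _ _ _ (others_type X (e k)) _ _
          (fun z => (freeze_arg ag aPg (fun w => `|V w|) (k := k) z)%:E) w
          (mA (fun w => `|V w|) ag aPg mag maPg mAV)).
      * move=> u _; rewrite abse_EFin lee_fin /freeze_arg !normrM.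
        rewrite ler_wpM2l// ler_wpM2l// normr_prod.
        by apply: ler_prod => i _; rewrite normr_ge0/=; case: ifP.
  split.
    by apply: eq_integrable I1 => // w _; rewrite /F0 freeze_argE.
  transitivity (\int[P]_w F0 (w, X (e k) w))%E.
    by apply: eq_integral => w _; rewrite /F0 freeze_argE.
  by rewrite I2; apply: eq_integral => w _; rewrite /F0 integral_arg.
have E0 w : chain_term g Pg V 0 w = V w * \prod_(i < n) Pg i (Y i w) by [].
have En w : chain_term g Pg V n w =
    V w * \prod_(i < n) g i (Y i w + X (e i) w).
  by congr (_ * _); apply: eq_bigr => i _; rewrite ltn_ord.
have Ieq k : (k <= n)%N -> (\int[P]_w (chain_term g Pg V k w)%:E =
    \int[P]_w (chain_term g Pg V 0 w)%:E)%E.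
  elim: k => [//|k IH] kn; rewrite -(IH (ltnW kn)).
  by have [_] := step (Ordinal kn).
split; last split; last first.
  transitivity (\int[P]_w (chain_term g Pg V n w)%:E)%E.
    by apply: eq_integral => w _; rewrite En.
  by rewrite Ieq//; apply: eq_integral => w _; rewrite E0.
  (* Measurability of V is known only relative to some [others_type], so one index is needed to see
     V as measurable on T. *)
  pose i0 := Ordinal n_gt0.
  have mT (f : T -> R) : measurable_fun [set: others_type X (e i0)]
      (f : others_type X (e i0) -> R) -> measurable_fun [set: T] f.
    move=> mf _ A mA; have := mf measurableT A mA; rewrite !setTI.
    exact: others_measurable.
  apply/integrableP; split.
    apply/measurable_EFinP; apply: measurable_funM; first exact: mT.
    by apply: measurable_bigprod => i _; apply: measurableT_comp => //; exact: mT.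
  apply: le_lt_trans Voo; apply: (@ge0_le_integral _ _ _ P setT measurableT) => //.
  - apply/measurable_EFinP; apply: measurableT_comp => //.
    apply: measurable_funM; first exact: mT.
    by apply: measurable_bigprod => i _; apply: measurableT_comp => //; exact: mT.
  - apply/measurable_EFinP; apply: measurable_funM.
      by apply: measurableT_comp => //; exact: mT.
    by apply: measurable_bigprod => i _; apply: measurableT_comp => //; exact: mT.
  - move=> w _; rewrite abse_EFin lee_fin normrM ler_wpM2l// normr_prod.
    by apply: ler_prod => i _; rewrite normr_ge0/=.
suff : P.-integrable setT (fun w => (chain_term g Pg V n w)%:E).
  by apply: eq_integrable => // w _; rewrite En.
have kn : (n.-1 < n)%N by rewrite prednK.
by have [+ _] := step (Ordinal kn); rewrite /= prednK.
Qed.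

End Chain.

(** * Gaussian integrals *)

Lemma cvg0_le {R : realType} (f g : nat -> R) : (forall n, `|f n| <= g n) ->
  g @ \oo --> (0 : R) -> f @ \oo --> (0 : R).
Proof.
move=> fg g0; apply/norm_cvg0P.
apply: (squeeze_cvgr _ (cvg_cst (0 : R)) g0).
by apply: nearW => n; rewrite normr_ge0 fg.
Qed.

Section NormalIntegral.
Context {R : realType}.
Local Notation mu := (@lebesgue_measure R).

Lemma ge0_integral_normal_prob (m s : R) (f : R -> \bar R) : s != 0 ->
  (forall x, (0 <= f x)%E) -> measurable_fun [set: R] f ->
  (\int[normal_prob m s]_x f x = \int[mu]_x (f x * (normal_pdf m s x)%:E))%E.
Proof.
move=> s0 f0 mf.
pose nu := [the probability _ R of normal_prob m s].
have numu : nu `<< mu by exact: normal_prob_dominates.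
rewrite -(Radon_Nikodym_SigmaFinite.change_of_variables numu f0 measurableT mf).
have mpdf : measurable_fun [set: R] (fun x => (normal_pdf m s x)%:E).
  by apply/measurable_EFinP; exact: measurable_normal_pdf.
have iRN := Radon_Nikodym_SigmaFinite.f_integrable numu.
apply: ae_eq_integral => //.
- by apply: emeasurable_funM => //; exact: measurable_int iRN.
- exact: emeasurable_funM.
- apply: ae_eqe_mul2l; apply: integral_ae_eq => // E _ mE.
  by rewrite -Radon_Nikodym_SigmaFinite.f_integral.
Qed.

Lemma integral_normal_prob (m s : R) (f : R -> R) : s != 0 ->
  measurable_fun [set: R] f ->
  mu.-integrable [set: R] (fun x => (f x * normal_pdf m s x)%:E) ->
  (normal_prob m s).-integrable [set: R] (fun x => (f x)%:E) /\
  (\int[normal_prob m s]_x (f x)%:E = \int[mu]_x (f x * normal_pdf m s x)%:E)%E.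
Proof.
move=> s0 mf fi.
have mfE : measurable_fun [set: R] (fun x => (f x)%:E) by exact/measurable_EFinP.
have fnu : (normal_prob m s).-integrable [set: R] (fun x => (f x)%:E).
  apply/integrableP; split=> //.
  rewrite ge0_integral_normal_prob//; last exact: measurableT_comp.
  case/integrableP: fi => _; apply: le_lt_trans.
  apply: ge0_le_integral => //.
  - by move=> x _; rewrite mule_ge0// lee_fin normal_pdf_ge0.
  - apply: emeasurable_funM; first exact: measurableT_comp.
    by apply/measurable_EFinP; exact: measurable_normal_pdf.
  - apply: measurableT_comp => //; apply/measurable_EFinP.
    by apply: measurable_funM => //; exact: measurable_normal_pdf.
  - by move=> x _; rewrite !abse_EFin normrM EFinM (ger0_norm (normal_pdf_ge0 _ _ _)).
split=> //.
rewrite integralE [RHS]integralE; congr (_ - _)%E.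
- rewrite ge0_integral_normal_prob//; last exact: measurable_funepos.
  apply: eq_integral => x _; rewrite funepos.unlock /= EFinM.
  by rewrite maxe_pMl ?lee_fin ?normal_pdf_ge0// mul0e.
- rewrite ge0_integral_normal_prob//; last exact: measurable_funeneg.
  apply: eq_integral => x _; rewrite funeneg.unlock; lazy beta; rewrite EFinM.
  by rewrite maxe_pMl ?lee_fin ?normal_pdf_ge0// mul0e mulNe.
Qed.

Lemma integral_derivative_line (g g' : R -> R) :
  (forall x : R, is_derive x 1 g (g' x)) -> continuous g' ->
  mu.-integrable [set: R] (EFin \o g') ->
  (fun n : nat => g n%:R) @ \oo --> (0 : R) ->
  (fun n : nat => g (- n%:R)) @ \oo --> (0 : R) ->
  (\int[mu]_x (g' x)%:E = 0)%E.
Proof.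
move=> dg cg' ig' g0 gN0.
pose F n := (\int[mu]_(x in `[(- n%:R)%R, n%:R%R]) (g' x)%:E)%E.
have FE n : F n.+1 = (g n.+1%:R - g (- n.+1%:R))%:E.
  rewrite /F (continuous_FTC2 (F := g))//.
  - by rewrite ltrNl (@lt_le_trans _ _ 0)// oppr_lt0 ltr0n.
  - by apply: continuous_subspaceT => x; exact: cg'.
  - split.
    + by move=> x _; have [] := dg x.
    + apply: cvg_at_right_filter; apply: differentiable_continuous.
      by apply/derivable1_diffP; have [] := dg (- n.+1%:R).
    + apply: cvg_at_left_filter; apply: differentiable_continuous.
      by apply/derivable1_diffP; have [] := dg n.+1%:R.
  - by move=> x _; rewrite derive1E; have [_ ->] := dg x.
have F0 : (fun n => F n.+1) @ \oo --> 0%E.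
  under eq_fun do rewrite FE.
  apply/fine_cvgP; split; first exact: nearW.
  have -> : (fine \o (fun n => (g n.+1%:R - g (- n.+1%:R))%:E)) =
            (fun n => g n.+1%:R - g (- n.+1%:R)) by [].
  rewrite -[X in _ --> X](subr0 0); apply: cvgB.
    by rewrite -(cvg_shiftS (fun n => g n%:R)) in g0.
  by rewrite -(cvg_shiftS (fun n => g (- n%:R))) in gN0.
have Fg : F @ \oo --> (\int[mu]_x (g' x)%:E)%E.
  pose f_ n := (fun x => (g' x)%:E) \_ `[(- n%:R)%R, n%:R%R].
  have -> : F = fun n => (\int[mu]_x f_ n x)%E.
    by apply/funext => n; rewrite /F integral_mkcond.
  have mg' : measurable_fun [set: R] (fun x => (g' x)%:E).
    by apply/measurable_EFinP; exact: continuous_measurable_fun.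
  have [] := @dominated_convergence _ _ _ mu _ measurableT f_
     (fun x => (g' x)%:E) (fun x => `|(g' x)%:E|)%E => //.
  - by move=> n; apply/(measurable_restrictT _ _).1; [|exact: measurable_funTS].
  - apply: aeW => x _; apply: cvg_near_cst.
    near=> n; rewrite /f_ patchE ifT// inE/= in_itv/= -ler_norml.
    by near: n; exact: nbhs_infty_ger.
  - exact: integrable_abse.
  - apply: aeW => x n _; rewrite /f_ patchE; case: ifP => // _.
    by rewrite abse0.
have F0' : F @ \oo --> 0%E by rewrite -(cvg_shiftS F).
by rewrite -(cvg_lim _ Fg)//; apply/cvg_lim.
Unshelve. all: by end_near. Qed.

Lemma expR_normr_le (x : R) : expR `|x| <= expR x + expR (- x).
Proof.
by case: (ger0P x) => _; [rewrite lerDl|rewrite lerDr]; exact: expR_ge0.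
Qed.

Lemma normrX_le_expR (k : nat) (x : R) : `|x| ^+ k <= k`!%:R * expR `|x|.
Proof.
case: k => [|k]; first by rewrite expr0 fact0 mul1r -expR0 ler_expR.
rewrite -ler_pdivrMl ?ltr0n ?fact_gt0// mulrC.
by apply: le_trans (expR_ge1Dxn k (normr_ge0 x)); rewrite lerDr.
Qed.

Lemma normal_exp_shift (b k u : R) (c : R) : 0 < c ->
  expR (k * u) * normal_pdf b (Num.sqrt c) u =
  expR (k * b + k ^+ 2 * c / 2) * normal_pdf (b + k * c) (Num.sqrt c) u.
Proof.
move=> c0.
have s0 : Num.sqrt c != 0 by rewrite sqrtr_eq0 -ltNge.
rewrite !normal_pdfE// /normal_fun sqr_sqrtr ?(ltW c0)//.
rewrite mulrCA [RHS]mulrCA -!expRD; congr (_ * expR _).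
by field; rewrite gt_eqF.
Qed.

Lemma integrable_poly_normal (a b c : R) (k : nat) : 0 < c ->
  mu.-integrable [set: R]
    (fun u => ((a + u) ^+ k * normal_pdf b (Num.sqrt c) u)%:E).
Proof.
move=> c0.
have s0 : Num.sqrt c != 0 by rewrite sqrtr_eq0 -ltNge.
pose C := k`!%:R * expR `|a|.
(* |a + u|^k is at most C (e^u + e^(-u)), and multiplying a normal density by e^u or e^(-u) only
   shifts its mean, up to a constant ([normal_exp_shift]). *)
pose dom u := C * (expR (1 * b + 1 ^+ 2 * c / 2) *
    normal_pdf (b + 1 * c) (Num.sqrt c) u) +
  C * (expR (-1 * b + (-1) ^+ 2 * c / 2) *
    normal_pdf (b + -1 * c) (Num.sqrt c) u).
apply: (@le_integrable _ _ _ mu _ measurableT _ (EFin \o dom)).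
- apply/measurable_EFinP; apply: measurable_funM; last exact: measurable_normal_pdf.
  by apply: measurable_funX; exact: measurable_funD.
- move=> u _; rewrite /= lee_fin normrM (ger0_norm (normal_pdf_ge0 _ _ _)).
  apply: le_trans (ler_norm _); rewrite /dom -!normal_exp_shift//.
  rewrite -mulrDr -mulrDl mulrA ler_wpM2r ?normal_pdf_ge0//.
  rewrite normrX (le_trans (normrX_le_expR _ _))// /C -mulrA.
  rewrite ler_wpM2l// mul1r mulN1r.
  apply: (@le_trans _ _ (expR `|a| * expR `|u|)).
    by rewrite -expRD ler_expR ler_normD.
  by rewrite ler_wpM2l ?expR_ge0// expR_normr_le.
- rewrite /dom /=; apply: (@integrableD _ _ _ mu _ measurableT
    (fun u => (C * (_ * normal_pdf (b + 1 * c) _ u))%:E)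
    (fun u => (C * (_ * normal_pdf (b + -1 * c) _ u))%:E));
  under eq_fun do rewrite !EFinM; do 2 apply: integrableZl => //;
  exact: integrable_normal_pdf.
Qed.

Lemma is_derive_normal_pdf (b c u : R) : 0 < c ->
  is_derive u 1 (normal_pdf b (Num.sqrt c))
    (- ((u - b) / c) * normal_pdf b (Num.sqrt c) u).
Proof.
move=> c0.
have s0 : Num.sqrt c != 0 by rewrite sqrtr_eq0 -ltNge.
rewrite normal_pdfE// /normal_fun.
have -> : (fun x : R => normal_peak (Num.sqrt c) *
    expR (- (x - b) ^+ 2 / (Num.sqrt c ^+ 2 *+ 2))) =
  (fun x : R => normal_peak (Num.sqrt c) * expR (- (2 * c)^-1 * (x - b) ^+ 2)).
  apply/funext => x; rewrite sqr_sqrtr ?(ltW c0)// -mulr_natl.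
  by congr (_ * expR _); rewrite !mulNr mulrC.
apply: is_derive_eq.
rewrite /GRing.scale /= sqr_sqrtr ?(ltW c0)//.
have -> : - (u - b) ^+ 2 / (c *+ 2) = - (2 * c)^-1 * (u - b) ^+ 2.
  by rewrite -(mulr_natl c 2) !mulNr mulrC.
by field; rewrite gt_eqF.
Qed.

Lemma cvg_expRNn (C : R) : (fun n : nat => C * expR (- n%:R)) @ \oo --> (0 : R).
Proof.
rewrite -[X in _ --> X](mulr0 C); apply: cvgMr.
have -> : (fun n : nat => expR (- n%:R)) = (fun n => (expR (-1)) ^+ n) :> (nat -> R).
  by apply/funext => n; rewrite -expRM_natl mulrN1.
by apply: cvg_expr; rewrite ger0_norm ?expR_ge0// expR_lt1 ltrN10.
Qed.

Lemma poly_normal_bound (a b c : R) (k : nat) : 0 < c ->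
  exists C, forall u, `|(a + u) ^+ k * normal_pdf b (Num.sqrt c) u| <=
    C * expR (- `|u|).
Proof.
move=> c0.
have s0 : Num.sqrt c != 0 by rewrite sqrtr_eq0 -ltNge.
(* The exponent comes from 2|u| <= 2|b| + 2|u - b| and 2|u - b| <= (u - b)^2 / (2c) + 2c. *)
exists (k`!%:R * expR (`|a| + 2 * `|b| + 2 * c) * normal_peak (Num.sqrt c)) => u.
rewrite normrM (ger0_norm (normal_pdf_ge0 _ _ _)) normrX.
rewrite normal_pdfE// /normal_fun sqr_sqrtr ?(ltW c0)//.
apply: (@le_trans _ _ (k`!%:R * expR (`|a| + `|u|) * (normal_peak (Num.sqrt c) *
    expR (- (u - b) ^+ 2 / (c *+ 2))))).
  rewrite ler_wpM2r//; first by rewrite mulr_ge0 ?expR_ge0 ?normal_peak_ge0.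
  apply: le_trans (normrX_le_expR _ _) _.
  by rewrite ler_wpM2l// ler_expR ler_normD.
rewrite -!mulrA ler_wpM2l// mulrCA [leRHS]mulrCA.
rewrite ler_wpM2l ?normal_peak_ge0// -!expRD ler_expR.
have bu : `|u| <= `|b| + `|u - b| by rewrite -{1}(subrKC b u) ler_normD.
have -> : - (u - b) ^+ 2 / (c *+ 2) = - (`|u - b| ^+ 2 / (2 * c)).
  by rewrite real_normK ?num_real// -(mulr_natl c 2) mulNr.
have : 2 * `|u - b| <= `|u - b| ^+ 2 / (2 * c) + 2 * c.
  rewrite -subr_ge0.
  have -> : `|u - b| ^+ 2 / (2 * c) + 2 * c - 2 * `|u - b| =
     (`|u - b| - 2 * c) ^+ 2 / (2 * c) by field; rewrite gt_eqF.
  by rewrite divr_ge0 ?sqr_ge0// mulr_ge0// ltW.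
move: bu; set p := `|u - b|; set q := _ ^+ 2 / _.
lra.
Qed.

Lemma poly_normal_cvg0 (a b c : R) (k : nat) (s : nat -> R) : 0 < c ->
  (forall n, `|s n| = n%:R) ->
  (fun n => (a + s n) ^+ k * normal_pdf b (Num.sqrt c) (s n)) @ \oo --> (0 : R).
Proof.
move=> c0 sn; have [C HC] := poly_normal_bound a b k c0.
by apply: cvg0_le (cvg_expRNn C) => n; rewrite (le_trans (HC _))// sn.
Qed.

Lemma integral_poly_normal (a b c : R) (k : nat) : 0 < c ->
  (\int[mu]_u ((a + u) ^+ k * normal_pdf b (Num.sqrt c) u)%:E
   = (hermite_moment (a + b) c k)%:E)%E.
Proof.
move=> c0.
have s0 : Num.sqrt c != 0 by rewrite sqrtr_eq0 -ltNge.
elim/ltn_ind: k => -[|k] IH.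
  under eq_integral do rewrite expr0 mul1r.
  by rewrite integral_normal_pdf.
pose f j u := (a + u) ^+ j * normal_pdf b (Num.sqrt c) u.
have fi j : mu.-integrable setT (fun u => (f j u)%:E).
  exact: integrable_poly_normal.
pose I j := fine (\int[mu]_u (f j u)%:E).
have iZ r j : mu.-integrable setT (fun u => (r * f j u)%:E).
  by under eq_fun do rewrite EFinM; exact: integrableZl.
have IZ r j : (\int[mu]_u (r * f j u)%:E = (r * I j)%:E)%E.
  under eq_integral do rewrite EFinM; rewrite integralZl// EFinM fineK//.
  exact: integrable_fin_num.
(* This is the derivative of [f k], with u - b written as (a + u) - (a + b). Its vanishing integral
   is the moment recurrence. *)
pose g' u := k%:R * f k.-1 u - c^-1 * f k.+1 u + (a + b) / c * f k u.
have gi0 : mu.-integrable setT (fun u => (k%:R * f k.-1 u - c^-1 * f k.+1 u)%:E).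
  by apply: (integrableB _ (iZ k%:R k.-1) (iZ c^-1 k.+1)).
have gi : mu.-integrable setT (EFin \o g').
  by apply: (integrableD _ gi0 (iZ ((a + b) / c) k)).
have : (\int[mu]_u (g' u)%:E = 0)%E.
  apply: (@integral_derivative_line (f k)) => //.
  - move=> u; rewrite /f.
    have dn := is_derive_normal_pdf b u c0.
    rewrite /g' /f; case: (k) => [|j].
      under eq_fun do rewrite expr0 mul1r.
      apply: is_derive_eq; rewrite !expr0 expr1.
      by field; rewrite gt_eqF.
    have dX : is_derive u 1 (fun u : R => (a + u) ^+ j.+1)
        (j.+1%:R * (a + u) ^+ j).
      have d1 : is_derive u 1 (fun u : R => a + u) 1.
        exact: (is_derive_eq (is_deriveD (is_derive_cst a u 1)
          (is_derive_id u 1)) (add0r _)).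
      have -> : (fun u : R => (a + u) ^+ j.+1) = (fun u : R => a + u) ^+ j.+1.
        by rewrite exprfctE.
      apply: (is_derive_eq (is_deriveX j.+1 d1)).
      by rewrite /GRing.scale /= mulr1 ?mulr_natl.
    apply: (is_derive_eq (is_deriveM dX dn)).
    rewrite /GRing.scale /= !exprS.
    by field; rewrite gt_eqF.
  - have cf j : continuous (f j).
      move=> u; apply: cvgM; last exact: continuous_normal_pdf.
      apply: (cvg_comp (fun u => a + u) (fun z => z ^+ j)).
        by apply: cvgD; [exact: cvg_cst|exact: cvg_id].
      exact: exprn_continuous.
    move=> u; apply: cvgD; first apply: cvgB.
    + by apply: cvgM; [exact: cvg_cst|exact: cf].
    + by apply: cvgM; [exact: cvg_cst|exact: cf].
    + by apply: cvgM; [exact: cvg_cst|exact: cf].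
  - by apply: poly_normal_cvg0 => // n; rewrite ger0_norm.
  - by apply: poly_normal_cvg0 => // n; rewrite normrN ger0_norm.
have -> : (\int[mu]_u (g' u)%:E =
    (k%:R * I k.-1 - c^-1 * I k.+1 + (a + b) / c * I k)%:E)%E.
  transitivity (\int[mu]_u ((k%:R * f k.-1 u - c^-1 * f k.+1 u)%:E
    + ((a + b) / c * f k u)%:E))%E; first by [].
  rewrite (integralD _ gi0 (iZ ((a + b) / c) k))// IZ EFinD.
  congr (_ + _)%E.
  transitivity (\int[mu]_u ((k%:R * f k.-1 u)%:E - (c^-1 * f k.+1 u)%:E))%E.
    by [].
  by rewrite (integralB _ (iZ k%:R k.-1) (iZ c^-1 k.+1))// !IZ.
have Ik : I k = hermite_moment (a + b) c k.
  by rewrite /I /f IH.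
have Ik1 : k%:R * I k.-1 = k%:R * hermite_moment (a + b) c k.-1.
  case: (posnP k) => [->|k0]; first by rewrite !mul0r.
  by rewrite /I /f IH// ltnS leq_pred.
move=> -[]; rewrite Ik Ik1 => I0.
rewrite -/(f k.+1) -[LHS]fineK; last exact: (integrable_fin_num measurableT (fi k.+1)).
rewrite -/(I k.+1) hermite_momentS; congr EFin.
apply: (mulfI (_ : c^-1 != 0)); first by rewrite invr_eq0 gt_eqF.
apply/eqP; rewrite -subr_eq0 -oppr_eq0 -I0; apply/eqP.
by field; rewrite gt_eqF.
Qed.

End NormalIntegral.

Section GaussStep.
Context {R : realType}.
Local Notation mu := (@lebesgue_measure R).

(** The factor produced by averaging one coordinate over a step of length h, when the remaining time
    goes from tau = a - s to tau - h. The argument y already contains the drift v h, which y - v h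
    removes. *)
Definition gauss_factor (v tau h y : R) : R :=
  expR (- v * (y - v * h) - v ^+ 2 * h / 2 - (y - v * h) ^+ 2 / (2 * tau))
  * Num.sqrt ((tau - h) / tau).

Definition gauss_monomial (v tau : R) (k : nat) (z : R) : R :=
  z ^+ k * expR (- v * z - z ^+ 2 / (2 * tau)).

Lemma measurable_gauss_monomial v tau k :
  measurable_fun [set: R] (gauss_monomial v tau k).
Proof.
apply: measurable_funM; first exact: measurable_funX.
apply: measurableT_comp => //; apply: measurable_funB.
  exact: measurable_funM.
by apply: measurable_funM => //; exact: measurable_funX.
Qed.

Lemma ratio_gt0 (tau h : R) : 0 < tau * (tau - h) -> 0 < (tau - h) / tau.
Proof.
move=> tt; have t0 : tau != 0 by apply: contraTneq tt => ->; rewrite mul0r ltxx.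
have -> : (tau - h) / tau = (tau * (tau - h)) / tau ^+ 2 by field.
by rewrite divr_gt0// exprn_even_gt0.
Qed.

(** Completing the square. The factor exp(-v z) removes the drift, and for tau > 0 the resulting
    normal law of y + u is that of a Brownian bridge which reaches 0 at time a, of mean (y - v
    h)(tau - h)/tau and variance h (tau - h)/tau. Positivity of tau (tau - h) says that both times
    lie on the same side of a. *)
Lemma gauss_monomial_normal v tau h y u k : 0 < h -> 0 < tau * (tau - h) ->
  gauss_monomial v (tau - h) k (y + u) * normal_pdf 0 (Num.sqrt h) u =
  gauss_factor v tau h y * ((y + u) ^+ k *
    normal_pdf ((y - v * h) * (tau - h) / tau - y)
      (Num.sqrt (h * ((tau - h) / tau))) u).
Proof.
move=> h0 tt; have q0 := ratio_gt0 tt.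
have t0 : tau != 0 by apply: contraTneq tt => ->; rewrite mul0r ltxx.
have th0 : tau - h != 0 by apply: contraTneq tt => ->; rewrite mulr0 ltxx.
have c0 : 0 < h * ((tau - h) / tau) by rewrite mulr_gt0.
have s0 : Num.sqrt h != 0 by rewrite sqrtr_eq0 -ltNge.
have s1 : Num.sqrt (h * ((tau - h) / tau)) != 0 by rewrite sqrtr_eq0 -ltNge.
rewrite !normal_pdfE// /normal_fun /normal_peak.
rewrite !sqr_sqrtr ?(ltW c0) ?(ltW h0)//.
rewrite /gauss_monomial /gauss_factor.
have -> : Num.sqrt (h * ((tau - h) / tau) * pi *+ 2) =
    Num.sqrt ((tau - h) / tau) * Num.sqrt (h * pi *+ 2).
  rewrite -sqrtrM ?(ltW q0)//; congr Num.sqrt.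
  by rewrite -(mulr_natl (_ * pi)) -(mulr_natl (h * pi)); field.
set p := Num.sqrt (h * _ *+ 2); set q := Num.sqrt ((tau - h) / tau).
have qn0 : q != 0 by rewrite /q sqrtr_eq0 -ltNge.
have pn0 : p != 0.
  by rewrite /p sqrtr_eq0 -ltNge pmulrn_lgt0// mulr_gt0// pi_gt0.
rewrite invfM; set a := (y + u) ^+ k.
set E1 := expR _; set E2 := expR _; set E3 := expR _; set E4 := expR _.
have HE : E1 * E2 = E3 * E4.
  rewrite /E1 /E2 /E3 /E4 -!expRD; congr expR.
  rewrite -(mulr_natl h 2) -(mulr_natl (h * ((tau - h) / tau)) 2).
  by field; rewrite t0 th0 gt_eqF.
have -> : a * E1 * (p^-1 * E2) = a * p^-1 * (E1 * E2) by ring.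
by rewrite HE; field; rewrite qn0 pn0.
Qed.

Lemma gauss_step v tau h y k : 0 < h -> 0 < tau * (tau - h) ->
  (normal_prob 0 (Num.sqrt h)).-integrable [set: R]
    (fun u => (gauss_monomial v (tau - h) k (y + u))%:E) /\
  (\int[normal_prob 0 (Num.sqrt h)]_u
      (gauss_monomial v (tau - h) k (y + u))%:E =
    (gauss_factor v tau h y *
     hermite_moment ((y - v * h) * ((tau - h) / tau))
       (h * ((tau - h) / tau)) k)%:E)%E.
Proof.
move=> h0 tt; have q0 := ratio_gt0 tt.
have c0 : 0 < h * ((tau - h) / tau) by rewrite mulr_gt0.
have s0 : Num.sqrt h != 0 by rewrite sqrtr_eq0 -ltNge.
have mg : measurable_fun [set: R] (fun u => gauss_monomial v (tau - h) k (y + u)).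
  apply: (measurableT_comp (measurable_gauss_monomial _ _ _)).
  exact: measurable_funD.
set b := (y - v * h) * (tau - h) / tau - y.
have ip := integrable_poly_normal y b k c0.
have eq1 u := @gauss_monomial_normal v tau h y u k h0 tt.
have [|I1 I2] := @integral_normal_prob _ 0 _ _ s0 mg.
  apply: eq_integrable; first exact: measurableT; last first.
    exact: (integrableZl measurableT (gauss_factor v tau h y) ip).
  by move=> u _ /=; rewrite eq1 EFinM.
split => //; rewrite I2.
transitivity (\int[mu]_u ((gauss_factor v tau h y)%:E * ((y + u) ^+ k *
    normal_pdf b (Num.sqrt (h * ((tau - h) / tau))) u)%:E))%E.
  by apply: eq_integral => u _; rewrite eq1 EFinM.
rewrite integralZl// integral_poly_normal// -EFinM; congr (_ * hermite_moment _ _ _)%:E.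
by rewrite /b subrKC mulrA.
Qed.

Definition gauss_abs (v tau h : R) (k : nat) (y : R) : R :=
  fine (\int[normal_prob 0 (Num.sqrt h)]_u
    `|gauss_monomial v (tau - h) k (y + u)|%:E)%E.

Lemma integral_gauss_abs v tau h y k : 0 < h -> 0 < tau * (tau - h) ->
  (\int[normal_prob 0 (Num.sqrt h)]_u
    `|gauss_monomial v (tau - h) k (y + u)|%:E = (gauss_abs v tau h k y)%:E)%E.
Proof.
move=> h0 tt; have [ig _] := @gauss_step v tau h y k h0 tt.
rewrite /gauss_abs fineK//; apply: integrable_fin_num => //.
exact: (integrable_abse ig).
Qed.

(** |z|^k <= k! (e^z + e^(-z)), and the two exponentials change v into v - 1 and v + 1, so that the
    case k = 0 of [gauss_step] gives the integrals. *)
Lemma gauss_abs_le v tau h y k : 0 < h -> 0 < tau * (tau - h) ->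
  gauss_abs v tau h k y <=
    k`!%:R * (gauss_factor (v - 1) tau h y + gauss_factor (v + 1) tau h y).
Proof.
move=> h0 tt.
have [i1 e1] := @gauss_step (v - 1) tau h y 0 h0 tt.
have [i2 e2] := @gauss_step (v + 1) tau h y 0 h0 tt.
have [ig _] := @gauss_step v tau h y k h0 tt.
rewrite -lee_fin -integral_gauss_abs//.
have -> : (k`!%:R * (gauss_factor (v - 1) tau h y + gauss_factor (v + 1) tau h y))%:E
  = (\int[normal_prob 0 (Num.sqrt h)]_u (k`!%:R%:E *
      ((gauss_monomial (v - 1) (tau - h) 0 (y + u))%:E +
       (gauss_monomial (v + 1) (tau - h) 0 (y + u))%:E)))%E.
  rewrite integralZl//; last exact: integrableD.
  by rewrite integralD// e1 e2 /= !mulr1.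
apply: ge0_le_integral => //.
- apply/measurable_EFinP; apply: measurableT_comp => //.
  by apply/measurable_EFinP; case/integrableP: ig.
- apply: emeasurable_funM => //.
  by apply: emeasurable_funD; [case/integrableP: i1|case/integrableP: i2].
- move=> u _; rewrite -EFinD -EFinM lee_fin /gauss_monomial !expr0 !mul1r.
  rewrite normrM (ger0_norm (expR_ge0 _)) normrX.
  set z := y + u.
  apply: le_trans (ler_wpM2r (expR_ge0 _) (normrX_le_expR k z)) _.
  rewrite -mulrA ler_wpM2l//.
  apply: le_trans (ler_wpM2r (expR_ge0 _) (expR_normr_le z)) _.
  rewrite mulrDl -!expRD.
  apply: lerD; rewrite ler_expR le_eqVlt; apply/orP; left; apply/eqP; ring.
Qed.

(** For tau > 0 the exponent is a concave quadratic in y and the bound is uniform; for tau < 0 it is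
    convex and a bound exists only on bounded sets. This is the origin of the alternatives in the
    lemmas on stopping. *)
Lemma gauss_abs_bounded v tau h k (K : R) : 0 < h -> 0 < tau * (tau - h) ->
  exists2 C, 0 <= C & forall y, 0 < tau \/ `|y| <= K -> gauss_abs v tau h k y <= C.
Proof.
move=> h0 tt.
have t0 : tau != 0 by apply: contraTneq tt => ->; rewrite mul0r ltxx.
pose K' w := K + `|w * h|.
pose bd w := expR (w ^+ 2 * `|tau| / 2 + `|w| * K' w + K' w ^+ 2 / (2 * `|tau|)).
have tau0 : 0 < `|tau| by rewrite normr_gt0.
have bd_le w y : 0 < tau \/ `|y| <= K -> 0 <= K -> gauss_factor w tau h y <=
    bd w * Num.sqrt ((tau - h) / tau).
  move=> yK K0; rewrite /gauss_factor ler_wpM2r ?sqrtr_ge0// ler_expR.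
  set z := y - w * h.
  have w0 : 0 <= w ^+ 2 * h / 2 by rewrite divr_ge0// mulr_ge0 ?sqr_ge0// ltW.
  have K'0 : 0 <= K' w by rewrite addr_ge0.
  have q1 : 0 <= w ^+ 2 * `|tau| / 2 by rewrite divr_ge0// mulr_ge0 ?sqr_ge0.
  have q2 : 0 <= `|w| * K' w by rewrite mulr_ge0.
  have q3 : 0 <= K' w ^+ 2 / (2 * `|tau|) by rewrite divr_ge0 ?sqr_ge0// mulr_ge0.
  case: yK => [tp|yK].
    have : - w * z - z ^+ 2 / (2 * tau) <= w ^+ 2 * tau / 2.
      rewrite -subr_ge0.
      have -> : w ^+ 2 * tau / 2 - (- w * z - z ^+ 2 / (2 * tau)) =
         (z + w * tau) ^+ 2 / (2 * tau) by field.
      by rewrite divr_ge0 ?sqr_ge0// mulr_ge0// ltW.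
    move: q1; rewrite (gtr0_norm tp) => q1; rewrite (gtr0_norm tp) in q3; lra.
  have zK : `|z| <= K' w by rewrite (le_trans (ler_normB _ _))// lerD2r.
  have p1 : - w * z <= `|w| * K' w.
    rewrite (le_trans (ler_norm _))// normrM normrN.
    by rewrite ler_wpM2l.
  have p2 : - (z ^+ 2 / (2 * tau)) <= K' w ^+ 2 / (2 * `|tau|).
    rewrite (le_trans (ler_norm _))// normrN normf_div normrX normrM.
    rewrite (ger0_norm (ler0n _ 2)) ler_wpM2r// ?invr_ge0 ?mulr_ge0//.
    by rewrite lerXn2r// nnegrE.
  lra.
(* For K < 0 no y satisfies the second alternative, and only the bound for tau > 0 remains. *)
have [K0|K0] := leP 0 K; last first.
  have [C HC] : exists C, forall y, 0 < tau -> gauss_abs v tau h k y <= C.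
    exists (k`!%:R * (expR ((v - 1) ^+ 2 * tau / 2) * Num.sqrt ((tau - h) / tau)
      + expR ((v + 1) ^+ 2 * tau / 2) * Num.sqrt ((tau - h) / tau))) => y tp.
    apply: le_trans (gauss_abs_le v y k h0 tt) _; rewrite ler_wpM2l//.
    have B w : gauss_factor w tau h y <=
        expR (w ^+ 2 * tau / 2) * Num.sqrt ((tau - h) / tau).
      rewrite /gauss_factor ler_wpM2r ?sqrtr_ge0// ler_expR.
      set z := y - w * h; rewrite -subr_ge0.
      have -> : w ^+ 2 * tau / 2 - (- w * z - w ^+ 2 * h / 2 - z ^+ 2 / (2 * tau)) =
         (z + w * tau) ^+ 2 / (2 * tau) + w ^+ 2 * h / 2 by field.
      rewrite addr_ge0//; first by rewrite divr_ge0 ?sqr_ge0// mulr_ge0// ltW.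
      by rewrite divr_ge0// mulr_ge0 ?sqr_ge0// ltW.
    by apply: lerD.
  exists `|C| => // y [tp|/(le_trans (normr_ge0 _))]; last by rewrite leNgt K0.
  by rewrite (le_trans (HC _ tp))// ler_norm.
exists (k`!%:R * (bd (v - 1) * Num.sqrt ((tau - h) / tau)
    + bd (v + 1) * Num.sqrt ((tau - h) / tau))).
  by rewrite mulr_ge0// addr_ge0// mulr_ge0// ?expR_ge0 ?sqrtr_ge0.
move=> y yK; apply: le_trans (gauss_abs_le v y k h0 tt) _; rewrite ler_wpM2l//.
by apply: lerD; exact: bd_le.
Qed.

Lemma measurable_gauss_abs v tau h k : 0 < h -> 0 < tau * (tau - h) ->
  measurable_fun [set: R] (gauss_abs v tau h k).
Proof.
move=> h0 tt; apply: measurableT_comp => //.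
pose F (z : R * R) := (`|gauss_monomial v (tau - h) k (z.1 + z.2)|%:E)%E.
apply: (@measurable_fun_fubini_tonelli_F _ _ _ _ _
  [the probability _ R of normal_prob 0 (Num.sqrt h)] F).
- apply/measurable_EFinP; apply: measurableT_comp => //.
  apply: (measurableT_comp (measurable_gauss_monomial _ _ _)).
  by apply: measurable_funD; [exact: measurable_fst|exact: measurable_snd].
- by move=> z; rewrite lee_fin.
Qed.

End GaussStep.

(** * The space-time kernel and Brownian increments *)

Section Kernel.
Context {R : realType}.

Lemma integral_lincomb (d : measure_display) (T : measurableType d)
    (mu : {measure set T -> \bar R}) (A : Type) (S : seq (R * A))
    (F G : A -> T -> R) :
  (forall s, mu.-integrable setT (fun w => (F s w)%:E)) ->
  (forall s, mu.-integrable setT (fun w => (G s w)%:E)) ->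
  (forall s, \int[mu]_w (F s w)%:E = \int[mu]_w (G s w)%:E)%E ->
  [/\ mu.-integrable setT (fun w => (\sum_(s <- S) s.1 * F s.2 w)%:E),
      mu.-integrable setT (fun w => (\sum_(s <- S) s.1 * G s.2 w)%:E)
    & (\int[mu]_w (\sum_(s <- S) s.1 * F s.2 w)%:E =
       \int[mu]_w (\sum_(s <- S) s.1 * G s.2 w)%:E)%E].
Proof.
move=> iF iG FG; elim: S => [|s S [I1 I2 I3]].
  split; [| |by apply: eq_integral => w _; rewrite !big_nil];
  by under eq_fun do rewrite big_nil; exact: integrable0.
have iFs : mu.-integrable setT (fun w => (s.1 * F s.2 w)%:E).
  by under eq_fun do rewrite EFinM; exact: integrableZl.
have iGs : mu.-integrable setT (fun w => (s.1 * G s.2 w)%:E).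
  by under eq_fun do rewrite EFinM; exact: integrableZl.
have e1 w : (\sum_(s0 <- s :: S) s0.1 * F s0.2 w)%:E =
  ((s.1 * F s.2 w)%:E + (\sum_(s <- S) s.1 * F s.2 w)%:E)%E by rewrite big_cons.
have e2 w : (\sum_(s0 <- s :: S) s0.1 * G s0.2 w)%:E =
  ((s.1 * G s.2 w)%:E + (\sum_(s <- S) s.1 * G s.2 w)%:E)%E by rewrite big_cons.
split.
- by under eq_fun do rewrite e1; exact: integrableD.
- by under eq_fun do rewrite e2; exact: integrableD.
- under eq_integral do rewrite e1; under [RHS]eq_integral do rewrite e2.
  rewrite !integralD//; congr (_ + _)%E => //.
  under eq_integral do rewrite EFinM; under [RHS]eq_integral do rewrite EFinM.
  by rewrite !integralZl// FG.
Qed.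

Context {d : nat}.
Implicit Types (v y : 'rV[R]_d).

Definition nu_of : R := (d%:R - 2) / 2.

Definition zonal_fun v n y : R := zonal nu_of (dotv v y) (dotv v v * dotv y y) n.

(* The space-time function whose composition with the drifted Brownian motion is
   a local martingale up to the time a (for all times when a < 0). *)
Definition heat_fun v n (a t : R) y : R :=
  `|a - t| `^ (- (d%:R / 2 + n%:R)) * expR (dotv v v * t / 2 - dotv v y
     - dotv y y / (2 * (a - t))) * zonal_fun v n y.

End Kernel.

Section ZonalHomogeneity.
Context {R : realType}.

Lemma zonal_homogeneous (nu L Q r : R) n :
  zonal nu (r * L) (r ^+ 2 * Q) n = r ^+ n * zonal nu L Q n.
Proof.
suff [] : zonal nu (r * L) (r ^+ 2 * Q) n = r ^+ n * zonal nu L Q n /\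
  zonal nu (r * L) (r ^+ 2 * Q) n.+1 = r ^+ n.+1 * zonal nu L Q n.+1 by [].
elim: n => [|n [IH1 IH2]].
  by rewrite /= expr0 expr1 mul1r; split => //; ring.
split=> //; move: IH1 IH2 => /=.
set z0 := zonal nu (r * L) _ n; set z1 := (match n with _.+1 => _ | _ => _ end).
move=> -> ->; rewrite !exprS; ring.
Qed.

Lemma sqrtX_mulX_powR (r : R) (d n : nat) : 0 < r ->
  Num.sqrt r ^+ d * r ^+ n = r `^ (d%:R / 2 + n%:R).
Proof.
move=> r0; rewrite powRD; last by rewrite (gt_eqF r0) implybT.
rewrite powR_mulrn ?(ltW r0)//; congr (_ * _).
by rewrite -powR12_sqrt ?(ltW r0)// mulrC powRrM powR_mulrn ?powR_ge0// div1r.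
Qed.

End ZonalHomogeneity.

(* [normal_prob] lives on [measurableTypeR R], whose measure display differs from
   that of [R]. *)
Section NormalLaw.
Context {R : realType} (s : R).

Definition measurable_idR : measurableTypeR R -> R := idfun.

Lemma measurable_fun_idR : measurable_fun [set: measurableTypeR R] measurable_idR.
Proof. exact: measurable_id. Qed.

HB.instance Definition _ :=
  isMeasurableFun.Build _ _ _ _ measurable_idR measurable_fun_idR.

Definition normal_law : probability R R :=
  distribution [the probability _ R of normal_prob (0 : R) s] measurable_idR.

Lemma integral_normal_law (f : R -> R) :
  (normal_prob 0 s).-integrable [set: R] (fun u => (f u)%:E) ->
  normal_law.-integrable [set: R] (fun u => (f u)%:E) /\
  (\int[normal_law]_u (f u)%:E = \int[normal_prob 0 s]_u (f u)%:E)%E.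
Proof.
move=> fi; have mf : measurable_fun [set: R] (fun u => (f u)%:E).
  by case/integrableP: fi.
have e : (\int[normal_law]_u (f u)%:E = \int[normal_prob 0 s]_u (f u)%:E)%E.
  by rewrite integral_distribution.
split=> //; apply/integrableP; split=> //.
rewrite ge0_integral_distribution//; last exact: measurableT_comp.
by case/integrableP: fi.
Qed.

End NormalLaw.

Section BrownianStep.
Context {R : realType} {disp : measure_display} {T : measurableType disp}
  (P : probability T R) {d : nat} (hd : (2 <= d)%N)
  {x v : 'rV[R]_d} {B : R -> T -> 'rV[R]_d} (hB : brownian P x B).

Definition drifted (t : R) (w : T) : 'rV[R]_d := B t w + t *: v.

Lemma measurable_drifted t i : 0 <= t ->
  measurable_fun [set: T] (fun w => drifted t w ord0 i).
Proof.
move=> t0; rewrite /drifted; under eq_fun do rewrite mxE.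
by apply: measurable_funD => //; exact: (brownian_measurable hB).
Qed.

Variables (tt : nat -> R) (M : nat).
Hypothesis tt0 : tt 0%N = 0.
Hypothesis tt_lt : forall j, tt j < tt j.+1.

Definition incr (ji : 'I_M.+1 * 'I_d) (w : T) : R :=
  B (tt ji.1.+1) w ord0 ji.2 - B (tt ji.1) w ord0 ji.2.

Let tt_ge0 j : 0 <= tt j.
Proof. by elim: j => [|j IH]; [rewrite tt0|exact: le_trans IH (ltW _)]. Qed.

Let indep : independent_family P incr.
Proof. by apply: (brownian_independent hB) => //; rewrite tt0. Qed.

Let m_incr ji : measurable_fun [set: T] (incr ji).
Proof. by apply: measurable_funB; exact: (brownian_measurable hB). Qed.

(** V does not involve the last increment. It is stated for each of its coordinates in turn, because
    [chain_integral] integrates the coordinates of that increment one after another. *)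
Definition past_measurable (V : T -> R) := forall i0 : 'I_d,
  measurable_fun [set: others_type incr (ord_max, i0)]
    (V : others_type incr (ord_max, i0) -> R).

Lemma past_measurable_brownian j i : (j <= M)%N ->
  past_measurable (fun w => B (tt j) w ord0 i).
Proof.
move=> jM i0; elim: j jM => [|j IH] jM.
  rewrite tt0; under eq_fun do rewrite (brownian_start hB).
  exact: measurable_cst.
have -> : (fun w => B (tt j.+1) w ord0 i) =
    (fun w => B (tt j) w ord0 i + incr (inord j, i) w).
  apply/funext => w; rewrite /incr /= inordK; last by rewrite ltnW.
  by rewrite subrKC.
apply: measurable_funD; first by apply: IH; exact: ltnW.
apply: measurable_fun_others => //.
rewrite xpair_eqE negb_and -val_eqE /= inordK; last by rewrite ltnW.
by rewrite ltn_eqF.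
Qed.

Lemma past_measurable_drifted j i : (j <= M)%N ->
  past_measurable (fun w => drifted (tt j) w ord0 i).
Proof.
move=> jM i0; rewrite /drifted; under eq_fun do rewrite mxE.
by apply: measurable_funD => //; exact: past_measurable_brownian.
Qed.

Let s := tt M.
Let t := tt M.+1.
Let h := t - s.
Let h_gt0 : 0 < h. Proof. by rewrite /h subr_gt0; exact: tt_lt. Qed.

(** The martingale identity over the last interval, tested against a function V of the past.
    Monomials factor over the coordinates and are averaged by [chain_integral]; the mean value
    property then recombines them. If a lies before s, V must confine the path, since the kernel
    grows like a Gaussian. *)
Lemma heat_fun_step (V : T -> R) (n : nat) (a K : R) : past_measurable V ->
  (forall w, `|V w| <= 1) -> 0 < (a - s) * (a - t) ->
  (forall w, V w != 0 -> 0 < a - s \/ forall i, `|drifted s w ord0 i| <= K) ->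
  [/\ P.-integrable setT (fun w => (V w * heat_fun v n a t (drifted t w))%:E),
      P.-integrable setT (fun w => (V w * heat_fun v n a s (drifted s w))%:E)
    & (\int[P]_w (V w * heat_fun v n a t (drifted t w))%:E =
       \int[P]_w (V w * heat_fun v n a s (drifted s w))%:E)%E].
Proof.
move=> mV V1 tau2 hK.
pose tau := a - s.
have tauh : tau - h = a - t by rewrite /tau /h opprB addrA subrK.
have tt2 : 0 < tau * (tau - h) by rewrite tauh.
have q0 := ratio_gt0 tt2.
set q := (tau - h) / tau in q0.
(* The position at time t without the Brownian increment: the drift over the step is already
   included. *)
pose Y (i : 'I_d) (w : T) : R := drifted s w ord0 i + v ord0 i * h.
pose m := normal_law (Num.sqrt h).
pose e (i : 'I_d) : 'I_M.+1 * 'I_d := (ord_max, i).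
have inj_e : injective e by move=> i j [].
have law i A : measurable A -> P (incr (e i) @^-1` A) = m A.
  by move=> mA; rewrite -[RHS](brownian_gaussian hB i (tt_ge0 M) (tt_lt M) mA).
have mY i j : measurable_fun [set: others_type incr (e i)]
    (Y j : others_type incr (e i) -> R).
  by apply: measurable_funD => //; exact: past_measurable_drifted.
have XE i w : drifted t w ord0 i = Y i w + incr (e i) w.
  by rewrite /Y /drifted /incr /= !mxE -/s -/t /h; ring.
have d0 : (0 < d)%N by exact: leq_trans hd.
have nu0 : 0 <= nu_of (R := R) (d := d).
  by rewrite divr_ge0// subr_ge0 (ler_nat _ 2).
have nuE : d%:R = 2 * nu_of (R := R) (d := d) + 2 by rewrite /nu_of; field.
have [S [S1 S2]] := ZonalPolynomial.zonal_decomposition (v ord0) nu0 nuE n.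
pose g (k : 'I_d -> nat) i := gauss_monomial (v ord0 i) (a - t) (k i).
pose Pg (k : 'I_d -> nat) i y := gauss_factor (v ord0 i) tau h y *
  hermite_moment ((y - v ord0 i * h) * q) (h * q) (k i).
pose F k w := V w * \prod_i g k i (Y i w + incr (e i) w).
pose G k w := V w * \prod_i Pg k i (Y i w).
have FG k : [/\ P.-integrable setT (fun w => (F k w)%:E),
    P.-integrable setT (fun w => (G k w)%:E) &
    (\int[P]_w (F k w)%:E = \int[P]_w (G k w)%:E)%E].
  have gs i y := @gauss_step R (v ord0 i) tau h y (k i) h_gt0 tt2.
  have := @chain_integral _ _ _ P _ incr indep m_incr d e inj_e m law V Y mV mY
    d0 (g k) (Pg k) (fun i => gauss_abs (v ord0 i) tau h (k i)).
  case.
  - by move=> i; exact: measurable_gauss_monomial.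
  - move=> i; apply: measurable_funM.
      apply: measurable_funM => //; apply: measurableT_comp => //.
      apply: measurable_funB; first apply: measurable_funB => //.
        by apply: measurable_funM => //; exact: measurable_funB.
      apply: measurable_funM => //; apply: measurable_funX.
      exact: measurable_funB.
    have mh c j : measurable_fun [set: R]
        (fun y => hermite_moment ((y - v ord0 i * h) * q) c j).
      suff [] : measurable_fun [set: R]
          (fun y => hermite_moment ((y - v ord0 i * h) * q) c j) /\
        measurable_fun [set: R]
          (fun y => hermite_moment ((y - v ord0 i * h) * q) c j.+1) by [].
      have my : measurable_fun [set: R] (fun y : R => (y - v ord0 i * h) * q).
        by apply: measurable_funM => //; exact: measurable_funB.
      elim: j => [|j [IH1 IH2]]; first by split => //; exact: measurable_cst.
      split=> //; under eq_fun do rewrite hermite_momentS /=.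
      by apply: measurable_funD; apply: measurable_funM.
    exact: mh.
  - by move=> i; exact: measurable_gauss_abs.
  - by move=> i y; rewrite /g -tauh; exact: (integral_normal_law (gs i y).1).1.
  - move=> i y; rewrite /g -tauh (integral_normal_law (gs i y).1).2.
    exact: (gs i y).2.
  - move=> i y; rewrite -(integral_gauss_abs _ _ _ h_gt0 tt2) /g -tauh.
    have := (gs i y).1 => /integrable_abse /= /(@integral_normal_law _ _).
    by case.
  - have gb i : exists C, 0 <= C /\ forall y, 0 < tau \/ `|y| <= K + `|v ord0 i * h| ->
        gauss_abs (v ord0 i) tau h (k i) y <= C.
      by have [C C0 HC] := gauss_abs_bounded (v ord0 i) (k i)
        (K + `|v ord0 i * h|) h_gt0 tt2; exists C.
    have [C HC] := choice gb.
    apply: (@le_lt_trans _ _ (\int[P]_w (\prod_i C i)%:E)%E); last first.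
      rewrite (integral_cst P measurableT (\prod_i C i)%:E).
      rewrite [X in (_ * X)%E](_ : _ = 1%E) ?mule1 ?ltry//.
      exact: probability_setT.
    have ga0 i y : 0 <= gauss_abs (v ord0 i) tau h (k i) y.
      by rewrite /gauss_abs fine_ge0// integral_ge0.
    have mT (f : T -> R) (i0 : 'I_d) : measurable_fun [set: others_type incr (e i0)]
      (f : others_type incr (e i0) -> R) -> measurable_fun [set: T] f.
      move=> mf _ A mA; have := mf measurableT A mA; rewrite !setTI.
      exact: others_measurable.
    apply: (@ge0_le_integral _ _ _ P setT measurableT).
    + by move=> w _; rewrite lee_fin mulr_ge0//; exact: prodr_ge0.
    + apply/measurable_EFinP; apply: measurable_funM.
        apply: measurableT_comp => //; exact: (mT _ (Ordinal d0) (mV _)).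
      apply: measurable_bigprod => i _.
      apply: measurableT_comp; first exact: measurable_gauss_abs.
      exact: (mT _ (Ordinal d0) (mY _ _)).
    + exact: measurable_cst.
    + move=> w _; rewrite lee_fin.
      have [V0|V0] := eqVneq (V w) 0.
        rewrite V0 normr0 mul0r; apply: prodr_ge0 => i _.
        by have [] := HC i.
      rewrite -[leRHS]mul1r ler_pM//; first exact: prodr_ge0.
      apply: ler_prod => i _; rewrite ga0 /=.
      have [_] := HC i; apply; case: (hK w V0) => [|XK]; [by left|right].
      by rewrite (le_trans (ler_normD _ _))// lerD2r.
  by move=> H1 [H2 H3]; split.
have [I1 I2 I3] := @integral_lincomb R _ _ P _ S F G
  (fun k => let: And3 h1 _ _ := FG k in h1)
  (fun k => let: And3 _ h2 _ := FG k in h2)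
  (fun k => let: And3 _ _ h3 := FG k in h3).
pose Ct := `|a - t| `^ (- (d%:R / 2 + n%:R)) * expR (dotv v v * t / 2).
have qE : \sum_i v ord0 i ^+ 2 = dotv v v by apply: eq_bigr => i _; rewrite expr2.
have FE w : V w * heat_fun v n a t (drifted t w) = Ct * \sum_(k <- S) k.1 * F k.2 w.
  rewrite /heat_fun /zonal_fun.
  have := S1 (fun i => drifted t w ord0 i).
  rewrite qE; under [X in _ * X]eq_bigr do rewrite expr2.
  rewrite -/(dotv v (drifted t w)) -/(dotv (drifted t w) (drifted t w)) => ->.
  rewrite -addrA expRD !mulr_sumr; apply: eq_bigr => k _.
  rewrite /F.
  have -> : \prod_i g k.2 i (Y i w + incr (e i) w) = \prod_i (
      drifted t w ord0 i ^+ k.2 i * expR (- v ord0 i * drifted t w ord0 i -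
        drifted t w ord0 i ^+ 2 / (2 * (a - t)))).
    by apply: eq_bigr => i _; rewrite -XE.
  rewrite big_split /= -expR_sum.
  have -> : \sum_i (- v ord0 i * drifted t w ord0 i -
      drifted t w ord0 i ^+ 2 / (2 * (a - t))) =
      - dotv v (drifted t w) - dotv (drifted t w) (drifted t w) / (2 * (a - t)).
    rewrite sumrB; congr (_ - _).
      by rewrite /dotv -sumrN; apply: eq_bigr => i _; rewrite mulNr.
    by rewrite /dotv mulr_suml; apply: eq_bigr => i _; rewrite expr2.
  rewrite /Ct; ring.
have GE w : V w * heat_fun v n a s (drifted s w) = Ct * \sum_(k <- S) k.1 * G k.2 w.
  have -> : \sum_(k <- S) k.1 * G k.2 w = V w *
      (\prod_i gauss_factor (v ord0 i) tau h (Y i w)) *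
      (\sum_(k <- S) k.1 * \prod_i hermite_moment (drifted s w ord0 i * q) (h * q) (k.2 i)).
    rewrite mulr_sumr; apply: eq_bigr => k _; rewrite /G /Pg big_split /=.
    under [X in _ * (_ * (_ * X)) = _]eq_bigr do rewrite /Y addrK.
    ring.
  (* The averaged monomials sum to the zonal polynomial at the mean, which is the position at time s
     scaled by q. *)
  rewrite (S2 (fun i => drifted s w ord0 i * q) (h * q)).
  rewrite /gauss_factor big_split /= -expR_sum prodr_const card_ord.
  have -> : \sum_i (- v ord0 i * (Y i w - v ord0 i * h) - v ord0 i ^+ 2 * h / 2
      - (Y i w - v ord0 i * h) ^+ 2 / (2 * tau)) =
     - dotv v (drifted s w) - dotv v v * h / 2 -
       dotv (drifted s w) (drifted s w) / (2 * tau).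
    rewrite !sumrB; congr (_ - _ - _).
    - rewrite /dotv -sumrN; apply: eq_bigr => i _.
      by rewrite /Y addrK mulNr.
    - by rewrite /dotv !mulr_suml; apply: eq_bigr => i _; rewrite expr2.
    - rewrite /dotv mulr_suml; apply: eq_bigr => i _.
      by rewrite /Y addrK expr2.
  rewrite /heat_fun /zonal_fun qE.
  have -> : \sum_i v ord0 i * (drifted s w ord0 i * q) = q * dotv v (drifted s w).
    by rewrite /dotv mulr_sumr; apply: eq_bigr => i _; ring.
  have -> : dotv v v * \sum_i (drifted s w ord0 i * q) ^+ 2 =
      q ^+ 2 * (dotv v v * dotv (drifted s w) (drifted s w)).
    rewrite mulrCA; congr (_ * _).
    by rewrite /dotv mulr_sumr; apply: eq_bigr => i _; ring.
  rewrite zonal_homogeneous /Ct.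
  have tau_n0 : tau != 0 by apply: contraTneq tt2 => ->; rewrite mul0r ltxx.
  have qn : q = `|a - t| / `|tau|.
    by rewrite -normf_div -tauh -/q gtr0_norm.
  (* The d normalizing roots give q^(d/2) and homogeneity gives q^n; together they convert the power
     of |a - t| into the power of |a - s|. *)
  have e1 : `|a - t| `^ (- (d%:R / 2 + n%:R)) * (Num.sqrt q ^+ d * q ^+ n) =
      `|a - s| `^ (- (d%:R / 2 + n%:R)).
    rewrite sqrtX_mulX_powR// qn; move: (d%:R / 2 + n%:R) => p.
    rewrite powRM ?invr_ge0// -(powR_inv1 (normr_ge0 tau)) -powRrM mulN1r.
    rewrite mulrA -powRD; last first.
      by rewrite normr_eq0 -tauh; apply/implyP => _; apply: contraTneq tt2 => ->;
        rewrite mulr0 ltxx.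
    by rewrite addNr powRr0 mul1r.
  rewrite -e1 -/tau.
  have -> : dotv v v * s / 2 - dotv v (drifted s w) -
      dotv (drifted s w) (drifted s w) / (2 * tau) =
    dotv v v * t / 2 + (- dotv v (drifted s w) - dotv v v * h / 2 -
      dotv (drifted s w) (drifted s w) / (2 * tau)).
    by rewrite /h; ring.
  rewrite expRD; ring.
have CE (f : T -> R) (f' : T -> R) : (forall w, f w = Ct * f' w) ->
    P.-integrable setT (fun w => (f' w)%:E) ->
    P.-integrable setT (fun w => (f w)%:E) /\
    (\int[P]_w (f w)%:E = Ct%:E * \int[P]_w (f' w)%:E)%E.
  move=> ff' if'; split.
    by under eq_fun do rewrite ff' EFinM; exact: integrableZl.
  by under eq_integral do rewrite ff' EFinM; rewrite integralZl.
have [J1 J2] := CE _ _ FE I1; have [J3 J4] := CE _ _ GE I2.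
by split => //; rewrite J2 J4 I3.
Qed.

End BrownianStep.

(** * First zeros of continuous paths *)

Section FirstZero.
Context {R : realType}.

(** Paths are controlled only on times t >= 0. Composing with the maximum with 0 extends them to
    continuous functions on the whole line. *)
Lemma continuous_max0 (V : topologicalType) (f : R -> V) :
  {within `[0, +oo[, continuous f} -> continuous (fun t : R => f (Num.max 0 t)).
Proof.
move=> /subspace_continuousP cf t.
have A0 : `[0, +oo[%classic (Num.max 0 t) by rewrite /= in_itv/= andbT le_max lexx.
apply: (@cvg_comp _ _ _ (Num.max 0) f _ (within `[0, +oo[ (nbhs (Num.max 0 t))));
  last exact: cf.
move=> U hU; rewrite /fmap /= nbhs_simpl.
have cm : (Num.max 0 t' : R) @[t' --> t] --> (Num.max 0 t : R).
  by apply: continuous_max; [exact: cvg_cst|exact: cvg_id].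
have := cm _ hU; rewrite nbhs_simpl /=; apply: filterS => y; apply.
by rewrite /= in_itv/= andbT le_max lexx.
Qed.

Variable p : R -> R.
Hypothesis cp : continuous p.
Hypothesis p0 : 0 < p 0.

Definition first_zero : \bar R :=
  ereal_inf [set t%:E | t in [set t : R | 0 <= t /\ p t = 0]].

Lemma first_zero_le (t : R) : 0 <= t -> p t <= 0 -> (first_zero <= t%:E)%E.
Proof.
move=> t0 pt; have ct : {within `[0, t], continuous p}.
  by apply: continuous_subspaceT => u; exact: cp.
have [|u] := @IVT _ p 0 t 0 t0 ct.
  by rewrite ge_min pt orbT /= le_max (ltW p0).
rewrite in_itv/= => /andP[u0 ut] pu.
apply: (@le_trans _ _ u%:E); last by rewrite lee_fin.
by apply: ereal_inf_lbound; exists u.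
Qed.

(** From right to left, positivity at s persists on an interval beyond s, which makes the inequality
    strict. The converse is the intermediate value theorem. *)
Lemma lt_first_zeroP (s : R) : 0 <= s ->
  (s%:E < first_zero)%E <-> (forall u, 0 <= u <= s -> 0 < p u).
Proof.
move=> s0; split=> [sz u /andP[u0 us]|ps].
  rewrite ltNge; apply: contraTN sz => pu; rewrite -leNgt.
  by apply: le_trans (first_zero_le u0 pu) _; rewrite lee_fin.
have ps0 : 0 < p s by apply: ps; rewrite s0 lexx.
have /cvgrPdist_lt /(_ _ ps0) /nbhs_ballP [e /= e0 He] := @cp s.
have e2 : 0 < e / 2 by rewrite divr_gt0.
apply: (@lt_le_trans _ _ (s + e / 2)%:E); first by rewrite lte_fin ltrDl.
apply: le_ereal_inf_tmp => _ [u [u0 pu] <-]; rewrite lee_fin leNgt; apply/negP => ue.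
have [us|su] := leP u s.
  by have := ps u; rewrite u0 us pu ltxx => /(_ isT).
have : ball s e u.
  rewrite /ball /= ltr_norml; apply/andP; split; lra.
by move=> /He; rewrite pu subr0 gtr0_norm// ltxx.
Qed.

Lemma first_zero_gt0 : (0 < first_zero)%E.
Proof.
apply/lt_first_zeroP => // u; rewrite -eq_le => /eqP <- //.
Qed.

Lemma first_zero_fin (t : R) : first_zero = t%:E ->
  [/\ 0 < t, p t = 0 & forall u, 0 <= u < t -> 0 < p u].
Proof.
move=> st; have t0 : 0 < t by have := first_zero_gt0; rewrite st lte_fin.
have pu u : 0 <= u < t -> 0 < p u.
  move=> /andP[u0 ut].
  have /lt_first_zeroP : (u%:E < first_zero)%E by rewrite st lte_fin.
  by apply => //; rewrite u0 lexx.
split => //; apply/eqP; rewrite eq_le; apply/andP; split.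
  rewrite leNgt; apply/negP => pt.
  have : (t%:E < first_zero)%E.
    apply/lt_first_zeroP; first exact: ltW.
    move=> u /andP[u0]; rewrite le_eqVlt => /predU1P[->//|ut].
    by apply: pu; rewrite u0.
  by rewrite st ltxx.
rewrite leNgt; apply/negP => pt.
have pt' : 0 < - p t by rewrite oppr_gt0.
have /cvgrPdist_lt /(_ _ pt') /nbhs_ballP [e /= e0 He] := @cp t.
pose u := Num.max 0 (t - e / 2).
have ut : 0 <= u < t.
  by rewrite /u le_max lexx /= gt_max t0 /=; lra.
have := He u; have := pu u ut; rewrite /ball /= => p1 p2.
have : `|t - u| < e.
  rewrite /u; case: (leP 0 (t - e / 2)) => h; rewrite ger0_norm; lra.
move=> /p2; rewrite ltr_norml => /andP[+ _]; lra.
Qed.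

(** The condition p < c is open, so it also holds at the grid point just to the left of u as soon as
    the grid is fine enough. *)
Lemma grid_below (s c : R) (u : R) : 0 <= u <= s -> p u < c ->
  \forall M \near \oo, exists2 j, (j <= M.+1)%N & p (s * j%:R / M.+1%:R) < c.
Proof.
move=> /andP[u0 us] pu.
have [s0|s0] := leP s 0.
  have u_0 : u = 0 by apply/eqP; rewrite eq_le u0 (le_trans us).
  by apply: nearW => M; exists 0%N => //; rewrite mulr0 mul0r -u_0.
have cpu : 0 < c - p u by rewrite subr_gt0.
have /cvgrPdist_lt /(_ _ cpu) /nbhs_ballP [e /= e0 He] := @cp u.
near=> M.
pose j := Num.truncn (u * M.+1%:R / s).
have q0 : 0 <= u * M.+1%:R / s by rewrite divr_ge0 ?mulr_ge0 ?(ltW s0).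
have /andP[j1 j2] : j%:R <= u * M.+1%:R / s < j.+1%:R by exact: truncn_itv.
have M0 : 0 < M.+1%:R :> R by rewrite ltr0n.
exists j.
  rewrite -(ler_nat R); apply: le_trans j1 _.
  by rewrite ler_pdivrMr// mulrC ler_wpM2l// ltW.
have d1 : 0 <= u - s * j%:R / M.+1%:R.
  rewrite subr_ge0 ler_pdivrMr// mulrC -ler_pdivlMr//.
have d2 : u - s * j%:R / M.+1%:R < s / M.+1%:R.
  rewrite ltrBlDr -mulrDl ltr_pdivlMr//.
  move: j2; rewrite ltr_pdivrMr// -natr1; lra.
have : ball u e (s * j%:R / M.+1%:R).
  rewrite /ball /= ger0_norm// (lt_trans d2)//.
  rewrite ltr_pdivrMr// mulrC -ltr_pdivrMr//.
  apply: (@lt_trans _ _ M%:R); last by rewrite ltr_nat.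
  by near: M; exact: nbhs_infty_gtr.
move=> /He; rewrite distrC => /ltr_normlW; lra.
Unshelve. all: by end_near. Qed.

Lemma min_positive (s : R) : 0 <= s -> (forall u, 0 <= u <= s -> 0 < p u) ->
  exists2 c, 0 < c & forall u, 0 <= u <= s -> c <= p u.
Proof.
move=> s0 pu; have cs : {within `[0, s], continuous p}.
  by apply: continuous_subspaceT => u; exact: cp.
have [c cI Hc] := EVT_min s0 cs.
exists (p c); first by apply: pu; rewrite in_itv/= in cI.
by move=> u us; apply: Hc; rewrite in_itv.
Qed.

End FirstZero.

(** * Optional stopping *)

Section EuclideanNorm.
Context {R : realType} {d : nat}.
Implicit Types y : 'rV[R]_d.

Lemma dotv_ge0 y : 0 <= dotv y y.
Proof. by apply: sumr_ge0 => i _; rewrite -expr2 sqr_ge0. Qed.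

Lemma sqr_enorm y : enorm y ^+ 2 = dotv y y.
Proof. by rewrite /enorm sqr_sqrtr// dotv_ge0. Qed.

Lemma enorm_ge0 y : 0 <= enorm y. Proof. exact: sqrtr_ge0. Qed.

Lemma coord_le_enorm y i : `|y ord0 i| <= enorm y.
Proof.
rewrite -(ler_pXn2r (_ : 0 < 2)%N)// ?nnegrE ?enorm_ge0//.
rewrite sqr_enorm /dotv (bigD1 i)//= real_normK ?num_real// expr2 lerDl.
by apply: sumr_ge0 => j _; rewrite -expr2 sqr_ge0.
Qed.

Lemma measurable_dotv (disp : measure_display) (S : measurableType disp)
    (X : S -> 'rV[R]_d) :
  (forall i, measurable_fun [set: S] (fun w => X w ord0 i)) ->
  measurable_fun [set: S] (fun w => dotv (X w) (X w)).
Proof.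
by move=> mX; apply: measurable_sum => i; apply: measurable_funM.
Qed.

Lemma measurable_enorm (disp : measure_display) (S : measurableType disp)
    (X : S -> 'rV[R]_d) :
  (forall i, measurable_fun [set: S] (fun w => X w ord0 i)) ->
  measurable_fun [set: S] (fun w => enorm (X w)).
Proof.
move=> mX; apply: (measurableT_comp (f := @Num.sqrt R)); last exact: measurable_dotv.
by apply: continuous_measurable_fun; exact: sqrt_continuous.
Qed.

End EuclideanNorm.

Section StoppedLimit.
Context {R : realType} {disp : measure_display} {T : measurableType disp}
  (P : probability T R).

Lemma stopped_limit (F G E V : T -> R) (V_ : nat -> T -> R) :
  measurable_fun [set: T] F -> measurable_fun [set: T] G ->
  (forall n, measurable_fun [set: T] (V_ n)) ->
  (forall w, V_ ^~ w @ \oo --> V w) ->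
  (forall n w, `|V_ n w| <= E w) ->
  P.-integrable setT (fun w => (E w * F w)%:E) ->
  P.-integrable setT (fun w => (E w * G w)%:E) ->
  (forall n, \int[P]_w (V_ n w * F w)%:E = \int[P]_w (V_ n w * G w)%:E)%E ->
  [/\ measurable_fun [set: T] V, P.-integrable setT (fun w => (V w * F w)%:E),
      P.-integrable setT (fun w => (V w * G w)%:E)
    & (\int[P]_w (V w * F w)%:E = \int[P]_w (V w * G w)%:E)%E].
Proof.
move=> mF mG mV_ cV VE iF iG FG.
have mV : measurable_fun [set: T] V.
  by apply: (measurable_fun_cvg mV_) => w _; exact: cV.
have dc (H : T -> R) : measurable_fun [set: T] H ->
    P.-integrable setT (fun w => (E w * H w)%:E) ->
    P.-integrable setT (fun w => (V w * H w)%:E) /\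
    (fun n => \int[P]_w (V_ n w * H w)%:E)%E @ \oo --> (\int[P]_w (V w * H w)%:E)%E.
  move=> mH iH.
  have [] := @dominated_convergence _ _ _ P setT measurableT
    (fun n w => (V_ n w * H w)%:E) (fun w => (V w * H w)%:E)
    (fun w => `|(E w * H w)%:E|)%E.
  - by move=> n; apply/measurable_EFinP; exact: measurable_funM.
  - by apply/measurable_EFinP; exact: measurable_funM.
  - apply: aeW => w _; apply: cvg_EFin; first exact: nearW.
    by apply: cvgM; [exact: cV|exact: cvg_cst].
  - exact: integrable_abse.
  - apply: aeW => w n _; rewrite !abse_EFin lee_fin !normrM ler_wpM2r//.
    by rewrite (le_trans (VE n w))// ler_norm.
  by [].
have [I1 C1] := dc F mF iF; have [I2 C2] := dc G mG iG.
split => //; rewrite -(cvg_lim _ C1)// -(cvg_lim _ C2)//.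
by congr (limn _); apply/funext.
Qed.

End StoppedLimit.

Section StoppedStep.
Context {R : realType} {disp : measure_display} {T : measurableType disp}
  (P : probability T R) {d : nat} (hd : (2 <= d)%N)
  {x v : 'rV[R]_d} {B : R -> T -> 'rV[R]_d} (hB : brownian P x B)
  (r : R) (hxr : enorm x <> r).
Local Notation X := (@drifted R disp T d v B).

(** The sign is chosen so that the gap is positive at the start, inside or outside: hitting the
    sphere is then the first zero of a path that starts positive. *)
Definition gap (y : 'rV[R]_d) : R :=
  if enorm x < r then r - enorm y else enorm y - r.

Definition gap_path (w : T) (t : R) : R := gap (X (Num.max 0 t) w).

Definition exit_time (w : T) : \bar R :=
  hitting_time (fun t => enorm (B t w + t *: v)) r.

Lemma drifted0 w : X 0 w = x.
Proof. by rewrite /drifted (brownian_start hB) scale0r addr0. Qed.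

Lemma gap0 (y : 'rV[R]_d) : gap y = 0 <-> enorm y = r.
Proof.
by rewrite /gap; case: ifP => _; split => [/eqP|->]; rewrite ?subrr// subr_eq0 => /eqP.
Qed.

Lemma gap_path0 w : 0 < gap_path w 0.
Proof.
rewrite /gap_path maxxx drifted0 /gap; case: (ltgtP (enorm x) r) => h; rewrite ?subr_gt0//.
Qed.

Lemma exit_timeE w : exit_time w = first_zero (gap_path w).
Proof.
congr ereal_inf; apply/seteqP; split => [_ [t [t0 tr] <-]|_ [t [t0 tr] <-]];
  exists t => //; split => //; move: tr; rewrite /gap_path (max_idPr t0) => tr.
  exact/gap0.
exact/gap0.
Qed.

Lemma continuous_drifted w i : continuous (fun t : R => X (Num.max 0 t) w ord0 i).
Proof.
have cB : continuous (fun t : R => B (Num.max 0 t) w).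
  by apply: (continuous_max0 (f := fun t => B t w)); exact: (brownian_continuous hB).
move=> t; rewrite /drifted.
have -> : (fun t0 : R => (B (Num.max 0 t0) w + Num.max 0 t0 *: v) ord0 i) =
    (fun t0 : R => B (Num.max 0 t0) w ord0 i + Num.max 0 t0 * v ord0 i).
  by apply/funext => u; rewrite !mxE.
apply: cvgD.
  apply: (cvg_comp (fun t0 : R => B (Num.max 0 t0) w) (fun M : 'rV[R]_d => M ord0 i)).
    exact: cB.
  exact: coord_continuous.
apply: cvgM; last exact: cvg_cst.
by apply: continuous_max; [exact: cvg_cst|exact: cvg_id].
Qed.

Lemma continuous_dotv_drifted w :
  continuous (fun t : R => dotv (X (Num.max 0 t) w) (X (Num.max 0 t) w)).
Proof.
move=> t; apply: cvg_big => [|i _]; first exact: add_continuous.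
by apply: cvgM; exact: continuous_drifted.
Qed.

Lemma continuous_gap_path w : continuous (gap_path w).
Proof.
move=> t.
have ce : enorm (X (Num.max 0 t0) w) @[t0 --> t] --> enorm (X (Num.max 0 t) w).
  apply: (cvg_comp (fun t0 : R => dotv (X (Num.max 0 t0) w) (X (Num.max 0 t0) w))
    (@Num.sqrt R)); first exact: continuous_dotv_drifted.
  exact: sqrt_continuous.
rewrite /continuous_at /gap_path /gap; case: (enorm x < r).
  by apply: cvgB => //; exact: cvg_cst.
by apply: cvgB => //; exact: cvg_cst.
Qed.

Lemma measurable_gap (disp' : measure_display) (S : measurableType disp')
    (Y : S -> 'rV[R]_d) :
  (forall i, measurable_fun [set: S] (fun w => Y w ord0 i)) ->
  measurable_fun [set: S] (fun w => gap (Y w)).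
Proof.
move=> mY; rewrite /gap; case: (enorm x < r); apply: measurable_funB => //;
exact: measurable_enorm.
Qed.

Lemma measurable_ge_indic (disp' : measure_display) (S : measurableType disp')
    (g : S -> R) (c : R) : measurable_fun [set: S] g ->
  measurable_fun [set: S] (fun w => (c <= g w)%R%:R : R).
Proof.
move=> mg.
have -> : (fun w => (c <= g w)%R%:R : R) = \1_(g @^-1` `[c, +oo[).
  apply/funext => w; rewrite indicE; congr (nat_of_bool _)%:R.
  by apply/idP/idP; rewrite inE /= in_itv/= andbT.
apply: measurable_indic; rewrite -[_ @^-1` _]setTI; exact: mg.
Qed.

Lemma measurable_heat_fun n a t : 0 <= t ->
  measurable_fun [set: T] (fun w => heat_fun v n a t (X t w)).
Proof.
move=> t0; have mX i := measurable_drifted hB i t0 (v := v).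
have mL : measurable_fun [set: T] (fun w => dotv v (X t w)).
  by apply: measurable_sum => i; exact: measurable_funM.
have mQ : measurable_fun [set: T] (fun w => dotv v v * dotv (X t w) (X t w)).
  by apply: measurable_funM => //; exact: measurable_dotv.
apply: measurable_funM.
  apply: measurable_funM => //; apply: measurableT_comp => //.
  apply: measurable_funB; first exact: measurable_funB.
  by apply: measurable_funM => //; exact: measurable_dotv.
rewrite /zonal_fun.
suff [] : measurable_fun [set: T] (fun w => zonal (nu_of (d := d)) (dotv v (X t w))
    (dotv v v * dotv (X t w) (X t w)) n) /\
  measurable_fun [set: T] (fun w => zonal (nu_of (d := d)) (dotv v (X t w))
    (dotv v v * dotv (X t w) (X t w)) n.+1) by [].
elim: n => [|n [IH1 IH2]].
  by split; [exact: measurable_cst|exact: measurable_funM].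
split => //; apply: measurable_funM => //; apply: measurable_funB.
  by apply: measurable_funM => //; exact: measurable_funM.
by apply: measurable_funM => //; exact: measurable_funM.
Qed.

Definition alive (s : R) (w : T) : R := (s%:E < exit_time w)%E%:R.

Lemma gap_coord_le w s : enorm x < r -> 0 <= gap (X s w) ->
  forall i, `|X s w ord0 i| <= r.
Proof.
move=> xr; rewrite /gap xr subr_ge0 => h i.
exact: le_trans (coord_le_enorm _ _) h.
Qed.

Section Grid.
Variables (s t : R) (s0 : 0 < s) (st : s < t).

(** The indices up to M + 1 cut [0, s] into M + 1 equal parts, the index M + 2 is t, and the later
    values only keep the sequence increasing. *)
Definition grid (M j : nat) : R :=
  if (j <= M.+1)%N then s * j%:R / M.+1%:R else t + (j - M.+2)%:R.

Lemma grid0 M : grid M 0 = 0. Proof. by rewrite /grid /= mulr0 mul0r. Qed.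

Lemma grid_lt M j : grid M j < grid M j.+1.
Proof.
rewrite /grid; case: (ltngtP j M.+1) => h.
- rewrite ltr_pM2r ?invr_gt0 ?ltr0n// ltr_pM2l// ltr_nat//.
- by rewrite ltrD2l ltr_nat; lia.
- rewrite h subnn addr0 mulfK ?pnatr_eq0//.
Qed.

Lemma grid_s M : grid M M.+1 = s.
Proof. by rewrite /grid leqnn mulfK ?pnatr_eq0. Qed.

Lemma grid_t M : grid M M.+2 = t.
Proof. by rewrite /grid ltnn subnn addr0. Qed.

(** A function of finitely many increments. The event of survival up to s is reached in two limits:
    first M tends to infinity at a fixed level c, where a failure gap < c is an open condition and
    is seen by fine grids, then c decreases to 0. *)
Definition grid_alive (c : R) (M : nat) (w : T) : R :=
  \prod_(j < M.+2) (c <= gap (X (grid M j) w))%R%:R.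

Lemma grid_alive01 c M w : grid_alive c M w = 0 \/ grid_alive c M w = 1.
Proof.
rewrite /grid_alive; elim/big_ind: _ => [|a b|i _]; [by right| |].
  by move=> [] -> [] ->; rewrite ?mul0r ?mulr0 ?mulr1; tauto.
by case: (_ <= _); [right|left].
Qed.

Lemma grid_alive_ge c M w : grid_alive c M w != 0 ->
  forall j, (j <= M.+1)%N -> c <= gap (X (grid M j) w).
Proof.
move=> /prodf_neq0 h j jM.
have := h (Ordinal (jM : (j < M.+2)%N)) isT => /=.
by case: (_ <= _) => //; rewrite eqxx.
Qed.

Lemma grid_step c M n a : 0 <= c -> 0 < (a - s) * (a - t) ->
  0 < a - s \/ enorm x < r ->
  (\int[P]_w (grid_alive c M w * heat_fun v n a t (X t w))%:E =
   \int[P]_w (grid_alive c M w * heat_fun v n a s (X s w))%:E)%E.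
Proof.
move=> c0 tau2 hax.
have := @heat_fun_step R disp T P d hd x v B hB (grid M) M.+1 (grid0 M) (grid_lt M)
  (grid_alive c M) n a r.
rewrite grid_s grid_t; case => //.
- move=> i0; apply: measurable_bigprod => j _.
  apply: measurable_ge_indic; apply: measurable_gap => i.
  by apply: past_measurable_drifted;
    first [exact: hB|exact: grid0|exact: grid_lt|rewrite -ltnS].
- by move=> w; case: (grid_alive01 c M w) => ->; rewrite ?normr0 ?normr1.
- move=> w /grid_alive_ge /(_ M.+1 (leqnn _)); rewrite grid_s => cg.
  case: hax => [|xr]; [by left|right]; apply: gap_coord_le => //.
  exact: le_trans cg.
Qed.

Definition cell_alive (c : R) (w : T) : R :=
  (`[< forall u, 0 <= u <= s -> c <= gap_path w u >])%:R.

Lemma cvg_grid_alive c w : grid_alive c ^~ w @ \oo --> cell_alive c w.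
Proof.
have gp M j : (j <= M.+1)%N -> gap (X (grid M j) w) = gap_path w (s * j%:R / M.+1%:R).
  move=> jM; rewrite /gap_path /grid jM; congr (gap (X _ w)).
  by apply/esym/max_idPr; rewrite divr_ge0// mulr_ge0// ltW.
rewrite /cell_alive; case: asboolP => h.
  apply: cvg_near_cst; apply: nearW => M; apply: big1 => j _.
  rewrite gp; last by rewrite -ltnS.
  rewrite h// divr_ge0 ?mulr_ge0 ?(ltW s0)//= ler_pdivrMr ?ltr0n//.
  by rewrite ler_wpM2l ?(ltW s0)// ler_nat -ltnS.
apply: cvg_near_cst.
have [u us pu] : exists2 u, 0 <= u <= s & gap_path w u < c.
  apply: contrapT => hn; apply: h => u us; rewrite leNgt; apply/negP => pu.
  by apply: hn; exists u.
have := grid_below (@continuous_gap_path w) us pu.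
apply: filterS => M [j jM pj]; apply/eqP/negbNE/negP => /grid_alive_ge /(_ j jM).
by rewrite gp// leNgt pj.
Qed.

Lemma cvg_cell_alive w : (fun m : nat => cell_alive m.+1%:R^-1 w) @ \oo --> alive s w.
Proof.
have := lt_first_zeroP (@continuous_gap_path w) (gap_path0 w) (ltW s0).
rewrite -exit_timeE /alive; case: ltP => h [h1 h2]; apply: cvg_near_cst.
  have [c c0 hc] := min_positive (@continuous_gap_path w) (ltW s0) (h1 isT).
  near=> m; rewrite /cell_alive; case: asboolP => // -[] u us.
  apply: le_trans (hc u us); rewrite -(invrK c) lef_pV2 ?posrE ?invr_gt0 ?ltr0n//.
  apply: (@le_trans _ _ m%:R); last by rewrite ler_nat.
  by near: m; exact: nbhs_infty_ger.
apply: nearW => m; rewrite /cell_alive; case: asboolP => // hm.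
have // : false by apply: h2 => u us; apply: lt_le_trans (hm u us); rewrite invr_gt0.
Unshelve. all: by end_near. Qed.

End Grid.

End StoppedStep.

Section TightLimit.
Context {R : realType} {disp : measure_display} {T : measurableType disp}
  (P : probability T R).

Lemma bounded_integrable (f : T -> R) (C : R) : measurable_fun [set: T] f ->
  (forall w, `|f w| <= C) -> P.-integrable setT (fun w => (f w)%:E).
Proof.
move=> mf fC.
apply: (@le_integrable _ _ _ P setT measurableT _ (fun=> C%:E)).
- exact/measurable_EFinP.
- by move=> w _; rewrite !abse_EFin lee_fin (le_trans (fC w))// ler_norm.
- exact: finite_measure_integrable_cst.
Qed.

(* Clipping [F_ n] at the level [C] changes its expectation by at most
   [eta * K], and the clipped variables converge boundedly. *)
Lemma tight_limit (F_ G_ : nat -> T -> R) (F : T -> R) (K f0 C0 : R) :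
  (forall n, P.-integrable setT (fun w => (F_ n w)%:E)) ->
  (forall n, P.-integrable setT (fun w => (G_ n w)%:E)) ->
  (forall w, F_ ^~ w @ \oo --> F w) -> (forall w, `|F w| <= C0) ->
  (forall n w, 0 <= G_ n w) ->
  (forall eta, 0 < eta -> exists C, forall n w, `|F_ n w| <= C + eta * G_ n w) ->
  (forall n, \int[P]_w (F_ n w)%:E = f0%:E)%E ->
  (forall n, \int[P]_w (G_ n w)%:E = K%:E)%E ->
  P.-integrable setT (fun w => (F w)%:E) /\ (\int[P]_w (F w)%:E = f0%:E)%E.
Proof.
move=> iF iG cF FC G0 tight EF EG.
have mF_ n : measurable_fun [set: T] (F_ n).
  by apply/measurable_EFinP; case/integrableP: (iF n).
have mF : measurable_fun [set: T] F.
  by apply: (measurable_fun_cvg mF_) => w _; exact: cF.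
have iFF := bounded_integrable mF FC; split => //.
have fF : (\int[P]_w (F w)%:E)%E \is a fin_num by exact: integrable_fin_num.
set I := fine (\int[P]_w (F w)%:E)%E.
have K0 : 0 <= K.
  rewrite -lee_fin -(EG 0%N); apply: integral_ge0 => w _; exact: G0.
have key eta : 0 < eta -> `|f0 - I| <= eta * K.
  move=> eta0; have [C1 HC1] := tight eta eta0.
  pose C := Num.max (Num.max C0 C1) 0.
  have C_0 : 0 <= C by rewrite /C le_max lexx orbT.
  have C0C : C0 <= C by rewrite /C !le_max lexx.
  have C1C : C1 <= C by rewrite /C !le_max lexx orbT.
  pose clip (y : R) := Num.max (- C) (Num.min C y).
  have clip_le y : `|clip y| <= C.
    rewrite ler_norml /clip le_max lexx /= ge_max.
    by rewrite (_ : - C <= C) ?ge_min ?lexx//; lra.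
  have clip_id y : `|y| <= C -> clip y = y.
    rewrite ler_norml /clip => /andP[y1 y2].
    by rewrite (min_idPr y2) (max_idPr y1).
  have clip_dist y g : 0 <= g -> `|y| <= C + g -> `|y - clip y| <= g.
    move=> g0; rewrite ler_norml /clip => /andP[y1 y2].
    rewrite ler_norml; case: (leP C y) => h1; case: (leP (- C) _) => h2; lra.
  have cclip : continuous clip.
    move=> y; rewrite /continuous_at /clip.
    by apply: (continuous_max (f := fun=> - C)); [exact: cvg_cst|
      apply: (continuous_min (f := fun=> C)); [exact: cvg_cst|exact: cvg_id]].
  have mclip (f : T -> R) : measurable_fun [set: T] f ->
      measurable_fun [set: T] (clip \o f).
    by move=> mf; apply: measurableT_comp => //; exact: continuous_measurable_fun.
  have iclip n : P.-integrable setT (fun w => (clip (F_ n w))%:E).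
    by apply: (@bounded_integrable _ C) => //; exact: mclip.
  pose J n := fine (\int[P]_w (clip (F_ n w))%:E)%E.
  have cJ : J @ \oo --> I.
    apply: fine_cvg; rewrite fineK//.
    have [] := @dominated_convergence _ _ _ P setT measurableT
      (fun n w => (clip (F_ n w))%:E) (fun w => (F w)%:E) (fun=> C%:E).
    - by move=> n; apply/measurable_EFinP; exact: mclip.
    - exact/measurable_EFinP.
    - apply: aeW => w _; apply: cvg_EFin; first exact: nearW.
      rewrite -[X in _ --> X](clip_id (F w)); last exact: le_trans (FC w) C0C.
      by apply: continuous_cvg; [exact: cclip|exact: cF].
    - by apply: (@bounded_integrable _ C) => // w; rewrite ger0_norm.
    - by apply: aeW => w n _; rewrite abse_EFin lee_fin.
    by [].
  have dJ n : `|f0 - J n| <= eta * K.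
    rewrite -lee_fin -abse_EFin EFinB -(EF n) /J fineK; last exact: integrable_fin_num.
    rewrite -integralB//.
    apply: le_trans (le_abse_integral P measurableT _) _.
      by case/integrableP: (integrableB measurableT (iF n) (iclip n)).
    rewrite EFinM -(EG n) -integralZl//.
    apply: (@ge0_le_integral _ _ _ P setT measurableT) => //.
    + apply: measurableT_comp => //.
      by case/integrableP: (integrableB measurableT (iF n) (iclip n)).
    + by case/integrableP: (integrableZl measurableT eta (iG n)).
    + move=> w _; rewrite -EFinB abse_EFin -EFinM lee_fin.
      apply: clip_dist; first by rewrite mulr_ge0// ltW.
      by rewrite (le_trans (HC1 n w))// lerD2r.
  have cd : `|f0 - J n| @[n --> \oo] --> `|f0 - I|.
    by apply: cvg_norm; apply: cvgB => //; exact: cvg_cst.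
  rewrite -(cvg_lim _ cd)//; apply: limr_le; first exact: cvgP cd.
  exact: nearW.
suff : f0 = I by move=> ->; rewrite fineK.
apply/eqP; rewrite -subr_eq0 -normr_le0; apply/ler_addgt0Pr => e e0.
rewrite add0r; apply: (@le_trans _ _ (e / (K + 1) * K)).
  by apply: key; rewrite divr_gt0// ltr_wpDl.
by rewrite -mulrA ler_piMr ?(ltW e0)// mulrC ler_pdivrMr ?mul1r ?lerDl ?ltr_wpDl.
Qed.

End TightLimit.

Section OptionalStopping.
Context {R : realType} {disp : measure_display} {T : measurableType disp}
  (P : probability T R) {d : nat} (hd : (2 <= d)%N)
  {x v : 'rV[R]_d} {B : R -> T -> 'rV[R]_d} (hB : brownian P x B)
  (r : R) (hxr : enorm x <> r).
Local Notation X := (@drifted R disp T d v B).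
Local Notation gap := (@gap R d x r).
Local Notation alive := (@alive R disp T d v B r).
Local Notation exit_time := (@exit_time R disp T d v B r).
Local Notation grid_alive s t := (@grid_alive R disp T d x v B r s t).
Local Notation cell_alive s := (@cell_alive R disp T d x v B r s).

Let grid_alive01 s t c M w : grid_alive s t c M w = 0 \/ grid_alive s t c M w = 1.
Proof. exact: grid_alive01. Qed.

Lemma measurable_grid_alive s t c M : 0 < s -> s < t ->
  measurable_fun [set: T] (grid_alive s t c M).
Proof.
move=> s0 st; apply: measurable_bigprod => j _.
apply: measurable_ge_indic; apply: measurable_gap => i.
apply: (measurable_drifted hB); rewrite /grid -ltnS ltn_ord.
by rewrite divr_ge0// mulr_ge0// ltW.
Qed.

Lemma measurable_cell_alive s c : 0 < s -> measurable_fun [set: T] (cell_alive s c).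
Proof.
move=> s0; apply: (@measurable_fun_cvg _ _ R setT (grid_alive s (s + 1) c)).
  by move=> M; apply: measurable_grid_alive; rewrite // ltrDl.
by move=> w _; exact: (cvg_grid_alive hB).
Qed.

Lemma alive0 w : alive 0 w = 1.
Proof.
rewrite /alive (@exit_timeE R disp T d x v B r w) first_zero_gt0//.
  exact: (continuous_gap_path hB).
exact: (gap_path0 hB).
Qed.

Lemma measurable_alive s : 0 <= s -> measurable_fun [set: T] (alive s).
Proof.
rewrite le_eqVlt => /predU1P[<-|s0].
  by rewrite (_ : alive 0 = cst 1)//; apply/funext => w; rewrite alive0.
apply: (@measurable_fun_cvg _ _ R setT (fun m => cell_alive s m.+1%:R^-1)).
  by move=> m; exact: measurable_cell_alive.
by move=> w _; exact: (cvg_cell_alive hB hxr).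
Qed.

(** The identity of [grid_step] carried through both limits by dominated convergence. At s = 0 there
    is nothing to subdivide: [alive] is 1 and a single step from the deterministic start
    suffices. *)
Lemma stopped_step s t n a : 0 <= s -> s < t -> 0 < (a - s) * (a - t) ->
  0 < a - s \/ enorm x < r ->
  [/\ P.-integrable setT (fun w => (alive s w * heat_fun v n a t (X t w))%:E),
      P.-integrable setT (fun w => (alive s w * heat_fun v n a s (X s w))%:E)
    & (\int[P]_w (alive s w * heat_fun v n a t (X t w))%:E =
       \int[P]_w (alive s w * heat_fun v n a s (X s w))%:E)%E].
Proof.
rewrite le_eqVlt => /predU1P[<- t0 a2 ha|s0 st a2 ha].
  pose tt (j : nat) : R := if j is k.+1 then t + k%:R else 0.
  have tt_lt j : tt j < tt j.+1.
    by case: j => [|j] /=; rewrite ?addr0// ltrD2l ltr_nat.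
  have tt1 : tt 1%N = t by rewrite /= addr0.
  have := @heat_fun_step R disp T P d hd x v B hB tt 0 erefl tt_lt (fun=> 1) n a
    (enorm x).
  rewrite tt1 /=; case => //.
  - by move=> w; rewrite normr1.
  - move=> w _; right => i; rewrite (drifted0 hB); exact: coord_le_enorm.
  move=> h1 h2 h3; split.
  + by under eq_fun do rewrite alive0.
  + by under eq_fun do rewrite alive0.
  + by under eq_integral do rewrite alive0; rewrite h3;
      under [RHS]eq_integral do rewrite alive0.
(* E dominates all the cut-offs, and depends only on the position at time s. When the start is
   inside, it keeps this position in the ball, so [heat_fun_step] applies to E itself. *)
pose E w : R := (0 <= gap (X s w))%R%:R.
have mf u : 0 <= u -> measurable_fun [set: T] (fun w => heat_fun v n a u (X u w)).
  exact: (measurable_heat_fun hB).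
have t0 : 0 <= t by rewrite (le_trans (ltW s0))// ltW.
have [iEF iEG _] : [/\ P.-integrable setT (fun w => (E w * heat_fun v n a t (X t w))%:E),
      P.-integrable setT (fun w => (E w * heat_fun v n a s (X s w))%:E)
    & (\int[P]_w (E w * heat_fun v n a t (X t w))%:E =
       \int[P]_w (E w * heat_fun v n a s (X s w))%:E)%E].
  have := @heat_fun_step R disp T P d hd x v B hB (grid s t 0) 1 (grid0 _ _ _)
    (grid_lt hd s0 st 0) E n a r.
  rewrite (grid_s _ _ 0) (grid_t _ _ 0); apply => //.
  - move=> i0; apply: measurable_ge_indic; apply: measurable_gap => i.
    have := past_measurable_drifted hB (M := 1) (grid0 s t 0) i (leqnn 1) (i0 := i0).
    by rewrite (grid_s s t 0).
  - by move=> w; rewrite /E; case: (0 <= gap _); rewrite ?normr1 ?normr0.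
  - move=> w; rewrite /E; case: (leP 0 (gap _)) => [g0 _|]; last by rewrite eqxx.
    case: ha => [|xr]; [by left|right]; exact: (gap_coord_le xr g0).
have lim1 c : 0 < c -> (\int[P]_w (cell_alive s c w * heat_fun v n a t (X t w))%:E =
    \int[P]_w (cell_alive s c w * heat_fun v n a s (X s w))%:E)%E.
  move=> c0.
  have [] // := @stopped_limit R disp T P (fun w => heat_fun v n a t (X t w))
    (fun w => heat_fun v n a s (X s w)) E (cell_alive s c) (grid_alive s t c)
    (mf t t0) (mf s (ltW s0)).
  - by move=> M; exact: measurable_grid_alive.
  - by move=> w; exact: (cvg_grid_alive hB).
  - move=> M w; case: (grid_alive01 s t c M w) => e; rewrite e ?normr0 ?normr1.
      by rewrite /E.
    have ne : grid_alive s t c M w != 0 by rewrite e oner_neq0.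
    have := grid_alive_ge ne (leqnn M.+1); rewrite grid_s /E => cg.
    by rewrite (le_trans (ltW c0) cg).
  - by move=> M; apply: grid_step => //; exact: ltW.
have [] // := @stopped_limit R disp T P (fun w => heat_fun v n a t (X t w))
    (fun w => heat_fun v n a s (X s w)) E (alive s)
    (fun m => cell_alive s m.+1%:R^-1) (mf t t0) (mf s (ltW s0)).
- by move=> m; exact: measurable_cell_alive.
- by move=> w; exact: (cvg_cell_alive hB hxr).
- move=> m w; rewrite /(cell_alive s _); case: asboolP => h; last by rewrite normr0 /E.
  rewrite normr1 /E; have := h s; rewrite lexx (ltW s0) => /(_ isT).
  rewrite /gap_path (max_idPr (ltW s0)) => hs.
  by rewrite (le_trans _ hs).
- by move=> m; exact: lim1.
Qed.

(** The sum telescopes up to u, the first grid point not smaller than tau. *)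
Lemma stopped_sum (tau H : R) N : 0 < tau -> tau <= H ->
  exists2 u, [/\ tau <= u, u < tau + H / N.+1%:R & u <= H] & forall phi : R -> R,
    phi 0 + \sum_(k < N.+1) (H * k%:R / N.+1%:R < tau)%R%:R *
      (phi (H * k.+1%:R / N.+1%:R) - phi (H * k%:R / N.+1%:R)) = phi u.
Proof.
move=> tau0 tauH; have H0 : 0 < H by exact: lt_le_trans tauH.
pose g k : R := H * k%:R / N.+1%:R.
have N0 : 0 < N.+1%:R :> R by rewrite ltr0n.
have g_lt k l : (g k < g l) = (k < l)%N.
  by rewrite /g ltr_pM2r ?invr_gt0// ltr_pM2l// ltr_nat.
have ex : exists k, tau <= g k.
  by exists N.+1; rewrite /g mulfK// gt_eqF.
case: (ex_minnP ex) => K tK minK.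
have KN : (K <= N.+1)%N by apply: minK; rewrite /g mulfK// gt_eqF.
have K0 : (0 < K)%N.
  by rewrite lt0n; apply: contraTneq tK => ->; rewrite /g mulr0 mul0r leNgt tau0.
have gK k : (g k < tau) = (k < K)%N.
  apply/idP/idP => h.
    by rewrite -g_lt; exact: lt_le_trans tK.
  by rewrite ltNge; apply: contraL h => /minK; rewrite leqNgt.
exists (g K).
  split => //.
    have : g K.-1 < tau by rewrite gK prednK.
    rewrite -{2}(prednK K0) /g -[K.-1.+1%:R]natr1 => h.
    by rewrite mulrDr mulr1 mulrDl ltrD2r.
  by rewrite /g -[leRHS](mulfK (_ : N.+1%:R != 0)) ?gt_eqF// ler_pM2r ?invr_gt0//
    ler_pM2l// ler_nat.
move=> phi; have sumE m : (m <= N.+1)%N ->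
    phi 0 + \sum_(0 <= k < m) (g k < tau)%R%:R * (phi (g k.+1) - phi (g k)) =
    phi (g (minn m K)).
  elim: m => [|m IH] mN.
    by rewrite big_geq// min0n addr0 /g mulr0 mul0r.
  rewrite big_nat_recr//= addrA IH ?(ltnW mN)// gK.
  case: (ltnP m K) => h.
    rewrite (minn_idPl h) mul1r; lra.
  by rewrite mul0r addr0 (minn_idPr (leqW h)).
rewrite -(big_mkord xpredT (fun k => (g k < tau)%R%:R * (phi (g k.+1) - phi (g k)))).
by rewrite sumE// (minn_idPr KN).
Qed.

Definition stop_time (H : R) (w : T) : R := fine (mine (exit_time w) H%:E).

Lemma exit_time_gt0 w : (0 < exit_time w)%E.
Proof.
by rewrite (@exit_timeE R disp T d x v B r w); apply: first_zero_gt0;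
  [exact: (continuous_gap_path hB)|exact: (gap_path0 hB)].
Qed.

Lemma stop_timeE H w : 0 < H -> (stop_time H w)%:E = mine (exit_time w) H%:E.
Proof.
move=> H0; rewrite /stop_time fineK//.
have := exit_time_gt0 w; case: (exit_time w) => [s||]//= _.
by rewrite /mine; case: ifP.
Qed.

Lemma stop_time_bounds H w : 0 < H -> 0 < stop_time H w <= H.
Proof.
move=> H0; rewrite -lte_fin -lee_fin (stop_timeE w H0).
by rewrite lt_min exit_time_gt0 lte_fin H0 /= ge_min lexx orbT.
Qed.

Lemma gap_stop_time H w : 0 < H -> 0 <= gap (X (stop_time H w) w).
Proof.
move=> H0; have /andP[t0 tH] := stop_time_bounds w H0.
rewrite -[stop_time H w](max_idPr (ltW t0)) -/(@gap_path R disp T d x v B r w _).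
have e := stop_timeE w H0; set t := stop_time H w in t0 tH e *.
have cg := @continuous_gap_path R disp T P d x v B hB r w.
have g0 : 0 < @gap_path R disp T d x v B r w 0 by exact: (gap_path0 hB hxr).
have : (t%:E <= exit_time w)%E by rewrite e ge_min lexx.
rewrite le_eqVlt => /predU1P[|].
  by rewrite (@exit_timeE R disp T d x v B r w) => /esym /(first_zero_fin cg g0)[_ -> _].
rewrite (@exit_timeE R disp T d x v B r w) => /(lt_first_zeroP cg g0 (ltW t0)) h.
by apply: ltW; apply: h; rewrite lexx ltW.
Qed.

Lemma continuous_heat_path n a t w : 0 <= t -> a != t ->
  heat_fun v n a u (X (Num.max 0 u) w) @[u --> t] --> heat_fun v n a t (X t w).
Proof.
move=> t0 at0; have cX i := @continuous_drifted R disp T P d x v B hB w i.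
have tE : Num.max 0 t = t by apply/max_idPr.
have cL : dotv v (X (Num.max 0 u) w) @[u --> t] --> dotv v (X t w).
  rewrite -[in X in _ --> X]tE; apply: cvg_big => [|i _]; first exact: add_continuous.
  by apply: cvgM; [exact: cvg_cst|exact: cX].
have cQ : dotv (X (Num.max 0 u) w) (X (Num.max 0 u) w) @[u --> t] -->
    dotv (X t w) (X t w).
  have := @continuous_dotv_drifted R disp T P d x v B hB w t.
  by rewrite /continuous_at tE.
have cat : a - u @[u --> t] --> a - t.
  by apply: cvgB; [exact: cvg_cst|exact: cvg_id].
have at1 : a - t != 0 by rewrite subr_eq0.
have nat0 : 0 < `|a - t| by rewrite normr_gt0.
rewrite /heat_fun; apply: cvgM; first apply: cvgM.
- have nn : \forall u \near t, 0 < `|a - u|.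
    have cn : `|a - u| @[u --> t] --> `|a - t| by exact: cvg_norm.
    near=> u; near: u; move/cvgrPdist_lt : cn => /(_ _ nat0); apply: filterS => u.
    by rewrite ltr_distlC => /andP[+ _]; rewrite subrr.
  rewrite {2}/powR gt_eqF//.
  have : expR (- (d%:R / 2 + n%:R) * ln `|a - u|) @[u --> t] -->
      expR (- (d%:R / 2 + n%:R) * ln `|a - t|).
    apply: continuous_cvg; first exact: continuous_expR.
    apply: cvgM; first exact: cvg_cst.
    apply: continuous_cvg; first exact: continuous_ln.
    exact: cvg_norm.
  apply: cvg_trans; apply: near_eq_cvg; apply: filterS nn => u u0.
  by rewrite /powR gt_eqF.
- apply: continuous_cvg; first exact: continuous_expR.
  apply: cvgB; first apply: cvgB => //.
    by apply: cvgM; [apply: cvgM; [exact: cvg_cst|exact: cvg_id]|exact: cvg_cst].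
  apply: cvgM => //; apply: cvgV; first by rewrite mulf_neq0.
  by apply: cvgM => //; exact: cvg_cst.
rewrite /zonal_fun; set L := dotv v (X t w) in cL *; set Q := dotv (X t w) (X t w) in cQ *.
have cQ' : dotv v v * dotv (X (Num.max 0 u) w) (X (Num.max 0 u) w) @[u --> t] -->
    dotv v v * Q by apply: cvgM => //; exact: cvg_cst.
suff [] : zonal (nu_of (d := d)) (dotv v (X (Num.max 0 u) w)) (dotv v v * dotv (X (Num.max 0 u) w) (X (Num.max 0 u) w)) n @[u --> t] --> zonal (nu_of (d := d)) L (dotv v v * Q) n /\
  zonal (nu_of (d := d)) (dotv v (X (Num.max 0 u) w)) (dotv v v * dotv (X (Num.max 0 u) w) (X (Num.max 0 u) w)) n.+1 @[u --> t] --> zonal (nu_of (d := d)) L (dotv v v * Q) n.+1 by [].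
elim: n => [|n [IH1 IH2]].
  by split; [exact: cvg_cst|apply: cvgM => //; exact: cvg_cst].
split => //; apply: cvgM; first exact: cvg_cst.
apply: cvgB; apply: cvgM => //; apply: cvgM => //; exact: cvg_cst.
Unshelve. all: by end_near. Qed.

Section Discretized.
Variables (H : R) (H0 : 0 < H).

Let g N k : R := H * k%:R / N.+1%:R.

(** The value of Y at the first grid point at or after [stop_time]. Written as a sum over steps,
    each term has expectation zero by [stopped_step] when Y is a kernel along the path. *)
Definition discretized (Y : R -> T -> R) N w : R := Y 0 w + \sum_(k < N.+1)
  alive (g N k) w * (Y (g N k.+1) w - Y (g N k) w).

Let g_ge0 N k : 0 <= g N k.
Proof. by rewrite /g divr_ge0// mulr_ge0// ltW. Qed.

Let g_le N k : (k <= N.+1)%N -> g N k <= H.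
Proof.
move=> kN; rewrite /g ler_pdivrMr ?ltr0n// ler_pM2l// ler_nat//.
Qed.

Lemma discretizedE N w : exists2 u, [/\ stop_time H w <= u,
    u < stop_time H w + H / N.+1%:R & u <= H] & forall Y,
  discretized Y N w = Y u w.
Proof.
have /andP[t0 tH] := stop_time_bounds w H0.
have [u hu hE] := @stopped_sum _ H N t0 tH.
exists u => // Y; rewrite -(hE (Y ^~ w)) /discretized; congr (_ + _).
apply: eq_bigr => k _; rewrite -/(g N k) -/(g N k.+1).
congr (_ * _); rewrite /alive; congr (nat_of_bool _)%:R.
rewrite -[RHS]lte_fin (stop_timeE w H0) lt_min lte_fin.
suff -> : g N k < H by rewrite andbT.
by rewrite /g ltr_pdivrMr ?ltr0n// ltr_pM2l// ltr_nat.
Qed.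

Lemma cvg_discretized (Y : R -> T -> R) (Z : R -> R) w :
  (forall u, 0 <= u -> Z u = Y u w) ->
  Z u @[u --> stop_time H w] --> Z (stop_time H w) ->
  discretized Y ^~ w @ \oo --> Y (stop_time H w) w.
Proof.
move=> ZY; have /andP[t0 tH] := stop_time_bounds w H0.
rewrite -ZY ?(ltW t0)//; set t := stop_time H w in t0 tH * => cf.
apply/cvgrPdist_lt => e e0.
move/cvgrPdist_lt : cf => /(_ _ e0) /nbhs_ballP [de /= de0 Hde].
near=> N; have [u [tu ut uH] ->] := discretizedE N w.
rewrite -ZY ?(le_trans (ltW t0))//.
apply: Hde; rewrite /ball /= ltr_norml; rewrite -/t in tu ut.
have : H / N.+1%:R < de.
  rewrite ltr_pdivrMr ?ltr0n// mulrC -ltr_pdivrMr//.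
  apply: (@lt_trans _ _ N%:R); last by rewrite ltr_nat.
  by near: N; exact: nbhs_infty_gtr.
move: ut; set h0 := H / _ => ut hN; apply/andP; split; lra.
Unshelve. all: by end_near. Qed.

Lemma measurable_discretized (Y : R -> T -> R) N :
  (forall t, 0 <= t -> measurable_fun [set: T] (Y t)) ->
  measurable_fun [set: T] (discretized Y N).
Proof.
move=> mY; apply: measurable_funD; first exact: mY.
apply: measurable_sum => k; apply: measurable_funM; first exact: measurable_alive.
by apply: measurable_funB; exact: mY.
Qed.

Lemma measurable_stopped (Y : R -> T -> R) :
  (forall t, 0 <= t -> measurable_fun [set: T] (Y t)) ->
  (forall w, continuous (fun t : R => Y (Num.max 0 t) w)) ->
  measurable_fun [set: T] (fun w => Y (stop_time H w) w).
Proof.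
move=> mY cY; apply: (@measurable_fun_cvg _ _ R setT (discretized Y)).
  by move=> N; exact: measurable_discretized.
move=> w _; apply: (@cvg_discretized Y (fun t => Y (Num.max 0 t) w)).
  by move=> u u0; rewrite (max_idPr u0).
exact: cY.
Qed.

Variables (n : nat) (a : R) (ha : H < a \/ (a < 0 /\ enorm x < r)).
Let Y t w := heat_fun v n a t (X t w).

Lemma cvg_discretized_heat w : discretized Y ^~ w @ \oo --> Y (stop_time H w) w.
Proof.
have /andP[t0 tH] := stop_time_bounds w H0.
have at0 : a != stop_time H w.
  case: ha => [Ha|[a0 _]]; first by rewrite gt_eqF// (le_lt_trans tH).
  by rewrite lt_eqF// (lt_trans a0).
apply: (@cvg_discretized Y (fun u => heat_fun v n a u (X (Num.max 0 u) w))).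
  by move=> u u0; rewrite (max_idPr u0).
have := @continuous_heat_path n a _ w (ltW t0) at0.
by rewrite (max_idPr (ltW t0)).
Qed.

Lemma integral_discretized N : P.-integrable setT (fun w => (discretized Y N w)%:E) /\
  (\int[P]_w (discretized Y N w)%:E = (heat_fun v n a 0 x)%:E)%E.
Proof.
pose D k w := alive (g N k) w * (heat_fun v n a (g N k.+1) (X (g N k.+1) w)
                     - heat_fun v n a (g N k) (X (g N k) w)).
have hD (k : 'I_N.+1) : P.-integrable setT (fun w => (D k w)%:E) /\
    (\int[P]_w (D k w)%:E = 0)%E.
  have gk : g N k < g N k.+1.
    by rewrite /g ltr_pM2r ?invr_gt0 ?ltr0n// ltr_pM2l// ltr_nat.
  have gk1 := g_le (ltn_ord k : (k.+1 <= N.+1)%N).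
  have a2 : 0 < (a - g N k) * (a - g N k.+1).
    case: ha => [Ha|[a0 _]]; first by rewrite mulr_gt0// subr_gt0; lra.
    have g1 := g_ge0 N k; have g2 := g_ge0 N k.+1.
    by rewrite nmulr_rgt0 subr_lt0; lra.
  have [|i1 i2 e] := stopped_step n (g_ge0 N k) gk a2.
    by case: ha => [Ha|[_ xr]]; [left; lra|right].
  have DE w : (D k w)%:E = ((alive (g N k) w * heat_fun v n a (g N k.+1) (X (g N k.+1) w))%:E
      - (alive (g N k) w * heat_fun v n a (g N k) (X (g N k) w))%:E)%E.
    by rewrite /D mulrBr EFinB.
  split; first by under eq_fun do rewrite DE; exact: integrableB.
  under eq_integral do rewrite DE; rewrite integralB// e subee//.
  exact: integrable_fin_num.
have icst : P.-integrable setT (fun=> (heat_fun v n a 0 x)%:E).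
  by apply: (@bounded_integrable _ _ _ P _ `|heat_fun v n a 0 x|).
have dE w : (discretized Y N w)%:E =
    ((heat_fun v n a 0 x)%:E + \sum_(k < N.+1) (D k w)%:E)%E.
  by rewrite /discretized /Y (drifted0 hB) EFinD -sumEFin.
have iS : P.-integrable setT (fun w => \sum_(k < N.+1) (D k w)%:E)%E.
  by apply: integrable_sum => // k _; exact: (hD k).1.
split; first by under eq_fun do rewrite dE; exact: integrableD.
under eq_integral do rewrite dE.
rewrite integralD// integral_sum//; last by move=> k; exact: (hD k).1.
rewrite big1 ?adde0; last by move=> k _; exact: (hD k).2.
by rewrite integral_cst// [X in (_ * X)%E](_ : _ = 1%E) ?mule1//; exact: probability_setT.
Qed.

End Discretized.

(** The discretized stopping overshoots the sphere, so the bound C0 on the correct side is available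
    only for the limit. Uniform integrability of the approximations comes from the comparison with
    the kernel of degree 0 and pole a', whose expectation is the same for all N. *)
Lemma optional_stopping n a a' H C0 : 0 < H -> H < a \/ (a < 0 /\ enorm x < r) ->
  H < a' \/ (a' < 0 /\ enorm x < r) ->
  (forall t y, 0 <= t <= H -> 0 <= gap y -> `|heat_fun v n a t y| <= C0) ->
  (forall eta, 0 < eta -> exists C, forall t y, 0 <= t <= H ->
     `|heat_fun v n a t y| <= C + eta * heat_fun v 0 a' t y) ->
  P.-integrable setT
    (fun w => (heat_fun v n a (stop_time H w) (X (stop_time H w) w))%:E) /\
  (\int[P]_w (heat_fun v n a (stop_time H w) (X (stop_time H w) w))%:E =
   (heat_fun v n a 0 x)%:E)%E.
Proof.
move=> H0 ha ha' bd tight.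
pose Y n a t w := heat_fun v n a t (X t w).
apply: (@tight_limit _ _ _ P (discretized H (Y n a)) (discretized H (Y 0%N a')) _
  (heat_fun v 0 a' 0 x) _ C0).
- by move=> N; exact: (integral_discretized H0 n ha N).1.
- by move=> N; exact: (integral_discretized H0 0 ha' N).1.
- by move=> w; have := @cvg_discretized_heat H H0 n a ha w.
- move=> w; have /andP[t0 tH] := stop_time_bounds w H0.
  by apply: bd; [rewrite (ltW t0)|exact: gap_stop_time].
- move=> N w; have [u _ ->] := discretizedE H0 N w.
  by rewrite /Y /heat_fun /= mulr1 mulr_ge0 ?powR_ge0 ?expR_ge0.
- move=> eta /tight [C HC]; exists C => N w.
  have /andP[t0 tH] := stop_time_bounds w H0.
  have [u [u1 u2 u3] e1] := discretizedE H0 N w.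
  by rewrite !e1; apply: HC; rewrite u3 andbT; lra.
- by move=> N; exact: (integral_discretized H0 n ha N).2.
- by move=> N; exact: (integral_discretized H0 0 ha' N).2.
Qed.

End OptionalStopping.

(** * Growth of the space-time kernel *)

Section ZonalBound.
Context {R : realType}.

(** The two coefficients of the recurrence are at most nu/2 + 1 and 2. With A = 4 (nu + 1) the
    induction reduces to (nu + 2)(A + 1) <= A^2. *)
Lemma zonal_bound (nu L Q S : R) n : 0 <= nu -> `|L| <= S -> `|Q| <= S ^+ 2 ->
  `|zonal nu L Q n| <= (4 * (nu + 1) * S) ^+ n.
Proof.
move=> nu0 LS QS; set A := 4 * (nu + 1).
have S0 : 0 <= S by exact: le_trans (normr_ge0 _) LS.
have A4 : 4 <= A by rewrite /A; lra.
have AS0 : 0 <= A * S by rewrite mulr_ge0//; lra.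
suff [] : `|zonal nu L Q n| <= (A * S) ^+ n /\
  `|zonal nu L Q n.+1| <= (A * S) ^+ n.+1 by [].
elim: n => [|n [IH1 IH2]].
  rewrite /= normr1 expr0 expr1 lexx; split=> //.
  rewrite normrM ger0_norm; last by rewrite mulr_ge0//; lra.
  by rewrite ler_pM// ?mulr_ge0// /A; lra.
split=> //; move: IH1 IH2 => /=.
set z0 := zonal nu L Q n; set z1 := (match n with _.+1 => _ | _ => _ end).
move=> IH1 IH2; set m := (A * S) ^+ n in IH1 *.
have m0 : 0 <= m by rewrite exprn_ge0.
have n0 : 0 <= n%:R :> R by [].
have n2 : 0 < n.+2%:R :> R by [].
have nE : n.+2%:R = n%:R + 2 :> R by rewrite -natrD addn2.
have c1 : `|(nu + n.+2%:R) / n.+2%:R| <= nu / 2 + 1.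
  rewrite ger0_norm; last by rewrite divr_ge0//; lra.
  by rewrite ler_pdivrMr// nE; nra.
have c2 : `|zonal_coef nu n| <= 2.
  rewrite /zonal_coef; case: (n) => [|k]; first by rewrite ger0_norm.
  have k1 : 1 <= k.+1%:R :> R by rewrite (ler_nat _ 1).
  rewrite ger0_norm; last by rewrite divr_ge0//; lra.
  by rewrite ler_pdivrMr; lra.
have z1b : `|2 * L * z1| <= 2 * S * (A * S * m).
  rewrite !normrM [`|2|]ger0_norm// -mulrA -[leRHS]mulrA ler_pM2l// ler_pM//.
  by rewrite -exprS.
have z0b : `|zonal_coef nu n * Q * z0| <= 2 * S ^+ 2 * m.
  by rewrite !normrM; apply: ler_pM => //; rewrite ?mulr_ge0//; exact: ler_pM.
rewrite normrM exprS exprS -/m.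
apply: (@le_trans _ _ ((nu / 2 + 1) * (2 * S * (A * S * m) + 2 * S ^+ 2 * m))).
  by apply: ler_pM => //; rewrite (le_trans (ler_normB _ _))// lerD.
have -> : (nu / 2 + 1) * (2 * S * (A * S * m) + 2 * S ^+ 2 * m) =
  (nu + 2) * (A + 1) * (S ^+ 2 * m) by field.
have -> : A * S * (A * S * m) = A ^+ 2 * (S ^+ 2 * m) by ring.
rewrite ler_wpM2r ?mulr_ge0 ?sqr_ge0// /A; nra.
Qed.

Lemma poly_gauss_bound (n : nat) (b c : R) : 0 < c ->
  exists2 C, 0 <= C & forall y, 0 <= y -> y ^+ n * expR (b * y - c * y ^+ 2) <= C.
Proof.
(* From y^n <= n! e^y and the maximum of (b + 1) y - c y^2. *)
move=> c0; exists (n`!%:R * expR ((b + 1) ^+ 2 / (4 * c))).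
  by rewrite mulr_ge0 ?expR_ge0.
move=> y y0; have := normrX_le_expR n y; rewrite (ger0_norm y0) => h.
apply: (@le_trans _ _ (n`!%:R * expR y * expR (b * y - c * y ^+ 2))).
  by rewrite ler_wpM2r ?expR_ge0.
rewrite -mulrA -expRD ler_wpM2l// ler_expR -subr_ge0.
have -> : (b + 1) ^+ 2 / (4 * c) - (y + (b * y - c * y ^+ 2)) =
  c * ((b + 1) / (2 * c) - y) ^+ 2 by field; exact: lt0r_neq0.
by rewrite mulr_ge0 ?sqr_ge0// ltW.
Qed.

End ZonalBound.

Section HeatGrowth.
Context {R : realType} {d : nat} (hd : (2 <= d)%N) (v : 'rV[R]_d).
Implicit Types y : 'rV[R]_d.

(** Cauchy-Schwarz by Lagrange's identity. *)
Lemma sqr_dotv_le y : dotv v y ^+ 2 <= dotv v v * dotv y y.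
Proof.
rewrite -subr_ge0 -(pmulr_rge0 _ (_ : 0 < 2 :> R))//.
have -> : 2 * (dotv v v * dotv y y - dotv v y ^+ 2) =
    \sum_i \sum_j (v ord0 i * y ord0 j - v ord0 j * y ord0 i) ^+ 2.
  have -> : \sum_i \sum_j (v ord0 i * y ord0 j - v ord0 j * y ord0 i) ^+ 2 =
      \sum_i \sum_j ((v ord0 i * v ord0 i) * (y ord0 j * y ord0 j)
        + (y ord0 i * y ord0 i) * (v ord0 j * v ord0 j)
        - 2 * ((v ord0 i * y ord0 i) * (v ord0 j * y ord0 j))).
    by apply: eq_bigr => i _; apply: eq_bigr => j _; ring.
  under eq_bigr do rewrite sumrB big_split/= -!mulr_sumr.
  rewrite sumrB big_split/= -!mulr_suml -mulr_sumr -mulr_suml /dotv; ring.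
by apply: sumr_ge0 => i _; apply: sumr_ge0 => j _; exact: sqr_ge0.
Qed.

Lemma normr_dotv_le y : `|dotv v y| <= enorm v * enorm y.
Proof.
rewrite -(ler_pXn2r (_ : 0 < 2)%N)// ?nnegrE ?mulr_ge0 ?enorm_ge0//.
by rewrite real_normK ?num_real// exprMn !sqr_enorm sqr_dotv_le.
Qed.

Lemma zonal_fun_bound n y :
  `|zonal_fun v n y| <= (4 * (nu_of (R := R) (d := d) + 1) * enorm v) ^+ n * enorm y ^+ n.
Proof.
rewrite /zonal_fun -exprMn.
have -> : 4 * (nu_of (R := R) (d := d) + 1) * enorm v * enorm y =
  4 * (nu_of (R := R) (d := d) + 1) * (enorm v * enorm y) by ring.
apply: zonal_bound.
- by rewrite divr_ge0// subr_ge0 (ler_nat _ 2).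
- exact: normr_dotv_le.
- by rewrite exprMn !sqr_enorm ger0_norm// mulr_ge0// dotv_ge0.
Qed.

Let A : R := 4 * (nu_of (R := R) (d := d) + 1) * enorm v.

Let A_ge0 n : 0 <= A ^+ n.
Proof.
rewrite exprn_ge0// mulr_ge0 ?enorm_ge0// mulr_ge0// addr_ge0//.
by rewrite divr_ge0// subr_ge0 (ler_nat _ 2).
Qed.

Let p_ge0 n : 0 <= d%:R / 2 + n%:R :> R.
Proof. by rewrite addr_ge0// divr_ge0. Qed.

Lemma heat_fun_bound n a t y : `|heat_fun v n a t y| <=
  `|a - t| `^ (- (d%:R / 2 + n%:R)) * expR (dotv v v * t / 2 - dotv v y
     - dotv y y / (2 * (a - t))) * (A ^+ n * enorm y ^+ n).
Proof.
rewrite /heat_fun !normrM [`|_ `^ _|]ger0_norm ?powR_ge0//.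
rewrite [`|expR _|]ger0_norm ?expR_ge0//.
by rewrite ler_wpM2l ?mulr_ge0 ?powR_ge0 ?expR_ge0// zonal_fun_bound.
Qed.

Lemma powRN_le (b c p : R) : 0 < b -> b <= c -> 0 <= p -> c `^ (- p) <= b `^ (- p).
Proof.
move=> b0 bc p0; rewrite !powRN lef_pV2 ?posrE ?powR_gt0 ?(lt_le_trans b0)//.
by rewrite ge0_ler_powR// nnegrE ltW// (lt_le_trans b0).
Qed.

Lemma heat_growth_outer n a H : 0 < H -> H < a -> exists C, forall t y,
  0 <= t <= H -> `|heat_fun v n a t y| <= C.
Proof.
move=> H0 Ha; have a0 : 0 < a by exact: lt_trans Ha.
have c0 : 0 < 1 / (2 * a) by rewrite divr_gt0// mulr_gt0.
have [C C0 HC] := poly_gauss_bound n (enorm v) c0.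
exists ((a - H) `^ (- (d%:R / 2 + n%:R)) * expR (dotv v v * H / 2) * A ^+ n * C).
move=> t y /andP[t0 tH]; apply: le_trans (heat_fun_bound _ _ _ _) _.
have at0 : 0 < a - t by lra.
rewrite (gtr0_norm at0) [A ^+ n * _]mulrC mulrA [leRHS]mulrAC.
apply: ler_pM => //; first by rewrite !mulr_ge0 ?powR_ge0 ?expR_ge0 ?exprn_ge0 ?enorm_ge0.
rewrite -!mulrA; apply: ler_pM; rewrite ?powR_ge0 ?mulr_ge0 ?expR_ge0 ?exprn_ge0 ?enorm_ge0//.
  by apply: powRN_le => //; lra.
apply: (@le_trans _ _ (expR (dotv v v * (H / 2)) *
   (enorm y ^+ n * expR (enorm v * enorm y - 1 / (2 * a) * enorm y ^+ 2)))); last first.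
  by rewrite ler_wpM2l ?expR_ge0// HC// enorm_ge0.
rewrite [leRHS]mulrCA [leLHS]mulrC ler_wpM2l ?exprn_ge0 ?enorm_ge0// -expRD ler_expR.
have h1 : - dotv v y <= enorm v * enorm y.
  by apply: le_trans (normr_dotv_le y); rewrite -normrN ler_norm.
have h2 : dotv v v * t <= dotv v v * H by rewrite ler_wpM2l// dotv_ge0.
have h3 : 1 / (2 * a) * enorm y ^+ 2 <= dotv y y / (2 * (a - t)).
  rewrite sqr_enorm mulrC div1r ler_wpM2l ?dotv_ge0// lef_pV2 ?posrE ?mulr_gt0//; lra.
lra.
Qed.

(** Moving the pole from a to a' closer to 0 raises the rate of the Gaussian growth. The gain
    absorbs |y|^n and still leaves a factor 1 + |y|, which later makes the ratio of the two kernels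
    arbitrarily small at infinity. *)
Lemma heat_growth_inner n a a' H : a < a' -> a' < 0 -> 0 < H ->
  exists2 M, 0 <= M & forall t y, 0 <= t <= H ->
  `|heat_fun v n a t y| * (1 + enorm y) <= M * heat_fun v 0 a' t y.
Proof.
move=> aa a'0 H0.
(* The difference of the Gaussian rates 1 / (2 (t - a')) and 1 / (2 (t - a)) at t = H, where it is
   smallest on [0, H]. *)
pose c := (a' - a) / (2 * (H - a) * (H - a')).
have c0 : 0 < c by rewrite /c divr_gt0 ?mulr_gt0//; lra.
have [C1 C10 HC1] := poly_gauss_bound n 0 c0.
have [C2 C20 HC2] := poly_gauss_bound n.+1 0 c0.
pose p : R := d%:R / 2 + n%:R; pose p0 : R := d%:R / 2 + 0%:R.
exists ((- a) `^ (- p) * (H - a') `^ p0 * A ^+ n * (C1 + C2)).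
  by rewrite !mulr_ge0 ?powR_ge0 ?addr_ge0.
move=> t y /andP[t0 tH].
apply: le_trans (ler_wpM2r _ (heat_fun_bound _ _ _ _)) _; first by rewrite addr_ge0 ?enorm_ge0.
have n1 : `|a - t| = t - a by rewrite ltr0_norm; lra.
have n2 : `|a' - t| = t - a' by rewrite ltr0_norm; lra.
rewrite /heat_fun /zonal_fun /= mulr1 n1 n2 -/p -/p0.
set e2 := expR (dotv v v * t / 2 - dotv v y - dotv y y / (2 * (a' - t))).
set rho := enorm y; have r0 : 0 <= rho by exact: enorm_ge0.
have -> : expR (dotv v v * t / 2 - dotv v y - dotv y y / (2 * (a - t))) =
    e2 * expR (- (a' - a) / (2 * (t - a) * (t - a')) * rho ^+ 2).
  rewrite -expRD; congr expR; rewrite /rho sqr_enorm; field.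
  by apply/and4P; split; lra.
have h1 : (t - a) `^ (- p) <= (- a) `^ (- p).
  by apply: powRN_le; [lra|lra|exact: p_ge0].
have h2 : 1 <= (H - a') `^ p0 * (t - a') `^ (- p0).
  rewrite powRN ler_pdivlMr ?powR_gt0 ?mul1r//; last by lra.
  by rewrite ge0_ler_powR ?nnegrE ?p_ge0//; lra.
have h3 : expR (- (a' - a) / (2 * (t - a) * (t - a')) * rho ^+ 2) * rho ^+ n * (1 + rho)
    <= C1 + C2.
  have -> : forall e : R, e * rho ^+ n * (1 + rho) = rho ^+ n * e + rho ^+ n.+1 * e.
    by move=> e; rewrite exprS; ring.
  have hc : expR (- (a' - a) / (2 * (t - a) * (t - a')) * rho ^+ 2) <=
      expR (0 * rho - c * rho ^+ 2).
    rewrite ler_expR mul0r add0r !mulNr lerN2 ler_wpM2r ?sqr_ge0// /c.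
    rewrite ler_wpM2l ?subr_ge0 ?(ltW aa)//.
    have q1 : 0 < 2 * (t - a) * (t - a') by rewrite !mulr_gt0//; lra.
    rewrite lef_pV2 ?posrE//; last by rewrite (lt_le_trans q1)//; nra.
    by nra.
  apply: lerD.
    by apply: le_trans (HC1 rho r0); rewrite ler_wpM2l ?exprn_ge0.
  by apply: le_trans (HC2 rho r0); rewrite ler_wpM2l ?exprn_ge0.
set e3 := expR _ in h3 *.
have -> : (t - a) `^ (- p) * (e2 * e3) * (A ^+ n * rho ^+ n) * (1 + rho) =
  (t - a) `^ (- p) * (e2 * A ^+ n) * (e3 * rho ^+ n * (1 + rho)) by ring.
have -> : (- a) `^ (- p) * (H - a') `^ p0 * A ^+ n * (C1 + C2) * ((t - a') `^ (- p0) * e2) =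
  (- a) `^ (- p) * (e2 * A ^+ n) * ((C1 + C2) * ((H - a') `^ p0 * (t - a') `^ (- p0))) by ring.
apply: ler_pM.
- by rewrite !mulr_ge0 ?powR_ge0 ?expR_ge0.
- by rewrite !mulr_ge0 ?exprn_ge0 ?expR_ge0 ?addr_ge0.
- by rewrite ler_wpM2r// mulr_ge0 ?expR_ge0.
- apply: le_trans h3 _; rewrite -[leLHS]mulr1 ler_wpM2l//.
  by rewrite addr_ge0.
Qed.

Lemma heat_inner_bound n a (H K : R) : a < 0 -> 0 <= K -> forall t y, 0 <= t <= H ->
  enorm y <= K -> `|heat_fun v n a t y| <=
  (t - a) `^ (- (d%:R / 2 + n%:R)) * expR (dotv v v * t / 2) *
  (expR (enorm v * K + K ^+ 2 / (2 * - a)) * (A ^+ n * K ^+ n)).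
Proof.
move=> a0 K0 t y /andP[t0 tH] yK; apply: le_trans (heat_fun_bound _ _ _ _) _.
have n1 : `|a - t| = t - a by rewrite ltr0_norm; lra.
rewrite n1 [leRHS]mulrA; apply: ler_pM.
- by rewrite mulr_ge0 ?powR_ge0 ?expR_ge0.
- by rewrite mulr_ge0 ?A_ge0// exprn_ge0 ?enorm_ge0.
- rewrite -!mulrA ler_wpM2l ?powR_ge0// -expRD ler_expR.
  have h1 : - dotv v y <= enorm v * K.
    apply: le_trans (ler_wpM2l (enorm_ge0 v) yK); apply: le_trans (normr_dotv_le y).
    by rewrite -normrN ler_norm.
  have h3 : - (dotv y y / (2 * (a - t))) <= K ^+ 2 / (2 * - a).
    rewrite -sqr_enorm -mulrN -invrN; apply: ler_pM; rewrite ?sqr_ge0//.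
    + by rewrite invr_ge0; lra.
    + by rewrite ler_pXn2r// nnegrE ?enorm_ge0.
    + by rewrite lef_pV2 ?posrE; lra.
  lra.
- by rewrite ler_wpM2l ?A_ge0// lerXn2r// nnegrE enorm_ge0.
Qed.

(* Away from the origin the Gaussian factor beats the singularity at [t = a]. *)
Lemma heat_outer_decay n a (r : R) : 0 < a -> 0 < r -> exists C, forall t y,
  0 <= t < a -> r <= enorm y -> `|heat_fun v n a t y| <= C * (a - t).
Proof.
(* k is an integer not smaller than p: the singular power is exchanged for k inverse powers of a -
   t, and the bound with exponent k + 1 leaves one power of a - t to spare. *)
move=> a0 r0; pose k := (d + n)%N; pose p : R := d%:R / 2 + n%:R.
have c0 : 0 < 1 / (4 * a) by rewrite divr_gt0// mulr_gt0.
have [C1 C10 HC1] := poly_gauss_bound n (enorm v) c0.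
have [C2 C20 HC2] : exists2 C, 0 <= C & forall z : R, 0 <= z ->
    z ^+ k.+1 * expR (- (r ^+ 2 / 4) * z) <= C.
  pose q : R := r ^+ 2 / 4; have q0 : 0 < q by rewrite /q divr_gt0// exprn_gt0.
  exists (k.+1`!%:R / q ^+ k.+1); first by rewrite divr_ge0// exprn_ge0// ltW.
  move=> z z0; rewrite ler_pdivlMr ?exprn_gt0// mulrAC -exprMn mulNr expRN.
  rewrite ler_pdivrMr ?expR_gt0// [z * q]mulrC.
  have := normrX_le_expR k.+1 (q * z).
  by rewrite !ger0_norm ?exprn_ge0// mulr_ge0// ltW.
exists (a `^ (k%:R - p) * expR (dotv v v * a / 2) * A ^+ n * (C1 * C2)).
move=> t y /andP[t0 ta] ry; apply: le_trans (heat_fun_bound _ _ _ _) _.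
set e := a - t; have e0 : 0 < e by rewrite /e subr_gt0.
rewrite (gtr0_norm e0) -/p; set rho := enorm y in ry *.
have rho0 : 0 <= rho by exact: enorm_ge0.
have kp : 0 <= k%:R - p.
  rewrite /p /k natrD opprD addrACA subrr addr0 subr_ge0 ler_pdivrMr//.
  by rewrite ler_peMr// (ler_nat _ 1).
have h1 : e `^ (- p) <= a `^ (k%:R - p) * e^-1 ^+ k.
  have -> : e `^ (- p) = e `^ (k%:R - p) * e^-1 ^+ k.
    rewrite -powR_mulrn ?invr_ge0 ?(ltW e0)// -powR_inv1 ?(ltW e0)// -powRrM mulN1r.
    rewrite -powRD; last by rewrite (gt_eqF e0) implybT.
    by congr (_ `^ _); ring.
  rewrite ler_wpM2r ?exprn_ge0 ?invr_ge0 ?(ltW e0)//.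
  by rewrite ge0_ler_powR ?nnegrE ?(ltW e0) ?(ltW a0)// /e; lra.
have h2 : expR (dotv v v * t / 2 - dotv v y - dotv y y / (2 * e)) <=
    expR (dotv v v * a / 2) * (expR (enorm v * rho - 1 / (4 * a) * rho ^+ 2) *
      expR (- (r ^+ 2 / 4) * e^-1)).
  rewrite -!expRD ler_expR -(sqr_enorm y) -/rho.
  have q1 : - dotv v y <= enorm v * rho.
    by apply: le_trans (normr_dotv_le y); rewrite -normrN ler_norm.
  have q2 : dotv v v * t <= dotv v v * a by rewrite ler_wpM2l ?dotv_ge0 ?ltW.
  have q3 : 1 / (4 * a) * rho ^+ 2 <= rho ^+ 2 / (4 * e).
    rewrite mulrC div1r ler_wpM2l ?sqr_ge0// lef_pV2 ?posrE ?mulr_gt0// /e; lra.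
  have q4 : r ^+ 2 / 4 * e^-1 <= rho ^+ 2 / (4 * e).
    rewrite invfM [rho ^+ 2 * _]mulrA ler_wpM2r ?invr_ge0 ?(ltW e0)//.
    by rewrite ler_wpM2r// ler_pXn2r// nnegrE ltW.
  have -> : rho ^+ 2 / (2 * e) = rho ^+ 2 / (4 * e) + rho ^+ 2 / (4 * e).
    by field; exact: lt0r_neq0.
  lra.
set E1 := expR (enorm v * rho - _) in h2; set E2 := expR (- (r ^+ 2 / 4) * _) in h2.
have h3 : rho ^+ n * E1 <= C1 by exact: HC1.
have h4 : e^-1 ^+ k * E2 <= C2 * e.
  have := HC2 e^-1; rewrite invr_ge0 (ltW e0) => /(_ isT).
  by rewrite exprSr -/E2 mulrAC ler_pdivrMr.
apply: (@le_trans _ _ (a `^ (k%:R - p) * e^-1 ^+ k * (expR (dotv v v * a / 2) * (E1 * E2))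
   * (A ^+ n * rho ^+ n))).
  rewrite ler_wpM2r ?mulr_ge0 ?A_ge0 ?exprn_ge0//.
  by apply: ler_pM; rewrite ?powR_ge0 ?expR_ge0.
have -> : a `^ (k%:R - p) * e^-1 ^+ k * (expR (dotv v v * a / 2) * (E1 * E2))
   * (A ^+ n * rho ^+ n) = a `^ (k%:R - p) * expR (dotv v v * a / 2) * A ^+ n *
   ((rho ^+ n * E1) * (e^-1 ^+ k * E2)) by ring.
rewrite -!mulrA ler_wpM2l ?powR_ge0// ler_wpM2l ?expR_ge0// ler_wpM2l//.
rewrite !mulrA -[leRHS]mulrA -[leLHS]mulrA.
by apply: ler_pM; rewrite ?mulr_ge0 ?exprn_ge0 ?expR_ge0 ?invr_ge0 ?(ltW e0).
Qed.

End HeatGrowth.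

(** * Hitting identities *)

Section HittingFunctional.
Context {R : realType} {disp : measure_display} {T : measurableType disp}
  (P : probability T R) {d : nat} (hd : (2 <= d)%N)
  {x v : 'rV[R]_d} {B : R -> T -> 'rV[R]_d} (hB : brownian P x B)
  (r : R) (hr : 0 < r) (hxr : enorm x <> r).
Local Notation X := (@drifted R disp T d v B).
Local Notation gap := (@gap R d x r).
Local Notation alive := (@alive R disp T d v B r).
Local Notation exit_time := (@exit_time R disp T d v B r).
Local Notation stop_time := (@stop_time R disp T d v B r).

Let nu := nu_of (R := R) (d := d).
Let A : R := 4 * (nu + 1) * enorm v.
Let p n : R := d%:R / 2 + n%:R.

Let A_ge0 n : 0 <= A ^+ n.
Proof.
rewrite exprn_ge0// mulr_ge0 ?enorm_ge0// mulr_ge0// addr_ge0//.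
by rewrite divr_ge0// subr_ge0 (ler_nat _ 2).
Qed.

Let p_ge1 n : 1 <= p n.
Proof.
apply: (@le_trans _ _ (d%:R / 2)); last by rewrite /p lerDl.
by rewrite ler_pdivlMr// mul1r (ler_nat _ 2).
Qed.

Let stop_bounds H w : 0 < H -> 0 < stop_time H w <= H.
Proof. exact: (stop_time_bounds hB hxr w). Qed.

Let stopE H w : 0 < H -> (stop_time H w)%:E = mine (exit_time w) H%:E.
Proof. exact: (stop_timeE hB hxr w). Qed.

Let gap_stop H w : 0 < H -> 0 <= gap (X (stop_time H w) w).
Proof. exact: (gap_stop_time hB hxr w). Qed.

Let exit_gt0 w : (0 < exit_time w)%E.
Proof. exact: (exit_time_gt0 hB hxr w). Qed.

(** For a beyond the horizon the kernel is bounded and serves as its own comparison kernel. For a <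
    0 the comparison kernel has its pole at a / 2. *)
Lemma stopped_heat n a H : 0 < H -> H < a \/ (a < 0 /\ enorm x < r) ->
  P.-integrable setT
    (fun w => (heat_fun v n a (stop_time H w) (X (stop_time H w) w))%:E) /\
  (\int[P]_w (heat_fun v n a (stop_time H w) (X (stop_time H w) w))%:E =
   (heat_fun v n a 0 x)%:E)%E.
Proof.
move=> H0 [Ha|[a0 xr]].
  have [C HC] := heat_growth_outer hd v n H0 Ha.
  apply: (@optional_stopping R disp T P d hd x v B hB r hxr n a a H C) => //;
    try by left.
    by move=> t y tH _; exact: HC.
  move=> eta eta0; exists C => t y tH; apply: le_trans (HC t y tH) _.
  by rewrite lerDl /heat_fun /= mulr1 !mulr_ge0 ?powR_ge0 ?expR_ge0 ?(ltW eta0).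
have aa : a < a / 2 by lra.
have a20 : a / 2 < 0 by lra.
have bounded_ball m b K : b < 0 -> 0 <= K -> exists C, forall t y, 0 <= t <= H ->
    enorm y <= K -> `|heat_fun v m b t y| <= C.
  move=> b0 K0; exists ((- b) `^ (- p m) * expR (dotv v v * H / 2) *
    (expR (enorm v * K + K ^+ 2 / (2 * - b)) * (A ^+ m * K ^+ m))).
  move=> t y tH yK; apply: le_trans (heat_inner_bound hd v m b0 K0 tH yK) _.
  move/andP: tH => [t0 tH].
  rewrite ler_wpM2r//; first by rewrite !mulr_ge0 ?expR_ge0 ?A_ge0 ?exprn_ge0.
  apply: ler_pM; rewrite ?powR_ge0 ?expR_ge0//.
    by apply: powRN_le; [lra|lra|exact: le_trans ler01 (p_ge1 m)].
  by rewrite ler_expR ler_pM2r// ler_wpM2l// dotv_ge0.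
have [M M0 HM] := heat_growth_inner hd v n aa a20 H0.
have [C HC] := bounded_ball n a r a0 (ltW hr).
apply: (@optional_stopping R disp T P d hd x v B hB r hxr n a (a / 2) H C) => //;
  try by right.
  by move=> t y tH; rewrite /gap xr subr_ge0 => yr; exact: HC.
move=> eta eta0.
(* Inside the ball of radius M / eta the comparison kernel is bounded; outside, the factor 1 + |y|
   of [heat_growth_inner] brings the ratio below eta. *)
have [|C2 HC2] := bounded_ball 0%N (a / 2) (M / eta) a20; first by rewrite divr_ge0// ltW.
exists (M * C2) => t y tH; have := HM t y tH.
have g0 : 0 <= heat_fun v 0 (a / 2) t y.
  by rewrite /heat_fun /= mulr1 mulr_ge0 ?powR_ge0 ?expR_ge0.
have y0 := enorm_ge0 y.
have := HC2 t y tH; rewrite (ger0_norm g0); set g := heat_fun v 0 _ t y in g0 *.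
set f := `|_| => h2 h1; have f0 : 0 <= f by exact: normr_ge0.
have [yM|yM] := leP (enorm y) (M / eta).
  have := ler_wpM2l M0 (h2 yM); nra.
move: yM; rewrite ltr_pdivrMr// => yM.
have C20 : 0 <= M * C2.
  rewrite mulr_ge0// -(normr0 R).
  have := HC2 t 0 tH; have -> : enorm (0 : 'rV[R]_d) = 0.
    by rewrite /enorm /dotv big1 ?sqrtr0// => i _; rewrite mxE mul0r.
  by rewrite divr_ge0 ?(ltW eta0)// => /(_ isT); apply: le_trans; rewrite normr0.
have h3 : f * (1 + enorm y) <= (eta * g) * (1 + enorm y).
  by apply: le_trans h1 _; rewrite mulrAC ler_wpM2r//; lra.
have : f <= eta * g by rewrite ler_pM2r in h3 => //; lra.
lra.
Qed.

Definition hit (w : T) : R := (exit_time w < +oo)%E%:R.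

(** On paths that never reach the sphere [fine] gives the value 0; the factor [hit] removes these
    paths wherever it matters. *)
Definition hit_time (w : T) : R := fine (exit_time w).

Definition hit_val n (w : T) : R := hit w * (expR (dotv v v * hit_time w / 2
  - dotv v (X (hit_time w) w)) * zonal_fun v n (X (hit_time w) w)).

Lemma alive_stop_time H w : 0 < H ->
  (alive H w = 1 /\ stop_time H w = H) \/
  [/\ alive H w = 0, hit w = 1, stop_time H w = hit_time w & hit_time w <= H].
Proof.
move=> H0; have e := stopE w H0; rewrite /alive /hit /hit_time.
case: ltP => h; [left|right].
  split => //; apply: EFin_inj; rewrite e.
  by apply/min_idPr; exact: ltW.
have ef : exit_time w \is a fin_num.
  rewrite ge0_fin_numE; first exact: le_lt_trans h (ltry _).
  exact/ltW/exit_gt0.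
have -> : (exit_time w < +oo)%E by exact: le_lt_trans h (ltry _).
split => //; last by rewrite -lee_fin fineK.
by apply: EFin_inj; rewrite e fineK//; exact/min_idPl.
Qed.

Lemma enorm_hit w : hit w = 1 -> enorm (X (hit_time w) w) = r.
Proof.
rewrite /hit /hit_time; case: ltP => [h _|_ /esym/eqP]; last by rewrite oner_eq0.
have ef : exit_time w \is a fin_num.
  rewrite ge0_fin_numE//; exact/ltW/exit_gt0.
have cg := @continuous_gap_path R disp T P d x v B hB r w.
have g0 : 0 < @gap_path R disp T d x v B r w 0 by exact: (gap_path0 hB hxr).
have e0 := @exit_timeE R disp T d x v B r w.
have := fineK ef; rewrite {2}e0 => /esym /(first_zero_fin cg g0)[t0 + _].
by rewrite /gap_path (max_idPr (ltW t0)) => /gap0.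
Qed.

Lemma hit_time_ge0 w : 0 <= hit_time w.
Proof. by rewrite fine_ge0//; exact/ltW/exit_gt0. Qed.

Lemma hit01 w : hit w = 0 \/ hit w = 1.
Proof. by rewrite /hit; case: (_ < _)%E; [right|left]. Qed.

Lemma alive01 s w : alive s w = 0 \/ alive s w = 1.
Proof. by rewrite /alive; case: (_ < _)%E; [right|left]. Qed.

Lemma alive_hit0 H w : hit w = 0 -> alive H w = 1.
Proof.
rewrite /hit /alive; case: ltP => [_ /eqP|]; first by rewrite oner_eq0.
by rewrite leye_eq => /eqP -> _; rewrite ltry.
Qed.

Lemma cvg_alive w : (fun m : nat => alive m.+1%:R w) @ \oo --> 1 - hit w.
Proof.
apply: cvg_near_cst; have [h|h] := hit01 w.
  by apply: nearW => m; rewrite h subr0 alive_hit0.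
near=> m; rewrite h subrr; apply/eqP.
have : hit_time w <= m%:R by near: m; exact: nbhs_infty_ger.
move=> hm; move: h; rewrite /hit /alive; case: (ltP (exit_time w)); last first.
  by move=> _ /esym/eqP; rewrite oner_eq0.
move=> h _; have ef : exit_time w \is a fin_num.
  rewrite ge0_fin_numE//; exact/ltW/exit_gt0.
rewrite ltNge -(fineK ef) lee_fin (le_trans hm)// ler_nat//.
Unshelve. all: by end_near. Qed.

Lemma cvg_stopped (Y : R -> R) w :
  (fun m : nat => (1 - alive m.+1%:R w) * Y (stop_time m.+1%:R w)) @ \oo -->
  hit w * Y (hit_time w).
Proof.
have [h|h] := hit01 w.
  rewrite h mul0r; apply: cvg_near_cst; apply: nearW => m.
  by rewrite alive_hit0// subrr mul0r.
have c1 : (fun m : nat => (1 - alive m.+1%:R w) * Y (hit_time w)) @ \oo -->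
    (1 - (1 - hit w)) * Y (hit_time w).
  apply: cvgM; last exact: cvg_cst.
  by apply: cvgB; [exact: cvg_cst|exact: cvg_alive].
rewrite subKr in c1; apply: cvg_trans c1; apply: near_eq_cvg; apply: nearW => m.
have [[-> _]|[_ _ -> _]//] := @alive_stop_time m.+1%:R w (ltr0Sn _ _).
by rewrite subrr !mul0r.
Qed.

Let malive m : measurable_fun [set: T] (alive m.+1%:R).
Proof. exact: (measurable_alive hB hxr). Qed.

Lemma measurable_hit : measurable_fun [set: T] hit.
Proof.
apply: (@measurable_fun_cvg _ _ R setT (fun m w => 1 - alive m.+1%:R w)).
  by move=> m; apply: measurable_funB.
move=> w _; rewrite -[hit w](subKr 1).
by apply: cvgB; [exact: cvg_cst|exact: cvg_alive].
Qed.

Let mstop (Y : R -> T -> R) m :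
  (forall t, 0 <= t -> measurable_fun [set: T] (Y t)) ->
  (forall w, continuous (fun t : R => Y (Num.max 0 t) w)) ->
  measurable_fun [set: T] (fun w => Y (stop_time m.+1%:R w) w).
Proof. exact: (measurable_stopped hB hxr (ltr0Sn _ _)). Qed.

Let mhit_ (Y : R -> T -> R) :
  (forall t, 0 <= t -> measurable_fun [set: T] (Y t)) ->
  (forall w, continuous (fun t : R => Y (Num.max 0 t) w)) ->
  measurable_fun [set: T] (fun w => hit w * Y (hit_time w) w).
Proof.
move=> mY cY; apply: (@measurable_fun_cvg _ _ R setT
  (fun m w => (1 - alive m.+1%:R w) * Y (stop_time m.+1%:R w) w)).
  by move=> m; apply: measurable_funM; [exact: measurable_funB|exact: mstop].
by move=> w _; exact: (@cvg_stopped (Y ^~ w)).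
Qed.

Lemma measurable_hit_time : measurable_fun [set: T] hit_time.
Proof.
have -> : hit_time = (fun w => hit w * hit_time w).
  apply/funext => w; rewrite /hit /hit_time; case: ltP; first by rewrite mul1r.
  by rewrite leye_eq => /eqP ->; rewrite mul0r.
apply: (mhit_ (Y := fun t _ => t)) => [t _|w t]; first exact: measurable_cst.
by apply: continuous_max; [exact: cvg_cst|exact: cvg_id].
Qed.

Lemma measurable_hit_val n : measurable_fun [set: T] (hit_val n).
Proof.
(* Multiplied by [hit], each coordinate is a pointwise limit of measurable stopped values, including
   on paths that never hit. *)
pose Y w : 'rV[R]_d := \row_i (hit w * X (hit_time w) w ord0 i).
have mY i : measurable_fun [set: T] (fun w => Y w ord0 i).
  under eq_fun do rewrite mxE.
  apply: (mhit_ (Y := fun t w => X t w ord0 i)) => [t t0|w].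
    exact: (measurable_drifted hB).
  exact: (continuous_drifted hB).
have -> : hit_val n = (fun w => hit w * (expR (dotv v v * hit_time w / 2
    - dotv v (Y w)) * zonal_fun v n (Y w))).
  apply/funext => w; rewrite /hit_val; have [->|h] := hit01 w; first by rewrite !mul0r.
  have -> : Y w = X (hit_time w) w by apply/rowP => i; rewrite mxE h mul1r.
  by [].
have mt := measurable_hit_time; have mh := measurable_hit.
have mL : measurable_fun [set: T] (fun w => dotv v (Y w)).
  by apply: measurable_sum => i; exact: measurable_funM.
have mQ : measurable_fun [set: T] (fun w => dotv v v * dotv (Y w) (Y w)).
  by apply: measurable_funM => //; exact: measurable_dotv.
apply: measurable_funM => //; apply: measurable_funM.
  apply: measurableT_comp => //; apply: measurable_funB => //.
  by apply: measurable_funM => //; exact: measurable_funM.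
rewrite /zonal_fun.
suff [] : measurable_fun [set: T] (fun w => zonal nu (dotv v (Y w))
    (dotv v v * dotv (Y w) (Y w)) n) /\
  measurable_fun [set: T] (fun w => zonal nu (dotv v (Y w))
    (dotv v v * dotv (Y w) (Y w)) n.+1) by [].
elim: n => [|n [IH1 IH2]].
  by split; [exact: measurable_cst|exact: measurable_funM].
split => //; apply: measurable_funM => //; apply: measurable_funB.
  by apply: measurable_funM => //; exact: measurable_funM.
by apply: measurable_funM => //; exact: measurable_funM.
Qed.

Lemma hit_val0_ge0 w : 0 <= hit_val 0 w.
Proof.
by rewrite /hit_val /zonal_fun /= mulr1 mulr_ge0 ?expR_ge0// /hit; case: (_ < _)%E.
Qed.

Lemma hit_val_bound n w : `|hit_val n w| <= A ^+ n * r ^+ n * hit_val 0 w.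
Proof.
have [h|h] := hit01 w; first by rewrite /hit_val h !mul0r normr0 mulr0.
have := zonal_fun_bound hd v n (X (hit_time w) w); rewrite (enorm_hit h).
rewrite /hit_val h !mul1r /zonal_fun /= mulr1 normrM [`|expR _|]ger0_norm ?expR_ge0// => hb.
by rewrite mulrC ler_wpM2r ?expR_ge0.
Qed.

Lemma heat_fun_hit n a w : hit w = 1 ->
  heat_fun v n a (hit_time w) (X (hit_time w) w) =
  `|a - hit_time w| `^ (- p n) * expR (- (r ^+ 2 / (2 * (a - hit_time w)))) * hit_val n w.
Proof.
move=> h; rewrite /heat_fun /hit_val h mul1r -(sqr_enorm (X _ w)) (enorm_hit h) expRD.
by rewrite -/(p n); ring.
Qed.

Lemma exit_time_hit w : hit w = 1 -> exit_time w = (hit_time w)%:E.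
Proof.
rewrite /hit /hit_time; case: ltP => [h _|_ /esym/eqP]; last by rewrite oner_eq0.
by rewrite fineK// ge0_fin_numE//; exact/ltW/exit_gt0.
Qed.

Lemma stop_time_hit H w : 0 < H -> hit w = 1 -> hit_time w <= H ->
  alive H w = 0 /\ stop_time H w = hit_time w.
Proof.
move=> H0 h tH; have a0 : alive H w = 0.
  by rewrite /alive (exit_time_hit h) lte_fin ltNge tH.
split=> //; have [[a1 _]|[]//] := alive_stop_time w H0.
by move: a1; rewrite a0 => /esym/eqP; rewrite oner_eq0.
Qed.

Definition outer_integrand n a w := (hit_time w < a)%R%:R * (a - hit_time w) `^ (- p n) *
    expR (- (r ^+ 2 / (2 * (a - hit_time w)))) * hit_val n w.

(** The horizons increase to a. A path that has not hit by [H m] contributes at most C (a - [H m])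
    by [heat_outer_decay], so in the limit only the paths that hit before a remain. *)
Lemma outer_hitting_identity n a : 0 < a -> r < enorm x ->
  P.-integrable setT (fun w => (outer_integrand n a w)%:E) /\
  (\int[P]_w (outer_integrand n a w)%:E = (heat_fun v n a 0 x)%:E)%E.
Proof.
move=> a0 rx; pose H (m : nat) : R := a - a / m.+2%:R.
have Ha m : H m < a by rewrite /H ltrBlDr ltrDl divr_gt0.
have H0 m : 0 < H m.
  by rewrite /H subr_gt0 ltr_pdivrMr// ltr_pMr// (ltr_nat _ 1).
have cH : H @ \oo --> a.
  rewrite -[X in _ --> X]subr0; apply: cvgB; first exact: cvg_cst.
  rewrite -(mulr0 a); apply: cvgM; first exact: cvg_cst.
  rewrite (cvg_shiftS (fun m : nat => m.+1%:R^-1 : R)); exact: cvg_harmonic.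
have [C HC] := heat_outer_decay hd v n a0 hr.
pose F m w := heat_fun v n a (stop_time (H m) w) (X (stop_time (H m) w) w).
have FI m : P.-integrable setT (fun w => (F m w)%:E) /\
  (\int[P]_w (F m w)%:E = (heat_fun v n a 0 x)%:E)%E.
  by apply: stopped_heat => //; left.
have Fb m w : `|F m w| <= C * (a - stop_time (H m) w).
  have /andP[t0 tH] := stop_bounds w (H0 m).
  apply: HC; first by rewrite (ltW t0) (le_lt_trans tH).
  have := gap_stop w (H0 m); rewrite /gap ltNge (ltW rx)/=.
  by rewrite subr_ge0.
have C0 : 0 <= C.
  have := HC 0 x; rewrite lexx a0 subr0 (ltW rx) => /(_ isT isT) h.
  by have := le_trans (normr_ge0 _) h; rewrite pmulr_lge0.
have cF w : F ^~ w @ \oo --> outer_integrand n a w.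
  have [[h ha]|hn] := pselect (hit w = 1 /\ hit_time w < a).
    apply: cvg_near_cst; near=> m; apply/eqP.
    have tm : hit_time w < H m.
      near: m; move/cvgrPdist_lt : cH => /(_ (a - hit_time w)).
      rewrite subr_gt0 => /(_ ha); apply: filterS => m.
      by rewrite ltr_norml => /andP[_]; lra.
    have [_ e] := stop_time_hit (H0 m) h (ltW tm).
    by rewrite /F e (heat_fun_hit n a h) /outer_integrand ha mul1r gtr0_norm ?subr_gt0.
  have L0 : outer_integrand n a w = 0.
    rewrite /outer_integrand; case: (ltP (hit_time w) a) => ta; last by rewrite !mul0r.
    have [h|h] := hit01 w; first by rewrite /hit_val h mul0r mulr0.
    by exfalso; apply: hn.
  have sE m : stop_time (H m) w = H m.
    have [[_ ->]//|[_ h st tH]] := alive_stop_time w (H0 m).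
    by exfalso; apply: hn; split => //; exact: le_lt_trans tH (Ha m).
  rewrite L0; apply: (@cvg0_le R _ (fun m => C * (a - H m))).
    by move=> m; have := Fb m w; rewrite sE.
  rewrite -(mulr0 C) -(subrr a); apply: cvgM; first exact: cvg_cst.
  by apply: cvgB => //; exact: cvg_cst.
have mF m : measurable_fun [set: T] (F m).
  by apply/measurable_EFinP; case/integrableP: (FI m).1.
have mL : measurable_fun [set: T] (outer_integrand n a).
  by apply: (measurable_fun_cvg mF) => w _; exact: cF.
have FC m w : `|F m w| <= C * a.
  apply: le_trans (Fb m w) _; rewrite ler_wpM2l//.
  by have /andP[t0 _] := stop_bounds w (H0 m); lra.
have [] := @dominated_convergence _ _ _ P setT measurableT
  (fun m w => (F m w)%:E) (fun w => (outer_integrand n a w)%:E) (fun=> (C * a)%:E).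
- by move=> m; apply/measurable_EFinP.
- exact/measurable_EFinP.
- by apply: aeW => w _; apply: cvg_EFin; [exact: nearW|exact: cF].
- exact: finite_measure_integrable_cst.
- by apply: aeW => w m _; rewrite abse_EFin lee_fin.
move=> iL _ /= cI; split => //; apply: (cvg_unique _ cI) => //.
have -> : (fun m => \int[P]_w (F m w)%:E)%E = (fun=> (heat_fun v n a 0 x)%:E).
  by apply/funext => m; rewrite (FI m).2.
exact: cvg_cst.
Unshelve. all: by end_near. Qed.

Section Inner.
Hypothesis xr : enorm x < r.

Let K : R := 2 `^ p 0 * expR (- dotv v x + enorm x ^+ 2 / 2).

Let aliveZ H w : 0 < H -> (0 <= alive H w) && (0 <= 1 - alive H w).
Proof. by move=> H0; case: (alive01 H w) => ->; rewrite ?subr0 ?subrr ?lexx ler01. Qed.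

(** Optional stopping for degree 0 with horizon h and pole -h. Choosing both of the same order
    bounds the ratio of the powers h^(-p) and (2h)^(-p) by 2^p, which is where K comes from. The
    bound is uniform in h; its second summand says that exp(|v|^2 h / 2) times the probability of
    survival up to h stays bounded. *)
Let mass (H : nat) : (\int[P]_w ((1 - alive H.+1%:R w) * hit_val 0 w +
   expR (dotv v v * H.+1%:R / 2 - enorm v * r) * alive H.+1%:R w)%:E <= K%:E)%E.
Proof.
set h : R := H.+1%:R; have h0 : 0 < h by [].
have h1 : 1 <= h by rewrite (ler_nat _ 1).
have nh0 : - h < 0 by rewrite oppr_lt0.
have [iF EF] := @stopped_heat 0 (- h) h h0 (or_intror (conj nh0 xr)).
set q := (2 * h) `^ (- p 0).
have q0 : 0 < q by rewrite powR_gt0 ?mulr_gt0.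
have mf : measurable_fun [set: T] (fun w => (1 - alive h w) * hit_val 0 w +
   expR (dotv v v * h / 2 - enorm v * r) * alive h w).
  apply: measurable_funD; apply: measurable_funM => //.
  - by apply: measurable_funB => //; exact: malive.
  - exact: measurable_hit_val.
  - exact: malive.
have nn w : 0 <= (1 - alive h w) * hit_val 0 w +
   expR (dotv v v * h / 2 - enorm v * r) * alive h w.
  have /andP[a1 a2] := aliveZ w h0.
  by rewrite addr_ge0// mulr_ge0 ?expR_ge0 ?hit_val0_ge0.
have le1 : (\int[P]_w (q * ((1 - alive h w) * hit_val 0 w +
   expR (dotv v v * h / 2 - enorm v * r) * alive h w))%:E <=
   (heat_fun v 0 (- h) 0 x)%:E)%E.
  rewrite -EF; apply: (@ge0_le_integral _ _ _ P setT measurableT).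
  - by move=> w _; rewrite lee_fin mulr_ge0// ltW.
  - by apply/measurable_EFinP; exact: measurable_funM.
  - by case/integrableP: iF.
  move=> w _; rewrite lee_fin.
  have g0 := gap_stop w h0.
  have [[al st]|[-> hw -> th]] := alive_stop_time w h0.
    rewrite st in g0 *; rewrite al subrr mul0r add0r mulr1 /heat_fun /zonal_fun /= mulr1.
    have -> : `|- h - h| = 2 * h by rewrite -opprD normrN ger0_norm; lra.
    rewrite ler_wpM2l ?powR_ge0// ler_expR.
    move: g0; rewrite /gap xr subr_ge0 => yr.
    have q1 : dotv v (X h w) <= enorm v * r.
      apply: (@le_trans _ _ (enorm v * enorm (X h w))).
        by apply: le_trans (normr_dotv_le v (X h w)); exact: ler_norm.
      by rewrite ler_wpM2l// enorm_ge0.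
    have q2 : 0 <= - (dotv (X h w) (X h w) / (2 * (- h - h))).
      rewrite -mulrN -invrN mulr_ge0 ?dotv_ge0// invr_ge0; lra.
    lra.
  rewrite subr0 mul1r mulr0 addr0 (heat_fun_hit 0 (- h) hw).
  rewrite ler_wpM2r ?hit_val0_ge0//.
  have t0 := hit_time_ge0 w.
  rewrite -[leLHS]mulr1; apply: ler_pM; rewrite ?powR_ge0//.
    rewrite ltr0_norm; last by lra.
    apply: powRN_le; [lra|lra|exact: le_trans ler01 (p_ge1 0)].
  rewrite -expR0 ler_expR -mulrN -invrN mulr_ge0 ?sqr_ge0// invr_ge0.
  by rewrite -mulrN opprD !opprK mulr_ge0 ?addr_ge0 ?(ltW h0).
have -> : K%:E = ((q^-1)%:E * (q * K)%:E)%E by rewrite -EFinM mulKf// gt_eqF.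
have -> : (\int[P]_w ((1 - alive h w) * hit_val 0 w +
    expR (dotv v v * h / 2 - enorm v * r) * alive h w)%:E =
    (q^-1)%:E * \int[P]_w (q * ((1 - alive h w) * hit_val 0 w +
    expR (dotv v v * h / 2 - enorm v * r) * alive h w))%:E)%E.
  rewrite -ge0_integralZl//.
  - by apply: eq_integral => w _; rewrite -EFinM mulKf// gt_eqF.
  - by apply/measurable_EFinP; exact: measurable_funM.
  - by move=> w _; rewrite lee_fin mulr_ge0// ltW.
  - by rewrite lee_fin invr_ge0 ltW.
rewrite lee_wpmul2l ?lee_fin ?invr_ge0 ?(ltW q0)//; apply: le_trans le1 _.
rewrite lee_fin /heat_fun /zonal_fun /= mulr1 subr0 normrN ger0_norm ?(ltW h0)//.
rewrite mulr0 mul0r add0r /K mulrA /q powRM ?(ltW h0)//.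
rewrite [_ * 2 `^ p 0]mulrAC -powRD; last by rewrite pnatr_eq0 implybT.
rewrite addNr powRr0 mul1r ler_wpM2l ?powR_ge0// ler_expR lerD2l -sqr_enorm mulrN invrN mulrN opprK.
rewrite ler_wpM2l ?sqr_ge0// lef_pV2 ?posrE; lra.
Qed.

(** Fatou along growing horizons, with the uniform bound of [mass]. *)
Lemma inner_integrable0 : P.-integrable setT (fun w => (hit_val 0 w)%:E).
Proof.
apply/integrableP; split; first by apply/measurable_EFinP; exact: measurable_hit_val.
pose f (m : nat) w := ((1 - alive m.+1%:R w) * hit_val 0 w)%:E.
have mf m : measurable_fun [set: T] (f m).
  apply/measurable_EFinP; apply: measurable_funM; last exact: measurable_hit_val.
  by apply: measurable_funB => //; exact: malive.
have f0 m w : setT w -> (0 <= f m w)%E.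
  have /andP[_ a2] := aliveZ w (ltr0Sn R m).
  by rewrite lee_fin mulr_ge0// hit_val0_ge0.
have := @fatou _ _ _ P setT measurableT f mf f0.
have -> : (\int[P]_w limn_einf (f^~ w) = \int[P]_w `|(hit_val 0 w)%:E|)%E.
  apply: eq_integral => w _; have cf : f ^~ w @ \oo --> (hit_val 0 w)%:E.
    apply: cvg_EFin; first exact: nearW.
    have -> : hit_val 0 w = (1 - (1 - hit w)) * hit_val 0 w.
      by rewrite subKr /hit_val; case: (hit01 w) => ->; rewrite ?mul0r ?mul1r.
    apply: cvgM; last exact: cvg_cst.
    by apply: cvgB; [exact: cvg_cst|exact: cvg_alive].
  rewrite (cvg_limn_einf_sup cf).1 gee0_abs// lee_fin; exact: hit_val0_ge0.
move=> h; apply: le_lt_trans h _; apply: (@le_lt_trans _ _ K%:E); last exact: ltry.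
rewrite limn_einf_lim; apply: lime_le; first exact: is_cvg_einfs.
apply: nearW => m; rewrite /einfs; apply: (@le_trans _ _ (\int[P]_w f m w)%E).
  by apply: ereal_inf_lbound; exists m => /=.
apply: le_trans (mass m); apply: (@ge0_le_integral _ _ _ P setT measurableT) => //.
- by move=> w _; exact: f0.
- apply/measurable_EFinP; apply: measurable_funD; apply: measurable_funM;
    first [exact: measurable_hit_val|exact: malive|exact: measurable_cst|
      by apply: measurable_funB; [exact: measurable_cst|exact: malive]].
move=> w _; have /andP[a1 _] := aliveZ w (ltr0Sn R m).
by rewrite lee_fin lerDl mulr_ge0 ?expR_ge0.
Qed.

Definition inner_integrand n s w :=
  (s + hit_time w) `^ (- p n) * expR (r ^+ 2 / (2 * (s + hit_time w))) * hit_val n w.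

(** On survival up to h the kernel is of order h^(-p) exp(|v|^2 h / 2). By [mass] the exponential is
    compensated by the probability of survival, and p >= 1 leaves an error of order 1/h. *)
Lemma inner_hitting_identity n s : 0 < s ->
  P.-integrable setT (fun w => (inner_integrand n s w)%:E) /\
  (\int[P]_w (inner_integrand n s w)%:E = (heat_fun v n (- s) 0 x)%:E)%E.
Proof.
move=> s0; have ns0 : - s < 0 by rewrite oppr_lt0.
pose F (m : nat) w := heat_fun v n (- s) (stop_time m.+1%:R w) (X (stop_time m.+1%:R w) w).
have FI m := @stopped_heat n (- s) m.+1%:R (ltr0Sn _ _) (or_intror (conj ns0 xr)).
have mt := measurable_hit_time; have mz := measurable_hit_val n.
have mG : measurable_fun [set: T] (inner_integrand n s).
  have mst : measurable_fun [set: T] (fun w => s + hit_time w) by exact: measurable_funD.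
  apply: measurable_funM => //; apply: measurable_funM.
    exact: (measurableT_comp (measurable_powR (- p n)) mst).
  apply: measurableT_comp => //; apply: measurable_funM => //.
  have -> : (fun w => (2 * (s + hit_time w))^-1) = (fun w => (2 * (s + hit_time w)) `^ (- 1)).
    by apply/funext => w; rewrite powR_inv1// mulr_ge0// addr_ge0 ?hit_time_ge0// ltW.
  apply: (measurableT_comp (measurable_powR (- 1))).
  exact: measurable_funM.
pose C := s `^ (- p n) * expR (r ^+ 2 / (2 * s)) * (A ^+ n * r ^+ n).
have C0 : 0 <= C by rewrite !mulr_ge0 ?powR_ge0 ?expR_ge0 ?A_ge0 ?exprn_ge0 ?(ltW hr).
have GC w : `|inner_integrand n s w| <= C * hit_val 0 w.
  rewrite /inner_integrand normrM ger0_norm ?mulr_ge0 ?powR_ge0 ?expR_ge0//.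
  rewrite /C -mulrA; have t0 := hit_time_ge0 w.
  apply: ler_pM; rewrite ?mulr_ge0 ?powR_ge0 ?expR_ge0//; last exact: hit_val_bound.
  apply: ler_pM; rewrite ?powR_ge0 ?expR_ge0//.
    by apply: powRN_le; [lra|lra|exact: le_trans ler01 (p_ge1 n)].
  by rewrite ler_expR ler_wpM2l ?sqr_ge0// lef_pV2 ?posrE; lra.
have iG : P.-integrable setT (fun w => (inner_integrand n s w)%:E).
  apply: (@le_integrable _ _ _ P setT measurableT _ (fun w => (C * hit_val 0 w)%:E)).
  - exact/measurable_EFinP.
  - by move=> w _; rewrite !abse_EFin lee_fin (le_trans (GC w))// ler_norm.
  - under eq_fun do rewrite EFinM.
    by apply: integrableZl => //; exact: inner_integrable0.
split => //.
pose F' (m : nat) w := (1 - alive m.+1%:R w) * inner_integrand n s w.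
have mF' m : measurable_fun [set: T] (F' m).
  by apply: measurable_funM => //; apply: measurable_funB => //; exact: malive.
have F'C m w : `|F' m w| <= C * hit_val 0 w.
  rewrite /F' normrM; apply: le_trans (GC w).
  by case: (alive01 m.+1%:R w) => ->; rewrite ?subr0 ?subrr ?normr1 ?normr0 ?mul1r ?mul0r.
have iC : P.-integrable setT (fun w => (C * hit_val 0 w)%:E).
  under eq_fun do rewrite EFinM.
  by apply: integrableZl => //; exact: inner_integrable0.
have iF' m : P.-integrable setT (fun w => (F' m w)%:E).
  apply: (@le_integrable _ _ _ P setT measurableT _ (fun w => (C * hit_val 0 w)%:E)) => //.
  - exact/measurable_EFinP.
  - by move=> w _; rewrite !abse_EFin lee_fin (le_trans (F'C m w))// ler_norm.
have [] := @dominated_convergence _ _ _ P setT measurableT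
  (fun m w => (F' m w)%:E) (fun w => (inner_integrand n s w)%:E)
  (fun w => (C * hit_val 0 w)%:E).
- by move=> m; apply/measurable_EFinP.
- exact/measurable_EFinP.
- apply: aeW => w _; apply: cvg_EFin; first exact: nearW.
  have -> : inner_integrand n s w = (1 - (1 - hit w)) * inner_integrand n s w.
    rewrite subKr /inner_integrand /hit_val.
    by case: (hit01 w) => ->; rewrite ?mul0r ?mulr0 ?mul1r.
  apply: cvgM; last exact: cvg_cst.
  by apply: cvgB; [exact: cvg_cst|exact: cvg_alive].
- exact: iC.
- by apply: aeW => w m _; rewrite abse_EFin lee_fin.
move=> _ _ /= cI.
set f0 := heat_fun v n (- s) 0 x in FI *.
have fin_G := integrable_fin_num measurableT iG.
(* The last factor undoes exp(-|v| r) in [mass]; the others come from [heat_inner_bound] on the ball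
   of radius r. *)
pose C1 := expR (enorm v * r + r ^+ 2 / (2 * s)) * (A ^+ n * r ^+ n) * expR (enorm v * r).
have C10 : 0 <= C1 by rewrite !mulr_ge0 ?expR_ge0 ?A_ge0 ?exprn_ge0 ?(ltW hr).
have dist0 m : `|f0 - fine (\int[P]_w (F' m w)%:E)%E| <= C1 * K * m.+1%:R^-1.
  rewrite -lee_fin -abse_EFin EFinB -(FI m).2 fineK; last exact: integrable_fin_num.
  rewrite -integralB//; last exact: (FI m).1.
  have iFF := integrableB measurableT (FI m).1 (iF' m).
  have mFF : measurable_fun [set: T] (fun w => ((F m w)%:E - (F' m w)%:E)%E).
    by case/integrableP: iFF.
  apply: le_trans (le_abse_integral P measurableT mFF) _.
  rewrite mulrAC EFinM; apply: le_trans (lee_wpmul2l _ (mass m)); last first.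
    by rewrite lee_fin mulr_ge0.
  pose D w := (1 - alive m.+1%:R w) * hit_val 0 w +
     expR (dotv v v * m.+1%:R / 2 - enorm v * r) * alive m.+1%:R w.
  have D0 w : 0 <= D w.
    have /andP[a1 a2] := aliveZ w (ltr0Sn R m).
    by rewrite addr_ge0// mulr_ge0 ?expR_ge0 ?hit_val0_ge0.
  have mD : measurable_fun [set: T] (fun w => (D w)%:E).
    apply/measurable_EFinP; apply: measurable_funD; apply: measurable_funM;
    first [exact: measurable_hit_val|exact: malive|exact: measurable_cst|
      by apply: measurable_funB; [exact: measurable_cst|exact: malive]].
  rewrite -ge0_integralZl//; first [exact: mD|by move=> w _; exact: D0|
    by rewrite lee_fin mulr_ge0|idtac].
  apply: (@ge0_le_integral _ _ _ P setT measurableT) => //.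
  - exact: measurableT_comp.
  - by apply: emeasurable_funM => //; exact: measurable_cst.
  move=> w _; rewrite -EFinB abse_EFin -EFinM lee_fin /F' /F.
  have h0 := ltr0Sn R m; set h : R := m.+1%:R in h0 *.
  have g0 := gap_stop w h0.
  have [[al st]|[al hw -> th]] := alive_stop_time w h0; last first.
    rewrite al subr0 mul1r (heat_fun_hit n (- s) hw) /inner_integrand.
    have t0 := hit_time_ge0 w.
    have -> : `|- s - hit_time w| = s + hit_time w by rewrite -opprD normrN ger0_norm; lra.
    have -> : - (r ^+ 2 / (2 * (- s - hit_time w))) = r ^+ 2 / (2 * (s + hit_time w)).
      by rewrite -mulrN -invrN -mulrN opprD !opprK.
    by rewrite subrr normr0 mul1r mulr0 addr0; apply: mulr_ge0 (hit_val0_ge0 w);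
      rewrite divr_ge0// ltW.
  rewrite /D al subrr !mul0r subr0 add0r mulr1; rewrite st in g0 *.
  move: g0; rewrite /gap xr subr_ge0 => yr.
  have := heat_inner_bound hd v n (H := h) ns0 (ltW hr) (t := h).
  rewrite (ltW h0) lexx => /(_ (X h w) isT yr); rewrite opprK => hb.
  apply: le_trans hb _; rewrite /C1.
  set c1 := expR (enorm v * r + _); set c2 := A ^+ n * r ^+ n.
  have c20 : 0 <= c2 by rewrite mulr_ge0 ?A_ge0 ?exprn_ge0 ?(ltW hr).
  have c10 : 0 <= c1 by exact: expR_ge0.
  have -> : c1 * c2 * expR (enorm v * r) * h^-1 * expR (dotv v v * h / 2 - enorm v * r) =
      h^-1 * expR (dotv v v * h / 2) * (c1 * c2).
    have alg (a1 a2 a3 a4 e : R) : e != 0 ->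
      a1 * a2 * e * a3 * (a4 * e^-1) = a3 * a4 * (a1 * a2) by move=> e0; field.
    by rewrite expRD expRN alg// gt_eqF ?expR_gt0.
  apply: ler_wpM2r; first exact: mulr_ge0.
  apply: ler_wpM2r; first exact: expR_ge0.
  rewrite -(powR_inv1 (ltW h0)).
  apply: (@le_trans _ _ (h `^ (- p n))).
    by apply: powRN_le; [lra|lra|exact: le_trans ler01 (p_ge1 n)].
  by rewrite ler_powR ?lerN2 ?p_ge1// (ler_nat _ 1).
have c0 : (fun m => fine (\int[P]_w (F' m w)%:E)%E) @ \oo --> f0.
  rewrite -[X in _ --> X]subr0.
  have -> : (fun m => fine (\int[P]_w (F' m w)%:E)%E) =
      (fun m => f0 - (f0 - fine (\int[P]_w (F' m w)%:E)%E)).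
    by apply/funext => k; rewrite subKr.
  apply: cvgB; first exact: cvg_cst.
  apply: (@cvg0_le R _ (fun m => C1 * K * m.+1%:R^-1) dist0).
  rewrite -(mulr0 (C1 * K)); apply: cvgM; first exact: cvg_cst.
  exact: cvg_harmonic.
apply: (cvg_unique _ cI) => //.
have -> : (fun m => \int[P]_w (F' m w)%:E)%E = (fun m => (fine (\int[P]_w (F' m w)%:E)%E)%:E).
  by apply/funext => k; rewrite fineK//; exact: integrable_fin_num.
by apply: cvg_EFin; first exact: nearW.
Qed.

End Inner.

End HittingFunctional.

(** * The Gamma function *)

Section ExponentialSubstitution.
Context {R : realType}.
Local Notation mu := (@lebesgue_measure R).

Lemma truncn_bound (y : R) : exists n : nat, `|y| <= n%:R.
Proof.
exists (Num.truncn `|y|).+1; have /andP[_ h] := truncn_itv (normr_ge0 y).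
exact: ltW.
Qed.

Lemma bigcup_itv_nat : \bigcup_n `[(- n%:R : R), n%:R]%classic = [set: R].
Proof.
apply/seteqP; split => // y _; have [n hn] := truncn_bound y; exists n => //=.
by rewrite in_itv/= -ler_norml.
Qed.

Lemma cvg_integral_itv_nat (f : R -> R) : continuous f -> (forall y, 0 <= f y) ->
  (fun n : nat => \int[mu]_(y in `[(- n%:R)%R, n%:R]) (f y)%:E)%E @ \oo -->
  (\int[mu]_y (f y)%:E)%E.
Proof.
move=> cf f0; rewrite -bigcup_itv_nat; apply: ge0_nondecreasing_set_cvg_integral => //.
- move=> m n mn; apply/subsetPset; apply: subset_itv; rewrite bnd_simp/=.
    by rewrite lerN2 ler_nat.
  by rewrite ler_nat.
- move=> n; apply/measurable_EFinP; apply: measurable_funTS.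
  exact: continuous_measurable_fun.
- by move=> n y _; rewrite lee_fin.
Qed.

(** The substitution y = c + k e^w moves half-line integrals to the whole line, where the integrands
    for [Gamma] and [besselK] are smooth and exhausted by the intervals [-n, n]. *)
Lemma ge0_integral_exp_subst (c k : R) (G : R -> R) : 0 < k ->
  (forall y, c < y -> {for y, continuous G}) -> (forall y, c < y -> 0 <= G y) ->
  (\int[mu]_(y in `]c, +oo[) (G y)%:E =
   \int[mu]_w (G (c + k * expR w) * (k * expR w))%:E)%E.
Proof.
move=> k0 cG G0; pose F (w : R) := c + k * expR w.
have dF (w : R) : is_derive w 1 F (k * expR w).
  rewrite /F; have := is_deriveD (is_derive_cst c w 1)
    (is_deriveM (is_derive_cst k w 1) (is_derive_expR w)).
  by move=> h; apply: (is_derive_eq h); rewrite scaler0 add0r addr0.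
have F'E : derive1 F = (fun w => k * expR w).
  by apply/funext => w; rewrite derive1E; exact: derive_val.
have cF' : continuous (fun w : R => k * expR w).
  by move=> w; apply: cvgM; [exact: cvg_cst|exact: continuous_expR].
have cF : continuous F.
  by move=> w; apply: cvgD; [exact: cvg_cst|exact: cF'].
have cFw w : c < F w by rewrite /F ltrDl mulr_gt0// expR_gt0.
have F_lt (a b : R) : (F a < F b) = (a < b) by rewrite /F ltrD2l ltr_pM2l// ltr_expR.
have F_le (a b : R) : (F a <= F b) = (a <= b) by rewrite /F lerD2l ler_pM2l// ler_expR.
have mG : measurable_fun `]c, +oo[ G.
  apply: open_continuous_measurable_fun; first exact: interval_open.
  by move=> y; rewrite inE/= in_itv/= andbT; exact: cG.
have U : \bigcup_n `[F (- n%:R), F n%:R]%classic = `]c, +oo[%classic.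
  apply/seteqP; split => [y [n _] /=|y /=]; rewrite !in_itv/= ?andbT.
    by move=> /andP[h _]; exact: lt_le_trans (cFw _) h.
  move=> cy; have [n hn] := truncn_bound (ln ((y - c) / k)); exists n => //=.
  have yE : y = F (ln ((y - c) / k)).
    rewrite /F lnK; last by rewrite posrE divr_gt0// subr_gt0.
    by rewrite mulrC divfK ?gt_eqF// subrKC.
  by rewrite in_itv/= yE !F_le -ler_norml.
have sub n : `[F (- n%:R), F n%:R]%classic `<=` `]c, +oo[%classic.
  by rewrite -U => y hy; exists n.
have c1 : (fun n : nat => \int[mu]_(y in `[F (- n%:R)%R, F n%:R%R]) (G y)%:E)%E @ \oo -->
    (\int[mu]_(y in `]c, +oo[) (G y)%:E)%E.
  rewrite -U; apply: ge0_nondecreasing_set_cvg_integral => //.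
  - move=> m n mn; apply/subsetPset; apply: subset_itv; rewrite bnd_simp/= F_le.
      by rewrite lerN2 ler_nat.
    by rewrite ler_nat.
  - move=> n; apply/measurable_EFinP; exact: measurable_funS (sub n) mG.
  - by move=> n y /(sub n) /=; rewrite in_itv/= andbT lee_fin; exact: G0.
have cGF : continuous (fun w => G (F w)).
  move=> w; apply: (@continuous_comp _ _ _ F G); [exact: cF|exact: cG].
have c2 : (fun n : nat => \int[mu]_(w in `[(- n%:R)%R, n%:R]) (G (F w) * (k * expR w))%:E)%E
    @ \oo --> (\int[mu]_w (G (F w) * (k * expR w))%:E)%E.
  apply: cvg_integral_itv_nat.
    by move=> w; apply: cvgM; [exact: cGF|exact: cF'].
  by move=> w; rewrite mulr_ge0 ?G0// mulr_ge0 ?expR_ge0// ltW.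
apply: (cvg_unique _ c1) => //.
suff -> : (fun n : nat => \int[mu]_(y in `[F (- n%:R)%R, F n%:R%R]) (G y)%:E)%E =
  (fun n : nat => \int[mu]_(w in `[(- n%:R)%R, n%:R]) (G (F w) * (k * expR w))%:E)%E by [].
apply/funext => n; rewrite (@integration_by_substitution_increasing R F G).
- by apply: eq_integral => w _; rewrite F'E.
- by rewrite (@le_trans _ _ 0)// oppr_le0.
- by move=> a b _ _; rewrite F_lt.
- by move=> w _; rewrite F'E; exact: cF'.
- by rewrite F'E; apply: cvgP; exact: cvg_at_right_filter (cF' _).
- by rewrite F'E; apply: cvgP; exact: cvg_at_left_filter (cF' _).
- split.
  + by move=> w _; have [] := dF w.
  + exact: cvg_at_right_filter (cF _).
  + exact: cvg_at_left_filter (cF _).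
- apply: continuous_in_subspaceT => y; rewrite inE/= => /(sub n) /=.
  by rewrite in_itv/= andbT; exact: cG.
Qed.

End ExponentialSubstitution.

Section GammaFunction.
Context {R : realType}.
Local Notation mu := (@lebesgue_measure R).
Implicit Types a c t : R.

(** [Gamma] returns a real number even if the integral were infinite. The extended value allows the
    functional equation to be proved before finiteness. *)
Definition gamma_int a : \bar R :=
  (\int[mu]_(t in `]0%R, +oo[) (t `^ (a - 1) * expR (- t))%:E)%E.

Lemma continuous_powR_at (p y : R) : 0 < y -> {for y, continuous (fun t : R => t `^ p)}.
Proof.
move=> y0; have h : expR (p * ln t) @[t --> y] --> y `^ p.
  have -> : y `^ p = expR (p * ln y) by rewrite /powR gt_eqF.
  apply: continuous_cvg; first exact: continuous_expR.
  by apply: cvgM; [exact: cvg_cst|exact: continuous_ln].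
apply: cvg_trans h; apply: near_eq_cvg.
apply: filterS (lt_nbhsr y0) => t t0; by rewrite /powR gt_eqF.
Qed.

Lemma gamma_intE a : gamma_int a = (\int[mu]_w (expR (a * w - expR w))%:E)%E.
Proof.
rewrite /gamma_int (@ge0_integral_exp_subst R 0 1)//.
- apply: eq_integral => w _; rewrite add0r mul1r; congr EFin.
  by rewrite -expRM mulrAC -!expRD; congr expR; ring.
- move=> y y0; apply: cvgM; first exact: continuous_powR_at.
  by apply: (@continuous_comp _ _ _ -%R expR); [exact: opp_continuous|exact: continuous_expR].
- by move=> y _; rewrite mulr_ge0 ?powR_ge0 ?expR_ge0.
Qed.

Lemma gamma_scale a c : 0 < c ->
  (\int[mu]_(t in `]0%R, +oo[) (t `^ (a - 1) * expR (- (c * t)))%:E =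
   (c `^ (- a))%:E * gamma_int a)%E.
Proof.
move=> c0; rewrite gamma_intE -ge0_integralZl//; first [by rewrite lee_fin powR_ge0|
  by move=> w _; rewrite lee_fin expR_ge0|apply/measurable_EFinP;
  apply: measurableT_comp => //; apply: measurable_funB => //; exact: measurable_funM|idtac].
rewrite (@ge0_integral_exp_subst R 0 c^-1) ?invr_gt0//.
- apply: eq_integral => w _; rewrite add0r -EFinM; congr EFin.
  rewrite [c * (_ * _)]mulrA divff ?gt_eqF// mul1r.
  have -> : c^-1 * expR w = expR (w - ln c).
    by rewrite expRD expRN lnK ?posrE// mulrC.
  rewrite -expRM /powR gt_eqF// -!expRD; congr expR; ring.
- move=> y y0; apply: cvgM; first exact: continuous_powR_at.
  apply: (@continuous_comp _ _ _ (fun t => - (c * t)) expR); last exact: continuous_expR.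
  by apply: cvgN; apply: cvgM; [exact: cvg_cst|exact: cvg_id].
- by move=> y _; rewrite mulr_ge0 ?powR_ge0 ?expR_ge0.
Qed.

Lemma integral_expRN c : 0 < c ->
  (\int[mu]_(t in `]0%R, +oo[) (expR (- (c * t)))%:E = (c^-1)%:E)%E.
Proof.
move=> c0; rewrite integral_itv_obnd_cbnd; last first.
  apply/measurable_EFinP; apply: measurable_funTS; apply: measurableT_comp => //.
  by apply: measurableT_comp => //; exact: measurable_funM.
have dE (t : R) : is_derive t 1 (fun t => - c^-1 * expR (- (c * t))) (expR (- (c * t))).
  have d1 : is_derive t 1 (fun t : R => - (c * t)) (- c).
    have := is_deriveN (is_deriveM (is_derive_cst c t 1) (is_derive_id t 1)).
    by move=> h; apply: (is_derive_eq h); rewrite scaler0 addr0 /GRing.scale/= mulr1.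
  have d2 := @is_derive1_comp R expR (fun t : R => - (c * t)) t _ _ (is_derive_expR _) d1.
  have := is_deriveM (is_derive_cst (- c^-1) t 1) d2.
  move=> h; apply: (is_derive_eq h).
  by rewrite scaler0 addr0 /GRing.scale/= mulrCA mulrNN mulVf ?mulr1// gt_eqF.
have cE : continuous (fun t : R => - c^-1 * expR (- (c * t))).
  by move=> t; apply: differentiable_continuous; apply/derivable1_diffP; have [] := dE t.
rewrite (@ge0_continuous_FTC2y R _ (fun t => - c^-1 * expR (- (c * t))) 0 0).
- by rewrite mulr0 oppr0 expR0 mulr1 -EFinB sub0r opprK.
- by move=> t _; exact: expR_ge0.
- apply: continuous_subspaceT => t; apply: continuous_comp; last exact: continuous_expR.
  by apply: cvgN; apply: cvgM; [exact: cvg_cst|exact: cvg_id].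
- rewrite -[X in _ --> X](mulr0 (- c^-1)); apply: cvgM; first exact: cvg_cst.
  have h : c * t @[t --> +oo] --> +oo by apply: gt0_cvgMry => //; exact: cvg_id.
  by apply: (cvg_comp _ (fun y => expR (- y)) h); exact: cvgr_expR.
- by move=> t _; have [] := dE t.
- exact: cvg_at_right_filter (cE _).
- by move=> t _; rewrite derive1E; apply: derive_val.
Qed.

Lemma gamma_int_ge1 a : 1 <= a -> (gamma_int a < +oo)%E.
Proof.
move=> a1; have [m hm] := truncn_bound (a - 1).
have am : a - 1 <= m%:R by apply: le_trans hm; exact: ler_norm.
(* The 1 covers t <= 1; beyond 1, t^m <= 2^m m! e^(t/2). *)
pose C : R := 1 + 2 ^+ m * m`!%:R.
apply: (@le_lt_trans _ _ (\int[mu]_(t in `]0%R, +oo[) (C * expR (- (2^-1 * t)))%:E)%E); last first.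
  under eq_integral do rewrite EFinM.
  rewrite ge0_integralZl//; first [by rewrite integral_expRN ?invr_gt0// -EFinM ltry|
    by move=> t _; rewrite lee_fin expR_ge0|
    by rewrite lee_fin /C addr_ge0// mulr_ge0// exprn_ge0|
    apply/measurable_EFinP; apply: measurable_funTS; apply: measurableT_comp => //;
    apply: measurableT_comp => //; exact: measurable_funM].
apply: (@ge0_le_integral _ _ _ mu `]0%R, +oo[%classic) => //.
- by move=> t _; rewrite lee_fin mulr_ge0 ?powR_ge0 ?expR_ge0.
- apply/measurable_EFinP; apply: measurable_funM.
    by apply: measurable_funTS; exact: measurable_powR.
  by apply: measurable_funTS; exact: measurableT_comp.
- apply/measurable_EFinP; apply: measurable_funM => //.
  apply: measurable_funTS; apply: measurableT_comp => //.
  by apply: measurableT_comp => //; exact: measurable_funM.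
move=> t /=; rewrite in_itv/= andbT => t0; rewrite lee_fin.
have e1 : 1 <= expR (2^-1 * t) by rewrite -expR0 ler_expR mulr_ge0 ?ltW.
have h : t `^ (a - 1) <= C * expR (2^-1 * t).
  rewrite mulrDl mul1r; have [t1|t1] := leP t 1.
    apply: (@le_trans _ _ 1).
      apply: (@le_trans _ _ (1 `^ (a - 1))); last by rewrite powR1.
      by rewrite ge0_ler_powR ?nnegrE ?(ltW t0)//; lra.
    by rewrite (le_trans e1)// lerDl !mulr_ge0 ?exprn_ge0 ?expR_ge0.
  apply: (@le_trans _ _ (t ^+ m)); first by rewrite -powR_mulrn ?(ltW t0)// ler_powR// ltW.
  have := normrX_le_expR m (2^-1 * t); rewrite ger0_norm; last by rewrite mulr_ge0// ltW.
  rewrite exprMn => h; have h2 : 2 ^+ m * (2^-1 ^+ m * t ^+ m) = t ^+ m.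
    by rewrite mulrA -exprMn divff// expr1n mul1r.
  rewrite -h2; apply: ler_wpDl; first exact: expR_ge0.
  by rewrite -mulrA ler_wpM2l// exprn_ge0.
apply: (@le_trans _ _ (C * expR (2^-1 * t) * expR (- t))).
  by rewrite ler_wpM2r ?expR_ge0.
by rewrite -mulrA -expRD (_ : 2^-1 * t - t = - (2^-1 * t))//; field.
Qed.

(** In the variable w the derivative of exp(a w - e^w) is a times itself minus the integrand for a +
    1, so the functional equation is the fundamental theorem of calculus on [-n, n] with vanishing
    boundary terms. *)
Lemma gamma_intS a : 0 < a -> (gamma_int (a + 1) = a%:E * gamma_int a)%E.
Proof.
move=> a0; pose f (b w : R) := expR (b * w - expR w).
have df (b w : R) : is_derive w 1 (f b) (b * f b w - f (b + 1) w).
  have d1 : is_derive w 1 (fun w : R => b * w - expR w) (b - expR w).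
    have h := is_deriveB (is_deriveM (is_derive_cst b w 1) (is_derive_id w 1))
      (is_derive_expR w).
    by apply: (is_derive_eq h); rewrite scaler0 addr0 /GRing.scale/= mulr1.
  apply: (is_derive_eq (@is_derive1_comp R expR (fun w : R => b * w - expR w) w _ _
    (is_derive_expR _) d1)).
  rewrite /f mulrBr [_ * b]mulrC; congr (_ - _).
  by rewrite -expRD; congr expR; ring.
have cf b : continuous (f b).
  by move=> t; apply: differentiable_continuous; apply/derivable1_diffP; have [] := df b t.
have f0 b w : 0 <= f b w by exact: expR_ge0.
rewrite !gamma_intE -/(f _ _).
have cA := cvg_integral_itv_nat (cf a) (f0 a).
have cB := cvg_integral_itv_nat (cf (a + 1)) (f0 (a + 1)).
have key n : (a%:E * \int[mu]_(w in `[(- n.+1%:R)%R, n.+1%:R]) (f a w)%:E =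
    (f a n.+1%:R - f a (- n.+1%:R))%:E + \int[mu]_(w in `[(- n.+1%:R)%R, n.+1%:R]) (f (a + 1) w)%:E)%E.
  have nn : - n.+1%:R < n.+1%:R :> R by rewrite (@lt_trans _ _ 0)// oppr_lt0.
  have ci (g : R -> R) : continuous g -> mu.-integrable `[(- n.+1%:R)%R, n.+1%:R] (EFin \o g).
    move=> cg; apply: continuous_compact_integrable; first exact: segment_compact.
    exact: continuous_subspaceT.
  have cf' : continuous (fun w => a * f a w - f (a + 1) w).
    by move=> w; apply: cvgB; [apply: cvgM; [exact: cvg_cst|exact: cf]|exact: cf].
  rewrite EFinB; have <- := @continuous_FTC2 R (fun w => a * f a w - f (a + 1) w) (f a) _ _ nn.
  - rewrite -integralD//=; last 2 first.
    + exact: (ci _ cf').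
    + exact: (ci _ (cf _)).
    rewrite -integralZl//; last exact: (ci _ (cf _)).
    by apply: eq_integral => w _; rewrite -EFinD -EFinM subrK.
  - exact: continuous_subspaceT.
  - split.
    + by move=> w _; have [] := df a w.
    + exact: cvg_at_right_filter (cf _ _).
    + exact: cvg_at_left_filter (cf _ _).
  - by move=> w _; rewrite derive1E; apply: derive_val.
have fn : (fun n : nat => f a n.+1%:R) @ \oo --> (0 : R).
  have ce : (fun n : nat => expR (- n.+1%:R) : R) @ \oo --> (0 : R).
    rewrite (cvg_shiftS (fun n : nat => expR (- n%:R) : R)).
    by have := cvg_expRNn (1 : R); under eq_fun do rewrite mul1r.
  apply: (squeeze_cvgr _ (cvg_cst (0 : R)) ce); near=> n.
  rewrite f0/= ler_expR; have := normrX_le_expR 2 (n.+1%:R : R).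
  rewrite ger0_norm// => h2; have h1 : 2 * a + 2 <= n.+1%:R.
    by rewrite (@le_trans _ _ n%:R)// ?ler_nat//; near: n; exact: nbhs_infty_ger.
  move: h2; set y : R := n.+1%:R in h1 *; set e := expR y; rewrite (_ : 2`!%:R = 2)//.
  have : (2 * a + 2) * y <= y * y by rewrite ler_wpM2r.
  rewrite expr2; lra.
have fNn : (fun n : nat => f a (- n.+1%:R)) @ \oo --> (0 : R).
  apply: (squeeze_cvgr (f := fun=> 0) (h := fun n : nat => a^-1 * n.+1%:R^-1)).
  - apply: nearW => n; rewrite f0/= /f mulrN expRD.
    have y0 : 0 < a * n.+1%:R by rewrite mulr_gt0.
    rewrite -[leRHS]mulr1; apply: ler_pM; rewrite ?expR_ge0//.
      rewrite expRN -invfM lef_pV2 ?posrE ?expR_gt0//.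
      by rewrite (le_trans _ (expR_ge1Dx _))// lerDr.
  - exact: cvg_cst.
  - rewrite -(mulr0 a^-1); apply: cvgM; first exact: cvg_cst.
    exact: cvg_harmonic.
have cA1 : (fun n : nat => a%:E * \int[mu]_(w in `[(- n.+1%:R)%R, n.+1%:R]) (f a w)%:E)%E
    @ \oo --> (a%:E * \int[mu]_w (f a w)%:E)%E.
  apply: cvgeZl => //.
  by rewrite (cvg_shiftS (fun n : nat => \int[mu]_(w in `[(- n%:R)%R, n%:R]) (f a w)%:E)%E).
apply/esym; apply: (cvg_unique _ cA1) => //.
rewrite /= (funext key).
rewrite -[X in _ --> X]add0e; apply: cvgeD => //.
- apply: cvg_EFin; first exact: nearW.
  by rewrite -(subrr 0); exact: cvgB.
by rewrite (cvg_shiftS (fun n : nat => \int[mu]_(w in `[(- n%:R)%R, n%:R]) (f (a + 1) w)%:E)%E).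
Unshelve. all: by end_near. Qed.

(** For a < 1 finiteness is inherited from a + 1 through the functional equation. *)
Lemma gamma_int_fin a : 0 < a -> (gamma_int a < +oo)%E.
Proof.
move=> a0; have : (gamma_int (a + 1) < +oo)%E by apply: gamma_int_ge1; rewrite lerDr ltW.
rewrite gamma_intS//; case: (gamma_int a) => //=; first by move=> ? _; rewrite ltry.
by rewrite gt0_muley ?lte_fin// ltxx.
Qed.

Lemma gamma_int_ge0 a : (0 <= gamma_int a)%E.
Proof.
by apply: integral_ge0 => t _; rewrite lee_fin mulr_ge0 ?powR_ge0 ?expR_ge0.
Qed.

Lemma GammaE a : 0 < a -> (Gamma a)%:E = gamma_int a.
Proof.
move=> a0; rewrite /Gamma /Rintegral fineK//.
by rewrite ge0_fin_numE ?gamma_int_fin// gamma_int_ge0.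
Qed.

Lemma GammaS a : 0 < a -> Gamma (a + 1) = a * Gamma a.
Proof.
by move=> a0; apply: EFin_inj; rewrite EFinM !GammaE ?addr_gt0// gamma_intS.
Qed.

Lemma Gamma_gt0 a : 0 < a -> 0 < Gamma a.
Proof.
move=> a0; rewrite -lte_fin GammaE// gamma_intE.
apply: (@lt_le_trans _ _ (\int[mu]_(w in `[0%R, 1%R]) (expR (- expR 1))%:E)%E).
  rewrite (integral_cst mu)//= lebesgue_measure_itv/= lte_fin ltr01 oppr0 adde0 mule1 lte_fin.
  exact: expR_gt0.
apply: (@le_trans _ _ (\int[mu]_(w in `[0%R, 1%R]) (expR (a * w - expR w))%:E)%E).
  have mm : measurable_fun (`[0%R, 1%R]%classic : set R) (fun w : R => (expR (a * w - expR w))%:E).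
    apply/measurable_EFinP; apply: measurable_funTS; apply: measurableT_comp => //.
    by apply: measurable_funB => //; exact: measurable_funM.
  apply: (@ge0_le_integral _ _ _ mu `[0%R, 1%R]%classic) => //.
  move=> w /=; rewrite in_itv/= => /andP[w0 w1]; rewrite lee_fin ler_expR.
  have : expR w <= expR 1 by rewrite ler_expR.
  have : 0 <= a * w by rewrite mulr_ge0// ltW.
  lra.
apply: ge0_subset_integral => //.
apply/measurable_EFinP; apply: measurableT_comp => //.
by apply: measurable_funB => //; exact: measurable_funM.
Qed.

Lemma integral_powR_expRN a c : 0 < a -> 0 < c ->
  (\int[mu]_(t in `]0%R, +oo[) (t `^ (a - 1) * expR (- (c * t)))%:E =
   (c `^ (- a) * Gamma a)%:E)%E.
Proof. by move=> a0 c0; rewrite gamma_scale// EFinM GammaE. Qed.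

Lemma Gamma_nat n : Gamma n.+1%:R = n`!%:R :> R.
Proof.
elim: n => [|n IH].
  rewrite fact0; apply: EFin_inj; rewrite GammaE// -[RHS]/1%E -[1%E in RHS]/(1%:E) -[in RHS]invr1 -integral_expRN//.
  by apply: eq_integral => t _; rewrite subrr powRr0 !mul1r.
by rewrite -natr1 GammaS// IH factS natrM.
Qed.

End GammaFunction.

(** * Uniqueness of Laplace transforms *)

Section FubiniKernel.
Context {R : realType} {disp : measure_display} {T : measurableType disp}
  (P : probability T R).
Local Notation mu := (@lebesgue_measure R).

Lemma measurable_invr : measurable_fun [set: R] (fun x : R => x^-1).
Proof.
have -> : (fun x : R => x^-1) =
    (fun x : R => (0 <= x)%R%:R * x `^ (- 1) - (0 <= - x)%R%:R * (- x) `^ (- 1)).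
  apply/funext => x; case: (ltgtP 0 x) => x0.
  - by rewrite oppr_ge0 leNgt x0 mul0r subr0 mul1r powR_inv1// ltW.
  - by rewrite oppr_ge0 (ltW x0) mul0r sub0r mul1r powR_inv1 ?oppr_ge0 ?ltW// invrN opprK.
  - by rewrite -x0 invr0 oppr0 lexx !mul1r subrr.
apply: measurable_funB; apply: measurable_funM.
- exact: measurable_ge_indic.
- exact: measurable_powR.
- by apply: measurable_ge_indic; exact: (continuous_measurable_fun opp_continuous).
- by apply: (measurableT_comp (measurable_powR (- 1))); exact: (continuous_measurable_fun opp_continuous).
Qed.

Variables (Z psi : T -> R) (g : T * R -> R).
Hypotheses (mZ : measurable_fun [set: T] Z) (mg : measurable_fun [set: T * R] g).
Hypotheses (g0 : forall z, 0 <= g z)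
  (gpsi : forall w, (\int[mu]_a (g (w, a))%:E = (psi w)%:E)%E).

Let f (z : T * R) : \bar R := (Z z.1 * g z)%:E.

Let mf : measurable_fun [set: T * R] f.
Proof.
by apply/measurable_EFinP; apply: measurable_funM => //; exact: measurableT_comp.
Qed.

Let mgw w : measurable_fun [set: R] (fun a => g (w, a)).
Proof. by apply: measurableT_comp => //; exact: pair1_measurable. Qed.

Let mgE w : measurable_fun [set: measurableTypeR R] (fun a : measurableTypeR R => (g (w, a))%:E).
Proof. by apply/measurable_EFinP; exact: mgw. Qed.

Lemma tonelli_kernel : (forall w, 0 <= Z w) ->
  (\int[P]_w (Z w * psi w)%:E = \int[mu]_a \int[P]_w (Z w * g (w, a))%:E)%E.
Proof.
move=> Z0; rewrite -(@fubini_tonelli _ _ _ _ _ P mu f mf); last first.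
  by move=> z; rewrite lee_fin mulr_ge0.
apply: eq_integral => w _; rewrite /f /=; under eq_integral do rewrite EFinM.
rewrite ge0_integralZl//; first by rewrite gpsi.
- by move=> a _; rewrite lee_fin.
- by rewrite lee_fin.
Qed.

(** Since g is nonnegative with integral psi, integrability of Z psi is the same as absolute
    integrability of Z g on the product space. *)
Lemma fubini_kernel : P.-integrable setT (fun w => (Z w * psi w)%:E) ->
  mu.-integrable setT (fun a => \int[P]_w (Z w * g (w, a))%:E)%E /\
  (\int[P]_w (Z w * psi w)%:E = \int[mu]_a \int[P]_w (Z w * g (w, a))%:E)%E.
Proof.
move=> iZ; have psi0 w : 0 <= psi w.
  by rewrite -lee_fin -gpsi; apply: integral_ge0 => a _; rewrite lee_fin.
have fin : (\int[P]_w \int[mu]_a `|f (w, a)| < +oo)%E.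
  have [_] := integrableP _ _ _ iZ; apply: le_lt_trans.
  rewrite le_eqVlt; apply/orP; left; apply/eqP; apply: eq_integral => w _.
  rewrite abse_EFin normrM (ger0_norm (psi0 w)) EFinM -gpsi -ge0_integralZl//.
  - by apply: eq_integral => a _; rewrite /f abse_EFin normrM (ger0_norm (g0 _)) EFinM.
  - by move=> a _; rewrite lee_fin.
have iF : (P \x mu)%E.-integrable setT f by apply/integrable12ltyP.
split.
  apply/integrableP; split; first exact: (measurable_fubini_G iF).
  apply: le_lt_trans ((integrable21ltyP P mu mf).1 iF).
  apply: (@ge0_le_integral _ _ _ mu setT measurableT) => //.
  - by apply: measurableT_comp => //; exact: (measurable_fubini_G iF).
  - apply: (@measurable_fun_fubini_tonelli_G _ _ _ _ R P (fun z => `|f z|)%E) => //.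
    exact: measurableT_comp.
  move=> a _; apply: le_abse_integral => //.
  by apply/measurable_EFinP; apply: measurable_funM => //; apply: measurableT_comp => //;
    exact: pair2_measurable.
rewrite -(Fubini iF); apply: eq_integral => w _; rewrite /f /=.
under [RHS]eq_integral do rewrite EFinM.
rewrite integralZl// ?gpsi//; apply/integrableP; split; first exact: mgE.
under eq_integral do rewrite abse_EFin (ger0_norm (g0 _)).
by rewrite gpsi ltry.
Qed.

End FubiniKernel.

Section LaplaceUniqueness.
Context {R : realType}.

(* [1 - (1 - e^{-jy})^m] with [m ~ j e^{jt}] is a polynomial in [e^{-y}] and
   tends to the indicator of [y <= t]. *)
Definition gumbel_exponent (t : R) (j : nat) : nat := (Num.truncn (j%:R * expR (j%:R * t))).+1.

Definition gumbel (t : R) (j : nat) (y : R) : R :=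
  1 - (1 - expR (- (j%:R * y))) ^+ gumbel_exponent t j.

Lemma bernoulli (y : R) n : 0 <= y <= 1 -> 1 - n%:R * y <= (1 - y) ^+ n.
Proof.
move=> /andP[y0 y1]; elim: n => [|n IH]; first by rewrite mul0r subr0 expr0.
rewrite exprS -natr1; apply: (@le_trans _ _ ((1 - y) * (1 - n%:R * y))).
  have : 0 <= n%:R * y * y by rewrite !mulr_ge0.
  rewrite mulrDl mul1r; nra.
by rewrite ler_wpM2l// subr_ge0.
Qed.

Lemma gumbel_exp01 (j : nat) (y : R) : 0 <= y ->
  0 <= 1 - expR (- (j%:R * y)) <= 1.
Proof.
move=> y0; rewrite subr_ge0 lerBlDr lerDl expR_ge0 andbT.
by rewrite -[leRHS]expR0 ler_expR oppr_le0 mulr_ge0.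
Qed.

Lemma gumbel01 t j y : 0 <= y -> `|gumbel t j y| <= 1.
Proof.
move=> y0; have /andP[h0 h1] := gumbel_exp01 j y0.
have q0 : 0 <= (1 - expR (- (j%:R * y))) ^+ gumbel_exponent t j by exact: exprn_ge0.
have q1 : (1 - expR (- (j%:R * y))) ^+ gumbel_exponent t j <= 1 by exact: exprn_ile1.
rewrite /gumbel ger0_norm; lra.
Qed.

(** Write z = e^(-jy) and m for the exponent. If y <= t, then (1 - z)^m <= e^(-mz) <= e^(-j); the
    factor j in m is what covers y = t. If y > t, Bernoulli's inequality bounds the value by m z,
    which is at most j e^(-j(y - t)) + z. *)
Lemma cvg_gumbel t y : 0 <= t -> 0 <= y -> gumbel t ^~ y @ \oo --> ((y <= t)%R%:R : R).
Proof.
move=> t0 y0; have e0 := cvg_expRNn (1 : R).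
have mE j : j%:R * expR (j%:R * t) < (gumbel_exponent t j)%:R <= j%:R * expR (j%:R * t) + 1.
  have h0 : 0 <= j%:R * expR (j%:R * t) by rewrite mulr_ge0 ?expR_ge0.
  have /andP[h1 h2] := truncn_itv h0; rewrite /gumbel_exponent h2 /=.
  by rewrite -natr1 lerD2r.
case: leP => yt.
  have -> : (true%:R : R) = 1 - 0 by rewrite subr0.
  apply: cvgB; first exact: cvg_cst.
  apply: (cvg0_le _ e0) => j; have /andP[h0 h1] := gumbel_exp01 j y0.
  have /andP[m1 _] := mE j; rewrite mul1r ger0_norm ?exprn_ge0//.
  set z := expR (- (j%:R * y)) in h0 h1 *; set m := gumbel_exponent t j in m1 *.
  apply: (@le_trans _ _ (expR (- z) ^+ m)).
    by rewrite lerXn2r ?nnegrE ?expR_ge0// expR_ge1Dx.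
  rewrite -expRM_natl ler_expR mulrN lerN2.
  have z0 : 0 < z by exact: expR_gt0.
  apply: (@le_trans _ _ (j%:R * expR (j%:R * t) * z)).
    rewrite -mulrA -expRD -[leLHS]mulr1 ler_wpM2l// -expR0 ler_expR -mulrBr.
    by rewrite mulr_ge0// subr_ge0.
  by rewrite ler_wpM2r// ltW.
have e1 : (fun j : nat => j%:R * expR (j%:R * t) * expR (- (j%:R * y)) +
    expR (- (j%:R * y))) @ \oo --> (0 : R).
  pose c := y - t; have c0 : 0 < c by rewrite subr_gt0.
  have yp : 0 < y by exact: le_lt_trans yt.
  have sq : (fun j : nat => (2 / c ^+ 2 + y^-1) * j.+1%:R^-1) @ \oo --> (0 : R).
    rewrite -(mulr0 (2 / c ^+ 2 + y^-1)); apply: cvgM; first exact: cvg_cst.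
    exact: cvg_harmonic.
  rewrite -(cvg_shiftS (fun j : nat => j%:R * expR (j%:R * t) * expR (- (j%:R * y)) +
    expR (- (j%:R * y)))).
  apply: (cvg0_le _ sq) => j; set q : R := j.+1%:R.
  have q0 : 0 < q by [].
  rewrite ger0_norm; last by rewrite addr_ge0 ?mulr_ge0 ?expR_ge0.
  rewrite mulrDl; apply: lerD; last first.
    rewrite expRN -invfM lef_pV2 ?posrE ?expR_gt0 ?mulr_gt0//.
    by rewrite mulrC (le_trans _ (expR_ge1Dx _))// lerDr.
  rewrite -mulrA -expRD.
  have -> : q * t - q * y = - (q * c) by rewrite /c; ring.
  have qc0 : 0 < q * c by exact: mulr_gt0.
  have := normrX_le_expR 2 (q * c); rewrite (ger0_norm (ltW qc0)) (_ : 2`!%:R = 2 :> R)// => h.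
  rewrite expRN ler_pdivrMr ?expR_gt0//.
  apply: (@le_trans _ _ (2 / c ^+ 2 / q * ((q * c) ^+ 2 / 2))).
    have -> : 2 / c ^+ 2 / q * ((q * c) ^+ 2 / 2) = q.
      have alg (a b : R) : a != 0 -> b != 0 -> 2 / b ^+ 2 / a * ((a * b) ^+ 2 / 2) = a.
        by move=> a0 b0; field; rewrite a0 b0.
      by rewrite alg// gt_eqF.
    by [].
  rewrite ler_wpM2l ?divr_ge0 ?(ltW q0) ?exprn_ge0 ?(ltW c0)//.
  by rewrite ler_pdivrMr// [leRHS]mulrC.
apply: (cvg0_le _ e1) => j; have /andP[h0 h1] := gumbel_exp01 j y0.
have /andP[_ m1] := mE j; rewrite /gumbel.
set z := expR (- (j%:R * y)) in h0 h1 *; set m := gumbel_exponent t j in m1 *.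
have z0 : 0 < z by exact: expR_gt0.
have q1 : (1 - z) ^+ m <= 1 by exact: exprn_ile1.
have q2 : 1 - m%:R * z <= (1 - z) ^+ m by apply: bernoulli; rewrite ltW//; lra.
have q3 : m%:R * z <= (j%:R * expR (j%:R * t) + 1) * z by rewrite ler_wpM2r// ltW.
rewrite ger0_norm; first by rewrite mulrDl mul1r in q3; lra.
lra.
Qed.

Context {d1 : measure_display} {T1 : measurableType d1} (m1 : {measure set T1 -> \bar R})
  {d2 : measure_display} {T2 : measurableType d2} (m2 : {measure set T2 -> \bar R}).
Variables (h1 tau1 : T1 -> R) (h2 tau2 : T2 -> R).
Hypotheses (tau1_ge0 : forall w, 0 <= tau1 w) (tau2_ge0 : forall w, 0 <= tau2 w).
Hypotheses (mt1 : measurable_fun [set: T1] tau1) (mt2 : measurable_fun [set: T2] tau2).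
Hypotheses (ih1 : m1.-integrable setT (EFin \o h1)) (ih2 : m2.-integrable setT (EFin \o h2)).
Hypothesis laplace : forall k : nat,
  (\int[m1]_w (h1 w * expR (- (k%:R * tau1 w)))%:E =
   \int[m2]_w (h2 w * expR (- (k%:R * tau2 w)))%:E)%E.

Let integrable_bdd (dd : measure_display) (T : measurableType dd) (m : {measure set T -> \bar R})
  (h f : T -> R) : m.-integrable setT (EFin \o h) -> measurable_fun [set: T] f ->
  (forall w, `|f w| <= 1) -> m.-integrable setT (fun w => (h w * f w)%:E).
Proof.
move=> ih mf f1; have mh : measurable_fun [set: T] h.
  by apply/measurable_EFinP; case/integrableP: ih.
apply: (@le_integrable _ _ _ m setT measurableT _ (EFin \o h)) => //.
  by apply/measurable_EFinP; exact: measurable_funM.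
by move=> w _; rewrite !abse_EFin lee_fin normrM ler_piMr.
Qed.

Let pow_exp (y : R) (i : nat) : expR (- y) ^+ i = expR (- (i%:R * y)).
Proof. by rewrite -expRM_natl mulrN. Qed.

Let poly_integral (dd : measure_display) (T : measurableType dd) (m : {measure set T -> \bar R})
  (h tau : T -> R) (q : {poly R}) : m.-integrable setT (EFin \o h) ->
  (forall w, 0 <= tau w) -> measurable_fun [set: T] tau ->
  (\int[m]_w (h w * q.[expR (- tau w)])%:E =
   \sum_(i < size q) (q`_i)%:E * \int[m]_w (h w * expR (- (i%:R * tau w)))%:E)%E.
Proof.
move=> ih t0 mt.
have ie (i : nat) : m.-integrable setT (fun w => (h w * expR (- (i%:R * tau w)))%:E).
  apply: integrable_bdd => //.
    apply: measurableT_comp => //; apply: measurableT_comp => //.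
    exact: measurable_funM.
  move=> w; rewrite ger0_norm ?expR_ge0// -[leRHS]expR0 ler_expR oppr_le0.
  by rewrite mulr_ge0.
have -> : (fun w => (h w * q.[expR (- tau w)])%:E) =
    (fun w => \sum_(i < size q) (q`_i)%:E * (h w * expR (- (i%:R * tau w)))%:E)%E.
  apply/funext => w; rewrite horner_coef mulr_sumr -sumEFin; apply: eq_bigr => i _.
  by rewrite -EFinM pow_exp mulrCA.
rewrite integral_sum//; last by move=> i; exact: integrableZl.
by apply: eq_bigr => i _; rewrite integralZl.
Qed.

Let gumbel_poly t j : {poly R} := 1 - (1 - 'X^j) ^+ gumbel_exponent t j.

Let gumbelE t j y : gumbel t j y = (gumbel_poly t j).[expR (- y)].
Proof. by rewrite /gumbel_poly /gumbel !hornerE pow_exp. Qed.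

Let cvg_int (dd : measure_display) (T : measurableType dd) (m : {measure set T -> \bar R})
  (h tau : T -> R) (t : R) : 0 <= t -> m.-integrable setT (EFin \o h) ->
  (forall w, 0 <= tau w) -> measurable_fun [set: T] tau ->
  (fun j => \int[m]_w (h w * gumbel t j (tau w))%:E)%E @ \oo -->
    (\int[m]_w (h w * (tau w <= t)%R%:R)%:E)%E.
Proof.
move=> tt0 ih t0 mt; have mh : measurable_fun [set: T] h.
  by apply/measurable_EFinP; case/integrableP: ih.
have mg j : measurable_fun [set: T] (fun w => gumbel t j (tau w)).
  apply: measurable_funB => //; apply: measurable_funX; apply: measurable_funB => //.
  apply: measurableT_comp => //; apply: measurableT_comp => //.
  exact: measurable_funM.
have cg w : gumbel t ^~ (tau w) @ \oo --> ((tau w <= t)%R%:R : R) by exact: cvg_gumbel.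
have [] := @dominated_convergence _ _ _ m setT measurableT
  (fun j w => (h w * gumbel t j (tau w))%:E) (fun w => (h w * (tau w <= t)%R%:R)%:E)
  (fun w => `|(h w)%:E|)%E.
- by move=> j; apply/measurable_EFinP; exact: measurable_funM.
- apply/measurable_EFinP; apply: measurable_funM => //.
  by apply: (measurable_fun_cvg mg) => w _; exact: cg.
- apply: aeW => w _; apply: cvg_EFin; first exact: nearW.
  by apply: cvgM; [exact: cvg_cst|exact: cg].
- exact: integrable_abse.
- by apply: aeW => w j _; rewrite !abse_EFin lee_fin normrM ler_piMr// gumbel01.
by [].
Qed.

(** Transforms at natural numbers integrate polynomials in e^(-tau), and the functions [gumbel] are
    such polynomials. The weights may be signed and the two spaces different: the lemma serves both
    to compare P with Lebesgue measure and to invert a transform on the line. *)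
Lemma laplace_uniqueness (t : R) : 0 <= t ->
  (\int[m1]_w (h1 w * (tau1 w <= t)%R%:R)%:E =
   \int[m2]_w (h2 w * (tau2 w <= t)%R%:R)%:E)%E.
Proof.
move=> t0; have c1 := cvg_int t0 ih1 tau1_ge0 mt1.
apply: (cvg_unique _ c1) => //.
have -> : (fun j => \int[m1]_w (h1 w * gumbel t j (tau1 w))%:E)%E =
    (fun j => \int[m2]_w (h2 w * gumbel t j (tau2 w))%:E)%E.
  apply/funext => j; under eq_integral do rewrite gumbelE.
  under [RHS]eq_integral do rewrite gumbelE.
  by rewrite !poly_integral//; apply: eq_bigr => i _; rewrite laplace.
exact: cvg_int.
Qed.

End LaplaceUniqueness.

Section ZeroFromIntegrals.
Context {R : realType}.
Local Notation mu := (@lebesgue_measure R).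

Lemma eq0_of_integrals (f : R -> R) (y : R) : 0 < y ->
  (forall t, 0 < t -> mu.-integrable `]0%R, t] (EFin \o f)) ->
  (forall t, 0 < t -> (\int[mu]_(u in `]0%R, t]) (f u)%:E = 0)%E) ->
  {for y, continuous f} -> f y = 0.
Proof.
move=> y0 fi f0 cf; have yy : y < y + 1 by rewrite ltrDl.
have [||dF <-] := @continuous_FTC1 R f (BRight 0) y (y + 1) yy _ _ cf.
- by apply: fi; rewrite addr_gt0.
- first [by rewrite lteBSide|exact: y0].
rewrite derive1E.
have : is_derive y 1 (cst 0 : R -> R) 0 by exact: is_derive_cst.
move=> h; rewrite -[RHS](@derive_val _ _ _ _ _ _ _ h).
apply: near_eq_derive.
near=> t; rewrite /Rintegral f0//; near: t; exact: lt_nbhsr.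
Unshelve. all: by end_near. Qed.

(** A density is known only through its integrals over ]0, t]. Lebesgue differentiation of the
    monotone primitive recovers its sign almost everywhere. *)
Lemma ge0_of_integrals (f : R -> R) (F : R -> R) :
  (forall t, 0 < t -> mu.-integrable `]0%R, t] (EFin \o f)) ->
  {homo F : s t / s <= t} ->
  (forall t, 0 < t -> (\int[mu]_(u in `]0%R, t]) (f u)%:E = (F t)%:E)%E) ->
  {ae mu, forall t, 0 < t -> 0 <= f t}.
Proof.
move=> fi ndF fF.
(* Extended by 0, f becomes locally integrable on the whole line, as differentiation requires. *)
pose g t := if 0 < t then f t else 0.
have gf t : 0 < t -> mu.-integrable `]0%R, t] (EFin \o g).
  move=> t0; have := fi t t0; apply: eq_integrable => //= u.
  by rewrite inE/= in_itv/= => /andP[u0 _]; rewrite /g u0.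
have gi t : mu.-integrable [set` Interval (BRight 0) (BRight t)] (EFin \o g).
  have [t0|t0] := ltP 0 t; first exact: gf.
  rewrite set_itv_ge ?bnd_simp -?leNgt//; exact: integrable_set0.
have mg : measurable_fun [set: R] g.
  have -> : [set: R] = \bigcup_n `[(- n%:R : R), n%:R]%classic by rewrite bigcup_itv_nat.
  apply/measurable_fun_bigcup => // n.
  have gn0 : measurable_fun `[(- n%:R : R), 0] g.
    have : measurable_fun `[(- n%:R : R), 0] (cst 0 : R -> R) by [].
    apply: eq_measurable_fun => u; rewrite inE/= in_itv/= => /andP[_ u0].
    by rewrite /g ltNge u0.
  have gn1 : measurable_fun `](0 : R), n%:R] g.
    by apply/measurable_EFinP; case/integrableP: (gi n%:R).
  have -> : `[(- n%:R : R), n%:R]%classic = `[- n%:R, 0]%classic `|` `]0, n%:R]%classic.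
    apply/seteqP; split => u /=; rewrite !in_itv/=.
      by case: (leP u 0) => u0 /andP[-> ->]; [left|right].
    case=> /andP[a1 a2]; first by rewrite a1 (le_trans a2).
    by rewrite a2 andbT (le_trans _ (ltW a1))// oppr_le0.
  by apply/measurable_funU.
have gl : locally_integrable [set: R] g.
  split => //; first exact: openT.
  move=> K _ cK; have [M [_ HM]] := compact_bounded cK.
  pose m := Num.max 1 (M + 1); have m0 : 0 < m by rewrite /m lt_max ltr01.
  have Mm : M < m by rewrite /m lt_max ltrDl ltr01 orbT.
  have mK : measurable K by exact: compact_measurable.
  have [_] := integrableP _ _ _ (gf m m0); apply: le_lt_trans.
  rewrite [leLHS]integral_mkcond [leRHS]integral_mkcond.
  apply: ge0_le_integral => //.
  - by move=> u _; rewrite patchE; case: ifP.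
  - apply/(measurable_restrictT _ mK); apply: measurable_funTS.
    by apply/measurable_EFinP; exact: measurableT_comp.
  - have mgE : measurable_fun [set: R] (fun u => `|(g u)%:E|)%E.
      by apply: measurableT_comp => //; exact/measurable_EFinP.
    apply/(measurable_restrictT _ (measurable_itv `](0 : R), m])).
    exact: measurable_funTS.
  move=> u _; rewrite !patchE; case: ifPn => uK; last by case: ifP => //= _; rewrite lee_fin.
  case: ifPn => //= um; rewrite /g; case: ifP => u0; last by rewrite normr0.
  exfalso; move/negP: um; apply; rewrite inE/= in_itv/= u0 /=.
  have := HM m Mm u; rewrite inE in uK => /(_ uK) /=.
  by rewrite ger0_norm// ltW.
have := FTC1 gi gl; apply: filterS; first exact: (ae_filter_ringOfSetsType mu).
move=> t ht t0.
have {ht} [|dG G'] := ht; first by first [rewrite lteBSide|exact: t0].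
set G := (fun x => _) in dG G'.
have GF u : 0 < u -> G u = F u.
  move=> u0; rewrite /G /Rintegral.
  have -> : (\int[mu]_(t in `]0%R, u]) (g t)%:E = \int[mu]_(t in `]0%R, u]) (f t)%:E)%E.
    apply: eq_integral => s; rewrite inE/= in_itv/= => /andP[s0 _].
    by rewrite /g s0.
  by rewrite fF.
have <- : g t = f t by rewrite /g t0.
rewrite -G' derive1E; apply: limr_ge; first exact: dG.
near=> h; rewrite /GRing.scale/= mulr1.
have ht : 0 < h + t.
  have : `|h| < t by near: h; exact: dnbhs0_lt.
  by rewrite ltr_norml => /andP[h1 _]; lra.
rewrite !GF//; have [h0|h0] := leP 0 h.
  by rewrite mulr_ge0 ?invr_ge0// subr_ge0 ndF// lerDr.
by rewrite -mulrNN mulr_ge0// ?oppr_ge0 ?invr_le0 ?(ltW h0)// subr_le0 ndF// gerDr ltW.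
Unshelve. all: by end_near. Qed.

End ZeroFromIntegrals.

(** * Bessel functions *)

Section BesselKernels.
Context {R : realType}.
Local Notation mu := (@lebesgue_measure R).

(** The power and Gaussian factors of [heat_fun] at remaining time b and radius rho, cut off at b <=
    0. *)
Definition kern (p rho b : R) : R :=
  (0 < b)%R%:R * (b `^ (- p) * expR (- (rho ^+ 2 / (2 * b)))).

Lemma kern_ge0 p rho b : 0 <= kern p rho b.
Proof. by rewrite /kern !mulr_ge0 ?powR_ge0 ?expR_ge0. Qed.

Lemma measurable_gt_indic (disp : measure_display) (S : measurableType disp)
    (g : S -> R) : measurable_fun [set: S] g ->
  measurable_fun [set: S] (fun w => (0 < g w)%R%:R : R).
Proof.
move=> mg; have -> : (fun w => (0 < g w)%R%:R : R) = (fun w => 1 - (0 <= - g w)%R%:R).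
  by apply/funext => w; rewrite oppr_ge0; case: ltP; rewrite ?subrr ?subr0.
apply: measurable_funB => //; apply: measurable_ge_indic.
exact: (measurableT_comp (continuous_measurable_fun opp_continuous)).
Qed.

Lemma measurable_kern p rho : measurable_fun [set: R] (kern p rho).
Proof.
apply: measurable_funM; first exact: measurable_gt_indic.
apply: measurable_funM; first exact: measurable_powR.
apply: measurableT_comp => //.
apply: (measurableT_comp (continuous_measurable_fun opp_continuous)).
apply: measurable_funM => //; apply: (measurableT_comp (@measurable_invr R)).
exact: measurable_funM.
Qed.

Lemma integral_pos_part (f : R -> R) :
  (\int[mu]_a ((0 < a)%R%:R * f a)%:E = \int[mu]_(a in `]0%R, +oo[) (f a)%:E)%E.
Proof.
rewrite [RHS]integral_mkcond; apply: eq_integral => a _; rewrite patchE.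
case: ifPn => [|/negP]; rewrite inE/= in_itv/= andbT; first by move=> ->; rewrite mul1r.
by move=> /negP; rewrite -leNgt ltNge => ->; rewrite mul0r.
Qed.

Lemma continuous_kern_at p rho (y : R) : 0 < y ->
  {for y, continuous (fun b : R => b `^ (- p) * expR (- (rho ^+ 2 / (2 * b))))}.
Proof.
move=> y0; apply: cvgM; first exact: continuous_powR_at.
apply: continuous_cvg; first exact: continuous_expR.
apply: cvgN; apply: cvgM; first exact: cvg_cst.
apply: cvgV; first by rewrite mulf_neq0// gt_eqF.
by apply: cvgM; [exact: cvg_cst|exact: cvg_id].
Qed.

(** Translation by tau in the variable a: after the exponential substitution based at tau, both
    sides are integrals over the same line. *)
Lemma kern_shift p rho u tau :
  (\int[mu]_a (expR (- (u * a)) * kern p rho (a - tau))%:E =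
   (expR (- (u * tau)))%:E * \int[mu]_a (expR (- (u * a)) * kern p rho a)%:E)%E.
Proof.
have c0 b y : 0 < y - b -> {for y, continuous (fun a : R => expR (- (u * a)) *
    ((a - b) `^ (- p) * expR (- (rho ^+ 2 / (2 * (a - b))))))}.
  move=> y0; apply: cvgM.
    apply: continuous_cvg; first exact: continuous_expR.
    by apply: cvgN; apply: cvgM; [exact: cvg_cst|exact: cvg_id].
  apply: (@continuous_comp _ _ _ (fun a : R => a - b)
    (fun a => a `^ (- p) * expR (- (rho ^+ 2 / (2 * a))))); last exact: continuous_kern_at.
  by apply: cvgB; [exact: cvg_id|exact: cvg_cst].
have sub b : (\int[mu]_a (expR (- (u * a)) * kern p rho (a - b))%:E =
    \int[mu]_w (expR (- (u * (b + expR w))) * (expR w `^ (- p) *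
      expR (- (rho ^+ 2 / (2 * expR w)))) * expR w)%:E)%E.
  transitivity (\int[mu]_(a in `]b, +oo[) (expR (- (u * a)) *
      ((a - b) `^ (- p) * expR (- (rho ^+ 2 / (2 * (a - b))))))%:E)%E.
    rewrite [RHS]integral_mkcond; apply: eq_integral => a _; rewrite patchE /kern subr_gt0.
    case: ifPn => [|/negP]; rewrite inE/= in_itv/= andbT; first by move=> ->; rewrite mul1r.
    by move=> /negP; rewrite -leNgt ltNge => ->; rewrite mul0r mulr0.
  rewrite (@ge0_integral_exp_subst R b 1)//.
  - apply: eq_integral => w _; have e : b + expR w - b = expR w by ring.
    by rewrite !mul1r !e.
  - by move=> y yb; apply: c0; rewrite subr_gt0.
  - by move=> y _; rewrite !mulr_ge0 ?powR_ge0 ?expR_ge0.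
have := sub 0; under eq_integral do rewrite subr0; rewrite sub => ->.
have mE : measurable_fun [set: R] (fun w : R => (expR (- (u * (0 + expR w))) *
    (expR w `^ (- p) * expR (- (rho ^+ 2 / (2 * expR w)))) * expR w)%:E).
apply/measurable_EFinP; apply: continuous_measurable_fun => w.
  apply: cvgM; last exact: continuous_expR.
  apply: (@continuous_comp _ _ _ expR (fun a => expR (- (u * (0 + a))) *
    (a `^ (- p) * expR (- (rho ^+ 2 / (2 * a)))))); first exact: continuous_expR.
  have := @c0 0 (expR w); rewrite subr0 => /(_ (expR_gt0 _)) h.
  have -> : (fun a : R => expR (- (u * (0 + a))) *
      (a `^ (- p) * expR (- (rho ^+ 2 / (2 * a))))) = (fun a : R => expR (- (u * a)) *
      ((a - 0) `^ (- p) * expR (- (rho ^+ 2 / (2 * (a - 0)))))).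
    by apply/funext => a; rewrite !subr0 add0r.
  exact: h.
rewrite -ge0_integralZl//; first [exact: mE|by rewrite lee_fin expR_ge0|
  by move=> w _; rewrite lee_fin !mulr_ge0 ?powR_ge0 ?expR_ge0|idtac].
apply: eq_integral => w _; rewrite -EFinM; congr EFin.
by rewrite add0r mulrDr opprD expRD; ring.
Qed.

Lemma continuous_cosh : continuous (@cosh R).
Proof.
move=> w; apply: cvgM; last exact: cvg_cst.
apply: cvgD; first exact: continuous_expR.
by apply: (@continuous_comp _ _ _ -%R expR); [exact: opp_continuous|exact: continuous_expR].
Qed.

Lemma continuous_expR_cosh (z m : R) : continuous (fun w => expR (- (z * cosh w) - m * w)).
Proof.
move=> w; apply: continuous_cvg; first exact: continuous_expR.
apply: cvgB; first by apply: cvgN; apply: cvgM; [exact: cvg_cst|exact: continuous_cosh].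
by apply: cvgM; [exact: cvg_cst|exact: cvg_id].
Qed.

(** Folding the line at the origin pairs e^(-mw) with e^(mw) and produces twice the defining
    integrand of [besselK]. Finiteness rests on cosh w >= w^2 / 4 for w >= 0. *)
Lemma besselK_gt0 (m z : R) : 0 <= m -> 0 < z ->
  (\int[mu]_w (expR (- (z * cosh w) - m * w))%:E = (2 * besselK m z)%:E)%E /\
  0 < besselK m z.
Proof.
move=> m0 z0.
have ccosh := continuous_cosh.
pose f w := expR (- (z * cosh w) - m * w).
have f0 w : 0 <= f w by exact: expR_ge0.
have cf : continuous f by exact: continuous_expR_cosh.
have cfN : continuous (fun w => f (- w)).
  by move=> w; apply: (@continuous_comp _ _ _ -%R f); [exact: opp_continuous|exact: cf].
pose k w := expR (- z * cosh w) * cosh (m * w).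
have k0 w : 0 <= k w by rewrite mulr_ge0 ?expR_ge0// divr_ge0// addr_ge0 ?expR_ge0.
have ck : continuous k.
  move=> w; apply: cvgM.
    apply: continuous_cvg; first exact: continuous_expR.
    by apply: cvgM; [exact: cvg_cst|exact: ccosh].
  apply: (@continuous_comp _ _ _ (fun w => m * w) (@cosh R)); last exact: ccosh.
  by apply: cvgM; [exact: cvg_cst|exact: cvg_id].
pose K := (\int[mu]_(w in `[0%R, +oo[) (k w)%:E)%E.
have EK : (\int[mu]_w (f w)%:E = 2%:E * K)%E.
  have -> : [set: R] = `]-oo, (- 0)%R]%classic `|` `]0%R, +oo[%classic.
    by rewrite oppr0; apply/seteqP; split => // w _ /=; rewrite !in_itv/= andbT; case: leP; [left|right].
  rewrite ge0_integral_setU//=; first last.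
  - rewrite oppr0; apply/disj_setPLR => w /=; rewrite !in_itv/= => w0.
    by rewrite andbT; apply/negP; rewrite -leNgt.
  - by move=> w _; rewrite lee_fin.
  - apply/measurable_EFinP; apply: measurable_funTS; exact: continuous_measurable_fun.
  rewrite ge0_integration_by_substitutionNy//; last exact: continuous_subspaceT.
  rewrite integral_itv_obnd_cbnd; last first.
    apply/measurable_EFinP; apply: measurable_funTS; exact: continuous_measurable_fun.
  rewrite -ge0_integralD//=; first [by move=> y _; rewrite lee_fin; exact: f0|
    by apply/measurable_EFinP; apply: measurable_funTS; exact: continuous_measurable_fun|idtac].
  rewrite /K -ge0_integralZl//; first [by move=> y _; rewrite lee_fin; exact: k0|
    by apply/measurable_EFinP; apply: measurable_funTS; exact: continuous_measurable_fun|idtac].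
  apply: eq_integral => w _; rewrite -EFinD -EFinM; congr EFin.
  have coshN : cosh (- w) = cosh w :> R by rewrite /cosh opprK addrC.
  have e3 : cosh (m * w) = (expR (m * w) + expR (- (m * w))) / 2 by [].
  by rewrite /f /k coshN e3 !expRD mulNr mulrN opprK; field.
have Kfin : (K < +oo)%E.
  have [N hN] := truncn_bound m.
  have [C C0 HC] := @poly_gauss_bound R 0 (m + 1) (z / 4) (divr_gt0 z0 (ltr0Sn _ 3)).
  apply: (@le_lt_trans _ _ (\int[mu]_(w in `[0%R, +oo[) (C * expR (- (1 * w)))%:E)%E).
    apply: (@ge0_le_integral _ _ _ mu `[0%R, +oo[%classic) => //.
    - by move=> w _; rewrite lee_fin.
    - apply/measurable_EFinP; apply: measurable_funTS; exact: continuous_measurable_fun.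
    - apply/measurable_EFinP; apply: measurable_funTS; apply: measurable_funM => //.
      apply: measurableT_comp => //; apply: measurableT_comp => //; exact: measurable_funM.
    move=> w /=; rewrite in_itv/= andbT => w0; rewrite lee_fin /k.
    have c1 : cosh (m * w) <= expR (m * w).
      rewrite /cosh ler_pdivrMr// mulr_natr mulr2n lerD2l ler_expR.
      by have : 0 <= m * w by [rewrite mulr_ge0]; lra.
    have c2 : w ^+ 2 / 4 <= cosh w.
      have := normrX_le_expR 2 w; rewrite (ger0_norm w0) (_ : 2`!%:R = 2 :> R)// /cosh.
      by have := expR_ge0 (- w); lra.
    apply: (@le_trans _ _ (expR ((m + 1) * w - z / 4 * w ^+ 2) * expR (- (1 * w)))).
      apply: (@le_trans _ _ (expR (- z * cosh w) * expR (m * w))).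
        by rewrite ler_wpM2l ?expR_ge0.
      rewrite -!expRD ler_expR.
      have : z * (w ^+ 2 / 4) <= z * cosh w by rewrite ler_wpM2l// ltW.
      lra.
    by rewrite ler_wpM2r ?expR_ge0//; have := HC w w0; rewrite expr0 mul1r.
  under eq_integral do rewrite EFinM.
  have mE1 : measurable_fun [set: R] (fun w : R => (expR (- (1 * w)))%:E).
    apply/measurable_EFinP.
    apply: measurableT_comp => //; apply: measurableT_comp => //; exact: measurable_funM.
  have mE : measurable_fun (`[0%R, +oo[%classic : set R) (fun w : R => (expR (- (1 * w)))%:E).
    exact: measurable_funTS.
  rewrite ge0_integralZl//; first [by move=> w _; rewrite lee_fin expR_ge0|idtac].
  rewrite -integral_itv_obnd_cbnd; last exact: measurable_funTS.
  by rewrite integral_expRN// -EFinM ltry.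
have KE : K = (besselK m z)%:E.
  rewrite /besselK /Rintegral fineK// ge0_fin_numE//.
  by apply: integral_ge0 => w _; rewrite lee_fin; exact: k0.
split; first by rewrite EK KE EFinM.
rewrite -lte_fin -KE; pose q := expR (- z * expR 1) / 2.
apply: (@lt_le_trans _ _ (\int[mu]_(w in `[0%R, 1%R]) q%:E)%E).
  rewrite (integral_cst mu)//= lebesgue_measure_itv/= lte_fin ltr01 oppr0 adde0 mule1 lte_fin.
  by rewrite divr_gt0 ?expR_gt0.
apply: (@le_trans _ _ (\int[mu]_(w in `[0%R, 1%R]) (k w)%:E)%E).
  apply: (@ge0_le_integral _ _ _ mu `[0%R, 1%R]%classic) => //.
  - by move=> w _; rewrite lee_fin divr_ge0 ?expR_ge0.
  - apply/measurable_EFinP; apply: measurable_funTS; exact: continuous_measurable_fun.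
  move=> w /=; rewrite in_itv/= => /andP[w0 w1]; rewrite lee_fin /q /k.
  apply: ler_pM; rewrite ?expR_ge0//.
    rewrite ler_expR !mulNr lerN2 ler_pM2l// /cosh.
    have h1 : expR w <= expR 1 by rewrite ler_expR.
    have h2 : expR (- w) <= expR 1 by rewrite ler_expR; lra.
    by rewrite ler_pdivrMr//; lra.
  rewrite /cosh ler_pdivlMr// mulVf//.
  have h1 : 1 <= expR (m * w) by rewrite -expR0 ler_expR mulr_ge0.
  by have := expR_ge0 (- (m * w)); lra.
apply: ge0_subset_integral => //.
- apply/measurable_EFinP; apply: measurable_funTS; exact: continuous_measurable_fun.
- by move=> w _; rewrite lee_fin.
- by apply: subset_itvl; rewrite bnd_simp.
Qed.

(** With b = sqrt(2u), the substitution a = (rho / b) e^w balances the two exponents: u a = rho b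
    e^w / 2 and rho^2 / (2a) = rho b e^(-w) / 2, with sum rho b cosh w. *)
Lemma kern_laplace (m rho u : R) : 0 <= m -> 0 < rho -> 0 < u ->
  (\int[mu]_a (expR (- (u * a)) * kern (m + 1) rho a)%:E =
   (2 * (Num.sqrt (2 * u) / rho) `^ m * besselK m (rho * Num.sqrt (2 * u)))%:E)%E.
Proof.
move=> m0 rho0 u0; set b := Num.sqrt (2 * u).
have b0 : 0 < b by rewrite sqrtr_gt0 mulr_gt0.
have b2 : b ^+ 2 = 2 * u by rewrite sqr_sqrtr// mulr_ge0 ?ltW.
have q0 : 0 < rho / b by rewrite divr_gt0.
transitivity (\int[mu]_(a in `]0%R, +oo[) (expR (- (u * a)) *
    (a `^ (- (m + 1)) * expR (- (rho ^+ 2 / (2 * a)))))%:E)%E.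
  by rewrite -integral_pos_part; apply: eq_integral => a _; rewrite /kern mulrCA.
rewrite (@ge0_integral_exp_subst R 0 (rho / b))//; first last.
- by move=> y _; rewrite !mulr_ge0 ?powR_ge0 ?expR_ge0.
- move=> y y0; apply: cvgM; last exact: continuous_kern_at.
  apply: continuous_cvg; first exact: continuous_expR.
  by apply: cvgN; apply: cvgM; [exact: cvg_cst|exact: cvg_id].
have [KE _] := besselK_gt0 m0 (mulr_gt0 rho0 b0).
have mE : measurable_fun [set: R] (fun w : R => (expR (- (rho * b * cosh w) - m * w))%:E).
  have cc := @continuous_expR_cosh (rho * b) m.
  by apply/measurable_EFinP; exact: continuous_measurable_fun cc.
rewrite mulrAC EFinM -KE muleC -ge0_integralZl//; first [exact: mE|
  by move=> w _; rewrite lee_fin expR_ge0|by rewrite lee_fin powR_ge0|idtac].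
apply: eq_integral => w _; rewrite add0r -EFinM; congr EFin.
have qE : (b / rho) `^ m = (rho / b) `^ (- m).
  rewrite -[in RHS]mulN1r powRrM powR_inv1 ?(ltW q0)//; congr (_ `^ _).
  by rewrite invf_div.
rewrite qE; have -> : rho / b * expR w = expR (ln (rho / b) + w).
  by rewrite expRD lnK ?posrE.
rewrite {2}/powR (gt_eqF q0) -expRM -!expRD; congr expR.
have e1 : u * expR (ln (rho / b) + w) = rho * b / 2 * expR w.
  have uE : u = b ^+ 2 / 2 by rewrite b2; field.
  have alg (y z e : R) : y != 0 -> y ^+ 2 / 2 * (z / y * e) = z * y / 2 * e.
    by move=> y0; field.
  by rewrite expRD lnK ?posrE// uE alg// gt_eqF.
have e2 : rho ^+ 2 / (2 * expR (ln (rho / b) + w)) = rho * b / 2 * expR (- w).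
  rewrite expRD lnK ?posrE// expRN; field.
  by rewrite !gt_eqF ?expR_gt0.
rewrite e1 e2 /cosh; field.
all: by [].
Qed.

End BesselKernels.

Section BesselSeries.
Context {R : realType}.
Local Notation mu := (@lebesgue_measure R).
Implicit Types p y : R.

(* [besselI m z = (z/2)^m * bessel_entire (m + 1) (z^2/4)]. *)
Definition bessel_coef p (k : nat) : R := (k`!%:R * Gamma (p + k%:R))^-1.

Definition bessel_entire p y : R := limn (pseries (bessel_coef p) y).

Lemma Gamma_shift_ge p k : 1 <= p -> Gamma p <= Gamma (p + k%:R).
Proof.
move=> p1; elim: k => [|k IH]; first by rewrite addr0.
rewrite -natr1 addrA GammaS; last by rewrite ltr_wpDr// (lt_le_trans ltr01).
apply: le_trans IH _; rewrite ler_peMl ?(ltW (Gamma_gt0 _))//.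
  by rewrite ltr_wpDr// (lt_le_trans ltr01).
by rewrite (le_trans p1)// lerDl.
Qed.

Let p_gt0 p : 1 <= p -> 0 < p. Proof. exact: lt_le_trans. Qed.

Lemma bessel_coef_gt0 p k : 1 <= p -> 0 < bessel_coef p k.
Proof.
move=> p1; rewrite invr_gt0 mulr_gt0 ?ltr0n ?fact_gt0// Gamma_gt0//.
by rewrite ltr_wpDr// p_gt0.
Qed.

Lemma bessel_coef_le p k : 1 <= p -> bessel_coef p k <= (Gamma p)^-1 * (k`!%:R)^-1.
Proof.
move=> p1; have g0 := Gamma_gt0 (p_gt0 p1); have k0 : 0 < k`!%:R :> R by rewrite ltr0n fact_gt0.
rewrite /bessel_coef -invfM lef_pV2 ?posrE ?mulr_gt0//; last first.
  by rewrite (lt_le_trans g0)// Gamma_shift_ge.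
by rewrite mulrC ler_wpM2l ?(ltW k0)// Gamma_shift_ge.
Qed.

Lemma is_cvg_bessel p y : 1 <= p -> cvgn (pseries (bessel_coef p) y).
Proof.
move=> p1; apply: normed_cvg.
apply: (series_le_cvg (v_ := fun k => (Gamma p)^-1 * exp_coeff `|y| k)).
- by move=> k /=; exact: normr_ge0.
- move=> k; rewrite mulr_ge0 ?invr_ge0 ?(ltW (Gamma_gt0 (p_gt0 p1)))//.
  by rewrite /exp_coeff divr_ge0// exprn_ge0.
- move=> k /=; rewrite normrM normrX gtr0_norm ?bessel_coef_gt0// /exp_coeff.
  have -> : (Gamma p)^-1 * (`|y| ^+ k / k`!%:R) = (Gamma p)^-1 / k`!%:R * `|y| ^+ k by ring.
  by rewrite ler_wpM2r ?exprn_ge0// bessel_coef_le.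
- rewrite (_ : series _ = (fun n => (Gamma p)^-1 * series (exp_coeff `|y|) n)).
    by apply: is_cvgM; [exact: is_cvg_cst|exact: is_cvg_series_exp_coeff].
  by apply/funext => n; rewrite /series/= mulr_sumr.
Qed.

Lemma bessel_diffs p : 1 <= p -> pseries_diffs (bessel_coef p) = bessel_coef (p + 1).
Proof.
move=> p1; apply/funext => k; rewrite /pseries_diffs /bessel_coef factS natrM.
rewrite -[in Gamma (p + k.+1%:R)]natr1 [k%:R + 1]addrC addrA -mulrA invfM mulrA divff ?mul1r//.
Qed.

Lemma continuous_bessel_entire p : 1 <= p -> continuous (bessel_entire p).
Proof.
move=> p1 y; have p2 : 1 <= p + 1 by lra.
have p3 : 1 <= p + 1 + 1 by lra.
have D : is_derive y 1 (bessel_entire p) (limn (pseries (pseries_diffs (bessel_coef p)) y)).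
  apply: (@pseries_snd_diffs R (bessel_coef p) (`|y| + 1)).
  - exact: is_cvg_bessel.
  - by rewrite bessel_diffs//; exact: is_cvg_bessel.
  - by rewrite !bessel_diffs//; exact: is_cvg_bessel.
  - by rewrite [ltRHS]ger0_norm ?addr_ge0// ltrDl.
by apply: differentiable_continuous; apply/derivable1_diffP; have [] := D.
Qed.

Lemma bessel_partial_le p y n : 1 <= p -> 0 <= y ->
  pseries (bessel_coef p) y n <= bessel_entire p y.
Proof.
move=> p1 y0; apply: nondecreasing_cvgn_le; last exact: is_cvg_bessel.
apply/nondecreasing_seqP => k; rewrite /pseries/= /series/= big_nat_recr//= lerDl.
by rewrite mulr_ge0 ?exprn_ge0// ltW// bessel_coef_gt0.
Qed.

Lemma bessel_entire_gt0 p y : 1 <= p -> 0 <= y -> 0 < bessel_entire p y.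
Proof.
move=> p1 y0; apply: lt_le_trans (bessel_partial_le 1 p1 y0).
by rewrite /pseries/= /series/= big_nat1 expr0 mulr1 bessel_coef_gt0.
Qed.

Lemma besselIE m z : 0 <= m -> 0 < z ->
  besselI m z = (z / 2) `^ m * bessel_entire (m + 1) (z ^+ 2 / 4).
Proof.
move=> m0 z0; rewrite /besselI /bessel_entire; have m1 : 1 <= m + 1 by lra.
have -> : series (fun k : nat => (z / 2) `^ (2 * k%:R + m) / (k`!%:R * Gamma (k%:R + m + 1))) =
    (fun n => (z / 2) `^ m * pseries (bessel_coef (m + 1)) (z ^+ 2 / 4) n).
  apply/funext => n; rewrite /pseries/= /series/= mulr_sumr; apply: eq_bigr => k _.
  have z2 : 0 < z / 2 by rewrite divr_gt0.
  rewrite powRD; last by rewrite (gt_eqF z2) implybT.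
  rewrite powRrM powR_mulrn ?powR_ge0// (powR_mulrn 2 (ltW z2)) /bessel_coef.
  have -> : k%:R + m + 1 = m + 1 + k%:R by ring.
  have -> : (z / 2) ^+ 2 = z ^+ 2 / 4 by field.
  by ring.
by apply: cvg_lim => //; apply: cvgM; [exact: cvg_cst|exact: is_cvg_bessel].
Qed.

Lemma bessel_entire_EFin p y : 1 <= p -> 0 <= y ->
  ((bessel_entire p y)%:E = \sum_(k <oo) (bessel_coef p k * y ^+ k)%:E)%E.
Proof.
move=> p1 y0; rewrite /bessel_entire -EFin_lim; last exact: is_cvg_bessel.
by congr (limn _); apply/funext => n /=; rewrite sumEFin.
Qed.

(** Term by term a Gamma integral: Gamma(p + k) cancels against the coefficient and the exponential
    series of c / s is left. *)
Lemma bessel_entire_laplace p c s : 1 <= p -> 0 <= c -> 0 < s ->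
  (\int[mu]_u ((0 < u)%R%:R * (expR (- (u * s)) * u `^ (p - 1) *
     bessel_entire p (c * u)))%:E = (s `^ (- p) * expR (c / s))%:E)%E.
Proof.
move=> p1 c0 s0; rewrite integral_pos_part.
pose f (k : nat) (u : R) := (bessel_coef p k * c ^+ k * (u `^ (p + k%:R - 1) * expR (- (s * u))))%:E.
transitivity (\int[mu]_(u in `]0%R, +oo[) (\sum_(k <oo) f k u))%E.
  apply: eq_integral => u; rewrite inE/= in_itv/= andbT => u0.
  rewrite EFinM bessel_entire_EFin ?mulr_ge0 ?(ltW u0)// -nneseriesZl; last first.
  - by move=> k _; rewrite lee_fin mulr_ge0 ?exprn_ge0 ?mulr_ge0 ?(ltW u0)// ltW// bessel_coef_gt0.
  apply: eq_eseriesr => k _; rewrite -EFinM /f; congr EFin.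
  have -> : p + k%:R - 1 = (p - 1) + k%:R by ring.
  rewrite [in RHS]powRD; last by rewrite (gt_eqF u0) implybT.
  by rewrite powR_mulrn ?(ltW u0)// exprMn [s * u]mulrC; ring.
have fk0 k : 0 <= bessel_coef p k * c ^+ k.
  by rewrite mulr_ge0 ?exprn_ge0// ltW// bessel_coef_gt0.
have mu1 q : measurable_fun (`]0%R, +oo[%classic : set R) (fun u : R => (u `^ q * expR (- (s * u)))%:E).
  apply/measurable_EFinP; apply: measurable_funTS; apply: measurable_funM.
    exact: measurable_powR.
  apply: measurableT_comp => //; apply: measurableT_comp => //; exact: measurable_funM.
rewrite integral_nneseries//; first last.
- move=> k u _; rewrite /f lee_fin; apply: mulr_ge0 (fk0 k) _.
  by rewrite mulr_ge0 ?powR_ge0 ?expR_ge0.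
- by move=> k; have := measurable_funeM (bessel_coef p k * c ^+ k)%:E (mu1 (p + k%:R - 1)).
have -> : (s `^ (- p) * expR (c / s))%:E = ((s `^ (- p))%:E * \sum_(k <oo) (exp_coeff (c / s) k)%:E)%E.
  rewrite EFinM; congr (_ * _)%E; rewrite /expR -EFin_lim; last exact: is_cvg_series_exp_coeff.
  by congr (limn _); apply/funext => n /=; rewrite sumEFin.
rewrite -nneseriesZl; last first.
- by move=> k _; rewrite lee_fin /exp_coeff divr_ge0// exprn_ge0// divr_ge0// ltW.
apply: eq_eseriesr => k _; rewrite /f.
under eq_integral do rewrite EFinM.
have pk0 : 0 < p + k%:R by rewrite ltr_wpDr// p_gt0.
rewrite ge0_integralZl//; first [exact: mu1|by rewrite lee_fin|
  by move=> u _; rewrite lee_fin mulr_ge0 ?powR_ge0 ?expR_ge0|idtac].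
rewrite integral_powR_expRN// -!EFinM; congr EFin.
rewrite /bessel_coef /exp_coeff opprD powRD; last by rewrite (gt_eqF s0) implybT.
rewrite [s `^ (- k%:R)]powRN powR_mulrn ?(ltW s0)//= expr_div_n.
have g0 := Gamma_gt0 pk0.
by field; rewrite !(gt_eqF _) ?exprn_gt0 ?ltr0n ?fact_gt0.
Qed.

End BesselSeries.

(** * Laplace transforms at the hitting time *)

Section HittingTransform.
Context {R : realType} {disp : measure_display} {T : measurableType disp}
  (P : probability T R) {d : nat} (hd : (2 <= d)%N)
  {x v : 'rV[R]_d} {B : R -> T -> 'rV[R]_d} (hB : brownian P x B)
  (r : R) (hr : 0 < r) (hx0 : 0 < enorm x) (hxr : enorm x <> r).
Local Notation mu := (@lebesgue_measure R).
Local Notation tau := (@hit_time R disp T d v B r).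
Local Notation Z := (@hit_val R disp T d v B r).

(** The Bessel index attached to degree n. The exponent of the kernel is larger by one, as in
    [kern_laplace] and [besselIE]. *)
Let m n : R := nu_of (R := R) (d := d) + n%:R.
Let p n : R := d%:R / 2 + n%:R.

Let pE n : p n = m n + 1. Proof. by rewrite /p /m /nu_of; field. Qed.

Let m_ge0 n : 0 <= m n.
Proof. by rewrite addr_ge0// divr_ge0// subr_ge0 (ler_nat _ 2). Qed.

Let p_ge1 n : 1 <= p n. Proof. by rewrite pE lerDr. Qed.

Definition start_val n : R := expR (- dotv v x) * zonal_fun v n x.

Let tau_ge0 w : 0 <= tau w. Proof. exact: (hit_time_ge0 hB hxr). Qed.
Let mtau : measurable_fun [set: T] tau. Proof. exact: (measurable_hit_time hB hxr). Qed.
Let mZ n : measurable_fun [set: T] (Z n). Proof. exact: (measurable_hit_val hB hxr). Qed.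
Let Z0_ge0 w : 0 <= Z 0 w. Proof. exact: hit_val0_ge0. Qed.

Let Z_dom (f : T -> R) n : measurable_fun [set: T] f -> (forall w, 0 <= f w) ->
  P.-integrable setT (fun w => (Z 0 w * f w)%:E) ->
  P.-integrable setT (fun w => (Z n w * f w)%:E).
Proof.
move=> mf f0 i0.
pose C := (4 * (nu_of (R := R) (d := d) + 1) * enorm v) ^+ n * r ^+ n.
apply: (@le_integrable _ _ _ P setT measurableT _ (fun w => (C%:E * (Z 0 w * f w)%:E)%E)) => //.
- by apply/measurable_EFinP; exact: measurable_funM.
- move=> w _; rewrite -EFinM !abse_EFin lee_fin; apply: le_trans (ler_norm _).
  rewrite normrM (ger0_norm (f0 w)) mulrA ler_wpM2r//.
  exact: (hit_val_bound hd hB hxr).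
- exact: integrableZl.
Qed.

Let mexp u : measurable_fun [set: T] (fun w => expR (- (u * tau w))).
Proof.
apply: measurableT_comp => //; apply: (measurableT_comp (continuous_measurable_fun opp_continuous)).
exact: measurable_funM.
Qed.

Section Outer.
Hypothesis rx : r < enorm x.

Let kap n u rho : R := 2 * (Num.sqrt (2 * u) / rho) `^ (m n) *
  besselK (m n) (rho * Num.sqrt (2 * u)).

Let kap_int n u rho : 0 < rho -> 0 < u ->
  (\int[mu]_a (expR (- (u * a)) * kern (p n) rho a)%:E = (kap n u rho)%:E)%E.
Proof. by move=> rho0 u0; rewrite pE kern_laplace. Qed.

Let kap_gt0 n u rho : 0 < rho -> 0 < u -> 0 < kap n u rho.
Proof.
move=> rho0 u0; have b0 : 0 < Num.sqrt (2 * u) by rewrite sqrtr_gt0 mulr_gt0.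
rewrite !mulr_gt0 ?powR_gt0 ?divr_gt0//.
by have [] := besselK_gt0 (m_ge0 n) (mulr_gt0 rho0 b0).
Qed.

Let g n u (z : T * R) : R := expR (- (u * z.2)) * kern (p n) r (z.2 - tau z.1).

Let g_ge0 n u z : 0 <= g n u z. Proof. by rewrite mulr_ge0 ?expR_ge0 ?kern_ge0. Qed.

Let mg n u : measurable_fun [set: T * R] (g n u).
Proof.
apply: measurable_funM.
  apply: measurableT_comp => //; apply: (measurableT_comp (continuous_measurable_fun opp_continuous)).
  exact: measurable_funM.
apply: (measurableT_comp (measurable_kern _ _)).
by apply: measurable_funB => //; exact: measurableT_comp.
Qed.

Let g_int n u : 0 < u -> forall w,
  (\int[mu]_a (g n u (w, a))%:E = (expR (- (u * tau w)) * kap n u r)%:E)%E.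
Proof. by move=> u0 w; rewrite /g /= kern_shift kap_int// EFinM. Qed.

(** For a > 0 this is [outer_hitting_identity] multiplied by e^(-ua); for a <= 0 both kernels vanish
    because tau >= 0. *)
Let Zg_int n u a : 0 < u -> (\int[P]_w (Z n w * g n u (w, a))%:E =
  (start_val n * (expR (- (u * a)) * kern (p n) (enorm x) a))%:E)%E.
Proof.
move=> u0; have [a0|a0] := leP a 0.
  rewrite integral0_eq; first by rewrite /kern ltNge a0 mul0r !mulr0.
  move=> w _; rewrite /g /kern /= subr_gt0 ltNge (le_trans a0)//.
  by rewrite mul0r !mulr0.
have [i1 e1] := @outer_hitting_identity R disp T P d hd x v B hB r hr hxr n a a0 rx.
have e w : (Z n w * g n u (w, a))%:E =
    ((expR (- (u * a)))%:E * (@outer_integrand R disp T d v B r n a w)%:E)%E.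
  by rewrite /g /kern /outer_integrand /= subr_gt0 -EFinM; congr EFin; ring.
under eq_integral do rewrite e; rewrite integralZl// e1 -EFinM; congr EFin.
rewrite /heat_fun /start_val /kern a0 subr0 gtr0_norm// mulr0 mul0r sub0r -sqr_enorm.
by rewrite expRD -/(p n) mul1r; ring.
Qed.

Let total n u : 0 < u -> (\int[mu]_a \int[P]_w (Z n w * g n u (w, a))%:E =
  (start_val n * kap n u (enorm x))%:E)%E.
Proof.
move=> u0; under eq_integral do rewrite Zg_int// EFinM.
rewrite integralZl//; first by rewrite kap_int// EFinM.
have mk : measurable_fun [set: R] (fun a => (expR (- (u * a)) * kern (p n) (enorm x) a)%:E).
  apply/measurable_EFinP; apply: measurable_funM; last exact: measurable_kern.
  apply: measurableT_comp => //; apply: (measurableT_comp (continuous_measurable_fun opp_continuous)).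
  exact: measurable_funM.
apply/integrableP; split => //.
have nk a : 0 <= expR (- (u * a)) * kern (p n) (enorm x) a.
  by rewrite mulr_ge0 ?expR_ge0 ?kern_ge0.
under eq_integral do rewrite abse_EFin (ger0_norm (nk _)).
by rewrite kap_int// ltry.
Qed.

(** In degree 0 everything is nonnegative, so Tonelli yields a finite value without prior
    integrability. The other degrees are dominated by this one through [Z_dom]. *)
Lemma outer_integrable0 u : 0 < u ->
  P.-integrable setT (fun w => (Z 0 w * expR (- (u * tau w)))%:E).
Proof.
move=> u0; have k0 := kap_gt0 0 hr u0.
have := tonelli_kernel P (mZ 0) (mg 0 u) (g_ge0 0 u) (g_int 0 u0) Z0_ge0.
rewrite total// => e.
apply/integrableP; split.
  by apply/measurable_EFinP; apply: measurable_funM => //; exact: mexp.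
have nz w : 0 <= Z 0 w * expR (- (u * tau w)) by rewrite mulr_ge0 ?expR_ge0.
under eq_integral do rewrite abse_EFin (ger0_norm (nz _)).
have : (\int[P]_w ((kap 0 u r)%:E * (Z 0 w * expR (- (u * tau w)))%:E) =
    (start_val 0 * kap 0 u (enorm x))%:E)%E.
  by rewrite -e; apply: eq_integral => w _; rewrite -EFinM; congr EFin; ring.
rewrite ge0_integralZl//; first last.
- by rewrite lee_fin ltW.
- by move=> w _; rewrite lee_fin mulr_ge0 ?expR_ge0.
- by apply/measurable_EFinP; apply: measurable_funM => //; exact: mexp.
case: (\int[P]_w _)%E => [q||]; first by rewrite ltry.
  by rewrite gt0_muley ?lte_fin.
by rewrite gt0_muleNy ?lte_fin.
Qed.

(* Integrating [outer_hitting_identity] against [e^{-ua} da] over a > 0 turns both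
   sides into Laplace transforms, and the Gaussian kernels into [besselK]. *)
Lemma outer_transform n u : 0 < u ->
  P.-integrable setT (fun w => (Z n w * expR (- (u * tau w)))%:E) /\
  (\int[P]_w (Z n w * expR (- (u * tau w)))%:E =
   (start_val n * (r `^ m n * besselK (m n) (enorm x * Num.sqrt (2 * u))
     / (enorm x `^ m n * besselK (m n) (r * Num.sqrt (2 * u)))))%:E)%E.
Proof.
move=> u0; have k0 := kap_gt0 n hr u0.
have iZ : P.-integrable setT (fun w => (Z n w * expR (- (u * tau w)))%:E).
  apply: Z_dom; [exact: mexp|by move=> w; exact: expR_ge0|exact: outer_integrable0].
split => //.
have e1 w : (Z n w * (expR (- (u * tau w)) * kap n u r))%:E =
    ((kap n u r)%:E * (Z n w * expR (- (u * tau w)))%:E)%E.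
  by rewrite -EFinM; congr EFin; ring.
have [|_] := fubini_kernel (P := P) (mZ n) (mg n u) (g_ge0 n u) (g_int n u0).
  by under eq_fun do rewrite e1; exact: integrableZl.
rewrite total//; under eq_integral do rewrite e1; rewrite integralZl//.
have fin := integrable_fin_num measurableT iZ.
rewrite -(fineK fin) -EFinM => h; have {}h := EFin_inj h; congr EFin.
set I := fine _ in h *.
apply: (mulfI (lt0r_neq0 k0)); rewrite h.
have b0 : 0 < Num.sqrt (2 * u) by rewrite sqrtr_gt0 mulr_gt0.
have [_ K1] := besselK_gt0 (m_ge0 n) (mulr_gt0 hr b0).
rewrite /kap !powRM ?invr_ge0 ?(ltW b0) ?(ltW hr) ?(ltW hx0)//.
have powV (y : R) : 0 < y -> y^-1 `^ m n = (y `^ m n)^-1.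
  by move=> y0; rewrite -powR_inv1 ?ltW// -powRrM mulN1r powRN.
rewrite !powV//.
have q1 : r `^ m n != 0 by rewrite gt_eqF// powR_gt0.
have q2 : enorm x `^ m n != 0 by rewrite gt_eqF// powR_gt0.
have q3 : besselK (m n) (r * Num.sqrt (2 * u)) != 0 by rewrite gt_eqF.
move: q1 q2 q3; set a1 := r `^ _; set a2 := enorm x `^ _; set a3 := besselK _ (r * _).
by move=> q1 q2 q3; field; rewrite q1 q2 q3.
Qed.

End Outer.

Section Inner.
Hypothesis xr : enorm x < r.

Let J n c u : R := bessel_entire (p n) (c * u).
Let cr : R := r ^+ 2 / 2.
Let cx : R := enorm x ^+ 2 / 2.
Let cr0 : 0 <= cr. Proof. by rewrite divr_ge0 ?sqr_ge0. Qed.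
Let cx0 : 0 <= cx. Proof. by rewrite divr_ge0 ?sqr_ge0. Qed.

Let M n u : \bar R := (\int[P]_w (Z n w * expR (- (u * tau w)))%:E)%E.

Let iZ0 : P.-integrable setT (fun w => (Z 0 w)%:E).
Proof. exact: (inner_integrable0 hd hB hr hxr xr). Qed.

Let iZu n u : 0 <= u -> P.-integrable setT (fun w => (Z n w * expR (- (u * tau w)))%:E).
Proof.
move=> u0; apply: Z_dom; [exact: mexp|by move=> w; exact: expR_ge0|].
apply: (@le_integrable _ _ _ P setT measurableT _ (fun w => (Z 0 w)%:E)) => //.
- by apply/measurable_EFinP; apply: measurable_funM => //; exact: mexp.
move=> w _; rewrite !abse_EFin lee_fin normrM ler_piMr// ger0_norm ?expR_ge0//.
by rewrite -[leRHS]expR0 ler_expR oppr_le0 mulr_ge0.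
Qed.

(** The second component is the rate u of the Laplace transform in tau. Integrating over u gives the
    kernel of [inner_integrand] at s by [bessel_entire_laplace]; integrating over P gives the
    transform of tau at u. *)
Let g n s (z : T * R) : R := (0 < z.2)%R%:R * (expR (- (z.2 * (s + tau z.1))) *
  z.2 `^ (p n - 1) * J n cr z.2).

Let J_gt0 n c u : 0 <= c -> 0 < u -> 0 < J n c u.
Proof. by move=> c0 u0; apply: bessel_entire_gt0 => //; rewrite mulr_ge0// ltW. Qed.

Let g_ge0 n s z : 0 <= g n s z.
Proof.
rewrite /g; case: ltP => [z0|_]; last by rewrite mul0r.
by rewrite mul1r !mulr_ge0 ?expR_ge0 ?powR_ge0// ltW// J_gt0.
Qed.

Let mJ n c : measurable_fun [set: R] (J n c).
Proof.
apply: (measurableT_comp (f := bessel_entire (p n))).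
  by apply: continuous_measurable_fun; exact: continuous_bessel_entire.
exact: measurable_funM.
Qed.

Let mg n s : measurable_fun [set: T * R] (g n s).
Proof.
apply: measurable_funM; first exact: measurable_gt_indic.
apply: measurable_funM; last exact: (measurableT_comp (mJ n cr)).
apply: measurable_funM; last exact: (measurableT_comp (measurable_powR (p n - 1))).
apply: measurableT_comp => //; apply: (measurableT_comp (continuous_measurable_fun opp_continuous)).
apply: measurable_funM => //; apply: measurable_funD => //; exact: measurableT_comp.
Qed.

Let psi n s w : R := (s + tau w) `^ (- p n) * expR (cr / (s + tau w)).

Let g_int n s : 0 < s -> forall w, (\int[mu]_a (g n s (w, a))%:E = (psi n s w)%:E)%E.
Proof.
by move=> s0 w; rewrite /g /= bessel_entire_laplace// ltr_wpDr.
Qed.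

Let h n c (u : R) : R := (0 < u)%R%:R * (u `^ (p n - 1) * J n c u).

Let Zg_int n s u : 0 < s -> (\int[P]_w (Z n w * g n s (w, u))%:E =
  (expR (- (s * u)) * h n cr u * fine (M n u))%:E)%E.
Proof.
move=> s0; have [u0|u0] := leP u 0.
  rewrite integral0_eq; first by rewrite /h ltNge u0 mul0r mulr0 mul0r.
  by move=> w _; rewrite /g /= ltNge u0 mul0r mulr0.
have e w : (Z n w * g n s (w, u))%:E =
    ((expR (- (s * u)) * h n cr u)%:E * (Z n w * expR (- (u * tau w)))%:E)%E.
  by rewrite /g /h /= u0 !mul1r mulrDr opprD expRD -EFinM [u * s]mulrC; congr EFin; ring.
under eq_integral do rewrite e.
rewrite integralZl//; last exact: (iZu n (ltW u0)).
by rewrite [RHS]EFinM fineK//; apply: integrable_fin_num => //; exact: (iZu n (ltW u0)).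
Qed.

Let inner_eq n s : 0 < s ->
  mu.-integrable setT (fun u => (expR (- (s * u)) * h n cr u * fine (M n u))%:E) /\
  (\int[mu]_u (expR (- (s * u)) * h n cr u * fine (M n u))%:E =
   (start_val n * (s `^ (- p n) * expR (cx / s)))%:E)%E.
Proof.
move=> s0; have [i1 e1] := @inner_hitting_identity R disp T P d hd x v B hB r hr hxr xr n s s0.
have e w : (Z n w * psi n s w)%:E = (@inner_integrand R disp T d v B r n s w)%:E.
  have q : r ^+ 2 / (2 * (s + tau w)) = cr / (s + tau w) by rewrite /cr invfM mulrA.
  by rewrite /psi /inner_integrand q; congr EFin; ring.
have [|i2 e2] := fubini_kernel (P := P) (mZ n) (mg n s) (g_ge0 n s) (g_int n s0).
  by under eq_fun do rewrite e.
split.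
  have -> : (fun u => (expR (- (s * u)) * h n cr u * fine (M n u))%:E) =
      (fun u => \int[P]_w (Z n w * g n s (w, u))%:E)%E.
    by apply/funext => u; rewrite Zg_int.
  exact: i2.
under eq_integral do rewrite -Zg_int//.
rewrite -e2; under eq_integral do rewrite e.
rewrite e1 /heat_fun /start_val subr0 normrN gtr0_norm// mulr0 mul0r sub0r expRD -/(p n).
have -> : - (dotv x x / (2 * - s)) = cx / s.
  by rewrite -sqr_enorm /cx; field; rewrite gt_eqF.
by congr EFin; ring.
Qed.

Let h_int n s : 0 < s -> mu.-integrable setT (fun u => (expR (- (s * u)) * h n cx u)%:E) /\
  (\int[mu]_u (expR (- (s * u)) * h n cx u)%:E = (s `^ (- p n) * expR (cx / s))%:E)%E.
Proof.
move=> s0.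
have e : (\int[mu]_u (expR (- (s * u)) * h n cx u)%:E = (s `^ (- p n) * expR (cx / s))%:E)%E.
  rewrite -(bessel_entire_laplace (p_ge1 n) cx0 s0); apply: eq_integral => u _.
  by rewrite /h [u * s]mulrC; congr EFin; rewrite /J; ring.
have h0 u : 0 <= h n cx u.
  rewrite /h; case: ltP => [u0|_]; last by rewrite mul0r.
  by rewrite mul1r mulr_ge0 ?powR_ge0// ltW// J_gt0.
split=> //; apply/integrableP; split.
  apply/measurable_EFinP; apply: measurable_funM.
    apply: measurableT_comp => //; apply: (measurableT_comp (continuous_measurable_fun opp_continuous)).
    exact: measurable_funM.
  apply: measurable_funM; first exact: measurable_gt_indic.
  by apply: measurable_funM; [exact: measurable_powR|exact: mJ].
have nh u : 0 <= expR (- (s * u)) * h n cx u by rewrite mulr_ge0 ?expR_ge0.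
under eq_integral do rewrite abse_EFin (ger0_norm (nh _)).
by rewrite e ltry.
Qed.

Let cont_M n (y : R) : 0 < y -> {for y, continuous (fun u => fine (M n u))}.
Proof.
move=> y0; have := @continuity_under_integral R disp T P (fun u w => Z n w * expR (- (u * tau w)))
  setT measurableT 0 (y + 1).
move=> /(_ _ _ (fun w => `|Z n w|)); apply.
- by move=> u; rewrite /= in_itv/= => /andP[u0 _]; exact: (iZu n (ltW u0)).
- apply: aeW => w _ u _; apply: cvgM; first exact: cvg_cst.
  apply: continuous_cvg; first exact: continuous_expR.
  by apply: cvgN; apply: cvgM; [exact: cvg_id|exact: cvg_cst].
- have := iZu n (lexx 0); under eq_fun do rewrite mul0r oppr0 expR0 mulr1.
  by move=> /integrable_abse.
- move=> u; rewrite /= in_itv/= => /andP[u0 _]; apply: aeW => w _.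
  rewrite normrM ler_piMr// ger0_norm ?expR_ge0//.
  by rewrite -[leRHS]expR0 ler_expR oppr_le0 mulr_ge0// ltW.
- by apply: mem_set; rewrite /= in_itv/= y0 ltrDl ltr01.
Qed.

(** The two functions of u have the same Laplace transform at all s = 1 + k. The weight e^(-u) makes
    them integrable, and the maximum with 0 can replace u because both vanish for u <= 0. Uniqueness
    equates their integrals over ]0, t], and continuity equates them at y. *)
Let M_E n (y : R) : 0 < y -> fine (M n y) * J n cr y = start_val n * J n cx y.
Proof.
move=> y0; pose h1 u := expR (- (1 * u)) * h n cr u * fine (M n u).
pose h2 u := expR (- (1 * u)) * (start_val n * h n cx u).
have h2E s u : (expR (- (s * u)) * (start_val n * h n cx u))%:E =
  ((start_val n)%:E * (expR (- (s * u)) * h n cx u)%:E)%E.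
  by rewrite -EFinM; congr EFin; ring.
have ih1 : mu.-integrable setT (EFin \o h1) by have [] := inner_eq n ltr01.
have ih2 : mu.-integrable setT (EFin \o h2).
  rewrite (_ : EFin \o h2 = (fun u => (start_val n)%:E * (expR (- (1 * u)) * h n cx u)%:E)%E).
    by apply: integrableZl => //; have [] := h_int n ltr01.
  by apply/funext => u; rewrite /= h2E.
have h_le0 c u : u <= 0 -> h n c u = 0 by move=> u0; rewrite /h ltNge u0 mul0r.
have lap (k : nat) : (\int[mu]_u (h1 u * expR (- (k%:R * Num.max 0 u)))%:E =
    \int[mu]_u (h2 u * expR (- (k%:R * Num.max 0 u)))%:E)%E.
  have k1 : 0 < 1 + k%:R :> R by rewrite ltr_wpDr.
  transitivity (start_val n * ((1 + k%:R) `^ (- p n) * expR (cx / (1 + k%:R))))%:E.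
    rewrite -(inner_eq n k1).2; apply: eq_integral => u _; rewrite /h1; congr EFin.
    have [u0|u0] := leP u 0; first by rewrite h_le0// !(mulr0, mul0r).
    by rewrite mulrDl opprD expRD; ring.
  rewrite EFinM -(h_int n k1).2 -integralZl//; last exact: (h_int n k1).1.
  apply: eq_integral => u _; rewrite -h2E /h2; congr EFin.
  have [u0|u0] := leP u 0; first by rewrite h_le0// !(mulr0, mul0r).
  by rewrite mulrDl opprD expRD; ring.
have mmaxR : measurable_fun [set: R] (fun u : R => Num.max 0 u).
  by apply: continuous_measurable_fun => u; apply: continuous_max; [exact: cvg_cst|exact: cvg_id].
have mmax : measurable_fun [set: measurableTypeR R] ((fun u : R => Num.max 0 u) : measurableTypeR R -> R).
  exact: mmaxR.
have max0 (u : R) : 0 <= Num.max 0 u by rewrite le_max lexx.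
have U t := @laplace_uniqueness R _ (measurableTypeR R) mu _ (measurableTypeR R) mu
  h1 _ h2 _ max0 max0 mmax mmax ih1 ih2 lap t.
pose f u := h1 u - h2 u.
have if_ : mu.-integrable setT (EFin \o f).
  by have := integrableB measurableT ih1 ih2; apply: eq_integrable => // u _; rewrite /= EFinB.
have f_int t : 0 < t -> (\int[mu]_(u in `]0%R, t]) (f u)%:E = 0)%E.
  move=> t0; have := U t (ltW t0).
  have rest hh : (forall u, u <= 0 -> hh u = 0) ->
      (\int[mu]_u (hh u * (Num.max 0 u <= t)%R%:R)%:E = \int[mu]_(u in `]0%R, t]) (hh u)%:E)%E.
    move=> hh0; rewrite [RHS]integral_mkcond; apply: eq_integral => u _; rewrite patchE.
    case: ifPn => [|/negP]; rewrite inE/= in_itv/=.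
      by move=> /andP[u0 ut]; rewrite ge_max (ltW t0) ut mulr1.
    move=> hn; have [u0|u0] := leP u 0; first by rewrite hh0// mul0r.
    case: leP => ut; last by rewrite mulr0.
    by exfalso; apply: hn; rewrite u0 ut.
  rewrite !rest => [e| |]; first last.
  - by move=> u u0; rewrite /h1 h_le0// mulr0 mul0r.
  - by move=> u u0; rewrite /h2 h_le0// !mulr0.
  have sub : `]0%R, t]%classic `<=` [set: R] by [].
  have j1 : mu.-integrable `]0%R, t] (EFin \o h1) by apply: integrableS ih1.
  have j2 : mu.-integrable `]0%R, t] (EFin \o h2) by apply: integrableS ih2.
  rewrite /f; under eq_integral do rewrite EFinB.
  rewrite integralB// e subee//; exact: integrable_fin_num.
have ch c : 0 <= c -> {for y, continuous (h n c)}.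
  move=> c0; have : {for y, continuous (fun u => u `^ (p n - 1) * J n c u)}.
    apply: cvgM; first exact: continuous_powR_at.
    apply: (@continuous_comp _ _ _ (fun u : R => c * u) (bessel_entire (p n))).
      by apply: cvgM; [exact: cvg_cst|exact: cvg_id].
    exact: continuous_bessel_entire.
  have hy : h n c y = y `^ (p n - 1) * J n c y by rewrite /h y0 mul1r.
  rewrite /prop_for /continuous_at hy => hc; apply: cvg_trans hc; apply: near_eq_cvg.
  by apply: filterS (lt_nbhsr y0) => u u0; rewrite /h u0 mul1r.
have cE : {for y, continuous (fun u : R => expR (- (1 * u)))}.
  apply: continuous_cvg; first exact: continuous_expR.
  by apply: cvgN; apply: cvgM; [exact: cvg_cst|exact: cvg_id].
have cf : {for y, continuous f}.
  apply: cvgB; apply: cvgM => //.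
  - by apply: cvgM => //; exact: ch.
  - exact: cont_M.
  - by apply: cvgM; [exact: cvg_cst|exact: ch].
have := @eq0_of_integrals R f y y0 _ f_int cf; rewrite /f => H.
have : h1 y = h2 y.
  apply/eqP; rewrite -subr_eq0; apply/eqP; apply: H => t t0.
  by apply: integrableS if_.
rewrite /h1 /h2 /h y0 !mul1r.
have q1 : expR (- y) != 0 by rewrite gt_eqF ?expR_gt0.
have q2 : y `^ (p n - 1) != 0 by rewrite gt_eqF ?powR_gt0.
move=> e; apply: (mulfI q1); apply: (mulfI q2).
by transitivity (expR (- y) * (y `^ (p n - 1) * J n cr y) * fine (M n y)); [ring|rewrite e; ring].
Qed.

(* Both sides of [inner_hitting_identity] are Laplace transforms in s of functions
   of u involving [bessel_entire]; uniqueness and continuity in u equate these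
   functions. *)
Lemma inner_transform n u : 0 < u ->
  P.-integrable setT (fun w => (Z n w * expR (- (u * tau w)))%:E) /\
  (\int[P]_w (Z n w * expR (- (u * tau w)))%:E =
   (start_val n * (r `^ m n * besselI (m n) (enorm x * Num.sqrt (2 * u))
     / (enorm x `^ m n * besselI (m n) (r * Num.sqrt (2 * u)))))%:E)%E.
Proof.
move=> u0; have iu := iZu n (ltW u0); split => //.
have fM : M n u \is a fin_num by exact: integrable_fin_num.
rewrite -[LHS](fineK fM); congr EFin.
have b0 : 0 < Num.sqrt (2 * u) by rewrite sqrtr_gt0 mulr_gt0.
have b2 : Num.sqrt (2 * u) ^+ 2 = 2 * u by rewrite sqr_sqrtr// mulr_ge0 ?ltW.
have Jr := J_gt0 n cr0 u0.
have e := M_E n u0.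
have arg rho : (rho * Num.sqrt (2 * u)) ^+ 2 / 4 = rho ^+ 2 / 2 * u.
  by rewrite exprMn b2; field.
rewrite !besselIE ?mulr_gt0// !arg -pE -/cr -/cx -/(J n cr u) -/(J n cx u).
have -> : fine (M n u) = start_val n * J n cx u / J n cr u by rewrite -e mulfK// gt_eqF.
have hs (rho : R) : 0 < rho -> (rho * Num.sqrt (2 * u) / 2) `^ m n =
    rho `^ m n * (Num.sqrt (2 * u) / 2) `^ m n.
  by move=> rho0; rewrite -mulrA powRM// ltW// divr_gt0.
rewrite !hs//.
have q1 : r `^ m n != 0 by rewrite gt_eqF// powR_gt0.
have q2 : enorm x `^ m n != 0 by rewrite gt_eqF// powR_gt0.
have q3 : J n cr u != 0 by rewrite gt_eqF.
have q4 : (Num.sqrt (2 * u) / 2) `^ m n != 0 by rewrite gt_eqF// powR_gt0// divr_gt0.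
move: q1 q2 q3 q4; set a1 := r `^ _; set a2 := enorm x `^ _; set a3 := J n cr u.
set a4 := (_ / 2) `^ _; by move=> q1 q2 q3 q4; field; rewrite q1 q2 q3 q4.
Qed.

End Inner.

End HittingTransform.

(** * Bessel hitting densities *)

Section HittingTimeLaw.
Context {R : realType} {disp : measure_display} {T : measurableType disp}
  (P : probability T R).
Local Notation mu := (@lebesgue_measure R).

(** The same two limits as for [alive]: grid points at a fixed positive level, then the level to
    0. *)
Lemma measurable_first_zero_gt (Y : R -> T -> R) (s : R) : 0 <= s ->
  (forall t, 0 <= t -> measurable_fun [set: T] (Y t)) ->
  (forall w, continuous (fun t : R => Y (Num.max 0 t) w)) ->
  (forall w, 0 < Y 0 w) ->
  measurable_fun [set: T]
    (fun w => (s%:E < first_zero (fun t => Y (Num.max 0%R t) w))%E%:R : R).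
Proof.
move=> s0 mY cY Y0; pose q w (t : R) := Y (Num.max 0 t) w.
have q0 w : 0 < q w 0 by rewrite /q maxxx.
pose G c (M : nat) w : R := \prod_(j < M.+2) (c <= q w (s * j%:R / M.+1%:R))%R%:R.
pose C c w : R := (`[< forall u, 0 <= u <= s -> c <= q w u >])%:R.
have mG c M : measurable_fun [set: T] (G c M).
  apply: measurable_bigprod => j _; apply: measurable_ge_indic.
  by rewrite /q; apply: mY; rewrite le_max lexx.
have cG c w : G c ^~ w @ \oo --> C c w.
  rewrite /C; case: asboolP => h.
    apply: cvg_near_cst; apply: nearW => M; apply: big1 => j _.
    rewrite h// divr_ge0 ?mulr_ge0// ler_pdivrMr ?ltr0n//.
    by rewrite ler_wpM2l// ler_nat -ltnS.
  apply: cvg_near_cst.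
  have [u us pu] : exists2 u, 0 <= u <= s & q w u < c.
    apply: contrapT => hn; apply: h => u us; rewrite leNgt; apply/negP => pu.
    by apply: hn; exists u.
  have := grid_below (@cY w) us pu; apply: filterS => M [j jM pj].
  by apply/eqP/prodf_eq0; exists (Ordinal (jM : (j < M.+2)%N)) => //=; rewrite leNgt pj.
have mC c : measurable_fun [set: T] (C c).
  by apply: (measurable_fun_cvg (mG c)) => w _; exact: cG.
apply: (@measurable_fun_cvg _ _ R setT (fun m => C m.+1%:R^-1)) => // w _.
have h := lt_first_zeroP (@cY w) (q0 w) s0.
apply: cvg_near_cst; case: (ltP s%:E (first_zero (q w))) => hs.
  have [c c0 hc] := min_positive (@cY w) s0 (h.1 hs).
  near=> m; rewrite /C; case: asboolP => // -[] u us.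
  apply: le_trans (hc u us); rewrite -(invrK c) lef_pV2 ?posrE ?invr_gt0 ?ltr0n//.
  apply: (@le_trans _ _ m%:R); last by rewrite ler_nat.
  by near: m; exact: nbhs_infty_ger.
apply: nearW => m; rewrite /C; case: asboolP => // hm; exfalso.
move: hs; rewrite leNgt => /negP; apply; apply/h => u us.
by apply: lt_le_trans (hm u us); rewrite invr_gt0.
Unshelve. all: by end_near. Qed.

(** The sign e makes e (Y - r) positive at the start, so that the hitting time is a first zero. *)
Lemma measurable_hitting_time (Y : R -> T -> R) (a r t : R) : 0 <= t -> a <> r ->
  (forall t, 0 <= t -> measurable_fun [set: T] (Y t)) -> (forall w, Y 0 w = a) ->
  (forall w, {within `[0, +oo[, continuous (Y ^~ w)}) ->
  measurable [set w | (hitting_time (Y ^~ w) r <= t%:E)%E].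
Proof.
move=> t0 ar mY Y0 cY; pose e : R := if a < r then -1 else 1.
have e0 : e != 0 by rewrite /e; case: ifP; rewrite ?oner_eq0 ?oppr_eq0 ?oner_eq0.
pose Z t w := e * (Y t w - r).
have hE w : hitting_time (Y ^~ w) r = first_zero (fun t => Z (Num.max 0%R t) w).
  congr ereal_inf; apply/seteqP; split => [_ [u [u0 ur] <-]|_ [u [u0 ur] <-]];
    exists u => //; split => //; move: ur; rewrite /Z (max_idPr u0).
    by move=> ->; rewrite subrr mulr0.
  by move=> /eqP; rewrite mulf_eq0 (negbTE e0)/= subr_eq0 => /eqP.
have m := @measurable_first_zero_gt Z t t0.
have -> : [set w | (hitting_time (Y ^~ w) r <= t%:E)%E] =
    (fun w => (t%:E < first_zero (fun t => Z (Num.max 0%R t) w))%E%:R : R) @^-1` [set 0].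
  apply/seteqP; split => w /=; rewrite hE leNgt.
    by move=> /negbTE ->.
  by case: (_ < _)%E => //= /eqP; rewrite oner_eq0.
rewrite -[_ @^-1` _]setTI; apply: m => //.
- move=> u u0; apply: measurable_funM => //; apply: measurable_funB => //; exact: mY.
- move=> w u; apply: cvgM; first exact: cvg_cst.
  apply: cvgB; last exact: cvg_cst.
  by have := continuous_max0 (@cY w) (x := u).
- move=> w; rewrite /Z Y0 /e; case: (ltgtP a r) => h; try by rewrite ?mulN1r ?oppr_gt0 ?subr_lt0 ?mul1r ?subr_gt0.
Qed.

(** The definition prescribes only the integrals over ]0, t]. Being probabilities they lie in
    [0, 1], which forces integrability; being monotone in t they force the sign. *)
Lemma density_of_time_facts (sigma : T -> \bar R) (q : R -> R) :
  (forall t, 0 <= t -> measurable [set w | (sigma w <= t%:E)%E]) ->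
  density_of_time P sigma q ->
  [/\ mu.-integrable `]0%R, +oo[ (EFin \o q),
      {ae mu, forall t, 0 < t -> 0 <= q t} &
      (\int[mu]_(t in `]0%R, +oo[) `|(q t)%:E| <= 1)%E].
Proof.
move=> ms [mq hq].
have sub (t : R) : `]0, t]%classic `<=` (`]0, +oo[%classic : set R).
  by move=> u /=; rewrite !in_itv/= andbT => /andP[].
have mqt t : measurable_fun (`]0%R, t]%classic : set R) (EFin \o q).
  by apply/measurable_EFinP; exact: measurable_funS (sub t) mq.
have P1 t : 0 <= t -> (\int[mu]_(s in `]0%R, t]) (q s)%:E <= 1)%E.
  by move=> t0; rewrite -hq//; exact/probability_le1/ms.
have P0 t : 0 <= t -> (0 <= \int[mu]_(s in `]0%R, t]) (q s)%:E)%E.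
  by move=> t0; rewrite -hq.
have iq t : 0 < t -> mu.-integrable `]0%R, t] (EFin \o q).
  move=> t0; have := P1 t (ltW t0); have := P0 t (ltW t0); rewrite integralE.
  set A := (\int[mu]_(x in _) _^\+ x)%E; set A' := (\int[mu]_(x in _) _^\- x)%E.
  have A0 : (0 <= A)%E by apply: integral_ge0 => s _; exact: funepos_ge0.
  have A'0 : (0 <= A')%E by apply: integral_ge0 => s _; exact: funeneg_ge0.
  move=> h0 h1; apply/integrableP; split; first exact: mqt.
  have -> : (\int[mu]_(x in `]0%R, t]) `|(EFin \o q) x| = A + A')%E.
    rewrite -ge0_integralD//.
    - by apply: eq_integral => s _; rewrite -[RHS]/((((EFin \o q) ^\+) \+ ((EFin \o q) ^\-))%E s) -fune_abse.
    - by apply: measurable_funepos; exact: mqt.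
    - by apply: measurable_funeneg; exact: mqt.
  (* The difference of the two parts lies in [0, 1]. Since +oo - +oo is -oo in this arithmetic,
     neither part can be infinite. *)
  by move: A0 A'0 h0 h1; case: A => [x||]; case: A' => [y||] //=; rewrite ltry.
pose F t := fine (P [set w | (sigma w <= (Num.max 0 t)%:E)%E]).
have ndF : {homo F : s t / s <= t}.
  move=> s t st; rewrite fine_le ?fin_num_measure//; try by apply: ms; rewrite le_max lexx.
  apply: le_measure; rewrite ?inE; try by apply: ms; rewrite le_max lexx.
  move=> w /= /le_trans; apply; rewrite lee_fin ge_max !le_max lexx /=.
  by rewrite st orbT.
have qF t : 0 < t -> (\int[mu]_(u in `]0%R, t]) (q u)%:E = (F t)%:E)%E.
  move=> t0; rewrite -hq ?(ltW t0)// /F (max_idPr (ltW t0)) fineK//.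
  by rewrite fin_num_measure//; apply: ms; exact: ltW.
have q0 := ge0_of_integrals iq ndF qF.
have U : \bigcup_n `]0, n%:R]%classic = (`]0, +oo[%classic : set R).
  apply/seteqP; split => [y [n _] /(sub _)//|y /=]; rewrite in_itv/= andbT => y0.
  have [n hn] := truncn_bound y; exists n => //=; rewrite in_itv/= y0 /=.
  by apply: le_trans hn; exact: ler_norm.
have bnd : (\int[mu]_(t in `]0%R, +oo[) `|(q t)%:E| <= 1)%E.
  rewrite -U; have c : (fun n : nat => \int[mu]_(t in `]0%R, n%:R]) `|(q t)%:E|)%E @ \oo -->
      (\int[mu]_(t in \bigcup_n `]0%R, n%:R]%classic) `|(q t)%:E|)%E.
    apply: ge0_nondecreasing_set_cvg_integral => //.
    - move=> k n kn; apply/subsetPset; apply: subset_itvl; rewrite bnd_simp/=.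
      by rewrite ler_nat.
    - by move=> n; apply: measurableT_comp => //; exact: mqt.
  rewrite -(cvg_lim _ c)//; apply: lime_le; first exact: cvgP c.
  apply: nearW => n; apply: le_trans (P1 n%:R _) => //.
  rewrite le_eqVlt; apply/orP; left; apply/eqP; apply: ae_eq_integral => //.
  - by apply: measurableT_comp => //; exact: mqt.
  - exact: mqt.
  move: q0; apply: filterS; first exact: (ae_filter_ringOfSetsType mu).
  move=> t ht /=; rewrite in_itv/= => /andP[t0 _].
  by rewrite ger0_norm// ht.
split=> //; apply/integrableP; split; first exact/measurable_EFinP.
by apply: le_lt_trans bnd _; rewrite ltry.
Qed.

End HittingTimeLaw.

Lemma bessel_hitting_density_facts {R : realType} (m a r : R) (q : R -> R) : a <> r ->
  bessel_hitting_density m a r q ->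
  [/\ measurable_fun (`]0, +oo[ : set R) q,
      lebesgue_measure.-integrable `]0%R, +oo[ (EFin \o q),
      {ae (@lebesgue_measure R), forall t, 0 < t -> 0 <= q t} &
      (\int[@lebesgue_measure R]_(t in `]0%R, +oo[) `|(q t)%:E| <= 1)%E].
Proof.
move=> ar [disp [T [P [X [bX dq]]]]].
have [h1 h2 h3] : _ := density_of_time_facts (P := P) (fun t t0 =>
  @measurable_hitting_time _ _ _ _ _ _ _ t0 ar (bessel_measurable bX) (bessel_start bX)
    (bessel_continuous bX)) dq.
by split => //; case: dq.
Qed.

(** * Gegenbauer polynomials *)

Section PowerSeries.
Context {R : realType}.
Implicit Types (f a : nat -> R) (t : R).

Definition geom_bounded f := exists C A : R,
  [/\ 0 <= C, 1 <= A & forall n, `|f n| <= C * A ^+ n].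

Definition shiftr_seq f n : R := if n is k.+1 then f k else 0.

Lemma geom_cvg f (C A t : R) : 1 <= A -> (forall n, `|f n| <= C * A ^+ n) ->
  A * `|t| < 1 -> cvgn (pseries f t).
Proof.
move=> A1 fA At; apply: normed_cvg.
have A0 : 0 <= A by exact: le_trans A1.
have C0 : 0 <= C by have := le_trans (normr_ge0 _) (fA 0%N); rewrite expr0 mulr1.
apply: (series_le_cvg (v_ := geometric C (A * `|t|))).
- by move=> n /=; exact: normr_ge0.
- by move=> n; rewrite /geometric/= mulr_ge0 ?exprn_ge0 ?mulr_ge0.
- move=> n; rewrite /geometric/= normrM normrX exprMn mulrA ler_wpM2r ?exprn_ge0//.
- by apply: is_cvg_geometric_series; rewrite ger0_norm// mulr_ge0.
Qed.

Lemma geom_diffs f (C A : R) : 0 <= C -> 1 <= A -> (forall n, `|f n| <= C * A ^+ n) ->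
  forall n, `|pseries_diffs f n| <= C * A * (2 * A) ^+ n.
Proof.
move=> C0 A1 fA n; have A0 : 0 <= A by exact: le_trans A1.
rewrite /pseries_diffs normrM ger0_norm//.
apply: (@le_trans _ _ (n.+1%:R * (C * A ^+ n.+1))); first by rewrite ler_wpM2l.
have h : n.+1%:R <= 2 ^+ n :> R by rewrite -natrX ler_nat ltn_expl.
rewrite exprMn exprS; apply: (@le_trans _ _ (2 ^+ n * (C * (A * A ^+ n)))).
  by rewrite ler_wpM2r// !mulr_ge0// exprn_ge0.
by rewrite le_eqVlt; apply/orP; left; apply/eqP; ring.
Qed.

Lemma geom_derive f : geom_bounded f -> exists2 rho, 0 < rho & forall t, `|t| < rho ->
  [/\ cvgn (pseries f t), cvgn (pseries (pseries_diffs f) t) &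
   is_derive t 1 (fun t => limn (pseries f t)) (limn (pseries (pseries_diffs f) t))].
Proof.
move=> [C [A [C0 A1 fA]]]; have A0 : 0 < A by exact: lt_le_trans A1.
(* The sequence and its first two formal derivatives grow at the rates A, 2A and 4A, all below
   8A. *)
pose K := (8 * A)^-1; have K0 : 0 < K by rewrite invr_gt0 mulr_gt0.
have AK : A * K = 8^-1 by rewrite /K invfM mulrCA divff ?mulr1// gt_eqF.
have d1 := geom_diffs C0 A1 fA.
have A2 : 1 <= 2 * A by lra.
have CA : 0 <= C * A by rewrite mulr_ge0// ltW.
have d2 := geom_diffs CA A2 d1.
have A4 : 1 <= 2 * (2 * A) by lra.
have cv (s : R) : `|s| <= K -> [/\ cvgn (pseries f s), cvgn (pseries (pseries_diffs f) s) &
    cvgn (pseries (pseries_diffs (pseries_diffs f)) s)].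
  move=> sK; have AsK : A * `|s| <= 8^-1 by rewrite -AK ler_wpM2l// ltW.
  split; [apply: (geom_cvg A1 fA)|apply: (geom_cvg A2 d1)|apply: (geom_cvg A4 d2)]; lra.
exists K => // t tK; have [c1 c2 _] := cv t (ltW tK).
have [|k1 k2 k3] := cv K; first by rewrite gtr0_norm.
split => //; apply: (pseries_snd_diffs k1 k2 k3).
by rewrite [ltRHS]gtr0_norm.
Qed.

Lemma pseries0 f : limn (pseries f 0) = f 0%N.
Proof.
have e n : pseries f 0 n.+1 = f 0%N.
  rewrite /pseries/= /series/= big_nat_recl//= expr0 mulr1 big1 ?addr0// => i _.
  by rewrite expr0n mulr0.
apply: cvg_lim => //; rewrite -(cvg_shiftS (pseries f 0)).
by rewrite (_ : [sequence pseries f 0 n.+1]_n = fun=> f 0%N); [exact: cvg_cst|apply/funext => n; exact: e].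
Qed.

Lemma cvg_pseries_shiftr f t l : pseries f t @ \oo --> l ->
  pseries (shiftr_seq f) t @ \oo --> t * l.
Proof.
move=> c; rewrite -(cvg_shiftS (pseries (shiftr_seq f) t)).
have e n : pseries (shiftr_seq f) t n.+1 = t * pseries f t n.
  rewrite /pseries/= /series/= big_nat_recl//= mul0r add0r mulr_sumr.
  by apply: eq_bigr => i _; rewrite exprS mulrCA.
rewrite (_ : [sequence pseries (shiftr_seq f) t n.+1]_n = fun n => t * pseries f t n).
  by apply: cvgM => //; exact: cvg_cst.
by apply/funext => n; exact: e.
Qed.

Lemma pseries_head0 a : geom_bounded a ->
  (exists2 rho, 0 < rho & forall t, 0 < `|t| < rho -> pseries a t @ \oo --> (0 : R)) ->
  a 0%N = 0.
Proof.
move=> ga [rho rho0 za]; have [rho' rho'0 D] := geom_derive ga.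
have [|_ _ [dL _]] := D 0; first by rewrite normr0.
have cL : (fun t => limn (pseries a t)) t @[t --> (0 : R)] --> a 0%N.
  rewrite -(pseries0 a); apply: differentiable_continuous; exact/derivable1_diffP.
have c1 : (fun t => limn (pseries a t)) t @[t --> (0 : R)^'] --> a 0%N.
  by apply: cvg_trans cL; apply: cvg_app; exact: cvg_within.
have c2 : (fun t => limn (pseries a t)) t @[t --> (0 : R)^'] --> (0 : R).
  apply: cvg_near_cst; near=> t; apply: cvg_lim => //; apply: za.
  apply/andP; split; last by near: t; exact: dnbhs0_lt.
  by rewrite normr_gt0; near: t; exact: nbhs_dnbhs_neq.
exact: (cvg_unique _ c1 c2).
Unshelve. all: by end_near. Qed.

(** Once the head is known to vanish, dividing by t shifts the sequence but loses the point t = 0;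
    this is why the hypothesis concerns a punctured neighbourhood. *)
Lemma pseries_uniq a : geom_bounded a ->
  (exists2 rho, 0 < rho & forall t, 0 < `|t| < rho -> pseries a t @ \oo --> (0 : R)) ->
  forall n, a n = 0.
Proof.
move=> ga za n; elim: n a ga za => [|n IH] a ga za; first exact: pseries_head0.
have a0 := pseries_head0 ga za; case: za => rho rho0 za.
apply: (IH (fun k => a k.+1)).
  case: ga => M [A [M0 A1 aA]]; exists (M * A), A; split => //.
    by rewrite mulr_ge0// (le_trans _ A1).
  by move=> k; rewrite -mulrA -exprS.
exists rho => // t tr; have := za t tr; rewrite -(cvg_shiftS (pseries a t)).
have t0 : t != 0 by rewrite -normr_gt0; case/andP: tr.
rewrite (_ : [sequence pseries a t k.+1]_k = fun k => t * pseries (fun k => a k.+1) t k); last first.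
  apply/funext => k; rewrite /pseries/= /series/= big_nat_recl//= a0 mul0r add0r mulr_sumr.
  by apply: eq_bigr => i _; rewrite exprS mulrCA.
move=> c.
have -> : pseries (fun k => a k.+1) t = (fun k => t^-1 * (t * pseries (fun k => a k.+1) t k)).
  by apply/funext => k; rewrite mulKf.
by rewrite -(mulr0 t^-1); apply: cvgM => //; exact: cvg_cst.
Qed.

End PowerSeries.

Section Gegenbauer.
Context {R : realType} (C : R -> nat -> {poly R}) (hC : gegenbauer C).
Variable xi : R.
Hypothesis xi1 : `|xi| <= 1.

Section PositiveIndex.
Variable nu : R.
Hypothesis nu0 : 0 < nu.

Let f n : R := (C nu n).[xi].
Let b (t : R) : R := 1 - 2 * t * xi + t ^+ 2.

Let b_gt0 t : `|t| < 1 -> 0 < b t.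
Proof.
move=> t1; have h : t * xi <= `|t|.
  by rewrite (le_trans (ler_norm _))// normrM ler_piMr.
have : t ^+ 2 = `|t| ^+ 2 by rewrite real_normK ?num_real.
by rewrite /b => ->; have := normr_ge0 t; nra.
Qed.

Let cvg_f t : `|t| < 1 -> pseries f t @ \oo --> b t `^ (- nu).
Proof. exact: (gegenbauer_gen hC nu0 xi1). Qed.

(** Convergence of the generating series at t = 1/2 bounds f n / 2^n. *)
Let gf : geom_bounded f.
Proof.
have h : `|2^-1 : R| < 1 by rewrite ger0_norm// invf_lt1// ltr1n.
have c : cvgn (pseries f 2^-1) by apply: cvgP (cvg_f h).
have c0 := cvg_series_cvg_0 c.
have [M [M0 HM]] := cvg_seq_bounded (cvgP _ c0).
have h1 := HM (M + 1) (ltr_pwDr ltr01 (lexx M)).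
exists (`|M| + 1), 2; split; [by rewrite addr_ge0|by rewrite ler1n|move=> n].
have := h1 n I; rewrite /= normrM normrX (ger0_norm (x := 2^-1))// exprVn.
rewrite ler_pdivrMr ?exprn_gt0// => /le_trans; apply.
by rewrite ler_wpM2r ?exprn_ge0// lerD2r ler_norm.
Qed.

(** The generating function G satisfies (1 - 2 t xi + t^2) G' = 2 nu (xi - t) G. *)
Let ode : exists2 rho, 0 < rho & forall t, `|t| < rho ->
  exists l l', [/\ pseries f t @ \oo --> l, pseries (pseries_diffs f) t @ \oo --> l' &
    b t * l' + nu * (2 * t - 2 * xi) * l = 0].
Proof.
have [rho rho0 D] := geom_derive gf.
exists (Num.min rho 1) => [|t]; first by rewrite lt_min rho0 ltr01.
rewrite lt_min => /andP[tr t1]; have [c1 c2 dL] := D t tr.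
exists (b t `^ (- nu)), (limn (pseries (pseries_diffs f) t)); split => //.
  exact: cvg_f.
have bt := b_gt0 t1.
have db : is_derive t 1 b (- (2 * xi) + 2 * t).
  have h1 : is_derive t 1 (fun t : R => 1 - 2 * t * xi) (- (2 * xi)).
    have h := is_deriveB (is_derive_cst (1 : R) t 1)
      (is_deriveM (is_deriveM (is_derive_cst (2 : R) t 1) (is_derive_id t 1)) (is_derive_cst xi t 1)).
    by apply: (is_derive_eq h); rewrite /GRing.scale/= !(mulr0, add0r, addr0, mulr1, mul0r, sub0r) mulrC.
  have h2 := is_deriveD h1 (is_deriveX 2 (is_derive_id t (1 : R))).
  by apply: (is_derive_eq h2); rewrite /GRing.scale/= expr1 mulr1 mulr_natl.
pose g (t : R) := expR (- nu * ln (b t)).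
have dg : is_derive t 1 g (expR (- nu * ln (b t)) * (- nu * ((b t)^-1 * (- (2 * xi) + 2 * t)))).
  have d1 := @is_derive1_comp R (@ln R) b t _ _ (is_derive1_ln bt) db.
  have d2 : is_derive t 1 (fun t => - nu * ln (b t)) (- nu * ((b t)^-1 * (- (2 * xi) + 2 * t))).
    have h := is_deriveM (is_derive_cst (- nu) t 1) d1.
    by apply: (is_derive_eq h); rewrite /GRing.scale/= mulr0 addr0.
  exact: (@is_derive1_comp R expR (fun t => - nu * ln (b t)) t _ _ (is_derive_expR _) d2).
have e : limn (pseries (pseries_diffs f) t) = 'D_1 g t.
  have -> : limn (pseries (pseries_diffs f) t) = 'D_1 (fun t => limn (pseries f t)) t.
    by have [_ ->] := dL.
  apply: near_eq_derive; near=> s.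
  have s1 : `|s| < 1.
    near: s; have cn : `|s| @[s --> t] --> `|t| by apply: cvg_norm; exact: cvg_id.
    exact: (cvgr_lt `|t| cn).
  rewrite (cvg_lim _ (cvg_f s1))// /g /powR gt_eqF// b_gt0//.
rewrite e; have [_ ->] := dg.
have -> : b t `^ (- nu) = expR (- nu * ln (b t)) by rewrite /powR gt_eqF.
have bn : b t != 0 by rewrite gt_eqF.
by field; rewrite bn.
Unshelve. all: by end_near. Qed.

(** The n-th coefficient of the differential equation; multiplication by t is the shift
    [shiftr_seq]. *)
Let e n : R := pseries_diffs f n - 2 * xi * shiftr_seq (pseries_diffs f) n
  + shiftr_seq (shiftr_seq (pseries_diffs f)) n + 2 * nu * shiftr_seq f n - 2 * nu * xi * f n.

Let ge : geom_bounded e.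
Proof.
have [K [A [K0 A1 fA]]] := gf; have A0 : 0 <= A by exact: le_trans A1.
have d1 := geom_diffs K0 A1 fA.
pose Y := K * A; have Y0 : 0 <= Y by rewrite mulr_ge0.
pose B := 2 * A; have B1 : 1 <= B by rewrite /B; lra.
have B0 : 0 <= B by exact: le_trans B1.
have pow n : B ^+ n <= B ^+ n.+1 by rewrite exprS ler_peMl// exprn_ge0.
have sh (g : nat -> R) (L : R) : 0 <= L -> (forall n, `|g n| <= L * B ^+ n) ->
    forall n, `|shiftr_seq g n| <= L * B ^+ n.
  move=> L0 gL [|n] /=; first by rewrite normr0 mulr_ge0// exprn_ge0.
  by rewrite (le_trans (gL n))// ler_wpM2l.
have fB n : `|f n| <= K * B ^+ n.
  rewrite (le_trans (fA n))// ler_wpM2l// lerXn2r ?nnegrE// /B; lra.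
exists (Y + 2 * Y + Y + 2 * nu * K + 2 * nu * K), B; split => //.
  by rewrite !addr_ge0 ?mulr_ge0// ltW.
move=> n; have h1 := d1 n; have h2 := sh _ _ Y0 d1 n; have h3 := sh _ _ Y0 (sh _ _ Y0 d1) n.
have h4 := sh _ _ K0 fB n; have h5 := fB n; rewrite -/Y -/B in h1 h2 h3.
have q2 : `|2 * xi * shiftr_seq (pseries_diffs f) n| <= 2 * (Y * B ^+ n).
  rewrite -mulrA normrM ger0_norm// ler_wpM2l// normrM -[leRHS]mul1r.
  by apply: ler_pM.
have q4 : `|2 * nu * shiftr_seq f n| <= 2 * nu * (K * B ^+ n).
  by rewrite normrM ger0_norm ?mulr_ge0 ?(ltW nu0)// ler_wpM2l ?mulr_ge0 ?(ltW nu0).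
have q5 : `|2 * nu * xi * f n| <= 2 * nu * (K * B ^+ n).
  rewrite -mulrA normrM ger0_norm ?mulr_ge0 ?(ltW nu0)// ler_wpM2l ?mulr_ge0 ?(ltW nu0)//.
  by rewrite normrM -[leRHS]mul1r; apply: ler_pM.
have -> : (Y + 2 * Y + Y + 2 * nu * K + 2 * nu * K) * B ^+ n =
  Y * B ^+ n + 2 * (Y * B ^+ n) + Y * B ^+ n + 2 * nu * (K * B ^+ n) + 2 * nu * (K * B ^+ n) by ring.
rewrite /e.
apply: le_trans (ler_normB _ _) _; apply: lerD => //.
apply: le_trans (ler_normD _ _) _; apply: lerD => //.
apply: le_trans (ler_normD _ _) _; apply: lerD => //.
by apply: le_trans (ler_normB _ _) _; apply: lerD.
Qed.

Let e0 n : e n = 0.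
Proof.
apply: pseries_uniq ge _ n.
have [rho rho0 D] := ode; exists rho => // t /andP[_ tr].
have [l [l' [cl cl' E]]] := D t tr.
have cs := cvg_pseries_shiftr cl'; have css := cvg_pseries_shiftr cs.
have csf := cvg_pseries_shiftr cl.
have -> : pseries e t = (fun n => pseries (pseries_diffs f) t n
    - 2 * xi * pseries (shiftr_seq (pseries_diffs f)) t n
    + pseries (shiftr_seq (shiftr_seq (pseries_diffs f))) t n
    + 2 * nu * pseries (shiftr_seq f) t n - 2 * nu * xi * pseries f t n).
  apply/funext => n; rewrite /pseries/= /series/= !mulr_sumr -!(sumrN, big_split)/=.
  by apply: eq_bigr => i _; rewrite /e; ring.
have -> : 0 = l' - 2 * xi * (t * l') + t * (t * l') + 2 * nu * (t * l) - 2 * nu * xi * l.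
  by rewrite -E /b; ring.
apply: cvgB; last by apply: cvgM => //; exact: cvg_cst.
apply: cvgD; last by apply: cvgM => //; exact: cvg_cst.
apply: cvgD => //; apply: cvgB => //.
by apply: cvgM => //; exact: cvg_cst.
Qed.

Let f0 : f 0%N = 1.
Proof.
have h : `|0 : R| < 1 by rewrite normr0 ltr01.
have <- : limn (pseries f 0) = f 0%N by exact: pseries0.
have -> : limn (pseries f 0) = b 0 `^ (- nu) by apply: cvg_lim => //; exact: cvg_f.
by rewrite /b !(mulr0, mul0r) subr0 expr0n addr0 powR1.
Qed.

(** The vanishing of e is the recurrence (n + 2) f(n+2) = 2 xi (nu + n + 1) f(n+1) - (n + 2 nu)
    f(n); multiplied by nu + n + 2 and divided by n + 2 it is the recurrence of [zonal]. *)
Lemma gegenbauer_zonal n : (nu + n%:R) * f n = nu * zonal nu xi 1 n.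
Proof.
suff [] : (nu + n%:R) * f n = nu * zonal nu xi 1 n /\
  (nu + n.+1%:R) * f n.+1 = nu * zonal nu xi 1 n.+1 by [].
elim: n => [|n [IH1 IH2]].
  rewrite f0 /= addr0 !mulr1; split => //.
  have := e0 0%N; rewrite /e /pseries_diffs /= f0 => h.
  have -> : f 1%N = 2 * nu * xi by lra.
  by ring.
split=> //; have h := e0 n.+1; rewrite /e /pseries_diffs /= in h.
have sh : shiftr_seq (fun i => i.+1%:R * f i.+1) n = n%:R * f n.
  by case: (n) => [|k] //=; rewrite mul0r.
rewrite sh in h.
have zE : zonal nu xi 1 n.+2 = (nu + n.+2%:R) / n.+2%:R *
    (2 * xi * zonal nu xi 1 n.+1 - zonal_coef nu n * 1 * zonal nu xi 1 n) by [].
have zc : zonal_coef nu n * (nu + n%:R) = n%:R + 2 * nu.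
  rewrite /zonal_coef; case: (n) => [|k]; first by rewrite addr0 add0r.
  by rewrite [nu + _]addrC divfK// gt_eqF// addr_gt0.
rewrite zE.
have n2 : n.+2%:R != 0 :> R by [].
have h1 : n.+2%:R * f n.+2 = 2 * xi * ((nu + n.+1%:R) * f n.+1) - (n%:R + 2 * nu) * f n.
  move: h; rewrite -[n.+1%:R]natr1; lra.
rewrite -zc in h1.
have -> : nu * ((nu + n.+2%:R) / n.+2%:R *
    (2 * xi * zonal nu xi 1 n.+1 - zonal_coef nu n * 1 * zonal nu xi 1 n)) =
  (nu + n.+2%:R) / n.+2%:R * (2 * xi * (nu * zonal nu xi 1 n.+1)
    - zonal_coef nu n * (nu * zonal nu xi 1 n)) by ring.
rewrite -IH1 -IH2 [zonal_coef nu n * _]mulrA -h1.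
by rewrite mulrA divfK.
Qed.

End PositiveIndex.

(** Multiplied by n, the explicit sum is 2 cos(n theta) for xi = cos theta, so it obeys the
    Chebyshev recurrence. This is checked on single terms; [Tm] is padded with zeros so that sums
    for different degrees can share a range. *)
Lemma gegenbauer_zonal0 n : (0 < n)%N -> n%:R * (C 0 n).[xi] = zonal 0 xi 1 n.
Proof.
pose Tm k m : R := if (m.*2 <= k)%N then (-1) ^+ m *
  (k%:R * ((k - m).-1)`!%:R / (m`!%:R * (k - m.*2)`!%:R)) * (2 * xi) ^+ (k - m.*2) else 0.
pose S k : R := \sum_(0 <= m < k.+1) Tm k m.
have SM k M : (k < M)%N -> \sum_(0 <= m < M) Tm k m = S k.
  move=> kM; rewrite (big_cat_nat (n := k.+1))//= [X in _ + X]big1_seq ?addr0//.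
  move=> m; rewrite mem_index_iota => /andP[_ /andP[km _]].
  by rewrite /Tm ifN// -ltnNge -addnn ltn_addr.
have CS k : (0 < k)%N -> k%:R * (C 0 k).[xi] = S k.
  move=> k0; rewrite (gegenbauer_0n hC)// mulr_sumr.
  have kk : (k./2.+1 <= k.+1)%N by rewrite ltnS; lia.
  rewrite /S [in RHS](big_cat_nat (n := k./2.+1))//= [X in _ = _ + X]big1_seq ?addr0; last first.
    move=> m; rewrite mem_index_iota => /andP[_ /andP[km _]].
    by rewrite /Tm ifN//; lia.
  rewrite !big_nat; apply: eq_bigr => m /andP[_ mk].
  have m2 : (m.*2 <= k)%N by lia.
  have km : (k - m = (k - m).-1.+1)%N by lia.
  rewrite /Tm m2 {1}km !Gamma_nat; ring.
have A j : j.+1%:R * j`!%:R / j.+1`!%:R = 1 :> R.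
  have f0 : j`!%:R != 0 :> R by rewrite pnatr_eq0 -lt0n fact_gt0.
  have k1 : j.+1%:R != 0 :> R by [].
  move: f0 k1; rewrite factS natrM; move: (j.+1%:R) (j`!%:R) => u w w0 u0.
  by field; rewrite w0 u0.
have T0 k : Tm k.+2 0%N = 2 * xi * Tm k.+1 0%N.
  rewrite /Tm double0 !subn0 !leq0n !expr0 fact0 !mul1r -!pred_Sn.
  rewrite (A k.+1) (A k).
  by rewrite !mul1r exprS.
have TS k m : (0 < k)%N -> Tm k.+2 m.+1 = 2 * xi * Tm k.+1 m.+1 - Tm k m.
  move=> k0; rewrite /Tm doubleS !ltnS.
  case: (leqP m.*2 k) => mk; last by rewrite ifN ?mulr0 ?subr0//; lia.
  have [j jE] : exists j, k = (m.*2 + j)%N by exists (k - m.*2)%N; rewrite subnKC.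
  have fm : m`!%:R != 0 :> R by rewrite pnatr_eq0 -lt0n fact_gt0.
  have m1 : m.+1%:R != 0 :> R by [].
  have fj i : i`!%:R != 0 :> R by rewrite pnatr_eq0 -lt0n fact_gt0.
  have e1 : (k.+2 - m.*2.+2 = j)%N by lia.
  have e2 : (k - m.*2 = j)%N by lia.
  have e3 : ((k.+2 - m.+1).-1 = (m + j))%N by lia.
  rewrite e1 e2 e3 exprS; case: j jE e1 e2 e3 => [|j] jE e1 e2 e3.
    (* Here k = 2m: the term of degree 0 in xi, to which the middle degree k + 1 contributes
       nothing. *)
    rewrite ifN; last by lia.
    have e4 : ((k - m).-1 = m.-1)%N by lia.
    have mp : (0 < m)%N by lia.
    rewrite e4 jE !addn0 expr0 mulr0 sub0r fact0 !mulr1.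
    have -> : m.*2.+2%:R = 2 * m.+1%:R :> R by rewrite -natrM; congr _%:R; lia.
    have -> : m.*2%:R = 2 * m%:R :> R by rewrite -natrM; congr _%:R; lia.
    have -> : 2 * m.+1%:R * m`!%:R / m.+1`!%:R = 2 :> R.
      by have := A m; rewrite -!mulrA => ->; rewrite mulr1.
    have -> : 2 * m%:R * (m.-1)`!%:R / m`!%:R = 2 :> R.
      by have := A m.-1; rewrite (prednK mp) -!mulrA => ->; rewrite mulr1.
    by rewrite mulN1r mulNr.
  rewrite ifT; last by lia.
  have e4 : ((k - m).-1 = (m + j))%N by lia.
  have e5 : (k.+1 - m.*2.+2 = j)%N by lia.
  rewrite e5 subSS !e4 addnS !factS !natrM !exprS.
  have j1 : j.+1%:R != 0 :> R by [].
  have kR : k%:R = 2 * m%:R + j%:R + 1 :> R.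
    by rewrite jE -addnn !natrD -natr1; ring.
  have k1R : k.+1%:R = 2 * m%:R + j%:R + 2 :> R by rewrite -natr1 kR; ring.
  have k2R : k.+2%:R = 2 * m%:R + j%:R + 3 :> R by rewrite -natr1 k1R; ring.
  have mjR : (m + j).+1%:R = m%:R + j%:R + 1 :> R by rewrite -natr1 natrD.
  rewrite kR k1R k2R mjR -[m.+1%:R]natr1 -[j.+1%:R]natr1.
  rewrite -natr1 in m1; rewrite -natr1 in j1.
  by field; rewrite m1 j1 fm fj.
have SS k : (0 < k)%N -> S k.+2 = 2 * xi * S k.+1 - S k.
  move=> k0; rewrite /S big_nat_recl//= T0.
  under eq_bigr do rewrite TS//.
  rewrite sumrB SM// addrA; congr (_ - _).
  by rewrite -mulr_sumr -mulrDr; congr (_ * _); rewrite -big_nat_recl// SM.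
suff H k : S k.+1 = zonal 0 xi 1 k.+1 /\ S k.+2 = zonal 0 xi 1 k.+2.
  by case: n => // n _; rewrite CS//; have [] := H n.
elim: k => [|k [IH1 IH2]].
  split.
    rewrite /S !big_nat_recr//= big_geq// /Tm /= !add0r addr0 fact0.
    by rewrite !(mul1r, mulr1, expr0, expr1, divr1, invr1, add0r).
  rewrite /S !big_nat_recr//= big_geq// /Tm /= addr0 add0r.
  rewrite !fact0 (_ : 1`! = 1)%N// (_ : 2`! = 2)%N//.
  by rewrite !add0r /zonal_coef; field.
split=> //; rewrite SS// IH1 IH2.
have zE : zonal 0 xi 1 k.+3 = (0 + k.+3%:R) / k.+3%:R *
    (2 * xi * zonal 0 xi 1 k.+2 - zonal_coef 0 k.+1 * 1 * zonal 0 xi 1 k.+1) by [].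
rewrite zE add0r divff// mul1r /zonal_coef mulr0 !addr0 divff// !mul1r.
by [].
Qed.

End Gegenbauer.

(** * The plane-wave expansion *)

Section PlaneWave.
Context {R : realType} (nu : R) (nu0 : 0 <= nu).

Let pos (n : nat) : 0 < nu + n.+1%:R.
Proof. by rewrite ltr_wpDl. Qed.

(** The coefficient of Q^k Z_n in the expansion of e^L, a term of total degree n + 2k. The sum over
    k at fixed n is [plane_coef]. *)
Definition wave_coef (n k : nat) : R :=
  Gamma (nu + 1) * 2^-1 ^+ (n + k.*2) * bessel_coef (nu + n%:R + 1) k.

Definition plane_coef (Q : R) (n : nat) : R :=
  Gamma (nu + 1) * 2^-1 ^+ n * bessel_entire (nu + n%:R + 1) (Q / 4).

Let nu1 n : 1 <= nu + n%:R + 1.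
Proof. by rewrite lerDr addr_ge0. Qed.

Let wave_coefSl n k : wave_coef n k = 2 * (nu + n.+1%:R + k%:R) * wave_coef n.+1 k.
Proof.
have g0 : 0 < nu + n.+1%:R + k%:R by rewrite ltr_wpDr// pos.
rewrite /wave_coef /bessel_coef addSn exprS.
have -> : nu + n.+1%:R + 1 + k%:R = (nu + n.+1%:R + k%:R) + 1 by ring.
rewrite (GammaS g0).
have -> : nu + n%:R + 1 + k%:R = nu + n.+1%:R + k%:R by rewrite -natr1; ring.
have := Gamma_gt0 g0; move: g0; set a := nu + n.+1%:R + k%:R => a0 ga.
have k0 : 0 < k`!%:R :> R by rewrite ltr0n fact_gt0.
by field; rewrite !gt_eqF.
Qed.

Let wave_coefSr n k : wave_coef n.+1 k = 2 * k.+1%:R * wave_coef n k.+1.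
Proof.
have g0 : 0 < nu + n%:R + 1 + k.+1%:R by rewrite ltr_wpDr// (lt_le_trans ltr01).
rewrite /wave_coef /bessel_coef doubleS !addnS addSn !exprS factS natrM.
have -> : nu + n.+1%:R + 1 + k%:R = nu + n%:R + 1 + k.+1%:R.
  by rewrite -natr1 -[k.+1%:R]natr1; ring.
have := Gamma_gt0 g0; move: (Gamma _) => a a0.
have k0 : 0 < k`!%:R :> R by rewrite ltr0n fact_gt0.
have k1 : 0 < k.+1%:R :> R by [].
move: (k`!%:R : R) (k.+1%:R : R) k0 k1 => f s f0 s0.
by field; rewrite !gt_eqF.
Qed.

Lemma fact_Gamma_le n : n`!%:R * Gamma (nu + 1) <= Gamma (nu + n%:R + 1).
Proof.
elim: n => [|n IH]; first by rewrite fact0 mul1r addr0.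
rewrite [leRHS]GammaS//; have -> : nu + n.+1%:R = nu + n%:R + 1 by rewrite -natr1 addrA.
rewrite factS natrM -mulrA; apply: ler_pM => //.
  by rewrite mulr_ge0// ltW// Gamma_gt0// ltr_wpDl.
by rewrite -natr1 -addrA lerDr.
Qed.

Lemma wave_coef_ge0 n k : 0 <= wave_coef n k.
Proof.
rewrite !mulr_ge0 ?exprn_ge0//; first by rewrite ltW// Gamma_gt0// ltr_wpDl.
by rewrite ltW// bessel_coef_gt0.
Qed.

Lemma wave_coef_le n k : wave_coef n k <= 2^-1 ^+ n / n`!%:R * (4^-1 ^+ k / k`!%:R).
Proof.
have n0 : 0 < n`!%:R :> R by rewrite ltr0n fact_gt0.
have g0 : 0 < Gamma (nu + 1) by apply: Gamma_gt0; rewrite ltr_wpDl.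
have g1 : 0 < Gamma (nu + n%:R + 1) by apply: Gamma_gt0; exact: lt_le_trans (nu1 n).
have e : 2^-1 ^+ (n + k.*2) = 2^-1 ^+ n * 4^-1 ^+ k :> R.
  rewrite exprD -mul2n exprM; congr (_ * _ ^+ _).
  by rewrite expr2 -invfM; congr _^-1; ring.
rewrite /wave_coef e; have h := bessel_coef_le k (nu1 n).
have G : Gamma (nu + 1) * (Gamma (nu + n%:R + 1))^-1 <= n`!%:R^-1.
  by rewrite ler_pdivrMr// mulrC ler_pdivlMr// mulrC fact_Gamma_le.
apply: (@le_trans _ _ (Gamma (nu + 1) * (2^-1 ^+ n * 4^-1 ^+ k) *
    ((Gamma (nu + n%:R + 1))^-1 / k`!%:R))).
  by rewrite ler_wpM2l// !mulr_ge0 ?exprn_ge0// ltW.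
have -> : Gamma (nu + 1) * (2^-1 ^+ n * 4^-1 ^+ k) * ((Gamma (nu + n%:R + 1))^-1 / k`!%:R) =
  Gamma (nu + 1) * (Gamma (nu + n%:R + 1))^-1 * (2^-1 ^+ n * (4^-1 ^+ k / k`!%:R)) by ring.
apply: (@le_trans _ _ (n`!%:R^-1 * (2^-1 ^+ n * (4^-1 ^+ k / k`!%:R)))).
  by rewrite ler_wpM2r// !mulr_ge0 ?exprn_ge0.
by rewrite le_eqVlt; apply/orP; left; apply/eqP; ring.
Qed.

Lemma exp_partial_le (x : R) n : 0 <= x -> series (exp_coeff x) n <= expR x.
Proof.
move=> x0; apply: nondecreasing_cvgn_le; last exact: is_cvg_series_exp_coeff.
apply/nondecreasing_seqP => k; rewrite /series/= big_nat_recr//= lerDl.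
by rewrite /exp_coeff/= divr_ge0// exprn_ge0.
Qed.

Let cvg_plane Q n : (fun K => \sum_(0 <= k < K) wave_coef n k * Q ^+ k) @ \oo --> plane_coef Q n.
Proof.
have -> : (fun K => \sum_(0 <= k < K) wave_coef n k * Q ^+ k) =
    (fun K => Gamma (nu + 1) * 2^-1 ^+ n * pseries (bessel_coef (nu + n%:R + 1)) (Q / 4) K).
  apply/funext => K; rewrite /pseries/= /series/= mulr_sumr; apply: eq_bigr => k _.
  rewrite /wave_coef exprMn exprD -mul2n exprM.
  have -> : 2^-1 ^+ 2 = 4^-1 :> R by rewrite expr2 -invfM; congr _^-1; ring.
  by ring.
by apply: cvgM; [exact: cvg_cst|exact: is_cvg_bessel].
Qed.

Lemma plane_coef_ge0 Q n : 0 <= Q -> 0 <= plane_coef Q n.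
Proof.
move=> Q0; rewrite !mulr_ge0 ?exprn_ge0//; first by rewrite ltW// Gamma_gt0// ltr_wpDl.
by rewrite ltW// bessel_entire_gt0// divr_ge0.
Qed.

Lemma plane_coef_le Q n : 0 <= Q -> plane_coef Q n <= 2^-1 ^+ n / n`!%:R * expR (Q / 4).
Proof.
move=> Q0; have c := @cvg_plane Q n; rewrite -(cvg_lim _ c)//.
apply: limr_le; first exact: cvgP c.
apply: nearW => K; apply: (@le_trans _ _
    (\sum_(0 <= k < K) 2^-1 ^+ n / n`!%:R * exp_coeff (Q / 4) k)).
  apply: ler_sum => k _; rewrite /exp_coeff/= exprMn.
  have -> : 2^-1 ^+ n / n`!%:R * (Q ^+ k * 4^-1 ^+ k / k`!%:R) =
     2^-1 ^+ n / n`!%:R * (4^-1 ^+ k / k`!%:R) * Q ^+ k :> R by ring.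
  by rewrite ler_wpM2r ?exprn_ge0// wave_coef_le.
rewrite -mulr_sumr ler_wpM2l ?mulr_ge0 ?exprn_ge0//.
by apply: exp_partial_le; rewrite divr_ge0.
Qed.

Variables L Q S : R.
Hypotheses (LS : `|L| <= S) (Q0 : 0 <= Q) (QS : Q <= S ^+ 2).
Local Notation Z := (zonal nu L Q).

Let t n k : R := wave_coef n k * Q ^+ k * Z n.
(** The factor n + 2k is the Euler degree of a term. It is split so that A is the part reached from
    degree n - 1 and B the part reached from degree n + 1 under multiplication by L. *)
Let A n k : R := n%:R / (nu + n%:R) * (nu + n%:R + k%:R) * t n k.
Let B n k : R := k%:R * zonal_coef nu n * t n k.

Let AB n k : A n k + B n k = (n + k.*2)%:R * t n k.
Proof.
rewrite /A /B -mulrDl; congr (_ * _); rewrite -muln2 natrD natrM /zonal_coef.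
case: n => [|n]; first by rewrite mul0r mul0r !add0r.
have := pos n; rewrite [n.+1%:R + nu]addrC; move: (n.+1%:R) => s p.
by field; rewrite gt_eqF.
Qed.

(** The three-term recurrence solved for L Z_n: one term raises n at the same k, the other lowers n
    and turns the factor Q into one more power. Both raise n + 2k by one. *)
Let Lt n k : L * t n k = A n.+1 k + (if n is m.+1 then B m k.+1 else 0).
Proof.
have g0 : nu + n.+1%:R != 0 by rewrite gt_eqF.
case: n g0 => [|n] g0.
  rewrite /A /t wave_coefSl /= addr0 mulr1.
  move: g0; move: (wave_coef 1 k) => w g0.
  by rewrite div1r; field.
rewrite /A /B /t wave_coefSl.
have -> : Z n.+2 = (nu + n.+2%:R) / n.+2%:R *
      (2 * L * Z n.+1 - zonal_coef nu n * Q * Z n) by [].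
have n2 : n.+2%:R != 0 :> R by [].
have e := wave_coefSr n k; have e' := wave_coefSl n.+1 k.
have -> : k.+1%:R * zonal_coef nu n * (wave_coef n k.+1 * Q ^+ k.+1 * Z n) =
    2^-1 * zonal_coef nu n * wave_coef n.+1 k * Q ^+ k * Q * Z n.
  by rewrite e exprS; field.
rewrite e'; move: (Z n.+1) (Z n) (zonal_coef nu n) (wave_coef n.+2 k) => z1 z c w.
move: g0 n2; move: (n.+2%:R) => s g0 n2.
by field; rewrite g0 n2.
Qed.

(* Multiplying the identity for N by L and expanding [L * Z n] with the three-term
   recurrence gives the identity for N + 1. *)
Let coef_sum N K : (N < K)%N ->
  \sum_(0 <= k < K) (if (k.*2 <= N)%N then t (N - k.*2) k else 0) = L ^+ N / N`!%:R.
Proof.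
elim: N K => [|N IH] [|K]// NK.
  rewrite big_nat_recl//= [X in _ + X]big1 ?addr0//.
  rewrite /t /wave_coef /bessel_coef /= double0 subn0 addn0 !expr0 !mulr1 !addr0 fact0 mul1r.
  by rewrite mul1r invr1 divff// gt_eqF// Gamma_gt0// ltr_wpDl.
have N1 : N.+1%:R != 0 :> R by [].
apply: (mulfI N1); rewrite factS natrM invfM exprS.
have -> : N.+1%:R * (L * L ^+ N * (N.+1%:R^-1 * N`!%:R^-1)) = L * (L ^+ N / N`!%:R) :> R.
  have f0 : N`!%:R != 0 :> R by rewrite pnatr_eq0 -lt0n fact_gt0.
  by move: N1 f0; move: (N.+1%:R) (N`!%:R) => s w s0 w0; field; rewrite s0 w0.
rewrite -(IH K)// !mulr_sumr.
transitivity (\sum_(0 <= k < K.+1) (if (k.*2 <= N.+1)%N then A (N.+1 - k.*2) k else 0)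
   + \sum_(0 <= k < K.+1) (if (k.*2 <= N.+1)%N then B (N.+1 - k.*2) k else 0)).
  rewrite -big_split/=; apply: eq_bigr => k _; case: ifP => h; last by rewrite mulr0 addr0.
  by rewrite AB subnK.
rewrite big_nat_recr//= ifN ?addr0; last by lia.
rewrite [X in _ + X]big_nat_recl//= [B _ 0%N]/B !mul0r add0r -big_split/=.
apply: eq_bigr => k _; rewrite doubleS !ltnS subSS.
case: (leqP k.*2 N) => h.
  rewrite leqW// Lt subSn//; congr (_ + _).
  case: ifP => h1; last by have -> : (N - k.*2 = 0)%N by lia.
  by have -> : (N - k.*2 = (N - k.*2.+1).+1)%N by lia.
rewrite (ifN _ _ (_ : ~~ (k.*2 < N)%N)); last by lia.
rewrite mulr0 addr0; case: ifP => h1 //.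
have -> : (N.+1 - k.*2 = 0)%N by lia.
by rewrite /A !mul0r.
Qed.

Let S0 : 0 <= S. Proof. exact: le_trans LS. Qed.

Let X : R := 2 * (nu + 1) * S.
Let Y : R := S ^+ 2 / 4.

Let X0 : 0 <= X. Proof. by rewrite !mulr_ge0// addr_ge0. Qed.

Let t_le n k : `|t n k| <= exp_coeff X n * exp_coeff Y k.
Proof.
have zb : `|Z n| <= (4 * (nu + 1) * S) ^+ n.
  by apply: zonal_bound => //; rewrite ger0_norm.
rewrite /t normrM normrM ger0_norm ?wave_coef_ge0// ger0_norm ?exprn_ge0//.
apply: (@le_trans _ _ (2^-1 ^+ n / n`!%:R * (4^-1 ^+ k / k`!%:R) * (S ^+ 2) ^+ k *
   (4 * (nu + 1) * S) ^+ n)).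
  apply: ler_pM => //; first by rewrite mulr_ge0 ?wave_coef_ge0 ?exprn_ge0.
  apply: ler_pM => //; rewrite ?wave_coef_ge0 ?exprn_ge0 ?wave_coef_le//.
  by rewrite lerXn2r ?nnegrE ?exprn_ge0.
rewrite /exp_coeff/= /X /Y le_eqVlt; apply/orP; left; apply/eqP.
have -> : 2 * (nu + 1) * S = 2^-1 * (4 * (nu + 1) * S) by field.
rewrite !exprMn exprVn; ring.
Qed.

(* The index set n + 2k >= N of the remainder costs a factor [2 ^- N] when the
   arguments of both exponential series are enlarged. *)
Let tail (N K : nat) : (N <= K)%N ->
  `|\sum_(0 <= n < N) (\sum_(0 <= k < K) wave_coef n k * Q ^+ k) * Z n - series (exp_coeff L) N|
  <= 2^-1 ^+ N * (expR (2 * X) * expR (4 * Y)).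
Proof.
move=> NK.
(* By [coef_sum] the partial sum of the exponential collects exactly the terms with n + 2k < N. *)
have E : series (exp_coeff L) N = \sum_(0 <= n < N) \sum_(0 <= k < K)
    (if (n + k.*2 < N)%N then t n k else 0).
  rewrite exchange_big/=.
  transitivity (\sum_(0 <= k < K) \sum_(0 <= n < N)
      (if (k.*2 <= n)%N then t (n - k.*2) k else 0)).
    rewrite exchange_big/= /series/= !big_nat; apply: eq_bigr => n /= nN.
    by rewrite coef_sum// (leq_trans nN).
  apply: eq_bigr => k _; rewrite -!big_mkcond/=.
  rewrite -(big_nat_widenl k.*2 0 N xpredT (fun n => t (n - k.*2) k))//.
  rewrite -{1}[k.*2]add0n big_addn.
  rewrite (eq_bigr (t ^~ k)) => [|i _]; last by rewrite addnK.
  rewrite (big_nat_widen 0 (N - k.*2) N xpredT (t ^~ k)) ?leq_subr//.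
  by apply: eq_bigl => n; rewrite ltn_subRL addnC.
rewrite E -sumrB.
under eq_bigr do rewrite mulr_suml -sumrB.
apply: le_trans (ler_norm_sum _ _ _) _.
apply: (@le_trans _ _ (\sum_(0 <= n < N) \sum_(0 <= k < K)
   2^-1 ^+ N * (exp_coeff (2 * X) n * exp_coeff (4 * Y) k))).
  apply: ler_sum => n _; apply: le_trans (ler_norm_sum _ _ _) _.
  apply: ler_sum => k _; rewrite -/(t n k).
  have p0 : 0 <= exp_coeff (2 * X) n * exp_coeff (4 * Y) k.
    rewrite /exp_coeff/= mulr_ge0// divr_ge0// exprn_ge0// mulr_ge0//.
    by rewrite divr_ge0// exprn_ge0.
  case: ltnP => h; first by rewrite subrr normr0 mulr_ge0 ?exprn_ge0.
  rewrite subr0; apply: le_trans (t_le n k) _.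
  have -> : exp_coeff (2 * X) n * exp_coeff (4 * Y) k =
      2 ^+ (n + k.*2) * (exp_coeff X n * exp_coeff Y k).
    rewrite /exp_coeff/= !exprMn exprD -mul2n exprM.
    have -> : 2 ^+ 2 = 4 :> R by ring.
    by ring.
  rewrite [leRHS]mulrA; apply: ler_peMl.
    rewrite /exp_coeff/= mulr_ge0// divr_ge0// exprn_ge0//.
    by rewrite divr_ge0// exprn_ge0.
  rewrite exprVn mulrC ler_pdivlMr ?exprn_gt0// mul1r ler_weXn2l// ler1n//.
under eq_bigr do rewrite -!mulr_sumr.
rewrite -mulr_sumr -mulr_suml ler_wpM2l ?exprn_ge0//.
apply: ler_pM; try by apply: sumr_ge0 => i _; rewrite /exp_coeff/= divr_ge0// exprn_ge0// mulr_ge0// divr_ge0// exprn_ge0.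
- by apply: exp_partial_le; rewrite mulr_ge0.
- by apply: exp_partial_le; rewrite mulr_ge0// divr_ge0// exprn_ge0.
Qed.

Lemma plane_wave_expansion :
  (fun N => \sum_(0 <= n < N) plane_coef Q n * Z n) @ \oo --> expR L.
Proof.
pose D N := \sum_(0 <= n < N) plane_coef Q n * Z n - series (exp_coeff L) N.
have DN N : `|D N| <= 2^-1 ^+ N * (expR (2 * X) * expR (4 * Y)).
  have c : (fun K => `|\sum_(0 <= n < N) (\sum_(0 <= k < K) wave_coef n k * Q ^+ k) * Z n
      - series (exp_coeff L) N|) @ \oo --> `|D N|.
    apply: cvg_norm; apply: cvgB; last exact: cvg_cst.
    elim: N {D} => [|N IH].
      by under eq_fun do rewrite big_geq//; rewrite big_geq//; exact: cvg_cst.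
    under eq_fun do rewrite big_nat_recr//=; rewrite big_nat_recr//=.
    by apply: cvgD => //; apply: cvgM; [exact: cvg_plane|exact: cvg_cst].
  rewrite -(cvg_lim _ c)//; apply: limr_le; first exact: cvgP c.
  by near=> K; apply: tail; near: K; exact: nbhs_infty_ge.
have D0 : D @ \oo --> (0 : R).
  apply: (@cvg0_le R _ (fun N => 2^-1 ^+ N * (expR (2 * X) * expR (4 * Y)))).
    exact: DN.
  rewrite -(mul0r (expR (2 * X) * expR (4 * Y))); apply: cvgM; last exact: cvg_cst.
  by apply: cvg_expr; rewrite ger0_norm// invf_lt1// ltr1n.
have -> : (fun N => \sum_(0 <= n < N) plane_coef Q n * Z n) =
    (fun N => D N + series (exp_coeff L) N).
  by apply/funext => N; rewrite /D subrK.
by rewrite -(add0r (expR L)); apply: cvgD => //; exact: is_cvg_series_exp_coeff.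
Unshelve. all: by end_near. Qed.

End PlaneWave.

(** * The density of the hitting time *)

Lemma cvg_EFin_seq {R : realType} (u : nat -> R) (l : R) :
  u @ \oo --> l -> (fun n => (u n)%:E) @ \oo --> l%:E.
Proof. by move=> ul; apply/fine_cvgP; split => //; exact: nearW. Qed.

Section MeasurableLimit.
Context {R : realType} {disp : measure_display} {T : measurableType disp}.

(** Where the sequence diverges [limn] is the default [point], so the set of convergence has to be
    measurable. It is where the upper limit of |S n - N| is 0, N being the upper limit of S; an
    infinite N makes these distances infinite. *)
Lemma measurable_fun_limn (D : set T) (S : nat -> T -> R) : measurable D ->
  (forall n, measurable_fun D (S n)) -> measurable_fun D (fun t => limn (S ^~ t)).
Proof.
move=> mD mS; pose N t := limn_esup (fun n => (S n t)%:E).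
pose M t := limn_esup (fun n => `|(S n t)%:E - N t|)%E.
have mN : measurable_fun D N.
  by apply: measurable_fun_limn_esup => n; exact/measurable_EFinP.
have mM : measurable_fun D M.
  apply: measurable_fun_limn_esup => n; apply: measurableT_comp => //.
  by apply: emeasurable_funB => //; exact/measurable_EFinP.
pose E := D `&` M @^-1` [set 0%E].
have mE : measurable E by apply: mM => //; exact: emeasurable_set1.
have cvE t : cvgn (S ^~ t) -> M t = 0%E /\ limn (S ^~ t) = fine (N t).
  move=> /cvg_ex[l cl].
  have NE : N t = l%:E.
    by rewrite /N; have [_ ->] := @cvg_limn_einf_sup _ (fun n => (S n t)%:E) l%:E (cvg_EFin_seq cl).
  split; last by rewrite NE /=; apply: cvg_lim.
  suff cM : (fun n => `|(S n t)%:E - N t|)%E @ \oo --> 0%E.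
    by rewrite /M; have [_ ->] := cvg_limn_einf_sup cM.
  rewrite NE; have -> : (fun n => `|(S n t)%:E - l%:E|)%E = EFin \o (fun n => `|S n t - l|).
    by apply/funext.
  by apply: cvg_EFin_seq; apply/norm_cvg0P; apply/subr_cvg0.
have Ecv t : M t = 0%E -> cvgn (S ^~ t).
  move=> M0; have c : (fun n => `|(S n t)%:E - N t|)%E @ \oo --> 0%E.
    by apply: limn_esup_le_cvg => [|n]; [rewrite -/(M t) M0|exact: abse_ge0].
  case NE : (N t) c => [l||] c.
  - apply: (cvgP l); apply/subr_cvg0; apply/norm_cvg0P.
    by apply/fine_cvg : c.
  - have c2 : (fun n => `|(S n t)%:E - +oo|)%E @ \oo --> +oo%E by exact: cvg_cst.
    by have e : 0%E = +oo%E :> \bar R by apply: (cvg_unique _ c c2).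
  - have c2 : (fun n => `|(S n t)%:E - -oo|)%E @ \oo --> +oo%E by exact: cvg_cst.
    by have e : 0%E = +oo%E :> \bar R by apply: (cvg_unique _ c c2).
apply: (@eq_measurable_fun _ _ _ _ _
    (fun t => \1_E t * fine (N t) + (1 - \1_E t) * (point : R))).
  move=> t; rewrite inE => Dt; rewrite indicE.
  case: (asboolP (E t)) => Et.
    rewrite mem_set// mul1r subrr mul0r addr0.
    by have [_ ->] := cvE t (Ecv t Et.2).
  rewrite memNset// mul0r add0r subr0 mul1r.
  apply/esym/xgetPN => l cl; apply: Et; split => //=.
  by have [] := cvE t (cvgP l cl).
have m1 : measurable_fun D (\1_E : T -> R).
  exact: measurable_indic.
apply: measurable_funD; apply: measurable_funM => //.
  by apply: measurableT_comp mN => //; exact: measurable_fine.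
by apply: measurable_funB.
Qed.

End MeasurableLimit.

Section SeriesOfDensities.
Context {R : realType} {disp : measure_display} {T : measurableType disp}
  (mu : {measure set T -> \bar R}) (D : set T) (mD : measurable D)
  (g : nat -> T -> R) (mg : forall n, measurable_fun D (g n))
  (g1 : forall n, (\int[mu]_(t in D) `|(g n t)%:E| <= 1)%E)
  (c : nat -> R) (M : R) (cM : forall N, \sum_(0 <= n < N) `|c n| <= M).

Let S N t : R := \sum_(0 <= n < N) c n * g n t.
Let G t : \bar R := (\sum_(n <oo) `|(c n * g n t)%:E|)%E.

Let mcg n : measurable_fun D (fun t => (c n * g n t)%:E).
Proof. by apply/measurable_EFinP; apply: measurable_funM. Qed.

Let mG : measurable_fun D G.
Proof.
have := @ge0_emeasurable_sum _ _ _ D (fun n t => `|(c n * g n t)%:E|)%E xpredT.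
apply => //; first by move=> n _; exact: measurableT_comp.
Qed.

Let G0 t : (0 <= G t)%E. Proof. exact: nneseries_ge0. Qed.

Let iG : mu.-integrable D G.
Proof.
apply/integrableP; split => //.
under eq_integral do rewrite gee0_abs//.
rewrite integral_nneseries//; last by move=> n; exact: measurableT_comp.
apply: (@le_lt_trans _ _ M%:E); last exact: ltry.
apply: lime_le; first by apply: is_cvg_nneseries => n _ _; exact: integral_ge0.
apply: nearW => N; apply: (@le_trans _ _ (\sum_(0 <= n < N) `|c n|%:E)%E); last first.
  by rewrite sumEFin lee_fin.
apply: lee_sum => n _.
under eq_integral do rewrite EFinM abseM.
rewrite ge0_integralZl//; last by apply: measurableT_comp => //; exact/measurable_EFinP.
by rewrite -[leRHS]mule1; apply: lee_wpmul2l.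
Qed.

Let S_le N t : (`|(S N t)%:E| <= G t)%E.
Proof.
rewrite /S -sumEFin; apply: le_trans (lee_abs_sum _ _ _) _.
exact: nneseries_lim_ge.
Qed.

(** Each g n has mass at most 1 and the coefficients are absolutely summable, so the series of
    absolute values has a finite integral and is finite almost everywhere. *)
Lemma ae_cvg_series : {ae mu, forall t, D t -> cvgn (S ^~ t)}.
Proof.
have := integrable_ae mD iG; apply: filterS.
move=> t /[apply] Gfin; apply: (@normed_cvg _ _ (fun n => c n * g n t)).
apply: nondecreasing_is_cvgn.
  by apply: nondecreasing_series => n _ _; exact: normr_ge0.
exists (fine (G t)) => _ [n _ <-]; rewrite -lee_fin fineK// /series/=.
by rewrite -sumEFin; exact: nneseries_lim_ge.
Qed.

Lemma integral_series (w : T -> R) : measurable_fun D w -> (forall t, D t -> 0 <= w t <= 1) ->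
  mu.-integrable D (fun t => (w t * limn (S ^~ t))%:E) /\
  forall (J : nat -> R) l, (forall n, \int[mu]_(t in D) (w t * g n t)%:E = (J n)%:E)%E ->
    (fun N => \sum_(0 <= n < N) c n * J n) @ \oo --> l ->
    (\int[mu]_(t in D) (w t * limn (S ^~ t))%:E = l%:E)%E.
Proof.
move=> mw w01.
have mS N : measurable_fun D (S N).
  by apply: measurable_sum => n; apply: measurable_funM.
have w1 t : D t -> `|w t| <= 1 by move=> /w01/andP[w0 ?]; rewrite ger0_norm.
have ig n : mu.-integrable D (fun t => (w t * g n t)%:E).
  apply/integrableP; split; first by apply/measurable_EFinP; exact: measurable_funM.
  apply: (@le_lt_trans _ _ 1%E); last exact: ltry.
  apply: le_trans (g1 n); apply: ge0_le_integral => //.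
  - by apply: measurableT_comp => //; apply/measurable_EFinP; exact: measurable_funM.
  - by apply: measurableT_comp => //; exact/measurable_EFinP.
  - by move=> t Dt; rewrite lee_fin normrM ler_piMl// w1.
have mwS N : measurable_fun D (fun t => (w t * S N t)%:E).
  by apply/measurable_EFinP; apply: measurable_funM.
have mwl : measurable_fun D (fun t => (w t * limn (S ^~ t))%:E).
  by apply/measurable_EFinP; apply: measurable_funM => //; exact: measurable_fun_limn.
have cwS : {ae mu, forall t, D t -> (fun N => (w t * S N t)%:E) @ \oo --> (w t * limn (S ^~ t))%:E}.
  have := ae_cvg_series; apply: filterS.
  by move=> t /[apply] ct; apply: cvg_EFin_seq; apply: cvgM => //; exact: cvg_cst.
have wSG : {ae mu, forall t (N : nat), D t -> (`|(w t * S N t)%:E| <= G t)%E}.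
  apply: aeW => t N Dt; apply: le_trans (S_le N t).
  by rewrite lee_fin normrM ler_piMl// w1.
have [h1 _ h3] := dominated_convergence mD mwS mwl cwS iG wSG.
split => // J l HJ cl.
have e N : (\int[mu]_(t in D) (w t * S N t)%:E = (\sum_(0 <= n < N) c n * J n)%:E)%E.
  rewrite -sumEFin.
  transitivity (\int[mu]_(t in D) (\sum_(0 <= n < N) (c n)%:E * (w t * g n t)%:E)%E)%E.
    apply: eq_integral => t _; rewrite /S mulr_sumr -sumEFin; apply: eq_bigr => n _.
    by rewrite -EFinM; congr EFin; ring.
  rewrite integral_sum//; last by move=> n; exact: integrableZl.
  by apply: eq_bigr => n _; rewrite integralZl// HJ.
move: h3; under eq_fun do rewrite e; move=> h3.
exact: (cvg_unique _ h3 (cvg_EFin_seq cl)).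
Qed.

End SeriesOfDensities.

Section HittingDensity.
Context {R : realType} {disp : measure_display} {T : measurableType disp}
  (P : probability T R) {d : nat} (hd : (2 <= d)%N)
  {x v : 'rV[R]_d} {B : R -> T -> 'rV[R]_d} (hB : brownian P x B)
  (r : R) (hr : 0 < r) (hx0 : 0 < enorm x) (hxr : enorm x <> r) (hv : 0 < enorm v)
  (p : R -> R -> R)
  (hp : forall m : R, 0 <= m -> bessel_hitting_density m (enorm x) r (p m)).
Local Notation mu := (@lebesgue_measure R).
Local Notation tau := (@hit_time R disp T d v B r).
Local Notation hit := (@hit R disp T d v B r).
Local Notation Z := (@hit_val R disp T d v B r).
Local Notation nu := (nu_of (R := R) (d := d)).

Let phi n u : R :=
  \int[mu]_(s in `]0, +oo[) (expR (- u * s) * p (nu + n%:R) s).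

Hypothesis hLout : r < enorm x -> forall m lambda : R, 0 <= m -> 0 < lambda ->
  \int[mu]_(s in `]0, +oo[) (expR (- lambda * s) * p m s)
  = r `^ m * besselK m (enorm x * Num.sqrt (2 * lambda))
    / (enorm x `^ m * besselK m (r * Num.sqrt (2 * lambda))).
Hypothesis hLin : enorm x < r -> forall m lambda : R, 0 <= m -> 0 < lambda ->
  \int[mu]_(s in `]0, +oo[) (expR (- lambda * s) * p m s)
  = r `^ m * besselI m (enorm x * Num.sqrt (2 * lambda))
    / (enorm x `^ m * besselI m (r * Num.sqrt (2 * lambda))).

Let nu0 : 0 <= nu. Proof. by rewrite divr_ge0// subr_ge0 (ler_nat _ 2). Qed.
Let m0 (n : nat) : 0 <= nu + n%:R. Proof. by rewrite addr_ge0. Qed.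

Let vv0 : 0 < dotv v v. Proof. by rewrite -sqr_enorm exprn_gt0. Qed.

Let tau_ge0 w : 0 <= tau w. Proof. exact: (hit_time_ge0 hB hxr). Qed.
Let mtau : measurable_fun [set: T] tau. Proof. exact: (measurable_hit_time hB hxr). Qed.
Let mhit : measurable_fun [set: T] hit. Proof. exact: (measurable_hit hB hxr). Qed.
Let mZ n : measurable_fun [set: T] (Z n). Proof. exact: (measurable_hit_val hB hxr). Qed.

Let transform n u : 0 < u ->
  P.-integrable setT (fun w => (Z n w * expR (- (u * tau w)))%:E) /\
  (\int[P]_w (Z n w * expR (- (u * tau w)))%:E = (start_val (x := x) (v := v) n * phi n u)%:E)%E.
Proof.
move=> u0; case: (ltgtP (enorm x) r) => h; last by case: hxr.
- have [h1 h2] := @inner_transform R disp T P d hd x v B hB r hr hx0 hxr h n u u0.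
  by split => //; rewrite h2 /phi hLin.
- have [h1 h2] := @outer_transform R disp T P d hd x v B hB r hr hx0 hxr h n u u0.
  by split => //; rewrite h2 /phi hLout.
Qed.

Let Q : R := dotv v v * r ^+ 2.
Let Q0 : 0 <= Q. Proof. by rewrite mulr_ge0 ?exprn_ge0 ?ltW. Qed.
Let b n : R := plane_coef nu Q n.
Let A : R := 4 * (nu + 1) * enorm v.
Let A0 : 0 <= A. Proof. by rewrite !mulr_ge0 ?addr_ge0 ?enorm_ge0. Qed.

(** Used with s = r to dominate the values at the hitting time, and with s = |x| for the absolute
    summability of the coefficients. *)
Let b_sum s N : 0 <= s ->
  \sum_(0 <= n < N) b n * (A ^+ n * s ^+ n) <= expR (A * s / 2) * expR (Q / 4).
Proof.
move=> s0; apply: (@le_trans _ _ (series (exp_coeff (A * s / 2)) N * expR (Q / 4))).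
  rewrite /series/= mulr_suml; apply: ler_sum => n _.
  apply: le_trans (ler_wpM2r _ (plane_coef_le nu0 n Q0)) _.
    by rewrite mulr_ge0 ?exprn_ge0.
  by rewrite /exp_coeff/= !exprMn le_eqVlt; apply/orP; left; apply/eqP; ring.
by rewrite ler_wpM2r ?expR_ge0// exp_partial_le// divr_ge0// mulr_ge0.
Qed.

Let b0 n : 0 <= b n. Proof. exact: plane_coef_ge0. Qed.

(** The rate is shifted by |v|^2 / 2 to cancel the exponential of time in [hit_val], and the plane
    wave cancels exp(-<v,y>) at the hitting point y. *)
Let cvg_hit k w : (fun N => \sum_(0 <= n < N) b n *
    (Z n w * expR (- ((k + dotv v v / 2) * tau w)))) @ \oo --> hit w * expR (- (k * tau w)).
Proof.
have [h|h] := @hit01 R disp T d v B r w.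
  rewrite h mul0r; apply: cvg_near_cst; apply: nearW => N; apply: big1 => n _.
  by rewrite /hit_val h !mul0r mulr0.
set y := drifted (v := v) (B := B) (tau w) w.
have ey : enorm y = r by exact: (enorm_hit hB hxr).
have yy : dotv y y = r ^+ 2 by rewrite -(sqr_enorm y) ey.
have c := @plane_wave_expansion R nu nu0 (dotv v y) Q (enorm v * enorm y)
  (normr_dotv_le v y) Q0 _.
have {c} c := c (_ : Q <= _).
have -> : (fun N => \sum_(0 <= n < N) b n * (Z n w * expR (- ((k + dotv v v / 2) * tau w)))) =
   (fun N => expR (- (k * tau w) - dotv v y) *
     \sum_(0 <= n < N) plane_coef nu Q n * zonal nu (dotv v y) Q n).
  apply/funext => N; rewrite mulr_sumr; apply: eq_bigr => n _.
  rewrite /hit_val h mul1r -/y /zonal_fun yy -/Q -/(b n).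
  have -> : expR (- (k * tau w) - dotv v y) =
     expR (dotv v v * tau w / 2 - dotv v y) * expR (- ((k + dotv v v / 2) * tau w)).
    by rewrite -expRD; congr expR; field.
  by ring.
rewrite h mul1r -[X in _ --> X](_ : expR (- (k * tau w) - dotv v y) * expR (dotv v y) = _).
  apply: cvgM; first exact: cvg_cst.
  by apply: c; rewrite exprMn (sqr_enorm v) ey.
by rewrite -expRD subrK.
Qed.

Let hit_integrable (k : R) : 0 <= k ->
  P.-integrable setT (fun w => (hit w * expR (- (k * tau w)))%:E).
Proof.
move=> k0; apply: (@bounded_integrable _ _ _ P _ 1) => [|w].
  apply: measurable_funM => //; apply: measurableT_comp => //.
  by apply: measurableT_comp => //; apply: measurable_funM.
rewrite normrM [`|expR _|]ger0_norm ?expR_ge0// mulr_ile1 ?normr_ge0 ?expR_ge0//.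
  by case: (@hit01 R disp T d v B r w) => ->; rewrite ?normr0 ?normr1.
by rewrite -expR0 ler_expR oppr_le0 mulr_ge0.
Qed.

(** Summation over n under P. By [hit_val_bound] all partial sums are dominated by a multiple of the
    integrable term of degree 0. *)
Let hit_laplace (k : R) : 0 <= k ->
  (fun N => \sum_(0 <= n < N) b n * (start_val (x := x) (v := v) n * phi n (k + dotv v v / 2)))
    @ \oo --> fine (\int[P]_w (hit w * expR (- (k * tau w)))%:E)%E.
Proof.
move=> k0; set u := k + dotv v v / 2.
have u0 : 0 < u by rewrite ltr_wpDl// divr_gt0.
pose f (N : nat) w := \sum_(0 <= n < N) b n * (Z n w * expR (- (u * tau w))).
pose C : R := expR (A * r / 2) * expR (Q / 4).
have me : measurable_fun [set: T] (fun w => expR (- (u * tau w))).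
  apply: measurableT_comp => //; apply: measurableT_comp => //.
  exact: measurable_funM.
have mf N : measurable_fun [set: T] (fun w => (f N w)%:E).
  apply/measurable_EFinP; apply: measurable_sum => n; apply: measurable_funM => //.
  exact: measurable_funM.
have mh : measurable_fun [set: T] (fun w => (hit w * expR (- (k * tau w)))%:E).
  by case/integrableP: (hit_integrable k0).
have cf : {ae P, forall w, [set: T] w -> (fun N => (f N w)%:E) @ \oo -->
    (hit w * expR (- (k * tau w)))%:E}.
  by apply: aeW => w _; apply: cvg_EFin_seq; exact: cvg_hit.
have iG : P.-integrable setT (fun w => (C%:E * (Z 0 w * expR (- (u * tau w)))%:E)%E).
  by apply: integrableZl => //; have [] := transform 0 u0.
have fG : {ae P, forall w (N : nat), [set: T] w ->
    (`|(f N w)%:E| <= C%:E * (Z 0 w * expR (- (u * tau w)))%:E)%E}.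
  apply: aeW => w N _; rewrite abse_EFin -EFinM lee_fin.
  apply: le_trans (ler_norm_sum _ _ _) _.
  apply: (@le_trans _ _ (\sum_(0 <= n < N) b n * (A ^+ n * r ^+ n) *
      (Z 0 w * expR (- (u * tau w))))).
    apply: ler_sum => n _; rewrite normrM (ger0_norm (b0 n)) -mulrA ler_wpM2l//.
    rewrite normrM (ger0_norm (expR_ge0 _)) mulrA ler_wpM2r ?expR_ge0//.
    exact: (hit_val_bound hd hB hxr).
  rewrite -mulr_suml ler_wpM2r//; last by apply: b_sum; exact: ltW.
  by rewrite mulr_ge0 ?expR_ge0// hit_val0_ge0.
have [_ _ h3] := dominated_convergence measurableT mf mh cf iG fG.
have e N : (\int[P]_w (f N w)%:E =
    (\sum_(0 <= n < N) b n * (start_val (x := x) (v := v) n * phi n u))%:E)%E.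
  rewrite -sumEFin.
  transitivity (\int[P]_w (\sum_(0 <= n < N) (b n)%:E * (Z n w * expR (- (u * tau w)))%:E)%E)%E.
    apply: eq_integral => w _; rewrite /f -sumEFin; apply: eq_bigr => n _.
    by rewrite -EFinM.
  rewrite integral_sum//; last first.
    by move=> n; apply: integrableZl => //; have [] := transform n u0.
  apply: eq_bigr => n _; rewrite integralZl//; last by have [] := transform n u0.
  by have [_ ->] := transform n u0.
move: h3; rewrite [X in X @ _ --> _](_ : _ = (fun N =>
  (\sum_(0 <= n < N) b n * (start_val (x := x) (v := v) n * phi n u))%:E)); last first.
  by apply/funext => N; exact: e.
rewrite -[X in _ --> X]fineK; last first.
  by apply: integrable_fin_num => //; exact: hit_integrable.
by move=> /fine_cvg.
Qed.

Let D : set R := `]0, +oo[%classic.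
Let g n t : R := p (nu + n%:R) t.

(** The product of [b n] and [start_val n] without exp(-<v,x>), which is carried by [q0]. *)
Definition hit_coef n : R := plane_coef nu Q n * zonal_fun v n x.

Let facts n := bessel_hitting_density_facts hxr (hp (m0 n)).

Let mg n : measurable_fun D (g n). Proof. by have [] := facts n. Qed.
Let g1 n : (\int[mu]_(t in D) `|(g n t)%:E| <= 1)%E.
Proof. by have [] := facts n. Qed.

Let coef_sum N : \sum_(0 <= n < N) `|hit_coef n| <= expR (A * enorm x / 2) * expR (Q / 4).
Proof.
apply: le_trans (b_sum N (enorm_ge0 x)); apply: ler_sum => n _.
rewrite normrM (ger0_norm (b0 n)) ler_wpM2l//; exact: zonal_fun_bound.
Qed.

Let mD : measurable (D : set (measurableTypeR R)).
Proof. exact: measurable_itv. Qed.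

Let S N t : R := \sum_(0 <= n < N) hit_coef n * p (nu + n%:R) t.

Lemma ae_cvg_hitting_series : {ae mu, forall t, 0 < t -> cvgn (S ^~ t)}.
Proof.
have := @ae_cvg_series R _ (measurableTypeR R) mu D mD g mg g1 hit_coef _ coef_sum.
apply: filterS.
by move=> t h t0; apply: h; rewrite /D/= in_itv/= andbT.
Qed.

Let weighted (u : R) : 0 <= u ->
  mu.-integrable D (fun t => (expR (- (u * t)) * limn (S ^~ t))%:E) /\
  forall l, (fun N => \sum_(0 <= n < N) hit_coef n * phi n u) @ \oo --> l ->
    (\int[mu]_(t in D) (expR (- (u * t)) * limn (S ^~ t))%:E = l%:E)%E.
Proof.
move=> u0; have mw : measurable_fun D (fun t : R => expR (- (u * t))).
  apply: measurable_funTS; apply: measurableT_comp => //.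
  by apply: measurableT_comp => //; apply: measurable_funM.
have w01 t : D t -> 0 <= expR (- (u * t)) <= 1.
  rewrite /D/= in_itv/= andbT => t0; rewrite expR_ge0/= -expR0 ler_expR oppr_le0.
  by rewrite mulr_ge0// ltW.
have [h1 h2] := @integral_series R _ (measurableTypeR R) mu D mD g mg g1 hit_coef _ coef_sum
  (fun t => expR (- (u * t))) mw w01.
split => // l; apply: (h2 (phi ^~ u)) => n; rewrite /phi.
have i : mu.-integrable D (fun t => (expR (- (u * t)) * g n t)%:E).
  apply: (@le_integrable _ _ _ mu D mD _ (EFin \o g n)).
  - by apply/measurable_EFinP; apply: measurable_funM; [exact: mw|exact: mg].
  - move=> t /w01/andP[w0 w1]; rewrite !abse_EFin lee_fin normrM ler_piMl//.
    by rewrite ger0_norm.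
  - by have [] := facts n.
rewrite /Rintegral fineK; first by apply: eq_integral => t _; rewrite mulNr.
have := integrable_fin_num mD i.
by under [X in _ -> X \is a fin_num]eq_integral do rewrite mulNr.
Qed.

Let q0 t : R := expR (- dotv v x) * (expR (- (dotv v v / 2 * t)) * limn (S ^~ t)).
(** Extended by 0 to the whole line, to match the form of [laplace_uniqueness] with time max(0,
    t). *)
Let h2 (t : R) : R := (0 < t)%R%:R * q0 t.

Let iq0 : mu.-integrable D (EFin \o q0).
Proof.
have [|i _] := @weighted (dotv v v / 2); first by rewrite ltW// divr_gt0.
have := integrableZl mD (expR (- dotv v x)) i; exact: eq_integrable.
Qed.

Let ih2 : mu.-integrable setT (EFin \o h2).
Proof.
have := iq0; rewrite (integrable_mkcond _ mD).
apply: eq_integrable => // t _; rewrite /patch /h2 /=.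
case: (boolP (0 < t)) => t0; rewrite ?mul1r ?mul0r.
  by rewrite mem_set// /D/= in_itv/= andbT.
by rewrite memNset// /D/= in_itv/= andbT; exact/negP.
Qed.

Let mmax : measurable_fun [set: measurableTypeR R] (fun t : R => Num.max 0 t).
Proof. by apply: measurable_maxr. Qed.

Let laplace (k : nat) : (\int[P]_w (hit w * expR (- (k%:R * tau w)))%:E =
  \int[mu]_t (h2 t * expR (- (k%:R * Num.max 0%R t)))%:E)%E.
Proof.
have k0 : 0 <= k%:R :> R by [].
set u := k%:R + dotv v v / 2.
have u0 : 0 <= u by rewrite addr_ge0// ltW// divr_gt0.
have [i2 I2] := weighted u0.
have c := hit_laplace k0; rewrite -/u in c.
set l := fine _ in c.
have c' : (fun N => \sum_(0 <= n < N) hit_coef n * phi n u) @ \oo --> expR (dotv v x) * l.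
  have -> : (fun N => \sum_(0 <= n < N) hit_coef n * phi n u) = (fun N => expR (dotv v x) *
     \sum_(0 <= n < N) b n * (start_val (x := x) (v := v) n * phi n u)).
    apply/funext => N; rewrite mulr_sumr; apply: eq_bigr => n _.
    rewrite /start_val /hit_coef -/(b n).
    have := expRxMexpNx_1 (dotv v x); move: (expR (- _)) (expR _) => e1 e2 ee.
    by rewrite -[LHS]mul1r -ee; ring.
  by apply: cvgM => //; exact: cvg_cst.
transitivity (l%:E).
  by rewrite /l fineK//; apply: integrable_fin_num => //; exact: hit_integrable.
transitivity (\int[mu]_t ((0 < t)%R%:R * (expR (- dotv v x) *
    (expR (- (u * t)) * limn (S ^~ t))))%:E)%E; last first.
  apply: eq_integral => t _; rewrite /h2; case: ltP => t0; last by rewrite !mul0r.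
  rewrite !mul1r /q0.
  have -> : - (u * t) = - (dotv v v / 2 * t) + - (k%:R * t) by rewrite /u; ring.
  by rewrite expRD; congr EFin; ring.
rewrite integral_pos_part; under eq_integral do rewrite EFinM.
rewrite integralZl// (I2 _ c') -EFinM; congr EFin.
by rewrite mulrA [expR _ * _]mulrC expRxMexpNx_1 mul1r.
Qed.

(** The law of tau weighted by [hit] is compared with h2 dt. The function q is prescribed only
    almost everywhere, since the series need not converge at every t. *)
Lemma hitting_density (q : R -> R) : measurable_fun (`]0, +oo[ : set R) q ->
  {ae mu, forall t, 0 < t ->
    q t = expR (- dotv v x - enorm v ^+ 2 * t / 2) * limn (S ^~ t)} ->
  density_of_time P (fun w => hitting_time (fun t => enorm (B t w + t *: v)) r) q.
Proof.
move=> mq qE; split => // t t0.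
have max0 (s : R) : 0 <= Num.max 0 s by rewrite le_max lexx.
have ih : P.-integrable setT (EFin \o hit).
  have := hit_integrable (lexx 0); apply: eq_integrable => // w _ /=.
  by rewrite mul0r oppr0 expR0 mulr1.
have L := @laplace_uniqueness R _ _ P _ (measurableTypeR R) mu hit _ h2 _
  tau_ge0 max0 mtau mmax ih ih2 laplace t t0.
(* The weight [hit] is essential: on paths that never hit, [tau] is 0 and would count as an
   immediate hit. *)
have E w : (exit_time (v := v) (B := B) r w <= t%:E)%E%:R = hit w * (tau w <= t)%R%:R :> R.
  have [h|h] := @hit01 R disp T d v B r w; last first.
    by rewrite h mul1r (exit_time_hit hB hxr h) lee_fin.
  rewrite h mul0r; move: h; rewrite /hit; case: ltP => [_ /eqP|].
    by rewrite oner_eq0.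
  by rewrite leye_eq => /eqP ->.
have mE : measurable [set w | (exit_time (v := v) (B := B) r w <= t%:E)%E].
  have -> : [set w | (exit_time (v := v) (B := B) r w <= t%:E)%E] =
      (fun w => hit w * (tau w <= t)%R%:R) @^-1` [set 1].
    apply/seteqP; split => w /=; rewrite -E; first by move=> ->.
    by case: (_ <= _)%E => // /esym/eqP; rewrite oner_eq0.
  rewrite -[_ @^-1` _]setTI; apply: measurable_funM => //.
  apply: (@measurableT_comp _ _ _ _ _ _ (fun s : R => (s <= t)%R%:R : R)) => //.
  have := @measurable_ge_indic R _ (measurableTypeR R) (fun s : R => - s) (- t) (measurable_funN (@measurable_id _ _ _)).
  by under eq_fun do rewrite lerN2.
transitivity (\int[P]_w (hit w * (tau w <= t)%R%:R)%:E)%E.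
  rewrite -[X in P X]setIT -integral_indic//; apply: eq_integral => w _.
  rewrite -E indicE; case: (boolP (exit_time (v := v) (B := B) r w <= t%:E)%E) => h.
    by rewrite mem_set.
  by rewrite memNset//; exact/negP.
rewrite L.
have sub : `]0, t]%classic `<=` D by move=> s /=; rewrite /D/= !in_itv/= andbT => /andP[].
transitivity (\int[mu]_(s in `]0%R, t]) (q0 s)%:E)%E.
  rewrite [RHS]integral_mkcond; apply: eq_integral => s _.
  rewrite /patch /h2; case: (boolP (0 < s)) => s0; rewrite ?mul0r ?mul1r; last first.
    by rewrite memNset//= in_itv/= => /andP[s0']; rewrite s0' in s0.
  rewrite (max_idPr (ltW s0)); case: (boolP (s <= t)) => st; rewrite ?mulr0 ?mulr1.
    by rewrite mem_set//= in_itv/= s0.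
  by rewrite memNset//= in_itv/= s0/=; exact/negP.
apply: ae_eq_integral => //.
- exact: measurable_funS sub (measurable_int _ iq0).
- by apply/measurable_EFinP; exact: measurable_funS sub mq.
move: qE; apply: filterS; first exact: (ae_filter_ringOfSetsType mu).
move=> s hs /=; rewrite in_itv/= => /andP[s0 _]; rewrite hs// /q0 mulrA -expRD sqr_enorm.
by congr (expR _ * _)%:E; ring.
Qed.

End HittingDensity.

(** * Comparison with the coefficients of the formula *)

Section BesselCoefficient.
Context {R : realType} {d : nat} (hd : (2 <= d)%N) (x v : 'rV[R]_d) (r : R)
  (hr : 0 < r) (hx : 0 < enorm x) (hv : 0 < enorm v).
Local Notation nu := (nu_of (R := R) (d := d)).
Local Notation xi := (dotv v x / (enorm v * enorm x)).

(** Written with [zonal] and Gamma(nu + 1) so that nu = 0 is covered: the power (z/2)^(nu+n) in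
    [besselIE] accounts for the powers of |v| and r and for 2^nu, and homogeneity reduces the
    polynomial to the cosine. *)
Lemma hit_coefE n : hit_coef (x := x) (v := v) r n =
  2 `^ nu * Gamma (nu + 1) * (zonal nu xi 1 n * besselI (nu + n%:R) (enorm v * r) *
    (enorm x ^+ n / (enorm v `^ nu * r `^ (nu + n%:R)))).
Proof.
have nu0 : 0 <= nu by rewrite divr_ge0// subr_ge0 (ler_nat _ 2).
have vx : enorm v * enorm x != 0 by rewrite mulf_neq0 ?gt_eqF.
have -> : hit_coef (x := x) (v := v) r n = plane_coef nu (dotv v v * r ^+ 2) n *
    ((enorm v * enorm x) ^+ n * zonal nu xi 1 n).
  rewrite /hit_coef /zonal_fun -zonal_homogeneous mulr1 exprMn !sqr_enorm.
  by rewrite [_ * xi]mulrC divfK.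
rewrite /plane_coef besselIE ?addr_ge0 ?mulr_gt0// [(enorm v * r) ^+ 2]exprMn sqr_enorm.
have -> : (enorm v * r / 2) `^ (nu + n%:R) =
    enorm v `^ nu * enorm v ^+ n * r `^ (nu + n%:R) * (2 `^ nu)^-1 * 2^-1 ^+ n.
  rewrite !powRM ?mulr_ge0 ?ltW//.
  rewrite [enorm v `^ (_ + _)]powRD ?(gt_eqF hv) ?implybT// powR_mulrn ?(ltW hv)//.
  rewrite [2^-1 `^ (_ + _)]powRD ?invr_eq0 ?pnatr_eq0 ?implybT// powR_mulrn ?invr_ge0//.
  by rewrite -powRN -powR_inv1// -powRrM mulN1r; ring.
have h1 : enorm v `^ nu != 0 by rewrite gt_eqF// powR_gt0.
have h2 : r `^ (nu + n%:R) != 0 by rewrite gt_eqF// powR_gt0.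
have h3 : 2 `^ nu != 0 :> R by rewrite gt_eqF// powR_gt0.
rewrite exprMn.
move: (_ `^ _) (_ `^ _) (2 `^ _) h1 h2 h3 => a b c a0 b0 c0.
move: (zonal _ _ _ _) (bessel_entire _ _) (Gamma _) => z J G.
by field; rewrite a0 b0 c0.
Qed.

Lemma normr_cos_le : `|xi| <= 1.
Proof.
rewrite normrM normfV ler_pdivrMr ?mul1r; last by rewrite normr_gt0 mulf_neq0 ?gt_eqF.
by rewrite [leRHS]ger0_norm ?normr_dotv_le// mulr_ge0// enorm_ge0.
Qed.

End BesselCoefficient.

Lemma enorm_gt0 {R : realType} {d : nat} (y : 'rV[R]_d) : y <> 0 -> 0 < enorm y.
Proof.
move=> y0; rewrite lt_neqAle enorm_ge0 andbT eq_sym; apply/eqP => e.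
apply: y0; apply/rowP => i; rewrite mxE; apply/eqP; rewrite -normr_le0 -e.
exact: coord_le_enorm.
Qed.

Theorem theorem1p1 (R : realType) (d : nat) (hd : (2 <= d)%N)
    (r : R) (hr : 0 < r)
    (x : 'rV[R]_d) (hx0 : x <> 0) (hxr : enorm x <> r)
    (v : 'rV[R]_d) (hv : v <> 0)
    (disp : measure_display) (T : measurableType disp) (P : probability T R)
    (B : R -> T -> 'rV[R]_d) (hB : brownian P x B)
    (C : R -> nat -> {poly R}) (hC : gegenbauer C)
    (p : R -> R -> R)
    (hp : forall mu : R, 0 <= mu -> bessel_hitting_density mu (enorm x) r (p mu))
    (hLout : r < enorm x -> forall mu lambda : R, 0 <= mu -> 0 < lambda ->
       \int[@lebesgue_measure R]_(s in `]0, +oo[) (expR (- lambda * s) * p mu s)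
       = r `^ mu * besselK mu (enorm x * Num.sqrt (2 * lambda))
         / (enorm x `^ mu * besselK mu (r * Num.sqrt (2 * lambda))))
    (hLin : enorm x < r -> forall mu lambda : R, 0 <= mu -> 0 < lambda ->
       \int[@lebesgue_measure R]_(s in `]0, +oo[) (expR (- lambda * s) * p mu s)
       = r `^ mu * besselI mu (enorm x * Num.sqrt (2 * lambda))
         / (enorm x `^ mu * besselI mu (r * Num.sqrt (2 * lambda)))) :
  let nu : R := (d%:R - 2) / 2 in
  let sigma (w : T) : \bar R :=
    hitting_time (fun t => enorm (B t w + t *: v)) r in
  let xi : R := dotv v x / (enorm v * enorm x) in
  (d = 2%N ->
     let a (n : nat) (t : R) : R :=
       n%:R * (C 0 n).[xi] * besselI n%:R (enorm v * r)
       * (enorm x ^+ n / r ^+ n) * p n%:R t in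
     {ae @lebesgue_measure R, forall t, 0 < t ->
        cvgn (fun N => \sum_(1 <= n < N) a n t)} /\
     density_of_time P sigma (fun t =>
       expR (- dotv v x - enorm v ^+ 2 * t / 2)
       * (besselI 0 (enorm v * r) * p 0 t 
          + limn (fun N => \sum_(1 <= n < N) a n t)))) /\
  ((3 <= d)%N ->
     let a (n : nat) (t : R) : R :=
       (nu + n%:R) * (C nu n).[xi] * besselI (nu + n%:R) (enorm v * r)
       * (enorm x ^+ n / (enorm v `^ nu * r `^ (nu + n%:R)))
       * p (nu + n%:R) t in
     {ae @lebesgue_measure R, forall t, 0 < t ->
        cvgn (fun N => \sum_(0 <= n < N) a n t)} /\
     density_of_time P sigma (fun t =>
       2 `^ nu * Gamma nu * expR (- dotv v x - enorm v ^+ 2 * t / 2)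
       * limn (fun N => \sum_(0 <= n < N) a n t))).
Proof.
have vx := enorm_gt0 hx0; have vv := enorm_gt0 hv.
move=> nu sigma xi.
have nu0 : 0 <= nu by rewrite divr_ge0// subr_ge0 (ler_nat _ 2).
pose S N t := \sum_(0 <= n < N) hit_coef (x := x) (v := v) r n * p (nu + n%:R) t.
have aeS : {ae @lebesgue_measure R, forall t, 0 < t -> cvgn (S ^~ t)}.
  exact: ae_cvg_hitting_series.
have density := @hitting_density R disp T P d hd x v B hB r hr vx hxr vv p hp hLout hLin.
have mp m : 0 <= m -> measurable_fun (`]0, +oo[ : set R) (p m).
  by move=> m0; have [] := bessel_hitting_density_facts hxr (hp m m0).
have mexp : measurable_fun (`]0, +oo[ : set R)
    (fun t => expR (- dotv v x - enorm v ^+ 2 * t / 2)).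
  apply: measurable_funTS; apply: measurableT_comp => //.
  apply: measurable_funB => //; apply: measurable_funM => //; exact: measurable_funM.
have xi1 : `|xi| <= 1 by exact: normr_cos_le.
split=> [d2|d3] a.
- have nuE : nu = 0 by rewrite /nu d2 subrr mul0r.
  have nuE' : nu_of (R := R) (d := d) = 0 by exact: nuE.
  have G1 : Gamma (1 : R) = 1 by rewrite -[X in Gamma X](_ : 1%:R = 1)// Gamma_nat.
  have aE n t : (0 < n)%N -> a n t = hit_coef (x := x) (v := v) r n * p (nu + n%:R) t.
    move=> n0; rewrite /a hit_coefE// -/xi nuE nuE' (gegenbauer_zonal0 hC)//.
    by rewrite !add0r !powRr0 G1 !mul1r powR_mulrn ?(ltW hr)//.
  (* The degree 0 term stands apart because [zonal] is 1 there, whereas the factor n would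
     annihilate C_0^0. *)
  have a0 t : besselI 0 (enorm v * r) * p 0 t = hit_coef (x := x) (v := v) r 0 * p (nu + 0%:R) t.
    by rewrite hit_coefE// -/xi nuE nuE' /= expr0 !add0r !powRr0 G1 !mul1r ?invr1 ?mulr1.
  have SE N t : \sum_(1 <= n < N.+1) a n t = S N.+1 t - besselI 0 (enorm v * r) * p 0 t.
    rewrite a0 /S [in RHS]big_ltn//= addrAC subrr add0r !big_nat; apply: eq_bigr => n /andP[n0 _].
    exact: aE.
  have cvE t : cvgn (S ^~ t) -> (fun N => \sum_(1 <= n < N) a n t) @ \oo -->
      limn (S ^~ t) - besselI 0 (enorm v * r) * p 0 t.
    move=> cS; rewrite -(cvg_shiftS (fun N => \sum_(1 <= n < N) a n t)).
    rewrite (_ : [sequence _]_n = (fun N => S N.+1 t - besselI 0 (enorm v * r) * p 0 t)).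
      apply: cvgB; last exact: cvg_cst.
      by rewrite (cvg_shiftS (S ^~ t)).
    by apply/funext => N; exact: SE.
  split.
    move: aeS; apply: filterS; first exact: (ae_filter_ringOfSetsType (@lebesgue_measure R)).
    by move=> t ht t0; exact: cvgP (cvE t (ht t0)).
  apply: density.
    apply: measurable_funM => //; apply: measurable_funD.
      by apply: measurable_funM => //; exact: mp.
    apply: measurable_fun_limn => // N; apply: measurable_sum => n.
    by apply: measurable_funM => //; exact: mp.
  move: aeS; apply: filterS; first exact: (ae_filter_ringOfSetsType (@lebesgue_measure R)).
  move=> t ht t0; congr (_ * _); rewrite (cvg_lim _ (cvE t (ht t0)))//.
  by rewrite addrC subrK.
- have nu1 : 0 < nu by rewrite divr_gt0// subr_gt0 (ltr_nat _ 2).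
  (* The factor nu of [gegenbauer_zonal] combines with Gamma(nu) to Gamma(nu + 1), so K times the
     stated terms are those of [hit_coef]. *)
  pose K : R := 2 `^ nu * Gamma nu.
  have K0 : K != 0 by rewrite mulf_neq0 ?gt_eqF ?powR_gt0 ?Gamma_gt0.
  have aE n t : K * a n t = hit_coef (x := x) (v := v) r n * p (nu + n%:R) t.
    rewrite /a hit_coefE// -/xi -[nu_of]/nu GammaS// (gegenbauer_zonal hC)// /K.
    by ring.
  have SE N t : \sum_(0 <= n < N) a n t = K^-1 * S N t.
    by rewrite /S; under [in RHS]eq_bigr do rewrite -aE; rewrite -mulr_sumr mulKf.
  have cvE t : cvgn (S ^~ t) -> (fun N => \sum_(0 <= n < N) a n t) @ \oo -->
      K^-1 * limn (S ^~ t).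
    move=> cS; rewrite (_ : (fun N => _) = (fun N => K^-1 * S N t)).
      by apply: cvgM => //; exact: cvg_cst.
    by apply/funext => N; exact: SE.
  split.
    move: aeS; apply: filterS; first exact: (ae_filter_ringOfSetsType (@lebesgue_measure R)).
    by move=> t ht t0; exact: cvgP (cvE t (ht t0)).
  apply: density.
    apply: measurable_funM; first exact: measurable_funM.
    apply: measurable_fun_limn => // N; apply: measurable_sum => n.
    by apply: measurable_funM => //; apply: mp; rewrite addr_ge0.
  move: aeS; apply: filterS; first exact: (ae_filter_ringOfSetsType (@lebesgue_measure R)).
  move=> t ht t0; rewrite (cvg_lim _ (cvE t (ht t0)))// -/K mulrAC mulrA divff// mul1r.
  by rewrite mulrC.
Qed.
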